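(* Let $\nu_n\ge1$ and let $X_1,\dots,X_n$ be iid mean zero random vectors in $\mathbb{R}^p$ such that $X_{ik}\sim\mathrm{subgaussian}(\nu_n^2)$ for all $k=1,\dots,p$. Suppose that there exist constants $C_1,C_2,C_3>0$ such that $\Gamma_{(j,k),(j,k)}\ge C_1$ for all $j,k=1,\dots,p$, $\xi_6\le C_2\nu_n^{1/3}$ and $\xi_8\le C_3\nu_n^{1/2}$. Let $\theta=\Sigma^{-1}b$, assume that $\theta\in\mathcal{G}'(r,\zeta_p)$, $r\in[0,1)$, and that $\nu_n^4\log^7(np)\le C_4n^{1-K}$ for some $K\in(0,1)$ and a constant $C_4>0$. Let $|\theta|_1\le M$, $\alpha\in(0,1)$, and $\lambda_*=Ma_{\bar T_n^\sharp}(1-\alpha)$. Then for all $w\in[1,\infty]$, $$|\hat\theta(\lambda_* )-\theta|_w\le\left(2\cdot6^{\frac1w}\cdot5^{\frac{1-r}w}\right)\zeta_p^{\frac1w}(M|\Sigma^{-1}|_{L^1})^{1-\frac rw}\,a_{\bar T_n^\sharp}^{1-\frac rw}(1-\alpha)$$ with probability at least $1-\alpha-Cn^{-K/6}$ for some constant $C>0$ depending only on $C_1,\dots,C_4$. In addition, $$\mathbb{E}[\lambda_*]\le C'M\xi_4^4(\log(p)/n)^{1/2},$$ where $C'>0$ is a constant depending only on $\alpha$ and $C_1,\dots,C_4$.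
   Context: Throughout $n\ge4$ and $d=p^2\ge3$; $p$ and the distribution of $X_i$ may depend on $n$. $\Sigma=\mathrm{Cov}(X_1)$ is invertible and $b\in\mathbb{R}^p$ is a fixed known vector. $X\sim\mathrm{subgaussian}(\nu^2)$ (mean zero, variance factor $\nu^2$) means $\mathbb{E}[\exp(X^2/\nu^2)]\le\sqrt2$. $\xi_q=\max_{1\le k\le p}(\mathbb{E}|X_{1k}|^q)^{1/q}$. For $\theta\in\mathbb{R}^p$, $|\theta|_w=(\sum_j|\theta_j|^w)^{1/w}$ for $w\in[1,\infty)$ and $|\theta|_\infty=\max_j|\theta_j|$ (with $1/\infty=0$). For a matrix, $|\Theta|_{L^1}=\max_{1\le k\le p}\sum_{m=1}^p|\theta_{mk}|$. $\mathcal{G}'(r,\zeta_p)=\{w\in\mathbb{R}^p:\sum_{j=1}^p|w_j|^r\le\zeta_p\}$ (for $r=0$, $|w_j|^0$ means $\mathbf 1\{w_j\ne0\}$). Covariance kernel: $h(x_1,x_2)=(x_1-x_2)(x_1-x_2)^\top/2$, with U-statistic $\hat S_n=(n-1)^{-1}\sum_{i=1}^n(X_i-\bar X_n)(X_i-\bar X_n)^\top$, $g(x)=(xx^\top-\Sigma)/2$ and $\Gamma=\mathrm{Cov}(g(X_1))$ indexed by pairs, so $\Gamma_{(j,k),(j,k)}=\mathrm{Var}(g_{jk}(X_1))$. Estimator: for $\lambda\ge0$, $\hat\theta(\lambda)$ is a minimizer of $|w|_1$ over $w\in\mathbb{R}^p$ subject to $|\hat S_nw-b|_\infty\le\lambda$.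 Bootstrap: $e_1,\dots,e_n$ are iid $N(0,1)$ independent of the data, $T_n^\sharp=\frac1{\sqrt n}\sum_{i=1}^n[\frac1{n-1}\sum_{j\ne i}h(X_i,X_j)-\hat S_n]e_i$, $\bar T_n^\sharp=2n^{-1/2}\max_{1\le m,k\le p}|T^\sharp_{n,mk}|$, and $a_{\bar T_n^\sharp}(\alpha)=\inf\{t\in\mathbb{R}:\mathbb{P}_e(\bar T_n^\sharp\le t)\ge\alpha\}$, $\mathbb{P}_e$ being the probability with respect to $e_1,\dots,e_n$ only (conditional on the data). *)

(* Defs.v *)
From HB Require Import structures.
From mathcomp Require Import all_boot all_order all_algebra.
From mathcomp Require Import all_classical all_reals all_analysis.

Set Implicit Arguments.
Unset Strict Implicit.
Unset Printing Implicit Defensive.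

Import Order.TTheory GRing.Theory Num.Theory.
Import numFieldNormedType.Exports.

Local Open Scope classical_set_scope.
Local Open Scope ring_scope.

Section Probability.
Context {d : measure_display} {T : measurableType d} {R : realType}.
Variable P : probability T R.

(* Taking some of the B i to be the full space gives the product rule for
   every subfamily. *)
Definition mutually_independent {I : finType} {d' : measure_display}
    {T' : measurableType d'} (X : I -> {RV P >-> T'}) : Prop :=
  forall B : I -> set T', (forall i, measurable (B i)) ->
    P [set t | forall i, B i (X i t)] = (\prod_(i : I) P (X i @^-1` B i))%E.

Definition independent_pair {d1 d2 : measure_display}
    {T1 : measurableType d1} {T2 : measurableType d2}
    (X : T -> T1) (Y : T -> T2) : Prop :=
  forall A B, measurable A -> measurable B ->
    P (X @^-1` A `&` Y @^-1` B) = (P (X @^-1` A) * P (Y @^-1` B))%E.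

(* Equality of laws is only required on measurable sets: the values of a
   measure elsewhere carry no meaning. *)
Definition identically_distributed {I : Type} {d' : measure_display}
    {T' : measurableType d'} (X : I -> {RV P >-> T'}) : Prop :=
  forall i j A, measurable A -> distribution P (X i) A = distribution P (X j) A.

Definition standard_normal (Z : {RV P >-> R}) : Prop :=
  forall A : set R, measurable A -> distribution P Z A = normal_prob 0 1 A.

(* A contains a measurable event of probability at least q; when A is itself
   measurable this is q <= P A. *)
Definition with_prob_ge (q : R) (A : set T) : Prop :=
  exists E : set T, [/\ measurable E, E `<=` A & (q%:E <= P E)%E].

Definition mean_zero (Z : T -> R) : Prop := ('E_P[Z] = 0)%E.

(* The moment condition in "Z ~ subgaussian(v)", v being the variance factor;
   the mean-zero condition is [mean_zero]. *)
Definition subgaussian (v : R) (Z : T -> R) : Prop :=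
  ('E_P[fun t => expR (Z t ^+ 2 / v)] <= (Num.sqrt 2)%:E)%E.

Definition rvcoord {p : nat} (Y : {RV P >-> p.-tuple R}) (k : 'I_p) : T -> R :=
  fun t => tnth (Y t) k.

(* Kept in \bar R, so that an infinite moment is not silently turned into a
   real number. *)
Definition xi {p : nat} (Y : {RV P >-> p.-tuple R}) (q : nat) : \bar R :=
  \big[maxe/0%E]_(k < p) 'N[P]_(q%:R%:E)[EFin \o rvcoord Y k]%E.

Definition cov_mx {p : nat} (Y : {RV P >-> p.-tuple R}) : 'M[R]_p :=
  \matrix_(j, k) fine (covariance P (rvcoord Y j) (rvcoord Y k)).

Definition gproj {p : nat} (Y : {RV P >-> p.-tuple R}) (jk : 'I_p * 'I_p) : T -> R :=
  fun t => (rvcoord Y jk.1 t * rvcoord Y jk.2 t - cov_mx Y jk.1 jk.2) / 2.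

Definition Gamma {p : nat} (Y : {RV P >-> p.-tuple R}) (jk lm : 'I_p * 'I_p) : \bar R :=
  covariance P (gproj Y jk) (gproj Y lm).

End Probability.

Section Vectors.
Context {R : realType} {p : nat}.
Implicit Types (v b : 'cV[R]_p) (A S : 'M[R]_p).

Definition norm1 v : R := \sum_j `|v j 0|.

Definition norm_oo v : R := \big[Num.max/0]_j `|v j 0|.

(* Used for 1 <= w only. *)
Definition lnorm (w : \bar R) v : R :=
  if w is r%:E then (\sum_j `|v j 0| `^ r) `^ r^-1 else norm_oo v.

(* 1/w, with 1/oo = 0. *)
Definition recip (w : \bar R) : R := if w is r%:E then r^-1 else 0.

Definition norm_L1 A : R := \big[Num.max/0]_k \sum_m `|A m k|.

Definition mx_max A : R := \big[Num.max/0]_m \big[Num.max/0]_k `|A m k|.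

(* |x|^r with the convention |x|^0 = 1{x <> 0}; powR alone would give
   0 `^ 0 = 1. *)
Definition abs_pow (r x : R) : R :=
  if r == 0 then (x != 0)%:R else `|x| `^ r.

Definition sparse_class (r zeta : R) : set 'cV[R]_p :=
  [set v | \sum_j abs_pow r (v j 0) <= zeta].

Definition feasible S b (lam : R) : set 'cV[R]_p :=
  [set v | norm_oo (S *m v - b) <= lam].

Definition l1_minimizer S b (lam : R) v : Prop :=
  feasible S b lam v /\ forall v', feasible S b lam v' -> norm1 v <= norm1 v'.

End Vectors.

Section Sample.
Context {R : realType} {n p : nat}.
Implicit Type x : 'I_n -> 'cV[R]_p.

Definition cov_kernel (y z : 'cV[R]_p) : 'M[R]_p :=
  2^-1 *: ((y - z) *m (y - z)^T).

Definition sample_mean x : 'cV[R]_p := n%:R^-1 *: \sum_i x i.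

Definition sample_cov x : 'M[R]_p :=
  (n%:R - 1)^-1 *: \sum_i (x i - sample_mean x) *m (x i - sample_mean x)^T.

Definition Tsharp x (z : 'I_n -> R) : 'M[R]_p :=
  (Num.sqrt n%:R)^-1 *:
    \sum_i z i *: ((n%:R - 1)^-1 *: (\sum_(j | j != i) cov_kernel (x i) (x j))
                   - sample_cov x).

Definition Tbar x (z : 'I_n -> R) : R :=
  2 / Num.sqrt n%:R * mx_max (Tsharp x z).

(* The quantile a(beta) as a function of the data x. The multipliers e are
   independent of the data, so the probability P_e conditional on the data is
   the law of e with x held fixed. *)
Definition boot_quantile {d : measure_display} {T : measurableType d}
    (P : probability T R) (e : 'I_n -> {RV P >-> R}) x (beta : R) : R :=
  inf [set s : R | (beta%:E <= P [set t | Tbar x (fun i => e i t) <= s]%R)%E].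

End Sample.

Section Estimator.
Context {d : measure_display} {T : measurableType d} {R : realType}.
Context {P : probability T R} {n p : nat}.
Implicit Type X : 'I_n -> {RV P >-> p.-tuple R}.

Definition data X (t : T) : 'I_n -> 'cV[R]_p := fun i => \col_k tnth (X i t) k.

(* thetahat lam t is the estimator with tuning parameter lam computed from
   the sample at t. The constraint set is empty for some samples (for instance
   when the sample covariance is singular and lam is small); no minimizer
   exists then and thetahat is left arbitrary. *)
Definition is_estimator X (b : 'cV[R]_p) (thetahat : R -> T -> 'cV[R]_p) : Prop :=
  forall lam t, 0 <= lam ->
    (exists v, feasible (sample_cov (data X t)) b lam v) ->
    l1_minimizer (sample_cov (data X t)) b lam (thetahat lam t).

End Estimator.

(* Main.v *)
(** Let S be the normalised sum of the vectors with coordinates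
    +-(X_ij X_ik - Sigma_jk) and Y its multiplier bootstrap, a Gaussian vector
    once the data are fixed. The laws of max S and max Y are compared by the
    Lindeberg replacement of one summand at a time: the indicator of an orthant
    is smoothed through the soft maximum b^-1 ln (sum_j exp (b y_j)), the third
    order remainders are supported on a thin band around the boundary of the
    orthant, and the probability of this band is controlled by the
    anti-concentration of the Gaussian vector together with the approximation
    error itself. On a good sample, where the empirical moments up to order four
    are close to the true ones, this gives sup_s |P(max S <= s) - P_e(max Y <= s)|
    <= C eps with eps^6 = nu^4 ln(np)^7 / n, so that sqrt n times the error of the
    sample covariance lies below the bootstrap quantile with probability at least
    1 - alpha - C eps. On that event theta is feasible, theta^hat has l1-norm at
    most |theta|_1 and sup-distance at most 2 M |Sigma^-1| a to theta, and
    |theta^hat_j - theta_j| <= |theta^hat_j| - |theta_j|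
    + 2 min(|theta_j|, |theta^hat_j - theta_j|) turns the sparsity of theta into
    the l1 rate; the other norms follow by interpolation. The expectation bound is
    the Gaussian tail estimate a <= sigma sqrt(2 ln(2 p^2 / alpha) / n), where
    sigma is bounded through the largest empirical fourth moment. *)
Require Import Defs.
From HB Require Import structures.
From mathcomp Require Import all_boot all_order all_algebra.
From mathcomp Require Import all_classical all_reals all_analysis.
From mathcomp Require Import ring lra measurable_realfun.

Set Implicit Arguments.
Unset Strict Implicit.
Unset Printing Implicit Defensive.

Import Order.TTheory GRing.Theory Num.Theory.
Import numFieldNormedType.Exports.

Local Open Scope classical_set_scope.
Local Open Scope ring_scope.

(** * Smoothed indicator functions *)

Section Derivatives.
Context {R : realType}.
Implicit Types (f g : R -> R) (x a b : R).

(** The obstacle is that the third order remainder of a replacement step is small only on a band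
    around the boundary, while anti-concentration is available for the Gaussian vector and not for
    the hybrid sums. The largest hybrid deviation is therefore bounded in terms of itself, with a
    coefficient made small by the choice of [kappa]. No joint Gaussian density appears: the vector
    is a linear image of the multipliers, cut into n equal pieces by the stability of the
    one-dimensional normal law. Independent copies are nested integrals of a function of a vector,
    so no product space is built for them. With q^2 = ln (np), the scales are phi = kappa q / eps
    and b = 2 q^2 phi: the soft maximum errs by at most 1 / phi, the band has Gaussian probability
    of order q / phi, that is eps, and exponential moments leave tails of order exp (- q^2). When
    eps exceeds a fixed threshold the probability bound is trivial. Anti-concentration rests on the
    same calculus: rescaling a Gaussian vector moves the soft maximum little, whereas the curvature
    gained detects the mass near the boundary. *)

Lemma is_deriveDf f g x a b : is_derive x (1 : R) f a -> is_derive x (1 : R) g b ->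
  is_derive x (1 : R) (fun s => f s + g s) (a + b).
Proof. exact: is_deriveD. Qed.

Lemma is_deriveMf f g x a b : is_derive x (1 : R) f a -> is_derive x (1 : R) g b ->
  is_derive x (1 : R) (fun s => f s * g s) (f x * b + g x * a).
Proof. exact: is_deriveM. Qed.

Lemma is_derive_idf x : is_derive x (1 : R) (fun s : R => s) 1.
Proof. exact: is_derive_id. Qed.

Lemma is_deriveZf f x (k a : R) : is_derive x (1 : R) f a ->
  is_derive x (1 : R) (fun s => k * f s) (k * a).
Proof. exact: is_deriveZ. Qed.

Lemma is_derive_compf f g x a b : is_derive (f x) (1 : R) g b ->
  is_derive x (1 : R) f a -> is_derive x (1 : R) (fun s => g (f s)) (b * a).
Proof.
move=> dg df; apply: DeriveDef.
  apply/derivable1_diffP; apply: (@differentiable_comp _ _ _ _ f g).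
    exact/derivable1_diffP.
  exact/derivable1_diffP.
have := @derive1_comp R f g x _ _.
rewrite !derive1E !derive_val => -> //; exact: ex_derive.
Qed.

Lemma is_derive_suml (I : Type) (r : seq I) (h : I -> R -> R) x (dh : I -> R) :
  (forall i, is_derive x (1 : R) (h i) (dh i)) ->
  is_derive x (1 : R) (fun s => \sum_(i <- r) h i s) (\sum_(i <- r) dh i).
Proof.
move=> H; elim: r => [|i r IH].
  rewrite big_nil (_ : (fun s => _) = cst 0); first exact: is_derive_cst.
  by apply/funext => s; rewrite big_nil.
rewrite big_cons (_ : (fun s => _) = (fun s => h i s + \sum_(j <- r) h j s)).
  exact: is_deriveDf.
by apply/funext => s; rewrite big_cons.
Qed.

Lemma is_derive_continuous f x a : is_derive x (1 : R) f a -> {for x, continuous f}.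
Proof. by move=> df; apply/differentiable_continuous/derivable1_diffP. Qed.

Lemma MV_ineq f df a b (K : R) : a <= b ->
  (forall x, is_derive x (1 : R) f (df x)) ->
  (forall x, a <= x <= b -> `|df x| <= K) -> `|f b - f a| <= K * (b - a).
Proof.
move=> ab dfP K_; have [|c cab ->] := MVT_segment ab (fun x _ => dfP x).
  by apply: continuous_subspaceT => x; apply: is_derive_continuous (dfP x).
rewrite normrM [`|b - a|]ger0_norm ?subr_ge0// ler_wpM2r ?subr_ge0//.
by apply: K_; move: cab; rewrite in_itv.
Qed.

(** The mean value inequality is applied to h2, to h1 minus its linear part and to h minus its
    quadratic part. The sharp factor 1/6 is given up. *)
Lemma taylor3 (h h1 h2 h3 : R -> R) (K : R) :
  (forall s, is_derive s (1 : R) h (h1 s)) ->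
  (forall s, is_derive s (1 : R) h1 (h2 s)) ->
  (forall s, is_derive s (1 : R) h2 (h3 s)) ->
  (forall s, 0 <= s <= 1 -> `|h3 s| <= K) ->
  `|h 1 - h 0 - h1 0 - h2 0 / 2| <= K.
Proof.
move=> d1 d2 d3 hK.
have K0 : 0 <= K by apply: le_trans (hK 0 _); rewrite ?lexx ?ler01.
have s2 s : 0 <= s <= 1 -> `|h2 s - h2 0| <= K.
  move=> /andP[s0 s1]; apply: (@le_trans _ _ (K * (s - 0))).
    apply: (MV_ineq s0 d3) => x /andP[x0 xs]; apply: hK.
    by rewrite x0 (le_trans xs).
  by rewrite subr0 ler_piMr.
have s1 s : 0 <= s <= 1 -> `|h1 s - h1 0 - s * h2 0| <= K.
  move=> /andP[s0 s1].
  pose r x := h1 x + (- h2 0) * x.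
  have dr x : is_derive x (1 : R) r (h2 x + (- h2 0) * 1).
    by apply: is_deriveDf; apply: is_deriveZf.
  have -> : h1 s - h1 0 - s * h2 0 = r s - r 0 by rewrite /r; ring.
  apply: (@le_trans _ _ (K * (s - 0))).
    apply: (MV_ineq s0 dr) => x /andP[x0 xs]; rewrite mulr1; apply: s2.
    by rewrite x0 (le_trans xs).
  by rewrite subr0 ler_piMr.
pose r x := h x + ((- h1 0) * x + (- (h2 0 / 2)) * (x * x)).
have dr x : is_derive x (1 : R) r (h1 x + ((- h1 0) * 1 + (- (h2 0 / 2)) * (x * 1 + x * 1))).
  apply: is_deriveDf; apply: is_deriveDf; apply: is_deriveZf.
have -> : h 1 - h 0 - h1 0 - h2 0 / 2 = r 1 - r 0 by rewrite /r; field.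
apply: (@le_trans _ _ (K * (1 - 0))); last by rewrite subr0 mulr1.
apply: (MV_ineq ler01 dr) => x x01.
by rewrite (_ : _ + _ = h1 x - h1 0 - x * h2 0) ?s1//; field.
Qed.

Lemma is_derive_exprf k x :
  is_derive x (1 : R) (fun s : R => s ^+ k.+1) (k.+1%:R * x ^+ k).
Proof.
elim: k => [|k IH]; first by rewrite expr0 mulr1; exact: is_derive_id.
have -> : (fun s : R => s ^+ k.+2) = (fun s => s * s ^+ k.+1).
  by apply/funext => s; rewrite exprS.
have := is_deriveMf (is_derive_idf x) IH.
by rewrite mulr1 [k.+2%:R]mulrS [in X in _ -> X]mulrDl mul1r addrC mulrCA -exprS addrC.
Qed.

End Derivatives.

Section Step.
Context {R : realType}.
Implicit Types x : R.

(** Truncated power x_+^k. For k = 0 it is 1 everywhere rather than the indicator of a half-line, so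
    only k >= 1 is used below. *)
Definition posX (k : nat) x : R := Num.max 0 x ^+ k.

Lemma posX_le0 k x : x <= 0 -> posX k.+1 x = 0.
Proof. by move=> x0; rewrite /posX max_l// expr0n. Qed.

Lemma posX_ge0 k x : 0 <= x -> posX k x = x ^+ k.
Proof. by move=> x0; rewrite /posX max_r. Qed.

(** Away from 0 the function is locally 0 or a monomial; at 0 the difference quotient is at most
    |h|^(k+1). *)
Lemma is_derive_posX k x : is_derive x (1 : R) (posX k.+2) (k.+2%:R * posX k.+1 x).
Proof.
have [x0|x0|x0] := ltgtP x 0.
- rewrite posX_le0 ?ltW// mulr0.
  apply: (@near_eq_is_derive _ _ _ (cst 0)).
    by near=> y; rewrite posX_le0// ltW//; near: y; exact: lt_nbhsl.
- have -> : posX k.+1 x = x ^+ k.+1 by rewrite posX_ge0// ltW.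
  apply: (@near_eq_is_derive R R^o R^o (fun y : R => y ^+ k.+2)).
    by near=> y; rewrite posX_ge0// ltW//; near: y; exact: lt_nbhsr.
  exact: is_derive_exprf.
- rewrite x0 posX_le0 ?lexx// mulr0.
  have H : h^-1 *: ((posX k.+2 \o shift 0) (h *: (1 : R)) - posX k.+2 0) @[h --> 0^'] --> (0 : R).
    apply/cvgrPdist_le => /= e e0; near=> h.
    rewrite sub0r normrN [posX _ 0]posX_le0 ?lexx// subr0 /= addr0.
    have h0 : h != 0 by near: h; exact: nbhs_dnbhs_neq.
    have h1 : `|h| <= 1 by near: h; apply: dnbhs0_le.
    have he : `|h| <= e by near: h; apply: dnbhs0_le.
    rewrite /GRing.scale/= mulr1 normrM normfV ler_pdivrMl ?normr_gt0//.
    apply: (@le_trans _ _ (`|h| ^+ k.+2)).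
      rewrite /posX normrX lerXn2r ?nnegrE//.
      by rewrite /Num.max; case: ifP; rewrite ?normr0.
    rewrite exprS ler_wpM2l// exprS (le_trans _ he)// ler_piMr//.
    by rewrite exprn_ile1.
  apply: DeriveDef.
    by apply/cvg_ex; exists 0.
  exact: cvg_lim.
Unshelve. all: by end_near. Qed.


(* third differences of the truncated powers: [stepf] is one minus the
   distribution function of the cubic B-spline with knots 0, ..., 4 *)
Definition stepd k x : R :=
  posX k x - 4 * posX k (x - 1) + 6 * posX k (x - 2) - 4 * posX k (x - 3)
  + posX k (x - 4).

Definition stepf x : R := 1 - stepd 4 x / 24.
Definition stepf1 x : R := - (stepd 3 x / 6).
Definition stepf2 x : R := - (stepd 2 x / 2).
Definition stepf3 x : R := - stepd 1 x.

Lemma is_derive_posX_shift k x c :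
  is_derive x (1 : R) (fun s => posX k.+2 (s - c)) (k.+2%:R * posX k.+1 (x - c)).
Proof.
rewrite -[k.+2%:R * _]mulr1.
apply: (@is_derive_compf _ (fun s => s - c) (posX k.+2)).
  exact: is_derive_posX.
rewrite -[X in is_derive _ _ _ X]addr0.
exact: (is_deriveDf (is_derive_idf x) (is_derive_cst (- c) x (1 : R))).
Qed.

Lemma is_derive_stepd k x :
  is_derive x (1 : R) (stepd k.+2) (k.+2%:R * stepd k.+1 x).
Proof.
have -> : stepd k.+2 = fun s => posX k.+2 (s - 0) + (- 4 * posX k.+2 (s - 1)
    + (6 * posX k.+2 (s - 2) + (- 4 * posX k.+2 (s - 3) + posX k.+2 (s - 4)))).
  by apply/funext => s; rewrite /stepd subr0; ring.
have -> : k.+2%:R * stepd k.+1 x = k.+2%:R * posX k.+1 (x - 0) +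
   (- 4 * (k.+2%:R * posX k.+1 (x - 1)) + (6 * (k.+2%:R * posX k.+1 (x - 2)) +
   (- 4 * (k.+2%:R * posX k.+1 (x - 3)) + k.+2%:R * posX k.+1 (x - 4)))).
  by rewrite /stepd subr0; ring.
have H := is_derive_posX_shift k x.
exact: (is_deriveDf (H 0) (is_deriveDf (is_deriveZf (-4) (H 1))
  (is_deriveDf (is_deriveZf 6 (H 2)) (is_deriveDf (is_deriveZf (-4) (H 3)) (H 4))))).
Qed.

Lemma is_derive_stepf x : is_derive x (1 : R) stepf (stepf1 x).
Proof.
have -> : stepf = fun s => 1 + (- 24^-1) * stepd 4 s.
  by apply/funext => s; rewrite /stepf; ring.
have -> : stepf1 x = 0 + (- 24^-1) * (4%:R * stepd 3 x) by rewrite /stepf1; field.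
exact: (is_deriveDf (is_derive_cst (1 : R) x (1 : R)) (is_deriveZf _ (is_derive_stepd 2 x))).
Qed.

Lemma is_derive_stepf1 x : is_derive x (1 : R) stepf1 (stepf2 x).
Proof.
have -> : stepf1 = fun s => (- 6^-1) * stepd 3 s.
  by apply/funext => s; rewrite /stepf1; ring.
have -> : stepf2 x = (- 6^-1) * (3%:R * stepd 2 x) by rewrite /stepf2; field.
exact/is_deriveZf/is_derive_stepd.
Qed.

Lemma is_derive_stepf2 x : is_derive x (1 : R) stepf2 (stepf3 x).
Proof.
have -> : stepf2 = fun s => (- 2^-1) * stepd 2 s.
  by apply/funext => s; rewrite /stepf2; ring.
have -> : stepf3 x = (- 2^-1) * (2%:R * stepd 1 x) by rewrite /stepf3; field.
exact/is_deriveZf/is_derive_stepd.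
Qed.

Lemma stepd_le0 k x : x <= 0 -> stepd k.+1 x = 0.
Proof. by move=> x0; rewrite /stepd !posX_le0 ?mulr0 ?subr0 ?addr0//; lra. Qed.

Lemma stepd_ge4 k x : (k < 4)%N -> 4 <= x -> stepd k x = 0.
Proof.
move=> k4 x4; rewrite /stepd !posX_ge0; try lra.
by case: k k4 => [|[|[|[|]]]]// _; ring.
Qed.

Lemma stepf_le0 x : x <= 0 -> stepf x = 1.
Proof. by move=> x0; rewrite /stepf stepd_le0// mul0r subr0. Qed.

Lemma stepf_ge4 x : 4 <= x -> stepf x = 0.
Proof.
by move=> x4; rewrite /stepf /stepd !posX_ge0; lra.
Qed.

Lemma stepfN_out x : (x <= 0) || (4 <= x) ->
  [/\ stepf1 x = 0, stepf2 x = 0 & stepf3 x = 0].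
Proof.
rewrite /stepf1 /stepf2 /stepf3 => /orP[x0|x4].
  by rewrite !stepd_le0// !mul0r !oppr0.
by rewrite !stepd_ge4// !mul0r !oppr0.
Qed.

Lemma posX_bnd k x c : 0 <= c -> x <= 4 -> 0 <= posX k (x - c) <= 4 ^+ k.
Proof.
move=> c0 x4; rewrite /posX exprn_ge0 ?le_max ?lexx//= lerXn2r ?nnegrE//.
  by rewrite le_max lexx.
by rewrite ge_max; apply/andP; split; lra.
Qed.

(** The factor 16 is 1 + 4 + 6 + 4 + 1. Dividing 16 4^k by 6, 2 and 1 for k = 3, 2, 1 gives the
    uniform bound 200 on the derivatives. *)
Lemma stepd_bnd k x : x <= 4 -> `|stepd k x| <= 16 * 4 ^+ k.
Proof.
move=> x4; rewrite /stepd -[in posX k x](subr0 x).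
have h0 := @posX_bnd k x 0 (lexx _) x4.
have h1 := @posX_bnd k x 1 ltac:(by []) x4.
have h2 := @posX_bnd k x 2 ltac:(by []) x4.
have h3 := @posX_bnd k x 3 ltac:(by []) x4.
have h4 := @posX_bnd k x 4 ltac:(by []) x4.
rewrite ler_norml; move: h0 h1 h2 h3 h4 => /andP[? ?] /andP[? ?] /andP[? ?] /andP[? ?] /andP[? ?].
by apply/andP; split; lra.
Qed.

Lemma stepf_bnd x : [/\ `|stepf1 x| <= 200, `|stepf2 x| <= 200 & `|stepf3 x| <= 200].
Proof.
have [x4|x4] := leP x 4; last first.
  have [-> -> ->] : [/\ stepf1 x = 0, stepf2 x = 0 & stepf3 x = 0].
    by apply: stepfN_out; rewrite (ltW x4) orbT.
  by rewrite normr0.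
have h1 := stepd_bnd 1 x4; have h2 := stepd_bnd 2 x4; have h3 := stepd_bnd 3 x4.
rewrite /stepf1 /stepf2 /stepf3 !normrN.
move: h1 h2 h3; rewrite !ler_norml !exprS expr0.
by move=> /andP[? ?] /andP[? ?] /andP[? ?]; split; apply/andP; split; lra.
Qed.

(** Nonnegativity of the cubic B-spline: between consecutive knots the cubic is rewritten as a
    combination of visibly nonnegative terms. *)
Lemma stepf1_le0 x : stepf1 x <= 0.
Proof.
have [x0|x0] := leP x 0.
  by have [-> _ _] : [/\ stepf1 x = 0, stepf2 x = 0 & stepf3 x = 0]
    by apply: stepfN_out; rewrite x0.
have [x4|x4] := leP 4 x.
  by have [-> _ _] : [/\ stepf1 x = 0, stepf2 x = 0 & stepf3 x = 0]
    by apply: stepfN_out; rewrite x4 orbT.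
rewrite /stepf1 oppr_le0 divr_ge0// /stepd.
rewrite [posX 3 x]posX_ge0; last exact: ltW.
rewrite [posX 3 (x - 4)]posX_le0; last first.
  by rewrite subr_le0 ltW.
have [x1|x1] := leP x 1.
  rewrite !posX_le0; try lra.
  by rewrite !(mulr0, subr0, addr0) exprn_ge0// ltW.
rewrite [posX 3 (x - 1)]posX_ge0; last lra.
have [x2|x2] := leP x 2.
  rewrite [posX 3 (x - 2)]posX_le0 1?[posX 3 (x - 3)]posX_le0; try lra.
  suff -> : x ^+ 3 - 4 * (x - 1) ^+ 3 + 6 * 0 - 4 * 0 + 0 =
    1 + 3 * (x - 1) + 3 * ((x - 1) ^+ 2 * (2 - x)).
    by rewrite !addr_ge0 ?mulr_ge0 ?sqr_ge0//; lra.
  by ring.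
rewrite [posX 3 (x - 2)]posX_ge0; last lra.
have [x3|x3] := leP x 3.
  rewrite [posX 3 (x - 3)]posX_le0; last lra.
  suff -> : x ^+ 3 - 4 * (x - 1) ^+ 3 + 6 * (x - 2) ^+ 3 - 4 * 0 + 0 =
    (3 - x) * (4 + 2 * (x - 2) + 2 * ((x - 2) * (3 - x))) + (x - 2) ^+ 3.
    have h1 : 0 <= (x - 2) * (3 - x) by apply: mulr_ge0; lra.
    have h2 : 0 <= (x - 2) ^+ 3 by apply: exprn_ge0; lra.
    by apply: addr_ge0 => //; apply: mulr_ge0; lra.
  by ring.
rewrite [posX 3 (x - 3)]posX_ge0; last lra.
suff -> : x ^+ 3 - 4 * (x - 1) ^+ 3 + 6 * (x - 2) ^+ 3 - 4 * (x - 3) ^+ 3 + 0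
  = (4 - x) ^+ 3 by apply: exprn_ge0; lra.
by ring.
Qed.

Lemma stepf_noninc x y : x <= y -> stepf y <= stepf x.
Proof.
move=> xy; rewrite -subr_le0.
have [|c _ ->] := MVT_segment xy (fun z _ => is_derive_stepf z).
  by apply: continuous_subspaceT => z; apply: is_derive_continuous (is_derive_stepf z).
by rewrite mulr_le0_ge0 ?stepf1_le0 ?subr_ge0.
Qed.

Lemma stepf_ge0 x : 0 <= stepf x.
Proof.
rewrite -(@stepf_ge4 (Num.max 4 x)) ?le_max ?lexx//.
by apply: stepf_noninc; rewrite le_max lexx orbT.
Qed.

Lemma stepf_le1 x : stepf x <= 1.
Proof.
rewrite -(@stepf_le0 (Num.min 0 x)) ?ge_min ?lexx//.
by apply: stepf_noninc; rewrite ge_min lexx orbT.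
Qed.

End Step.

(** * The soft maximum *)

Section Softmax.
Context {R : realType} {I : finType}.
Variables (i0 : I) (b : R) (hb : 0 < b).
Implicit Types (y u c : I -> R).

Definition partf y : R := \sum_i expR (b * y i).
Definition smax y : R := b^-1 * ln (partf y).
(** Average of [c] under the softmax weights at [y]; it is the derivative of [smax] at [y] in the
    direction [c]. *)
Definition gibbs y c : R := (\sum_i expR (b * y i) * c i) / partf y.

Lemma partf_gt0 y : 0 < partf y.
Proof.
rewrite /partf (bigD1 i0)//= ltr_pwDl ?expR_gt0// sumr_ge0//.
Qed.

Lemma smax_ge y i : y i <= smax y.
Proof.
rewrite /smax ler_pdivlMl// -ler_expR lnK ?posrE ?partf_gt0//.
rewrite /partf (bigD1 i)//= lerDl sumr_ge0//.
Qed.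

Lemma smax_le y t : (forall i, y i <= t) -> smax y <= t + ln #|I|%:R / b.
Proof.
move=> yt; rewrite /smax ler_pdivrMl// mulrDr mulrCA divff ?gt_eqF// mulr1.
have I0 : 0 < #|I|%:R :> R by rewrite ltr0n; apply/card_gt0P; exists i0.
rewrite -ler_expR lnK ?posrE ?partf_gt0// expRD lnK ?posrE//.
rewrite /partf (le_trans (ler_sum _ (G := fun=> expR (b * t)) _))//.
  by move=> i _; rewrite ler_expR ler_pM2l.
by rewrite sumr_const mulr_natr.
Qed.

Lemma smax_lip y u (U : R) : (forall i, `|u i| <= U) ->
  `|smax (fun i => y i + u i) - smax y| <= U.
Proof.
move=> uU; rewrite /smax -mulrBr normrM gtr0_norm ?invr_gt0// ler_pdivrMl//.
have H y1 y2 : (forall i, y1 i <= y2 i + U) -> ln (partf y1) - ln (partf y2) <= b * U.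
  move=> yy; rewrite lerBlDl -ler_expR lnK ?posrE ?partf_gt0//.
  rewrite expRD lnK ?posrE ?partf_gt0// /partf mulr_suml ler_sum// => i _.
  by rewrite -expRD -mulrDr ler_expR ler_pM2l.
rewrite ler_norml lerNl opprB; apply/andP; split; apply: H => i;
  by have := uU i; rewrite ler_norml => /andP[? ?]; lra.
Qed.

Lemma gibbs_ge0 y c : (forall i, 0 <= c i) -> 0 <= gibbs y c.
Proof.
move=> c0; rewrite divr_ge0 ?(ltW (partf_gt0 _))// sumr_ge0// => i _.
by rewrite mulr_ge0 ?expR_ge0.
Qed.

Lemma gibbs_cst y k : gibbs y (fun=> k) = k.
Proof. by rewrite /gibbs -mulr_suml mulrAC divff ?mul1r// gt_eqF ?partf_gt0. Qed.

Lemma gibbsD y c d : gibbs y (fun i => c i + d i) = gibbs y c + gibbs y d.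
Proof.
rewrite /gibbs -mulrDl -big_split/=; congr (_ / _).
by apply: eq_bigr => i _; rewrite mulrDr.
Qed.

Lemma gibbsZ y k c : gibbs y (fun i => k * c i) = k * gibbs y c.
Proof.
rewrite /gibbs mulrA mulr_sumr; congr (_ / _).
by apply: eq_bigr => i _; rewrite mulrCA.
Qed.

Lemma gibbs_le y c d : (forall i, c i <= d i) -> gibbs y c <= gibbs y d.
Proof.
move=> cd; rewrite /gibbs ler_pM2r ?invr_gt0 ?partf_gt0// ler_sum// => i _.
by rewrite ler_wpM2l ?expR_ge0.
Qed.

Lemma gibbs_norm y c : `|gibbs y c| <= gibbs y (fun i => `|c i|).
Proof.
rewrite ler_norml lerNl; apply/andP; split.
  rewrite (_ : - gibbs y c = gibbs y (fun i => -1 * c i)).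
    by apply: gibbs_le => i; rewrite mulN1r -normrN ler_norm.
  by rewrite gibbsZ mulN1r.
by apply: gibbs_le => i; rewrite ler_norm.
Qed.

(** Chebyshev's association inequality: the hypothesis is averaged over [j], then over [i]. *)
Lemma gibbs_chebyshev y c d :
  (forall i j, 0 <= (c i - c j) * (d i - d j)) ->
  gibbs y c * gibbs y d <= gibbs y (fun i => c i * d i).
Proof.
move=> H.
have H1 i : c i * gibbs y d + d i * gibbs y c <=
    c i * d i + gibbs y (fun j => c j * d j).
  rewrite -gibbsZ -[d i * gibbs y c]gibbsZ -gibbsD -[c i * d i](gibbs_cst y) -gibbsD.
  by apply: gibbs_le => j; have := H i j; lra.
have := gibbs_le y H1; rewrite gibbsD.
rewrite (_ : (fun i => c i * gibbs y d) = fun i => gibbs y d * c i); last first.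
  by apply/funext => i; rewrite mulrC.
rewrite (_ : (fun i => d i * gibbs y c) = fun i => gibbs y c * d i); last first.
  by apply/funext => i; rewrite mulrC.
by rewrite !gibbsZ gibbsD gibbs_cst; lra.
Qed.

Lemma gibbs_jensen2 y c : gibbs y c ^+ 2 <= gibbs y (fun i => c i ^+ 2).
Proof.
rewrite expr2; apply: (le_trans (gibbs_chebyshev y _)) => [i j|].
  by rewrite -expr2 sqr_ge0.
by apply: gibbs_le => i; rewrite expr2.
Qed.

Lemma gibbs_chebyshev3 y c : (forall i, 0 <= c i) ->
  gibbs y c * gibbs y (fun i => c i ^+ 2) <= gibbs y (fun i => c i ^+ 3).
Proof.
move=> c0; apply: (le_trans (gibbs_chebyshev y _)) => [i j|].
  rewrite subr_sqr mulrA -expr2 mulr_ge0 ?sqr_ge0// addr_ge0//.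
by apply: gibbs_le => i; rewrite -exprS.
Qed.

(** A move by at most U changes the numerator and the partition function by a factor at most exp (b
    U) each. Third order remainders along a segment can thus be expressed at its starting point. *)
Lemma gibbs_shift y u c (U : R) : (forall i, `|u i| <= U) -> (forall i, 0 <= c i) ->
  gibbs (fun i => y i + u i) c <= expR (2 * (b * U)) * gibbs y c.
Proof.
move=> uU c0; rewrite /gibbs.
have e1 i : expR (b * (y i + u i)) <= expR (b * U) * expR (b * y i).
  rewrite -expRD ler_expR -mulrDr ler_pM2l//.
  by have := uU i; rewrite ler_norml => /andP[? ?]; lra.
have e2 i : expR (b * y i) <= expR (b * U) * expR (b * (y i + u i)).
  rewrite -expRD ler_expR -mulrDr ler_pM2l//.
  by have := uU i; rewrite ler_norml => /andP[? ?]; lra.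
rewrite ler_pdivrMr ?partf_gt0//.
have p2 : partf y <= expR (b * U) * partf (fun i => y i + u i).
  by rewrite /partf mulr_sumr ler_sum.
set S := \sum_i expR (b * y i) * c i.
have S0 : 0 <= S by rewrite sumr_ge0// => i _; rewrite mulr_ge0 ?expR_ge0.
apply: (@le_trans _ _ (expR (b * U) * S)).
  by rewrite mulr_sumr ler_sum// => i _; rewrite mulrA ler_wpM2r.
set E := expR (b * U) in e1 e2 p2 *.
have -> : expR (2 * (b * U)) = E * E by rewrite mulr_natl mulr2n expRD.
set Z' := partf (fun i => y i + u i) in p2 *.
rewrite [leRHS](_ : _ = E * S * (E * Z' / partf y)); last by ring.
rewrite ler_peMr ?mulr_ge0 ?expR_ge0//.
by rewrite ler_pdivlMr ?partf_gt0// mul1r.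
Qed.

Section Line.
Variables (y u : I -> R).
Let ys (s : R) : I -> R := fun i => y i + s * u i.

Let Z (k : nat) (s : R) : R := \sum_i expR (b * ys s i) * u i ^+ k.
Let pk k s := gibbs (ys s) (fun i => u i ^+ k).

Let dZ k s : is_derive s (1 : R) (Z k) (b * Z k.+1 s).
Proof.
rewrite /Z mulr_sumr; apply: is_derive_suml => i.
have h1 := is_deriveZf b (is_deriveDf (is_derive_cst (y i) s (1 : R))
  (is_deriveMf (is_derive_idf s) (is_derive_cst (u i) s (1 : R)))).
have h2 := is_deriveMf (is_derive_compf (is_derive_expR _) h1)
  (is_derive_cst (u i ^+ k) s (1 : R)).
rewrite (_ : b * _ = expR (b * ys s i) * 0 + u i ^+ k *
    (expR (b * ys s i) * (b * (0 + (s * 0 + u i * 1))))); last by rewrite exprS; ring.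
exact: h2.
Qed.

Let Z0E s : Z 0 s = partf (ys s).
Proof. by apply: eq_bigr => i _; rewrite expr0 mulr1. Qed.

Let pkE k s : pk k s = Z k s * (Z 0 s)^-1.
Proof. by rewrite Z0E. Qed.

Let dinv f (x a : R) : f x != 0 -> is_derive x (1 : R) f a ->
  is_derive x (1 : R) (fun s => (f s)^-1) (- (f x) ^- 2 * a).
Proof. by move=> fx df; exact: is_deriveV. Qed.

(** The derivative of a Gibbs moment of [u] is b times its covariance with [u]. Hence F1, F2, F3 are
    the mean, b times the variance and b^2 times the third cumulant of [u]. *)
Let dpk k s : is_derive s (1 : R) (pk k) (b * (pk k.+1 s - pk k s * pk 1 s)).
Proof.
have Z0 : Z 0 s != 0 by rewrite Z0E gt_eqF ?partf_gt0.
have h := is_deriveMf (dZ k s) (dinv Z0 (dZ 0 s)).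
rewrite (_ : pk k = fun s => Z k s * (Z 0 s)^-1); last by apply/funext => x; exact: pkE.
rewrite !pkE (_ : b * _ = Z k s * (- Z 0 s ^- 2 * (b * Z 1 s)) + (Z 0 s)^-1 * (b * Z k.+1 s)).
  exact: h.
by field.
Qed.

Let dF s : is_derive s (1 : R) (fun s => smax (ys s)) (pk 1 s).
Proof.
have Z0 : 0 < Z 0 s by rewrite Z0E partf_gt0.
have h := is_deriveZf b^-1 (is_derive_compf (is_derive1_ln Z0) (dZ 0 s)).
rewrite (_ : (fun s => _) = fun s => b^-1 * ln (Z 0 s)); last first.
  by apply/funext => x; rewrite Z0E.
rewrite pkE (_ : Z 1 s * _ = b^-1 * ((Z 0 s)^-1 * (b * Z 1 s))) ?h//.
by field; rewrite !gt_eqF.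
Qed.

Let F1 := pk 1.
Let F2 s := b * (pk 2 s - pk 1 s * pk 1 s).
Let F3 s := b * (b * (pk 3 s - pk 2 s * pk 1 s)
  - (pk 1 s * F2 s + pk 1 s * F2 s)).

Let dF2 s : is_derive s (1 : R) F2 (F3 s).
Proof.
have h := is_deriveZf b (is_deriveDf (dpk 2 s)
  (is_deriveZf (-1) (is_deriveMf (dpk 1 s) (dpk 1 s)))).
rewrite (_ : F2 = fun s => b * (pk 2 s + -1 * (pk 1 s * pk 1 s))); last first.
  by apply/funext => x; rewrite /F2 mulN1r.
by rewrite (_ : F3 s = b * (b * (pk 3 s - pk 2 s * pk 1 s) + -1 *
  (pk 1 s * (b * (pk 2 s - pk 1 s * pk 1 s)) +
   pk 1 s * (b * (pk 2 s - pk 1 s * pk 1 s))))) ?h// /F3 mulN1r.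
Qed.

Let A3 s := gibbs (ys s) (fun i => `|u i| ^+ 3).

Let A3_ge0 s : 0 <= A3 s.
Proof. by apply: gibbs_ge0 => i; rewrite exprn_ge0. Qed.

Let bnd12 s : `|pk 1 s| * pk 2 s <= A3 s.
Proof.
apply: le_trans (gibbs_chebyshev3 (ys s) (c := fun i => `|u i|) _) => //.
have -> : pk 2 s = gibbs (ys s) (fun i => `|u i| ^+ 2).
  by congr gibbs; apply/funext => i; rewrite real_normK ?num_real.
apply: ler_pM => //.
  by apply: gibbs_ge0 => i; rewrite exprn_ge0.
apply: le_trans (gibbs_norm _ _) _; apply: gibbs_le => i; by rewrite expr1.
Qed.

Let pk2_ge s : pk 1 s ^+ 2 <= pk 2 s.
Proof.
rewrite /pk (_ : (fun i => u i ^+ 1) = u); last by apply/funext => i; rewrite expr1.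
exact: gibbs_jensen2.
Qed.

Let bnd3 s : `|pk 3 s| <= A3 s.
Proof.
apply: le_trans (gibbs_norm _ _) _; apply: gibbs_le => i; by rewrite normrX.
Qed.

Let bnd111 s : `|pk 1 s| ^+ 3 <= A3 s.
Proof.
apply: le_trans (bnd12 s); rewrite exprS ler_wpM2l//.
by rewrite real_normK ?num_real.
Qed.

(** The third cumulant is p3 - 3 p1 p2 + 2 p1^3, and each product is dominated by the third absolute
    moment; 6 = 1 + 3 + 2. *)
Let F3_bnd s : `|F3 s| <= 6 * b ^+ 2 * A3 s.
Proof.
have -> : F3 s = b ^+ 2 * (pk 3 s - 3 * (pk 1 s * pk 2 s) + 2 * pk 1 s ^+ 3).
  by rewrite /F3 /F2; ring.
have -> : 6 * b ^+ 2 * A3 s = b ^+ 2 * (6 * A3 s) by ring.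
rewrite normrM [`|b ^+ 2|]ger0_norm ?sqr_ge0//; apply: ler_wpM2l; first exact: sqr_ge0.
have h1 := bnd3 s; have h2 := bnd111 s; have h3 := bnd12 s.
have h4 : `|pk 1 s * pk 2 s| <= A3 s.
  by rewrite normrM [`|pk 2 s|]ger0_norm// (le_trans _ (pk2_ge s))// sqr_ge0.
move: h1 h2 h4; rewrite -normrX !ler_norml => /andP[? ?] /andP[? ?] /andP[? ?].
by apply/andP; split; lra.
Qed.

Let F12_bnd s : `|pk 1 s * F2 s| <= b * A3 s.
Proof.
rewrite /F2 normrM [`|b * _|]normrM (gtr0_norm hb) mulrCA; apply: ler_wpM2l (ltW hb) _ _ _.
apply: le_trans (bnd12 s); rewrite ler_wpM2l//.
rewrite -expr2 ger0_norm ?subr_ge0//.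
by rewrite lerBlDr lerDl sqr_ge0.
Qed.

Lemma smax_taylor (A : R) :
  (forall s, 0 <= s <= 1 -> gibbs (fun i => y i + s * u i) (fun i => `|u i| ^+ 3) <= A) ->
  `|smax (fun i => y i + u i) - smax y - gibbs y u
    - b * (gibbs y (fun i => u i ^+ 2) - gibbs y u ^+ 2) / 2| <= 6 * b ^+ 2 * A.
Proof.
move=> AP.
have := @taylor3 _ (fun s => smax (ys s)) F1 F2 F3 (6 * b ^+ 2 * A) dF _ dF2 _.
rewrite /F1 /F2 /pk.
have -> : ys 0 = y by apply/funext => i; rewrite /ys mul0r addr0.
have -> : ys 1 = fun i => y i + u i by apply/funext => i; rewrite /ys mul1r.
have -> : (fun i => u i ^+ 1) = u by apply/funext => i; rewrite expr1.
rewrite -expr2; apply.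
- move=> s; have := dpk 1 s; rewrite /pk.
  by have -> : (fun i => u i ^+ 1) = u by apply/funext => i; rewrite expr1.
- move=> s s01; apply: le_trans (F3_bnd s) _.
  by rewrite ler_pM2l ?mulr_gt0 ?exprn_gt0//; exact: AP.
Qed.

Variables (phi t : R) (hphi : 0 < phi) (phib : phi <= b).

Let x s := phi * (smax (ys s) - t).
Let h0 s := stepf (x s).
Let h1 s := phi * (stepf1 (x s) * F1 s).
Let h2 s := phi * (stepf1 (x s) * F2 s + F1 s * (stepf2 (x s) * (phi * F1 s))).
Let h3 s := phi * ((stepf1 (x s) * F3 s + F2 s * (stepf2 (x s) * (phi * F1 s)))
  + (F1 s * (stepf2 (x s) * (phi * F2 s) +
     phi * F1 s * (stepf3 (x s) * (phi * F1 s)))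
     + (stepf2 (x s) * (phi * F1 s)) * F2 s)).

Let dF1 s : is_derive s (1 : R) F1 (F2 s).
Proof. exact: dpk. Qed.

Let dx s : is_derive s (1 : R) x (phi * F1 s).
Proof.
rewrite -[F1 s]addr0.
exact: (is_deriveZf phi (is_deriveDf (dF s) (is_derive_cst (- t) s (1 : R)))).
Qed.

Let dh0 s : is_derive s (1 : R) h0 (h1 s).
Proof.
rewrite (_ : h1 s = stepf1 (x s) * (phi * F1 s)); last by rewrite /h1; ring.
exact: (is_derive_compf (is_derive_stepf _) (dx s)).
Qed.

Let dh1 s : is_derive s (1 : R) h1 (h2 s).
Proof.
exact: (is_deriveZf phi (is_deriveMf
  (is_derive_compf (is_derive_stepf1 _) (dx s)) (dF1 s))).
Qed.

Let dh2 s : is_derive s (1 : R) h2 (h3 s).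
Proof.
exact: (is_deriveZf phi (is_deriveDf
  (is_deriveMf (is_derive_compf (is_derive_stepf1 _) (dx s)) (dF2 s))
  (is_deriveMf (dF1 s) (is_deriveMf (is_derive_compf (is_derive_stepf2 _) (dx s))
     (is_deriveZf phi (dF1 s)))))).
Qed.

(** Since phi <= b, every term of the third derivative is at most phi b^2 A3 up to a constant; 2000
    = 200 (6 + 3 + 1). *)
Let h3_bnd s : `|h3 s| <= 2000 * (phi * b ^+ 2 * A3 s).
Proof.
have [s1 s2 s3] := stepf_bnd (x s).
have -> : h3 s = phi * (stepf1 (x s) * F3 s + 3 * phi * (stepf2 (x s) * (F1 s * F2 s))
    + phi ^+ 2 * (stepf3 (x s) * F1 s ^+ 3)) by rewrite /h3; ring.
have -> : 2000 * (phi * b ^+ 2 * A3 s) = phi * (2000 * (b ^+ 2 * A3 s)) by ring.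
rewrite normrM (gtr0_norm hphi); apply: ler_wpM2l (ltW hphi) _ _ _.
have b2 : 0 < b ^+ 2 by rewrite exprn_gt0.
have p2 : phi * b <= b ^+ 2 by rewrite expr2 ler_pM2r.
have p3 : phi ^+ 2 <= b ^+ 2 by rewrite lerXn2r ?nnegrE ?(ltW hphi) ?(ltW hb).
have a0 := A3_ge0 s.
have e1 : `|stepf1 (x s) * F3 s| <= 200 * (6 * b ^+ 2 * A3 s).
  by rewrite normrM ler_pM.
have e2 : `|3 * phi * (stepf2 (x s) * (F1 s * F2 s))| <= 3 * (200 * (b ^+ 2 * A3 s)).
  rewrite normrM (gtr0_norm (_ : 0 < 3 * phi)) ?mulr_gt0// normrM.
  rewrite -mulrA ler_pM2l// mulrCA ler_pM ?mulr_ge0// ?(ltW hphi)//.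
  apply: (@le_trans _ _ (phi * (b * A3 s))).
    by rewrite ler_pM2l// F12_bnd.
  by rewrite mulrA ler_wpM2r.
have e3 : `|phi ^+ 2 * (stepf3 (x s) * F1 s ^+ 3)| <= 200 * (b ^+ 2 * A3 s).
  rewrite normrM [`|phi ^+ 2|]ger0_norm ?sqr_ge0// normrM mulrCA.
  apply: ler_pM s3 _ => //; first by rewrite mulr_ge0 ?sqr_ge0.
  apply: ler_pM p3 _ => //; first exact: sqr_ge0.
  by rewrite normrX bnd111.
apply: le_trans (ler_normD _ _) _; apply: le_trans (lerD (ler_normD _ _) (lexx _)) _.
apply: le_trans (lerD (lerD e1 e2) e3) _.
have : 0 <= b ^+ 2 * A3 s by rewrite mulr_ge0// ltW.
lra.
Qed.

(** Smooth substitute for the indicator of an orthant: 1 where smax <= t, 0 where smax >= t + 4 /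
    phi. *)
Definition msmooth (y : I -> R) : R := stepf (phi * (smax y - t)).

Definition mquad (y u : I -> R) : R :=
  phi * (stepf1 (phi * (smax y - t)) * (b * (gibbs y (fun i => u i ^+ 2) - gibbs y u ^+ 2))
  + phi * (stepf2 (phi * (smax y - t)) * gibbs y u ^+ 2)).

Lemma msmooth_taylor (A : R) :
  (forall s, 0 <= s <= 1 ->
    `|h3 s| <= A) ->
  `|msmooth (fun i => y i + u i) - msmooth y
    - phi * (stepf1 (phi * (smax y - t)) * gibbs y u) - mquad y u / 2| <= A.
Proof.
move=> AP; have := taylor3 dh0 dh1 dh2 AP.
rewrite /h0 /h1 /h2 /F1 /F2 /x /pk.
have -> : ys 0 = y by apply/funext => i; rewrite /ys mul0r addr0.
have -> : ys 1 = fun i => y i + u i by apply/funext => i; rewrite /ys mul1r.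
have -> : (fun i => u i ^+ 1) = u by apply/funext => i; rewrite expr1.
rewrite /msmooth /mquad expr2.
set g1 := gibbs y u; set g2 := gibbs y _; set s1 := stepf1 _; set s2 := stepf2 _.
by rewrite (_ : g1 * (s2 * (phi * g1)) = phi * (s2 * (g1 * g1)))//; ring.
Qed.

(** The whole segment stays within 1 / b <= 1 / phi of its start in soft maximum, so outside the
    enlarged band the third derivative vanishes all along it. Inside, [gibbs_shift] costs exp 2. *)
Lemma msmooth_taylor_small (U : R) : (forall i, `|u i| <= U) -> b * U <= 1 ->
  `|msmooth (fun i => y i + u i) - msmooth y
    - phi * (stepf1 (phi * (smax y - t)) * gibbs y u) - mquad y u / 2| <=
  2000 * expR 2 * (phi * b ^+ 2) * gibbs y (fun i => `|u i| ^+ 3) *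
    ((t - phi^-1 <= smax y) && (smax y <= t + 5 / phi))%:R.
Proof.
move=> uU bU; apply: msmooth_taylor => s /andP[s0 s1].
have sU i : `|s * u i| <= U.
  by rewrite normrM (ger0_norm s0) (le_trans _ (uU i))// ler_piMl.
case: (boolP (_ && _)) => [_|out] /=; last first.
  rewrite mulr0 (_ : h3 s = 0) ?normr0// /h3.
  have [-> -> ->] : [/\ stepf1 (x s) = 0, stepf2 (x s) = 0 & stepf3 (x s) = 0].
    apply: stepfN_out; rewrite /x.
    have := smax_lip y sU; rewrite ler_norml => /andP[l1 l2].
    have bU' : U <= phi^-1.
      apply: le_trans (_ : b^-1 <= _); first by rewrite -[b^-1]mulr1 ler_pdivlMl.
      by rewrite lef_pV2.
    move: out; rewrite negb_and -!ltNge => /orP[ho|ho].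
      apply/orP; left; rewrite pmulr_rle0//; rewrite /ys; lra.
    apply/orP; right; rewrite -ler_pdivrMl// mulrC /ys; lra.
  by rewrite !(mul0r, mulr0, addr0).
rewrite mulr1; apply: le_trans (h3_bnd s) _.
set G := gibbs y _.
have -> : 2000 * expR 2 * (phi * b ^+ 2) * G = 2000 * (phi * b ^+ 2 * (expR 2 * G)) by ring.
apply: ler_wpM2l; first exact: ler0n.
apply: ler_wpM2l; first exact: mulr_ge0 (ltW hphi) (sqr_ge0 _).
apply: le_trans (gibbs_shift y (U := U) sU _) _; first by move=> i; rewrite exprn_ge0.
apply: ler_wpM2r; first by apply: gibbs_ge0 => i; rewrite exprn_ge0.
by rewrite ler_expR; lra.
Qed.

(** No cancellation is sought: the terms are bounded one by one by constants times 1, bU and (bU)^2,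
    all at most (bU)^3 here. *)
Lemma msmooth_taylor_large (U : R) : (forall i, `|u i| <= U) -> 1 <= b * U ->
  `|msmooth (fun i => y i + u i) - msmooth y
    - phi * (stepf1 (phi * (smax y - t)) * gibbs y u) - mquad y u / 2| <=
  1000 * (b * U) ^+ 3.
Proof.
move=> uU bU.
have [s1 s2 _] := stepf_bnd (phi * (smax y - t)).
have m01 z : 0 <= msmooth z <= 1 by rewrite stepf_ge0 stepf_le1.
have U0 : 0 <= U by apply: le_trans (uU i0); exact: normr_ge0.
have g1 : `|gibbs y u| <= U.
  by apply: le_trans (gibbs_norm _ _) _; rewrite -[leRHS](gibbs_cst y); exact: gibbs_le.
have g2 : gibbs y (fun i => u i ^+ 2) <= U ^+ 2.
  rewrite -[leRHS](gibbs_cst y); apply: gibbs_le => i.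
  by rewrite -[u i ^+ 2]real_normK ?num_real// lerXn2r ?nnegrE.
have g12 := gibbs_jensen2 y u.
set B := b * U in bU *.
have pU : 0 <= phi * U <= B by rewrite mulr_ge0 ?(ltW hphi)//=; apply: ler_wpM2r.
have B2 : B ^+ 2 <= B ^+ 3 by rewrite ler_weXn2l.
have B1 : B <= B ^+ 3 by rewrite -[leLHS]expr1; apply: ler_weXn2l.
have l1 : `|phi * (stepf1 (phi * (smax y - t)) * gibbs y u)| <= 200 * B.
  rewrite normrM (gtr0_norm hphi) normrM mulrCA ler_pM ?mulr_ge0 ?(ltW hphi)//.
  by case/andP: pU => _; apply: le_trans; rewrite ler_pM2l.
have BB : B ^+ 2 = b * (b * U ^+ 2) by rewrite /B; ring.
have l2 : `|mquad y u| <= 200 * B ^+ 2 + 200 * B ^+ 2.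
  rewrite /mquad mulrDr; apply: le_trans (ler_normD _ _) _; apply: lerD.
    rewrite normrM (gtr0_norm hphi) normrM mulrCA ler_pM ?mulr_ge0 ?(ltW hphi)//.
    rewrite BB normrM (gtr0_norm hb) ler_pM ?mulr_ge0 ?(ltW hphi) ?(ltW hb)//.
    rewrite ler_pM2l// ger0_norm ?subr_ge0//.
    by rewrite (le_trans _ g2)// lerBlDr lerDl sqr_ge0.
  rewrite mulrA normrM (gtr0_norm (_ : 0 < phi * phi)) ?mulr_gt0// normrM mulrCA.
  rewrite ler_pM ?mulr_ge0 ?(ltW hphi)// BB -mulrA.
  rewrite ler_pM ?mulr_ge0 ?(ltW hphi)//.
  rewrite ler_pM ?(ltW hphi)//.
  by rewrite ger0_norm ?sqr_ge0// (le_trans g12).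
have := m01 y; have := m01 (fun i => y i + u i).
move: l1 l2; rewrite !ler_norml => /andP[? ?] /andP[? ?] /andP[? ?] /andP[? ?].
by apply/andP; split; lra.
Qed.

End Line.
End Softmax.

(** * Normal laws *)

Section NormalLaw.
Import HBNNSimple.
Context {R : realType}.
Local Notation mu := (@lebesgue_measure R).
Local Notation TR := (measurableTypeR R).

Lemma lebesgue_measure_affine (a c : R) (ha : 0 < a) (A : set R) : measurable A ->
  (a%:E * pushforward mu (fun x : TR => (a * x + c)%R : TR) A)%E = mu A.
Proof.
move=> mA.
pose h : TR -> TR := fun x => (a * x + c)%R.
have mf : measurable_fun [set: TR] h.
  by apply: measurable_funD => //; exact: measurable_funM.
pose m0 : {measure set TR -> \bar R} :=
  measure_function_pushforward__canonical__measure_function_Measure mu mf.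
rewrite -[LHS]/(mscale (NngNum (ltW ha)) m0 A).
apply/esym/lebesgue_measure_unique => //= _ [[x y]] _ <-.
rewrite /mscale/= /pushforward/=.
have -> : h @^-1` `]x, y] = `](x - c) / a, (y - c) / a]%classic.
  apply/seteqP; split=> z /=; rewrite /h !in_itv/= => /andP[h1 h2]; apply/andP; split.
  - by rewrite ltr_pdivrMr//; lra.
  - by rewrite ler_pdivlMr//; lra.
  - by move: h1; rewrite ltr_pdivrMr//; lra.
  - by move: h2; rewrite ler_pdivlMr//; lra.
rewrite !lebesgue_measure_itv/= !lte_fin ltr_pM2r ?invr_gt0// ltrD2r.
case: ifPn => _; last by rewrite mule0.
by rewrite -!EFinD -EFinM; congr EFin; field; rewrite gt_eqF.
Qed.

Lemma ge0_integral_affine (a c : R) (ha : 0 < a) (f : R -> \bar R) :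
  measurable_fun [set: R] f -> (forall x, (0 <= f x)%E) ->
  (\int[mu]_x f x = a%:E * \int[mu]_x f (a * x + c)%R)%E.
Proof.
move=> mf f0.
pose h : TR -> TR := fun x => (a * x + c)%R.
have mg : measurable_fun [set: TR] h.
  by apply: measurable_funD => //; exact: measurable_funM.
pose m0 : {measure set TR -> \bar R} :=
  measure_function_pushforward__canonical__measure_function_Measure mu mg.
transitivity (\int[mscale (NngNum (ltW ha)) m0]_x f x)%E.
  by apply: eq_measure_integral => A mA _; exact: esym (lebesgue_measure_affine c ha mA).
rewrite ge0_integral_mscale//; congr (_ * _)%E.
by rewrite ge0_integral_pushforward.
Qed.

(** Extension from indicators to simple functions by linearity and to nonnegative functions by
    monotone convergence. *)
Lemma integral_normal_prob (m s : R) (f : R -> \bar R) :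
  measurable_fun [set: R] f -> (forall x, (0 <= f x)%E) ->
  (\int[normal_prob m s]_x f x = \int[mu]_x (f x * (normal_pdf m s x)%:E))%E.
Proof.
move=> mf f0.
have mpdf : measurable_fun [set: R] (fun x : R => (normal_pdf m s x)%:E).
  by apply/measurable_EFinP; exact: measurable_normal_pdf.
have p0 x : (0 <= (normal_pdf m s x)%:E)%E by rewrite lee_fin normal_pdf_ge0.
have indic (A : set R) : measurable A ->
    (\int[normal_prob m s]_x (\1_A x)%:E = \int[mu]_x ((\1_A x)%:E * (normal_pdf m s x)%:E))%E.
  move=> mA; rewrite integral_indic// setIT /normal_prob [LHS]integral_mkcond.
  apply: eq_integral => x _; rewrite patchE indicE.
  by case: (x \in A); rewrite ?mul1e ?mul0e.
pose f_ := nnsfun_approx (@measurableT _ TR) (mf : measurable_fun [set: TR] f).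
have step n : (\int[normal_prob m s]_x (f_ n x)%:E =
    \int[mu]_x ((f_ n x)%:E * (normal_pdf m s x)%:E))%E.
  under eq_integral do rewrite fimfunE -fsumEFin//.
  rewrite ge0_integral_fsum//=; last 2 first.
  - by move=> r; exact/measurable_EFinP/measurableT_comp.
  - by move=> r x _; exact: nnfun_muleindic_ge0.
  under [RHS]eq_integral => x _.
    rewrite fimfunE -fsumEFin// ge0_mule_fsuml//; last first.
      by move=> r; exact: nnfun_muleindic_ge0.
    over.
  rewrite /= ge0_integral_fsum//=; last 2 first.
  - move=> r; apply: emeasurable_funM => //.
    by apply/measurable_EFinP/measurable_funM => //; exact: measurable_indic.
  - by move=> r x _; apply: mule_ge0 => //; exact: nnfun_muleindic_ge0.
  apply: eq_fsbigr => r _.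
  have [r0|r0] := leP 0%R r; last first.
    by rewrite !integral0_eq// => x _; rewrite preimage_nnfun0// indic0 mulr0 ?mul0e.
  under eq_integral do rewrite EFinM.
  rewrite ge0_integralZl//=; last exact/measurable_EFinP/measurable_indic.
  rewrite indic; last by apply: (measurable_funPTI (f_ n)); exact: measurable_set1.
  rewrite -ge0_integralZl//.
  - by apply: eq_integral => x _; rewrite EFinM muleA.
  - by apply: emeasurable_funM => //; exact/measurable_EFinP/measurable_indic.
  - by move=> x _; rewrite mule_ge0// lee_fin.
have mono x : {homo (fun n => (f_ n x)%:E) : a b / (a <= b)%N >-> (a <= b)%E}.
  by move=> a b ab; rewrite lee_fin; exact/lefP/nd_nnsfun_approx.
transitivity (lim (\int[normal_prob m s]_x (f_ n x)%:E @[n --> \oo])%E).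
  rewrite -monotone_convergence//=.
  - by apply: eq_integral => x _; apply/esym/cvg_lim => //; exact: cvg_nnsfun_approx.
  - by move=> n; exact/measurable_EFinP/measurable_funTS.
  - by move=> n x _; rewrite lee_fin.
under eq_fun do rewrite step.
rewrite -monotone_convergence//=.
- apply: eq_integral => x _; apply/cvg_lim => //.
  by apply: cvgeZr => //; exact: cvg_nnsfun_approx.
- move=> n; apply: emeasurable_funM => //.
  exact/measurable_EFinP/measurable_funTS.
- by move=> n x _; rewrite mule_ge0// lee_fin.
- by move=> x _ a b ab; rewrite lee_wpmul2r//; exact: (mono x a b ab).
Qed.

Let normal_pdf_def (m s x : R) : s != 0 ->
  normal_pdf m s x = normal_peak s * normal_fun m s x.
Proof. by move=> s0; rewrite /normal_pdf (negbTE s0). Qed.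

(** Completing the square in z: the joint density of z and of u = s z' + t z is the marginal density
    of u times the conditional density of z given u. *)
Lemma normal_pdf_conv (s t u z : R) : 0 < s -> 0 < t ->
  normal_pdf 0 1 z * (normal_pdf 0 1 ((u - t * z) / s) / s) =
  normal_pdf 0 (Num.sqrt (s ^+ 2 + t ^+ 2)) u *
    normal_pdf (u * t / (s ^+ 2 + t ^+ 2)) (s / Num.sqrt (s ^+ 2 + t ^+ 2)) z.
Proof.
move=> s0 t0; set r := Num.sqrt _.
have q0 : 0 < s ^+ 2 + t ^+ 2 by rewrite addr_gt0 ?exprn_gt0.
have r0 : 0 < r by rewrite sqrtr_gt0.
have r2 : s ^+ 2 + t ^+ 2 = r ^+ 2 by rewrite sqr_sqrtr// ltW.
rewrite !normal_pdf_def ?oner_eq0 ?gt_eqF ?divr_gt0//.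
have pE (x : R) : 0 < x -> normal_peak x = (x * Num.sqrt (pi *+ 2))^-1.
  by move=> x0; rewrite /normal_peak -mulrnAr sqrtrM ?sqr_ge0// sqrtr_sqr gtr0_norm.
rewrite !pE ?divr_gt0//; set c := Num.sqrt (pi *+ 2).
have c0 : 0 < c by rewrite sqrtr_gt0 mulrn_wgt0// pi_gt0.
rewrite /normal_fun.
set A := (X in expR X); set B := (X in _ * (_ * expR X / _)).
set C := (X in _ = _ * expR X * _); set D := (X in _ = _ * (_ * expR X)).
have AB : A + B = C + D.
  rewrite /A /B /C /D r2 !subr0.
  rewrite (_ : (s / r) ^+ 2 = s ^+ 2 / (s ^+ 2 + t ^+ 2)); last by rewrite expr_div_n r2.
  rewrite -r2; field.
  by rewrite !gt_eqF.
rewrite [LHS](_ : _ = c^-1 * c^-1 / s * (expR A * expR B)); last first.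
  by rewrite !mul1r; ring.
rewrite [RHS](_ : _ = (r * c)^-1 * (s / r * c)^-1 * (expR C * expR D)); last by ring.
rewrite -!expRD AB; congr (_ * _).
by field; rewrite !gt_eqF.
Qed.

(** The inner integral is rewritten in the variable u = s z + t z', the integrals are exchanged, and
    z' is integrated out through the factorization of the joint density. *)
Lemma normal_stable (s t : R) (f : R -> \bar R) : 0 < s -> 0 < t ->
  measurable_fun [set: R] f -> (forall x, (0 <= f x)%E) ->
  (\int[normal_prob 0 1]_z' \int[normal_prob 0 1]_z f (s * z + t * z')%R =
   \int[normal_prob 0 1]_z f (Num.sqrt (s ^+ 2 + t ^+ 2) * z)%R)%E.
Proof.
move=> s0 t0 mf f0; set r := Num.sqrt _.
have q0 : 0 < s ^+ 2 + t ^+ 2 by rewrite addr_gt0 ?exprn_gt0.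
have r0 : 0 < r by rewrite sqrtr_gt0.
have mpdf (m v : R) : measurable_fun [set: R] (fun x : R => (normal_pdf m v x)%:E).
  by apply/measurable_EFinP; exact: measurable_normal_pdf.
have p0 (m v x : R) : (0 <= (normal_pdf m v x)%:E)%E by rewrite lee_fin normal_pdf_ge0.
have lhs z' : (\int[normal_prob 0 1]_z f (s * z + t * z')%R =
   \int[mu]_u (f u * (normal_pdf 0 1 ((u - t * z') / s) / s)%:E))%E.
  rewrite integral_normal_prob//; last first.
    apply: (measurableT_comp mf) => //.
    by apply: measurable_funD => //; exact: measurable_funM.
  rewrite [RHS](ge0_integral_affine (t * z') s0)//; last 2 first.
  - apply: emeasurable_funM => //; apply/measurable_EFinP; apply: measurable_funM => //.
    apply: (measurableT_comp (measurable_normal_pdf 0 1)).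
    by apply: measurable_funM => //; exact: measurable_funB.
  - by move=> x; rewrite mule_ge0// lee_fin divr_ge0 ?normal_pdf_ge0// ltW.
  rewrite -ge0_integralZl//.
  - apply: eq_integral => x _; rewrite addrK [s * x]mulrC mulfK ?gt_eqF//.
    rewrite muleCA -EFinM; congr (_ * _%:E)%E.
    by rewrite mulrCA divff ?mulr1// gt_eqF.
  - apply: emeasurable_funM => //.
      apply: (measurableT_comp mf) => //.
      by apply: measurable_funD => //; exact: measurable_funM.
    apply/measurable_EFinP; apply: measurable_funM => //.
    apply: (measurableT_comp (measurable_normal_pdf 0 1)).
    apply: measurable_funM => //; apply: measurable_funB => //.
    by apply: measurable_funD => //; exact: measurable_funM.
  - by move=> x _; rewrite mule_ge0// lee_fin divr_ge0 ?normal_pdf_ge0// ltW.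
  - by rewrite lee_fin ltW.
under eq_integral do rewrite lhs.
pose F (p : TR * TR) : \bar R :=
  (f p.2 * ((normal_pdf 0 1 ((p.2 - t * p.1) / s) / s)%:E * (normal_pdf 0 1 p.1)%:E))%E.
have mF0 : measurable_fun [set: TR * TR]
    (fun p : TR * TR => f p.2 * (normal_pdf 0 1 ((p.2 - t * p.1) / s) / s)%:E)%E.
  apply: emeasurable_funM; first exact: measurableT_comp.
  apply/measurable_EFinP; apply: measurable_funM => //.
  apply: (measurableT_comp (measurable_normal_pdf 0 1)).
  apply: measurable_funM => //; apply: measurable_funB => //.
  exact: measurable_funM.
have F00 p : (0 <= f p.2 * (normal_pdf 0 1 ((p.2 - t * p.1) / s) / s)%:E)%E.
  by rewrite mule_ge0// lee_fin divr_ge0 ?normal_pdf_ge0// ltW.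
have mF : measurable_fun [set: TR * TR] F.
  apply: (eq_measurable_fun (fun p : TR * TR =>
    f p.2 * (normal_pdf 0 1 ((p.2 - t * p.1) / s) / s)%:E * (normal_pdf 0 1 p.1)%:E)%E).
    by move=> p _; rewrite /F muleA.
  apply: emeasurable_funM => //.
  by apply: (measurableT_comp (mpdf 0 1)); exact: measurable_fst.
have F0 p : (0 <= F p)%E.
  by rewrite /F muleA mule_ge0.
rewrite [LHS]integral_normal_prob; last 2 first.
- have H := @measurable_fun_fubini_tonelli_F _ _ TR TR R mu _ mF0 F00; exact: H.
- by move=> x; apply: integral_ge0 => y _; exact: (F00 (x, y)).
transitivity (\int[mu]_x \int[mu]_y F (x, y))%E.
  apply: eq_integral => x _; rewrite -ge0_integralZr//.
  - by apply: eq_integral => y _; rewrite /F /= muleA.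
  - have mp : measurable_fun [set: TR] (fun y : TR => (x, y) : TR * TR).
      by apply: measurable_fun_pair.
    exact: (measurableT_comp mF0 mp).
  - by move=> y _; exact: (F00 (x, y)).
rewrite (fubini_tonelli F)//.
transitivity (\int[mu]_y (f y * (normal_pdf 0 r y)%:E))%E.
  apply: eq_integral => y _.
  transitivity (\int[mu]_x ((f y * (normal_pdf 0 r y)%:E) *
      (normal_pdf (y * t / (s ^+ 2 + t ^+ 2)) (s / r) x)%:E))%E.
    apply: eq_integral => x _; rewrite /F/= -muleA; congr (_ * _)%E.
    by rewrite -!EFinM -normal_pdf_conv// mulrC.
  rewrite ge0_integralZl//; last by rewrite mule_ge0.
    by rewrite integral_normal_pdf mule1.
  exact: mpdf.
rewrite [LHS](ge0_integral_affine 0 r0)//; last 2 first.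
- by apply: emeasurable_funM.
- by move=> x; rewrite mule_ge0.
rewrite integral_normal_prob//; last first.
  by apply: (measurableT_comp mf); exact: measurable_funM.
rewrite -ge0_integralZl//.
- apply: eq_integral => x _; rewrite addr0 muleCA -EFinM; congr (_ * _%:E)%E.
  rewrite !normal_pdf_def ?oner_eq0 ?gt_eqF// /normal_peak /normal_fun.
  rewrite expr1n mul1r -mulrnAr sqrtrM ?sqr_ge0// sqrtr_sqr gtr0_norm// mulrA.
  congr (_ * expR _); first by rewrite invfM mulrA divff ?mul1r// gt_eqF.
  by rewrite !subr0; field; rewrite gt_eqF.
- apply: emeasurable_funM.
    by apply: (measurableT_comp mf); apply: measurable_funD => //; exact: measurable_funM.
  apply: measurableT_comp => //.
  apply: (measurableT_comp (measurable_normal_pdf 0 r)).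
  by apply: measurable_funD => //; exact: measurable_funM.
- by move=> x _; rewrite mule_ge0.
- by rewrite lee_fin ltW.
Qed.

Lemma normal_sym (f : R -> \bar R) :
  measurable_fun [set: R] f -> (forall x, (0 <= f x)%E) ->
  (\int[normal_prob 0 1]_z f (- z)%R = \int[normal_prob 0 1]_z f z)%E.
Proof.
move=> mf f0.
have mN : measurable_fun [set: TR] (fun z : TR => (- z)%R : TR).
  exact: measurable_funN.
rewrite !integral_normal_prob//; last exact: (measurableT_comp mf).
pose g (x : TR) : \bar R := (f (- x)%R * (normal_pdf 0 1 (- x))%:E)%E.
have mpdf : measurable_fun [set: TR] (fun x : TR => (normal_pdf 0 1 x)%:E).
  by apply/measurable_EFinP; exact: measurable_normal_pdf.
have mG : measurable_fun [set: TR] (fun x => f x * (normal_pdf 0 1 x)%:E)%E.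
  exact: emeasurable_funM.
transitivity (\int[mu]_x g x)%E.
  apply: eq_integral => x _; rewrite /g; congr (_ * _%:E)%E.
  rewrite !normal_pdf_def ?oner_eq0//; congr (_ * expR _).
  by rewrite !subr0 sqrrN.
pose m0 : {measure set TR -> \bar R} :=
  measure_function_pushforward__canonical__measure_function_Measure mu mN.
transitivity (\int[m0]_x (f x * (normal_pdf 0 1 x)%:E))%E; last first.
  by apply: eq_measure_integral => A mA _; exact: lebesgue_measureN.
rewrite ge0_integral_pushforward// => x _.
by rewrite mule_ge0// lee_fin normal_pdf_ge0.
Qed.

Lemma normal_abs (k b : R) (f : R -> \bar R) :
  measurable_fun [set: R] f -> (forall x, (0 <= f x)%E) ->
  (\int[normal_prob 0 1]_z f (k * z + b)%R = \int[normal_prob 0 1]_z f (`|k| * z + b)%R)%E.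
Proof.
move=> mf f0; have [k0|k0] := leP 0 k; first by rewrite ger0_norm.
have mk : measurable_fun [set: R] (fun z => f (- k * z + b)%R).
  apply: (measurableT_comp mf); apply: measurable_funD; last exact: measurable_cst.
  by apply: measurable_funM.
rewrite ltr0_norm// -[RHS]normal_sym//.
by apply: eq_integral => z _; rewrite mulrNN.
Qed.

(** Symmetry of the normal law reduces to nonnegative coefficients. A zero coefficient gives a
    degenerate term to which the density argument does not apply, so it is handled apart. *)
Lemma normal_stableT (s t b : R) (f : R -> \bar R) :
  measurable_fun [set: R] f -> (forall x, (0 <= f x)%E) ->
  (\int[normal_prob 0 1]_z' \int[normal_prob 0 1]_z f (s * z + (t * z' + b))%R =
   \int[normal_prob 0 1]_z f (Num.sqrt (s ^+ 2 + t ^+ 2) * z + b)%R)%E.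
Proof.
move=> mf f0.
have cst1 (k : \bar R) : (\int[normal_prob 0 1]_(_ in [set: TR]) k = k)%E.
  rewrite integral_cst// [X in (_ * X)%E](_ : _ = 1%E) ?mule1//.
  exact: probability_setT.
under eq_integral do rewrite normal_abs//.
pose g (x : R) : \bar R := (\int[normal_prob 0 1]_z f (`|s| * z + x)%R)%E.
have mF : measurable_fun [set: TR * TR] (fun p : TR * TR => f (`|s| * p.2 + p.1)).
  apply: (measurableT_comp mf); apply: measurable_funD => //.
  by apply: measurable_funM => //; exact: measurable_snd.
have mg : measurable_fun [set: TR] g.
  have H := @measurable_fun_fubini_tonelli_F _ _ TR TR R (normal_prob 0 1) _ mF (fun x => f0 _).
  exact: H.
have g0 x : (0 <= g x)%E by exact: integral_ge0.
rewrite -/(g _) (normal_abs t b mg g0) /g.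
have [s0|s0] := eqVneq s 0.
  rewrite s0 normr0 expr0n/= add0r sqrtr_sqr.
  by apply: eq_integral => z _; under eq_integral do rewrite mul0r add0r; rewrite cst1.
have [t0|t0] := eqVneq t 0.
  rewrite t0 normr0 expr0n/= addr0 sqrtr_sqr.
  by under eq_integral do under eq_integral do rewrite mul0r add0r; rewrite cst1.
have := @normal_stable `|s| `|t| (fun x => f (x + b)%R).
rewrite !normr_gt0 s0 t0 => /(_ isT isT) H.
rewrite !real_normK ?num_real// in H.
rewrite -H; last 2 first.
- by apply: (measurableT_comp mf); exact: measurable_funD.
- by move=> x; exact: f0.
by apply: eq_integral => z _; apply: eq_integral => z' _; rewrite addrA.
Qed.

End NormalLaw.

(** * Averaging operators *)

Lemma integral_cst_prob (d : measure_display) (T : measurableType d) (R : realType)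
  (P : probability T R) (k : \bar R) : (\int[P]_t k = k)%E.
Proof.
rewrite integral_cst// [X in (_ * X)%E](_ : _ = 1%E) ?mule1//.
exact: probability_setT.
Qed.

Section Averaging.
Context {R : realType} {J : finType}.

(* Measurability on the plain function space J -> R, which carries no
   canonical sigma-algebra: f turns coordinatewise measurable maps into
   measurable functions. *)
Definition cmeas (f : (J -> R) -> \bar R) : Prop :=
  forall (d : measure_display) (T : measurableType d) (psi : T -> J -> R),
    (forall j, measurable_fun [set: T] (psi^~ j)) ->
    measurable_fun [set: T] (fun t => f (psi t)).

Definition nnc (f : (J -> R) -> \bar R) : Prop := cmeas f /\ (forall w, 0 <= f w)%E.

(** Convolution of [f] with the law of the random vector [psi]. Composing such operators amounts to
    adding independent vectors, even when all of them live on the same space. *)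
Definition avg (d : measure_display) (T : measurableType d) (P : probability T R)
    (psi : T -> J -> R) (f : (J -> R) -> \bar R) (w : J -> R) : \bar R :=
  (\int[P]_t f (fun j => (w j + psi t j)%R))%E.

Context {d : measure_display} {T : measurableType d} {P : probability T R}.
Implicit Types (f g : (J -> R) -> \bar R) (psi chi : T -> J -> R).

Lemma nnc_shift_measurable f psi (w : J -> R) : nnc f ->
  (forall j, measurable_fun [set: T] (psi^~ j)) ->
  measurable_fun [set: T] (fun t => f (fun j => w j + psi t j)).
Proof. by move=> [mf _] mpsi; apply: mf => j; apply: measurable_funD. Qed.

Lemma avg_nnc f psi : nnc f -> (forall j, measurable_fun [set: T] (psi^~ j)) ->
  nnc (avg P psi f).
Proof.
move=> [mf f0] mpsi; split; last by move=> w; exact: integral_ge0.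
move=> d' T' chi mchi.
pose F (x : T' * T) := f (fun j => chi x.1 j + psi x.2 j).
have mF : measurable_fun [set: T' * T] F.
  apply: mf => j; apply: measurable_funD.
    exact: (measurableT_comp (mchi j) measurable_fst).
  exact: (measurableT_comp (mpsi j) measurable_snd).
exact: (@measurable_fun_fubini_tonelli_F _ _ _ _ _ P F mF (fun x => f0 _)).
Qed.

Lemma avg_le f g psi w : nnc f -> nnc g ->
  (forall j, measurable_fun [set: T] (psi^~ j)) ->
  (forall w, f w <= g w)%E -> (avg P psi f w <= avg P psi g w)%E.
Proof.
move=> nf ng mpsi fg; apply: ge0_le_integral => //.
- by move=> t _; case: nf.
- exact: nnc_shift_measurable.
- exact: nnc_shift_measurable.
Qed.

Lemma nncD f g : nnc f -> nnc g -> nnc (fun w => f w + g w)%E.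
Proof.
move=> [mf f0] [mg g0]; split=> [d' T' psi mpsi|w]; last exact: adde_ge0.
by apply: emeasurable_funD; [exact: mf|exact: mg].
Qed.

Lemma nncZ f (k : R) : 0 <= k -> nnc f -> nnc (fun w => k%:E * f w)%E.
Proof.
move=> k0 [mf f0]; split=> [d' T' psi mpsi|w]; last by rewrite mule_ge0.
by apply: measurable_funeM; exact: mf.
Qed.

Lemma nnc_cst (k : R) : 0 <= k -> nnc (fun _ => k%:E).
Proof. by move=> k0; split=> [d' T' psi mpsi|w]; rewrite ?lee_fin. Qed.

Lemma avgD f g psi w : nnc f -> nnc g ->
  (forall j, measurable_fun [set: T] (psi^~ j)) ->
  avg P psi (fun w => f w + g w)%E w = (avg P psi f w + avg P psi g w)%E.
Proof.
move=> nf ng mpsi; rewrite /avg ge0_integralD//.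
- by move=> t _; case: nf.
- exact: nnc_shift_measurable.
- by move=> t _; case: ng.
- exact: nnc_shift_measurable.
Qed.

Lemma avgZ f (k : R) psi w : 0 <= k -> nnc f ->
  (forall j, measurable_fun [set: T] (psi^~ j)) ->
  avg P psi (fun w => k%:E * f w)%E w = (k%:E * avg P psi f w)%E.
Proof.
move=> k0 nf mpsi; rewrite /avg ge0_integralZl//.
- exact: nnc_shift_measurable.
- by move=> t _; case: nf.
Qed.

Lemma avg_cst (k : R) psi w : avg P psi (fun _ => k%:E) w = k%:E.
Proof. exact: integral_cst_prob. Qed.

End Averaging.

Section AveragingCommute.
Context {R : realType} {J : finType}.
Context {d : measure_display} {T : measurableType d} {P : probability T R}.
Context {d' : measure_display} {T' : measurableType d'} {P' : probability T' R}.

(** Tonelli's theorem; in terms of sums, independent summands may be added in any order. *)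
Lemma avgC (f : (J -> R) -> \bar R) psi chi w : nnc f ->
  (forall j, measurable_fun [set: T] (psi^~ j)) ->
  (forall j, measurable_fun [set: T'] (chi^~ j)) ->
  avg P psi (avg P' chi f) w = avg P' chi (avg P psi f) w.
Proof.
move=> [mf f0] mpsi mchi.
pose F (x : T * T') := f (fun j => w j + psi x.1 j + chi x.2 j).
have mF : measurable_fun [set: T * T'] F.
  apply: mf => j; apply: measurable_funD; last first.
    exact: (measurableT_comp (mchi j) measurable_snd).
  by apply: measurable_funD => //; exact: (measurableT_comp (mpsi j) measurable_fst).
rewrite /avg (fubini_tonelli F mF (fun x => f0 _)).
apply: eq_integral => t _; apply: eq_integral => t' _; rewrite /F/=.
by congr f; apply/funext => j; rewrite addrAC.
Qed.

End AveragingCommute.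

(** * Laws of finite families and independence as nested averaging *)

Section TupleLaw.
Context {d : measure_display} {T : measurableType d} {R : realType}.

Definition tuple_rect m (A : 'I_m -> set T) : set (m.-tuple T) :=
  [set x | forall i, A i (tnth x i)].

Lemma measurable_tuple_rect m (A : 'I_m -> set T) :
  (forall i, measurable (A i)) -> measurable (tuple_rect A).
Proof.
move=> mA.
rewrite (_ : tuple_rect A = \bigcap_(i in [set: 'I_m]) ((fun x => tnth x i) @^-1` A i)).
  apply: fin_bigcap_measurable => // i _.
  by rewrite -[X in measurable X]setTI; exact: (measurable_tnth i).
by apply/seteqP; split=> x /= H i; [move=> _|]; exact: H.
Qed.

(** Rectangles are stable under intersection and generate the sigma-algebra of tuples, so a finite
    measure is determined by them. *)
Lemma tuple_measure_unique m (m1 m2 : {measure set (m.-tuple T) -> \bar R}) :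
  (m1 setT < +oo)%E ->
  (forall A : 'I_m -> set T, (forall i, measurable (A i)) ->
     m1 (tuple_rect A) = m2 (tuple_rect A)) ->
  forall B, measurable B -> m1 B = m2 B.
Proof.
move=> m1T H B mB.
pose G : set (set (m.-tuple T)) :=
  [set B | exists2 A : 'I_m -> set T, (forall i, measurable (A i)) & B = tuple_rect A].
have rT : tuple_rect (fun _ : 'I_m => [set: T]) = setT.
  by apply/seteqP; split.
apply: (measure_unique G (fun _ => setT)) => //.
- apply/seteqP; split; last first.
    apply: smallest_sub; first exact: sigma_algebra_measurable.
    by move=> _ [A mA ->]; exact: measurable_tuple_rect.
  apply: smallest_sub; first exact: smallest_sigma_algebra.
  move=> C /=; rewrite -bigcup_seq => -[i _ [A mA <-]].
  apply: sub_sigma_algebra.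
  exists (fun j => if j == i then A else setT) => [j|]; first by case: ifP.
  apply/seteqP; split=> x /=.
    by move=> [_ Ax] j; case: eqP => // ->.
  by move=> /(_ i); rewrite eqxx.
- move=> _ _ [A mA ->] [A' mA' ->]; exists (fun i => A i `&` A' i).
    by move=> i; exact: measurableI.
  apply/seteqP; split=> x /=; first by move=> [h1 h2] i; split; [exact: h1|exact: h2].
  by move=> h; split=> i; case: (h i).
- by move=> _; exists (fun _ => setT).
- by rewrite bigcup_const.
- by move=> _ [A mA ->]; exact: H.
Qed.

End TupleLaw.

Section Independence.
Context {d : measure_display} {T : measurableType d} {R : realType} {P : probability T R}.
Context {d' : measure_display} {T' : measurableType d'} {I : finType}.
Variable X : I -> {RV P >-> T'}.
Hypothesis indX : mutually_independent X.

Let Ytup (s : seq I) (t : T) : (size s).-tuple T' :=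
  [tuple X (tnth (in_tuple s) k) t | k < size s].

Let mYtup s : measurable_fun [set: T] (Ytup s).
Proof.
apply/measurable_fun_tnthP => k.
rewrite (_ : _ \o _ = X (tnth (in_tuple s) k)).
  exact: measurable_funP.
by apply/funext => t /=; rewrite tnth_mktuple.
Qed.

Let consf m (x : T' * m.-tuple T') : m.+1.-tuple T' := [tuple of x.1 :: x.2].

Let mconsf m : measurable_fun [set: T' * m.-tuple T'] (@consf m).
Proof. exact: measurable_cons measurable_fst measurable_snd. Qed.

Let tnth_cons0 m (x : T') (y : m.-tuple T') : tnth [tuple of x :: y] ord0 = x.
Proof. by rewrite (tnth_nth x). Qed.

Let tnth_consS m (x : T') (y : m.-tuple T') k :
  tnth [tuple of x :: y] (lift ord0 k) = tnth y k.
Proof. by rewrite !(tnth_nth x). Qed.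

Let rect_cons m (A : 'I_m.+1 -> set T') (x : T') (y : m.-tuple T') :
  tuple_rect A [tuple of x :: y] <->
  A ord0 x /\ tuple_rect (fun k => A (lift ord0 k)) y.
Proof.
split=> [H|[H0 H1] k].
  split; first by have := H ord0; rewrite tnth_cons0.
  by move=> k; have := H (lift ord0 k); rewrite tnth_consS.
case: (unliftP ord0 k) => [l|] ->; rewrite ?tnth_cons0// tnth_consS.
exact: H1.
Qed.

Let indep_rect (i : I) (s : seq I) (A : 'I_(size s).+1 -> set T') :
  uniq (i :: s) -> (forall k, measurable (A k)) ->
  P [set t | tuple_rect A [tuple of X i t :: Ytup s t]] =
  (P (X i @^-1` A ord0) *
   P [set t | tuple_rect (fun k => A (lift ord0 k)) (Ytup s t)])%E.
Proof.
move=> /= /andP[iNs us] mA.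
(* The k-th entry of [s] receives the set of index k + 1; indices outside [s] receive the full
   space, which leaves the product rule for the subfamily. *)
pose B0 j : set T' := if insub (index j s) is Some k then A (lift ord0 k) else setT.
pose B (A0 : set T') j : set T' := if j == i then A0 else B0 j.
have mB A0 : measurable A0 -> forall j, measurable (B A0 j).
  move=> mA0 j; rewrite /B /B0; case: ifP => // _.
  by case: insubP => // k _ _; exact: mA.
have setE A0 : [set t | forall j, B A0 j (X j t)] =
    [set t | A0 (X i t) /\ tuple_rect (fun k => A (lift ord0 k)) (Ytup s t)].
  apply/seteqP; split=> t /=.
    move=> H; split; first by have := H i; rewrite /B eqxx.
    move=> k; rewrite tnth_mktuple; set j := tnth _ k.
    have js : j \in s by rewrite /j (tnth_nth i)/= mem_nth.
    have := H j; rewrite /B; case: eqP => [ji|_]; first by move: iNs; rewrite -ji js.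
    have ik : index j s = k by rewrite /j (tnth_nth i)/= index_uniq.
    rewrite /B0 ik; case: insubP => [l _ lk|]; last by rewrite ltn_ord.
    by rewrite (_ : l = k)//; exact/val_inj.
  move=> [H0 H1] j; rewrite /B; case: eqP => [->//|_].
  rewrite /B0; case: insubP => // k _ ki.
  have := H1 k; rewrite tnth_mktuple (tnth_nth i)/= ki nth_index//.
  by rewrite -index_mem -ki ltn_ord.
have cond1 : [set t | tuple_rect A [tuple of X i t :: Ytup s t]] =
    [set t | forall j, B (A ord0) j (X j t)].
  by rewrite setE; apply/seteqP; split=> t /= /rect_cons.
have cond2 : [set t | tuple_rect (fun k => A (lift ord0 k)) (Ytup s t)] =
    [set t | forall j, B setT j (X j t)].
  by rewrite setE; apply/seteqP; split=> t /=; [|case].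
rewrite cond1 cond2 !indX; [|exact: mB|exact: mB].
rewrite (bigD1 i)//= [in RHS](bigD1 i)//= {1 3}/B eqxx preimage_setT probability_setT mul1e.
congr (_ * _)%E; apply: eq_bigr => j ji.
by rewrite /B (negbTE ji).
Qed.

(** The law of [X i] joined with the tuple over [s] agrees with the product law on rectangles, hence
    everywhere, and Tonelli separates the integrals. The pair is stored as one longer tuple so that
    uniqueness on tuples applies. *)
Lemma indep_integral_cons (i : I) (s : seq I) (F : T' * (size s).-tuple T' -> \bar R) :
  uniq (i :: s) -> measurable_fun setT F -> (forall x, (0 <= F x)%E) ->
  (\int[P]_t F (X i t, Ytup s t) = \int[P]_t \int[P]_t' F (X i t, Ytup s t'))%E.
Proof.
move=> us mF F0; set m := size s in F mF F0 *.
pose Y : {mfun T >-> m.-tuple T'} := mfun_Sub (mem_set (@mYtup s)).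
have mC : measurable_fun [set: T] (fun t => [tuple of X i t :: Ytup s t]).
  by apply: measurable_cons; [exact: measurable_funP|exact: (@mYtup s)].
pose C : {mfun T >-> m.+1.-tuple T'} := mfun_Sub (mem_set mC).
pose m1 : {measure set (m.+1.-tuple T') -> \bar R} := distribution P C.
pose pr := (distribution P (X i) \x distribution P Y)%E.
pose m2 : {measure set (m.+1.-tuple T') -> \bar R} :=
  measure_function_pushforward__canonical__measure_function_Measure pr (@mconsf m).
pose F' (x : m.+1.-tuple T') := F (tnth x ord0, [tuple of behead x]).
have mF' : measurable_fun setT F'.
  apply: (measurableT_comp mF); apply: measurable_fun_pair.
    exact: measurable_tnth.
  exact: measurable_behead.
have beh (x : T') (y : m.-tuple T') : [tuple of behead [tuple of x :: y]] = y.
  exact/val_inj.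
transitivity (\int[m1]_x F' x)%E.
  rewrite /m1 ge0_integral_distribution//; last by move=> x; exact: F0.
  by apply: eq_integral => t _; rewrite /F' /= tnth_cons0 beh.
transitivity (\int[m2]_x F' x)%E.
  apply: eq_measure_integral => A mA _.
  apply: tuple_measure_unique => //; first by rewrite (_ : m1 setT = 1%E) ?ltry//; exact: probability_setT.
  move=> {mA}A mA; rewrite [LHS]/= /distribution /pushforward.
  rewrite [LHS](indep_rect us mA) [RHS]/= /pushforward.
  rewrite (_ : _ @^-1` _ = A ord0 `*` tuple_rect (fun k => A (lift ord0 k))).
    by rewrite product_measure1E//; exact: measurable_tuple_rect.
  by apply/seteqP; split=> -[x y] /= /rect_cons.
rewrite /m2 ge0_integral_pushforward//=; last 2 first.
- exact: mconsf.
- by move=> x _; exact: F0.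
under eq_integral => x _.
  rewrite /F' /= tnth_cons0 beh -surjective_pairing; over.
rewrite /pr fubini_tonelli1//.
rewrite ge0_integral_distribution//; last 2 first.
- exact: measurable_fun_fubini_tonelli_F.
- by move=> x; exact: integral_ge0.
apply: eq_integral => t _; rewrite /= /fubini_F.
rewrite ge0_integral_distribution//.
apply: (measurableT_comp mF); exact: measurable_fun_pair.
Qed.

(** Peeling off one summand at a time turns the law of an independent sum into a composition of
    averaging operators. *)
Lemma indep_avg {J : finType} (psi : I -> T' -> J -> R) (f : (J -> R) -> \bar R)
    (s : seq I) (w : J -> R) :
  (forall i j, measurable_fun [set: T'] (fun x => psi i x j)) -> nnc f -> uniq s ->
  (\int[P]_t f (fun j => (w j + \sum_(i <- s) psi i (X i t) j)%R) =
   foldr (fun i g => avg P (fun t => psi i (X i t)) g) f s w)%E.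
Proof.
move=> mpsi [mf f0]; elim: s w => [|i s IH] w us.
  under eq_integral do under eq_fun do rewrite big_nil addr0.
  exact: integral_cst_prob.
have := us => /= /andP[_ us'].
pose F (x : T' * (size s).-tuple T') := f (fun j => w j + (psi i x.1 j +
  \sum_(k < size s) psi (tnth (in_tuple s) k) (tnth x.2 k) j)).
have mF : measurable_fun setT F.
  apply: mf => j; apply: measurable_funD => //; apply: measurable_funD.
    exact: (measurableT_comp (mpsi i j) measurable_fst).
  apply: measurable_sum => k.
  apply: (measurableT_comp (mpsi _ j)).
  exact: (measurableT_comp (measurable_tnth k) measurable_snd).
transitivity (\int[P]_t F (X i t, Ytup s t))%E.
  apply: eq_integral => t _; rewrite /F/=; congr f; apply/funext => j.
  rewrite big_cons big_tnth; congr (_ + (_ + _)).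
  by apply: eq_bigr => k _; rewrite tnth_mktuple.
rewrite indep_integral_cons//; last by move=> x; exact: f0.
apply: eq_integral => t _; rewrite /F/= -IH//.
apply: eq_integral => t' _; congr f; apply/funext => j.
rewrite addrA [in RHS]big_tnth; congr (_ + _).
by apply: eq_bigr => k _; rewrite tnth_mktuple.
Qed.

End Independence.

Lemma normal_integral (d : measure_display) (T : measurableType d) (R : realType)
    (P : probability T R) (e : {RV P >-> R}) (f : R -> \bar R) :
  standard_normal e ->
  measurable_fun [set: R] f -> (forall x, (0 <= f x)%E) ->
  (\int[P]_t f (e t) = \int[normal_prob 0 1]_z f z)%E.
Proof.
move=> stdE mf f0.
pose e' : T -> measurableTypeR R := e.
have me : measurable_fun [set: T] e' by have := @measurable_funPT _ _ _ _ e.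
pose ei : {mfun T >-> measurableTypeR R} := mfun_Sub (mem_set me).
rewrite -(ge0_integral_distribution ei mf f0).
by apply: (eq_measure_integral (normal_prob 0 1)) => A mA _; exact: stdE.
Qed.

(** * Gaussian averaging operators and their semigroup property *)

Section GaussianOperators.
Context {d : measure_display} {T : measurableType d} {R : realType} {P : probability T R}.
Context {I J : finType}.
Variable e : I -> {RV P >-> R}.
Hypothesis indE : mutually_independent e.
Hypothesis stdE : forall i, standard_normal (e i).
Implicit Types (a : I -> J -> R) (f : (J -> R) -> \bar R) (w : J -> R).

Definition gvec a (t : T) (j : J) : R := \sum_i a i j * e i t.

Lemma measurable_gvec a j : measurable_fun [set: T] (fun t => gvec a t j).
Proof.
by apply: measurable_sum => i; apply: measurable_funM.
Qed.

Lemma measurable_gvecZ a s j : measurable_fun [set: T] (fun t => s * gvec a t j).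
Proof. by apply: measurable_funM => //; exact: measurable_gvec. Qed.

Definition gop a (s : R) f := avg P (fun t j => s * gvec a t j) f.

Let gop1 a (i : I) (s : R) f := avg (normal_prob 0 1) (fun (z : R) j => s * (a i j * z)) f.

Let mgop1 a i s j : measurable_fun [set: R] (fun z : R => s * (a i j * z)).
Proof. by apply: measurable_funM => //; exact: measurable_funM. Qed.

Let gop1_nnc a i s f : nnc f -> nnc (gop1 a i s f).
Proof. by move=> nf; apply: avg_nnc => // j; exact: mgop1. Qed.

Let fold_nnc a s (r : seq I) f : nnc f -> nnc (foldr (fun i => gop1 a i s) f r).
Proof. by move=> nf; elim: r => //= i r IH; exact: gop1_nnc. Qed.

Lemma gop_nnc a s f : nnc f -> nnc (gop a s f).
Proof. by move=> nf; apply: avg_nnc => // j; exact: measurable_gvecZ. Qed.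

Let gopE a s f w : nnc f -> gop a s f w = foldr (fun i => gop1 a i s) f (enum I) w.
Proof.
move=> nf.
have m1 i j : measurable_fun [set: R] (fun z : R => s * (a i j * z)) by exact: mgop1.
transitivity (foldr (fun i g => avg P (fun t j => s * (a i j * e i t)) g) f (enum I) w).
  rewrite -(indep_avg indE w m1 nf (enum_uniq _)) /gop /avg.
  apply: eq_integral => t _; congr f; apply/funext => j; congr (_ + _).
  by rewrite /gvec mulr_sumr big_enum.
have: nnc f by [].
move: (enum I) => r; elim: r w => //= i r IH w nf'.
have -> : foldr (fun i0 (g : (J -> R) -> \bar R) =>
    avg P (fun t j => s * (a i0 j * e i0 t)) g) f r = foldr (fun i => gop1 a i s) f r.
  by apply/funext => v; exact: IH.
have [mg g0] := fold_nnc a s r nf.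
rewrite /gop1 /avg (normal_integral (stdE i) (f := fun z =>
  foldr (fun i => gop1 a i s) f r (fun j => w j + s * (a i j * z))))//.
by apply: mg => j; exact: measurable_funD.
Qed.

Let gop1_merge a i s t f w : nnc f ->
  gop1 a i s (gop1 a i t f) w = gop1 a i (Num.sqrt (s ^+ 2 + t ^+ 2)) f w.
Proof.
move=> [mf f0]; rewrite /gop1 /avg.
pose g (z : R) : \bar R := f (fun j => w j + a i j * z).
have mg : measurable_fun [set: R] g.
  by apply: mf => j; apply: measurable_funD => //; exact: measurable_funM.
have H := @normal_stableT _ t s 0 g mg (fun x => f0 _).
transitivity (\int[normal_prob 0 1]_z' \int[normal_prob 0 1]_z
  g (t * z + (s * z' + 0))%R)%E.
  apply: eq_integral => z _; apply: eq_integral => z' _.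
  by congr f; apply/funext => j; ring.
rewrite H; apply: eq_integral => z _; congr f; apply/funext => j.
by rewrite [s ^+ 2 + _]addrC; ring.
Qed.

(** The one-dimensional operators commute, so the two factors attached to the same multiplier can be
    brought together and merged. *)
Let fold_comm a i s t (r : seq I) f w : nnc f ->
  foldr (fun k => gop1 a k s) (gop1 a i t f) r w =
  gop1 a i t (foldr (fun k => gop1 a k s) f r) w.
Proof.
move=> nf; elim: r w => [//|k r IH] w.
transitivity (gop1 a k s (gop1 a i t (foldr (fun k => gop1 a k s) f r)) w).
  have E : foldr (fun k => gop1 a k s) (gop1 a i t f) r =
    gop1 a i t (foldr (fun k => gop1 a k s) f r) by apply/funext => v; exact: IH.
  by rewrite -E.
apply: avgC.
- exact: fold_nnc.
- by move=> j; exact: mgop1.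
- by move=> j; exact: mgop1.
Qed.

Let fold_merge a s t (r : seq I) f w : nnc f ->
  foldr (fun k => gop1 a k s) (foldr (fun k => gop1 a k t) f r) r w =
  foldr (fun k => gop1 a k (Num.sqrt (s ^+ 2 + t ^+ 2))) f r w.
Proof.
move=> nf; elim: r w => [//|i r IH] w.
set g := foldr (fun k => gop1 a k t) f r.
have ng : nnc g by exact: fold_nnc.
have E1 : foldr (fun k => gop1 a k s) (gop1 a i t g) r =
    gop1 a i t (foldr (fun k => gop1 a k s) g r).
  by apply/funext => v; exact: (fold_comm a i s t r v ng).
have E2 : foldr (fun k => gop1 a k s) g r =
    foldr (fun k => gop1 a k (Num.sqrt (s ^+ 2 + t ^+ 2))) f r.
  by apply/funext => v; exact: IH.
rewrite [LHS]/(gop1 a i s (foldr (fun k => gop1 a k s) (gop1 a i t g) r) w).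
rewrite E1 E2; apply: gop1_merge; exact: fold_nnc.
Qed.

(** Semigroup property: each Gaussian operator splits into one-dimensional ones along the vectors
    [a i], and these merge by stability of the normal law. It serves both to divide the Gaussian
    vector into n equal pieces and to rescale it for anti-concentration. *)
Lemma gop_merge a s t f w : nnc f ->
  gop a s (gop a t f) w = gop a (Num.sqrt (s ^+ 2 + t ^+ 2)) f w.
Proof.
move=> nf; rewrite gopE; last exact: gop_nnc.
have -> : gop a t f = foldr (fun i => gop1 a i t) f (enum I).
  by apply/funext => v; exact: gopE.
by rewrite fold_merge// gopE.
Qed.

End GaussianOperators.

Section GaussianLinear.
Context {d : measure_display} {T : measurableType d} {R : realType} {P : probability T R}.
Context {I : finType}.
Variable e : I -> {RV P >-> R}.
Hypothesis indE : mutually_independent e.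
Hypothesis stdE : forall i, standard_normal (e i).

Lemma normal_linear (c : I -> R) (f : R -> \bar R) :
  measurable_fun [set: R] f -> (forall x, (0 <= f x)%E) ->
  (\int[P]_t f (\sum_i c i * e i t)%R =
   \int[normal_prob 0 1]_z f (Num.sqrt (\sum_i c i ^+ 2) * z)%R)%E.
Proof.
move=> mf f0.
(* A scalar function is seen as a function of a vector with a single coordinate, which makes
   [indep_avg] applicable. *)
pose ff (w : unit -> R) : \bar R := f (w tt).
have nff : nnc ff by split=> [d' T' psi mpsi|w]; [exact: (measurableT_comp mf)|exact: f0].
pose psi (i : I) (z : R) (_ : unit) := c i * z.
have mpsi i j : measurable_fun [set: R] (fun z => psi i z j) by exact: measurable_funM.
transitivity (foldr (fun i g => avg P (fun t => psi i (e i t)) g) ff (enum I) (fun=> 0)).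
  rewrite -(indep_avg indE (fun=> 0) mpsi nff (enum_uniq _)).
  by apply: eq_integral => t _; rewrite /ff add0r big_enum.
have main (r : seq I) w :
  foldr (fun i g => avg P (fun t => psi i (e i t)) g) ff r w =
  (\int[normal_prob 0 1]_z f (Num.sqrt (\sum_(i <- r) c i ^+ 2) * z + w tt)%R)%E.
  elim: r w => [|i r IH] w.
    rewrite big_nil sqrtr0.
    by under eq_integral do rewrite mul0r add0r; rewrite integral_cst_prob.
  rewrite /= big_cons /avg.
  set S := \sum_(i <- r) _ in IH *.
  have S0 : 0 <= S by apply: sumr_ge0 => k _; rewrite sqr_ge0.
  under eq_integral do rewrite IH.
  pose G (x : R) := (\int[normal_prob 0 1]_z f (Num.sqrt S * z + (c i * x + w tt))%R)%E.
  transitivity (\int[P]_t G (e i t))%E.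
    apply: eq_integral => t _; apply: eq_integral => z _.
    by rewrite /psi [w tt + _]addrC.
  rewrite (normal_integral (stdE i)); last 2 first.
  - have mF : measurable_fun [set: measurableTypeR R * measurableTypeR R]
        (fun p : measurableTypeR R * measurableTypeR R => f (Num.sqrt S * p.2 + (c i * p.1 + w tt))).
      apply: (measurableT_comp mf); apply: measurable_funD.
        by apply: measurable_funM => //; exact: measurable_snd.
      by apply: measurable_funD => //; apply: measurable_funM => //; exact: measurable_fst.
    have H := @measurable_fun_fubini_tonelli_F _ _ _ _ R (normal_prob 0 1) _ mF (fun x => f0 _).
    exact: H.
  - by move=> x; exact: integral_ge0.
  by rewrite /G normal_stableT// sqr_sqrtr// [S + _]addrC.
by rewrite main big_enum; apply: eq_integral => z _; rewrite addr0.
Qed.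

End GaussianLinear.

(** * Real expectations and Gaussian moments *)

Section ExpBounds.
Context {R : realType}.
Implicit Types x y : R.

Lemma pow_le_exp (k : nat) x : 0 <= x -> x ^+ k <= k`!%:R * expR x.
Proof.
move=> x0; case: k => [|k].
  by rewrite expr0 fact0 mul1r -expR0 ler_expR.
have := expR_ge1Dxn k x0.
have f0 : 0 < k.+1`!%:R :> R by rewrite ltr0n fact_gt0.
rewrite -lerBrDl ler_pdivrMr// mulrC => /le_trans; apply.
by rewrite ler_pM2l// lerBlDr lerDl.
Qed.

Lemma expR_taylor2 x : `|expR x - 1 - x - x ^+ 2 / 2| <= `|x| ^+ 3 * expR `|x|.
Proof.
have dE (k : nat) (s : R) : is_derive s (1 : R) (fun s => x ^+ k * expR (s * x)) (x ^+ k.+1 * expR (s * x)).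
  have h := is_deriveZf (x ^+ k) (is_derive_compf (is_derive_expR _)
    (is_deriveMf (is_derive_idf s) (is_derive_cst x s (1 : R)))).
  by rewrite (_ : x ^+ k.+1 * _ = x ^+ k * (expR (s * x) * (s * 0 + x * 1))) ?h// exprS; ring.
have := @taylor3 R _ _ _ _ (`|x| ^+ 3 * expR `|x|) (dE 0) (dE 1) (dE 2) _.
rewrite !mul0r !expr0 expR0 !mulr1 !mul1r expr1 => -> // s /andP[s0 s1].
rewrite normrM normrX ler_wpM2l ?exprn_ge0// ger0_norm ?expR_ge0// ler_expR.
by rewrite (le_trans (ler_norm _))// normrM ger0_norm// ler_piMl.
Qed.

(** The function (1 + y + y^2) exp (- y) has derivative (y - y^2) exp (- y), so on y <= 1 it is
    minimal at 0, where it equals 1. *)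
Lemma expR_le_quad x : x <= 1 -> expR x <= 1 + x + x ^+ 2.
Proof.
move=> x1.
pose f y := (1 + y + y ^+ 2) * expR (- y).
pose f' y := (y - y ^+ 2) * expR (- y).
have df y : is_derive y (1 : R) f (f' y).
  have h1 := is_deriveDf (is_deriveDf (is_derive_cst (1 : R) y (1 : R)) (is_derive_idf y))
    (is_derive_exprf 1 y).
  have h := is_deriveMf h1 (is_derive_compf (is_derive_expR _) (is_deriveZf (-1) (is_derive_idf y))).
  rewrite (_ : f = fun s => (1 + s + s ^+ 2) * expR (-1 * s)); last first.
    by apply/funext => s; rewrite mulN1r.
  rewrite (_ : f' y = (1 + y + y ^+ 2) * (expR (-1 * y) * (-1 * 1)) +
     expR (-1 * y) * (0 + 1 + 2%:R * y ^+ 1)) ?h//.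
  by rewrite /f' mulN1r; ring.
have cf a b : {within `[a, b], continuous f}.
  by apply: continuous_subspaceT => y; apply: is_derive_continuous (df y).
suff : 1 <= f x.
  rewrite /f expRN => h.
  by move: h; rewrite ler_pdivlMr ?expR_gt0// mul1r.
have f0 : f 0 = 1 by rewrite /f oppr0 expR0 expr0n/= !addr0 mulr1.
have [x0|x0] := leP 0 x.
  have [|c /=] := MVT_segment x0 (fun y _ => df y); first exact: cf.
  rewrite in_itv/= => /andP[c0 cx]; rewrite f0 subr0 => h.
  rewrite -subr_ge0 h mulr_ge0// /f' mulr_ge0 ?expR_ge0// expr2.
  by rewrite -{1}[c]mulr1 -mulrBr mulr_ge0// subr_ge0 (le_trans cx).
have [|c /=] := MVT_segment (ltW x0) (fun y _ => df y); first exact: cf.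
rewrite in_itv/= => /andP[cx c0]; rewrite f0 sub0r => h.
rewrite -subr_le0 h mulr_le0_ge0 ?oppr_ge0 ?(ltW x0)//.
rewrite /f' mulr_le0_ge0 ?expR_ge0// subr_le0 (le_trans c0)// sqr_ge0//.
Qed.

(** Stands for a passage to the limit l -> 0 in inequalities obtained from small perturbations. *)
Lemma le_of_eps (a b K : R) : (forall l, 0 < l <= 1 -> a <= b + l * K) -> a <= b.
Proof.
move=> H; rewrite leNgt; apply/negP => ab.
have K0 : 0 < K.
  by have := H 1; rewrite ltr01 lexx mul1r => /(_ isT); lra.
pose l := Num.min 1 ((a - b) / (2 * K)).
have l0 : 0 < l by rewrite lt_min ltr01 divr_gt0 ?subr_gt0 ?mulr_gt0.
have := H l; rewrite l0 ge_min lexx => /(_ isT).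
have : l * K <= (a - b) / 2.
  rewrite -ler_pdivlMr// ge_min; apply/orP; right.
  by rewrite invfM mulrA.
lra.
Qed.

End ExpBounds.

Section RealExpectation.
Context {d : measure_display} {T : measurableType d} {R : realType} (P : probability T R).
Implicit Types f g h : T -> R.

Definition intg f : Prop := P.-integrable [set: T] (EFin \o f).
(** An infinite integral is sent to 0 by [fine], so linearity and monotonicity require [intg]. *)
Definition Ex f : R := fine (\int[P]_t (f t)%:E)%E.

Lemma ExE f : intg f -> (\int[P]_t (f t)%:E)%E = (Ex f)%:E.
Proof. by move=> fi; rewrite /Ex fineK//; exact: integrable_fin_num fi. Qed.

Lemma intg_cst (k : R) : intg (fun=> k).
Proof. exact: finite_measure_integrable_cst. Qed.

Lemma intg_le f g : measurable_fun [set: T] f -> (forall t, `|f t| <= g t) ->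
  intg g -> intg f.
Proof.
move=> mf fg ig; apply: (le_integrable measurableT _ _ ig).
  exact/measurable_EFinP.
by move=> t _; rewrite /= lee_fin (le_trans (fg t))// ler_norm.
Qed.

Lemma intg_bnd f (k : R) : measurable_fun [set: T] f -> (forall t, `|f t| <= k) -> intg f.
Proof. by move=> mf fk; apply: (intg_le mf fk); exact: intg_cst. Qed.

Lemma intgD f g : intg f -> intg g -> intg (fun t => f t + g t).
Proof.
move=> fi gi; have := integrableD measurableT fi gi; apply: eq_integrable => //.
Qed.

Lemma intgZ (k : R) f : intg f -> intg (fun t => k * f t).
Proof.
move=> fi; rewrite /intg (_ : _ \o _ = (fun t => k%:E * (EFin \o f) t)%E)//.
exact: integrableZl.
Qed.

Lemma intgN f : intg f -> intg (fun t => - f t).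
Proof.
move=> fi; have := intgZ (-1) fi.
by rewrite (_ : (fun t => -1 * f t) = (fun t => - f t))//; apply/funext => t; rewrite mulN1r.
Qed.

Lemma intgB f g : intg f -> intg g -> intg (fun t => f t - g t).
Proof. by move=> fi gi; apply: intgD => //; exact: intgN. Qed.

Lemma intg_sum (I : Type) (r : seq I) (F : I -> T -> R) :
  (forall i, intg (F i)) -> intg (fun t => \sum_(i <- r) F i t).
Proof.
move=> Fi; elim: r => [|i r IH].
  rewrite (_ : (fun t => _) = fun=> 0); first exact: intg_cst.
  by apply/funext => t; rewrite big_nil.
rewrite (_ : (fun t => _) = fun t => F i t + \sum_(j <- r) F j t); first exact: intgD.
by apply/funext => t; rewrite big_cons.
Qed.

Lemma intg_abs f : intg f -> intg (fun t => `|f t|).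
Proof.
move=> fi; rewrite /intg (_ : _ \o _ = (fun t => `|(EFin \o f) t|%E))//.
exact: integrable_abse.
Qed.

Lemma ExD f g : intg f -> intg g -> Ex (fun t => f t + g t) = Ex f + Ex g.
Proof. by move=> fi gi; exact: RintegralD. Qed.

Lemma ExZ (k : R) f : intg f -> Ex (fun t => k * f t) = k * Ex f.
Proof. by move=> fi; exact: RintegralZl. Qed.

Lemma ExN f : intg f -> Ex (fun t => - f t) = - Ex f.
Proof.
move=> fi; rewrite -[RHS]mulN1r -ExZ//; congr Ex.
by apply/funext => t; rewrite mulN1r.
Qed.

Lemma ExB f g : intg f -> intg g -> Ex (fun t => f t - g t) = Ex f - Ex g.
Proof. by move=> fi gi; exact: RintegralB. Qed.

Lemma Ex_cst (k : R) : Ex (fun=> k) = k.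
Proof. by rewrite /Ex integral_cst_prob. Qed.

Lemma Ex_sum (I : Type) (r : seq I) (F : I -> T -> R) :
  (forall i, intg (F i)) -> Ex (fun t => \sum_(i <- r) F i t) = \sum_(i <- r) Ex (F i).
Proof.
move=> Fi; elim: r => [|i r IH].
  rewrite big_nil (_ : (fun t => _) = fun=> 0); first exact: Ex_cst.
  by apply/funext => t; rewrite big_nil.
rewrite big_cons -IH -ExD//; last exact: intg_sum.
by congr Ex; apply/funext => t; rewrite big_cons.
Qed.

Lemma Ex_le f g : intg f -> intg g -> (forall t, f t <= g t) -> Ex f <= Ex g.
Proof. by move=> fi gi fg; exact: le_Rintegral. Qed.

Lemma Ex_ge0 f : (forall t, 0 <= f t) -> 0 <= Ex f.
Proof. by move=> f0; apply: fine_ge0; apply: integral_ge0 => t _; rewrite lee_fin. Qed.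

Lemma Ex_norm f : intg f -> `|Ex f| <= Ex (fun t => `|f t|).
Proof. by move=> fi; exact: le_normr_Rintegral. Qed.

Lemma ge0_intg f (k : R) : measurable_fun [set: T] f -> (forall t, 0 <= f t) ->
  (\int[P]_t (f t)%:E <= k%:E)%E -> intg f /\ Ex f <= k.
Proof.
move=> mf f0 fk.
have fi : intg f.
  apply/integrableP; split; first exact/measurable_EFinP.
  under eq_integral do rewrite /= ger0_norm//.
  by rewrite (le_lt_trans fk)// ltry.
by split => //; rewrite -lee_fin -ExE.
Qed.

Lemma Ex_indic (A : set T) : measurable A -> (Ex \1_A)%:E = P A.
Proof.
move=> mA; rewrite -ExE; first by rewrite integral_indic// setIT.
apply: (intg_bnd (k := 1)); first exact: measurable_indic.
by move=> t; rewrite indicE; case: (_ \in _); rewrite ?normr1 ?normr0.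
Qed.

End RealExpectation.

Section NormalMoments.
Context {R : realType}.
Local Notation N01 := (@normal_prob R 0 1).

Lemma normal_mgf (l : R) : (\int[N01]_z (expR (l * z))%:E = (expR (l ^+ 2 / 2))%:E)%E.
Proof.
rewrite integral_normal_prob; last 2 first.
- apply/measurable_EFinP; apply: (measurableT_comp (@measurable_expR R)).
  exact: measurable_funM.
- by move=> x; rewrite lee_fin expR_ge0.
transitivity (\int[lebesgue_measure]_z ((expR (l ^+ 2 / 2))%:E * (normal_pdf l 1 z)%:E))%E.
  apply: eq_integral => z _; rewrite -!EFinM /normal_pdf oner_eq0; congr EFin.
  rewrite mulrCA [RHS]mulrCA; congr (_ * _); rewrite /normal_fun -!expRD.
  by congr expR; field.
rewrite ge0_integralZl//.
- by rewrite integral_normal_pdf mule1.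
- by apply/measurable_EFinP; exact: measurable_normal_pdf.
- by move=> x _; rewrite lee_fin normal_pdf_ge0.
Qed.

End NormalMoments.

Section GaussianMoments.
Context {d : measure_display} {T : measurableType d} {R : realType} {P : probability T R}.
Context {I : finType}.
Variable e : I -> {RV P >-> R}.
Hypothesis indE : mutually_independent e.
Hypothesis stdE : forall i, standard_normal (e i).

Definition lin (c : I -> R) (t : T) : R := \sum_i c i * e i t.
Definition var (c : I -> R) : R := \sum_i c i ^+ 2.

Lemma var_ge0 c : 0 <= var c.
Proof. by apply: sumr_ge0 => i _; rewrite sqr_ge0. Qed.

Lemma measurable_lin c : measurable_fun [set: T] (lin c).
Proof. by apply: measurable_sum => i; apply: measurable_funM. Qed.

Lemma lin_mgf c (l : R) :
  intg P (fun t => expR (l * lin c t)) /\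
  Ex P (fun t => expR (l * lin c t)) = expR (l ^+ 2 * var c / 2).
Proof.
have H : (\int[P]_t (expR (l * lin c t))%:E = (expR (l ^+ 2 * var c / 2))%:E)%E.
  rewrite (normal_linear indE stdE c (f := fun x => (expR (l * x))%:E)); last 2 first.
  - apply/measurable_EFinP; apply: (measurableT_comp (@measurable_expR R)).
    exact: measurable_funM.
  - by move=> x; rewrite lee_fin expR_ge0.
  under eq_integral do rewrite mulrA.
  by rewrite normal_mgf exprMn sqr_sqrtr ?var_ge0.
have [fi _] : intg P (fun t => expR (l * lin c t)) /\
    Ex P (fun t => expR (l * lin c t)) <= expR (l ^+ 2 * var c / 2).
  apply: ge0_intg => [|t|]; rewrite ?expR_ge0 ?H//.
  apply: (measurableT_comp (@measurable_expR R)).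
  by apply: measurable_funM => //; exact: measurable_lin.
by split => //; rewrite /Ex H.
Qed.

Lemma lin_mgf_abs c (l : R) : 0 <= l ->
  intg P (fun t => expR (l * `|lin c t|)) /\
  Ex P (fun t => expR (l * `|lin c t|)) <= 2 * expR (l ^+ 2 * var c / 2).
Proof.
move=> l0.
have [i1 e1] := lin_mgf c l; have [i2 e2] := lin_mgf c (- l).
have le t : expR (l * `|lin c t|) <= expR (l * lin c t) + expR (- l * lin c t).
  have [h|h] := leP 0 (lin c t); first by rewrite ger0_norm// lerDl expR_ge0.
  by rewrite ltr0_norm// mulrN -mulNr lerDr expR_ge0.
have i3 : intg P (fun t => expR (l * `|lin c t|)).
  apply: (intg_le _ _ (intgD i1 i2)) => [|t].
    apply: (measurableT_comp (@measurable_expR R)); apply: measurable_funM => //.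
    by apply: measurableT_comp => //; exact: measurable_lin.
  by rewrite ger0_norm ?expR_ge0.
split => //; apply: le_trans (Ex_le i3 (intgD i1 i2) le) _.
by rewrite ExD// e1 e2 sqrrN mulr_natl mulr2n.
Qed.

Lemma lin_exp_intg c (k : nat) (l : R) : 0 <= l ->
  intg P (fun t => `|lin c t| ^+ k * expR (l * `|lin c t|)).
Proof.
move=> l0; have l1 : 0 <= l + 1 by rewrite addr_ge0.
have [i1 _] := lin_mgf_abs c l1.
apply: (intg_le _ _ (intgZ k`!%:R i1)) => [|t].
  apply: measurable_funM.
    by apply: measurable_funX; apply: measurableT_comp => //; exact: measurable_lin.
  apply: (measurableT_comp (@measurable_expR R)); apply: measurable_funM => //.
  by apply: measurableT_comp => //; exact: measurable_lin.
rewrite normrM normrX normr_id (ger0_norm (expR_ge0 _)) mulrDl mul1r expRD.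
rewrite [leRHS](_ : _ = k`!%:R * expR `|lin c t| * expR (l * `|lin c t|)); last by ring.
by apply: ler_wpM2r; [exact: expR_ge0|exact: pow_le_exp].
Qed.

Lemma lin_pow_intg c (k : nat) : intg P (fun t => `|lin c t| ^+ k).
Proof.
have := lin_exp_intg c k (lexx 0).
by under [X in intg P X -> _]eq_fun do rewrite mul0r expR0 mulr1.
Qed.

Lemma lin_intg c : intg P (lin c).
Proof.
apply: (intg_le (measurable_lin c) _ (lin_pow_intg c 1)) => t.
by rewrite expr1.
Qed.

Lemma lin_sqr_intg c : intg P (fun t => lin c t ^+ 2).
Proof.
apply: (intg_le _ _ (lin_pow_intg c 2)) => [|t]; last by rewrite normrX.
by apply: measurable_funX; exact: measurable_lin.
Qed.

(** The bound x^3 <= 6 exp x is used at |lin c| / s, whose exponential moment is at most 2 exp (1/2)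
    <= 4; 24 = 6 times 4. *)
Lemma lin_abs3 c (s : R) : 0 < s -> var c <= s ^+ 2 ->
  Ex P (fun t => `|lin c t| ^+ 3) <= 24 * s ^+ 3.
Proof.
move=> s0 vs; have s'0 : 0 <= s^-1 by rewrite invr_ge0 ltW.
have [i1 e1] := lin_mgf_abs c s'0.
have le t : `|lin c t| ^+ 3 <= s ^+ 3 * 6 * expR (s^-1 * `|lin c t|).
  have := @pow_le_exp R 3 (s^-1 * `|lin c t|) (mulr_ge0 s'0 (normr_ge0 _)).
  rewrite exprMn -(ler_pM2l (_ : 0 < s ^+ 3)) ?exprn_gt0// mulrA -exprMn divff ?gt_eqF//.
  by rewrite expr1n mul1r mulrA.
apply: le_trans (Ex_le (lin_pow_intg c 3) (intgZ _ i1) le) _.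
rewrite ExZ//.
have : Ex P (fun t => expR (s^-1 * `|lin c t|)) <= 4.
  apply: le_trans e1 _.
  suff : expR (s^-1 ^+ 2 * var c / 2) <= 2 by lra.
  apply: le_trans (_ : expR (2^-1) <= _).
    rewrite ler_expR ler_pdivrMr// mulVf// exprVn mulrC ler_pdivrMr ?exprn_gt0//.
    by rewrite mul1r.
  have h1 : (2^-1 : R) <= 1 by lra.
  by have := expR_le_quad h1; lra.
move=> h; rewrite (_ : 24 * s ^+ 3 = s ^+ 3 * 6 * 4); last by ring.
by apply: ler_wpM2l => //; rewrite mulr_ge0 ?exprn_ge0// ltW.
Qed.

Lemma linN c t : lin (fun i => - c i) t = - lin c t.
Proof. by rewrite /lin -sumrN; apply: eq_bigr => i _; rewrite mulNr. Qed.

(** Step size for differentiating the moment generating function at 0: m shrinks with l and m^2 var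
    c <= m l. *)
Let scale c (l : R) : 0 < l <= 1 ->
  let m := l / (var c + 1) in [/\ 0 < m, m <= l & m ^+ 2 * var c <= m * l].
Proof.
move=> /andP[l0 l1] m; have v0 := var_ge0 c.
have v1 : 0 < var c + 1 by rewrite ltr_wpDl.
split; first by rewrite divr_gt0.
  by rewrite ler_pdivrMr// ler_peMr ?lerDr// ltW.
rewrite expr2 -mulrA ler_wpM2l ?divr_ge0 ?(ltW l0) ?(ltW v1)//.
rewrite /m -mulrA ler_piMr ?(ltW l0)// mulrC ler_pdivrMr// mul1r.
by rewrite lerDl.
Qed.

(** From 1 + m x <= exp (m x), m times the mean is at most exp (m^2 var c / 2) - 1 <= m l. Applying
    this to - c gives the reverse inequality. *)
Lemma lin_mean c : Ex P (lin c) = 0.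
Proof.
have main c' : Ex P (lin c') <= 0.
  apply: (@le_of_eps _ _ _ 1) => l l01; rewrite add0r mulr1.
  have [m0 ml mv] := scale c' l01; move: (l / _) m0 ml mv => m m0 ml mv.
  have [i1 e1] := lin_mgf c' m.
  have := Ex_le (intgD (intg_cst P 1) (intgZ m (lin_intg c'))) i1 (fun t => expR_ge1Dx _).
  rewrite ExD ?ExZ; [|exact: lin_intg|exact: intg_cst|exact/intgZ/lin_intg].
  rewrite Ex_cst e1 => h.
  case/andP: l01 => l0 l1; have v0 : 0 <= m ^+ 2 * var c' by rewrite mulr_ge0 ?sqr_ge0 ?var_ge0.
  have m1 : m * l <= 1 by rewrite mulr_ile1 ?(ltW m0) ?(ltW l0)// (le_trans ml).
  have := @expR_le_quad R (m ^+ 2 * var c' / 2).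
  set y := m ^+ 2 * var c' in h mv v0 *.
  have -> : y / 2 <= 1 by lra.
  move=> /(_ isT) h2; rewrite -(ler_pM2l m0).
  have : (y / 2) ^+ 2 <= y / 2 by rewrite expr2 ler_piMl//; lra.
  lra.
apply/eqP; rewrite eq_le main/= -oppr_le0 -ExN; last exact: lin_intg.
have := main (fun i => - c i).
by rewrite (_ : lin (fun i => - c i) = fun t => - lin c t)//; apply/funext => t; exact: linN.
Qed.

(** Second order version of the same argument: exp (m x) is expanded with a cubic remainder and the
    result is divided by m^2. *)
Lemma lin_var c : Ex P (fun t => lin c t ^+ 2) = var c.
Proof.
set V := Ex P _; pose M := Ex P (fun t => `|lin c t| ^+ 3 * expR (1 * `|lin c t|)).
have main (l : R) : 0 < l <= 1 -> `|V - var c| <= l * (2 * M + var c).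
  move=> l01; have [m0 ml mv] := scale c l01; move: (l / _) m0 ml mv => m m0 ml mv.
  case/andP: l01 => l0 l1; have m1 : m <= 1 by rewrite (le_trans ml).
  have [i1 e1] := lin_mgf c m.
  pose r t := expR (m * lin c t) - 1 - m * lin c t - m ^+ 2 / 2 * lin c t ^+ 2.
  have i2 := intgB (intgB (intgB i1 (intg_cst P 1)) (intgZ m (lin_intg c)))
    (intgZ (m ^+ 2 / 2) (lin_sqr_intg c)).
  have ir : intg P r by [].
  have Er : Ex P r = expR (m ^+ 2 * var c / 2) - 1 - m ^+ 2 / 2 * V.
    rewrite /r ExB; [|exact: intgB (intgB i1 (intg_cst P 1)) (intgZ m (lin_intg c))
      |exact: intgZ (lin_sqr_intg c)].
    rewrite ExB; [|exact: intgB i1 (intg_cst P 1)|exact: intgZ (lin_intg c)].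
    rewrite ExB; [|exact: i1|exact: intg_cst].
    by rewrite !ExZ; [|exact: lin_sqr_intg|exact: lin_intg]; rewrite lin_mean Ex_cst e1 mulr0 subr0.
  have rb t : `|r t| <= m ^+ 3 * (`|lin c t| ^+ 3 * expR (1 * `|lin c t|)).
    have := expR_taylor2 (m * lin c t).
    rewrite (_ : (m * lin c t) ^+ 2 / 2 = m ^+ 2 / 2 * lin c t ^+ 2); last by ring.
    move/le_trans; apply; rewrite normrM (gtr0_norm m0) exprMn -mulrA.
    rewrite ler_wpM2l ?exprn_ge0 ?(ltW m0)// ler_wpM2l ?exprn_ge0// ler_expR.
    by rewrite ler_wpM2r.
  have i3 := lin_exp_intg c 3 (ler01 : 0 <= 1 :> R).
  have : `|Ex P r| <= m ^+ 3 * M.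
    apply: le_trans (Ex_norm ir) _; rewrite -ExZ//.
    by apply: Ex_le => //; [exact: intg_abs|exact: intgZ].
  rewrite Er; set y := m ^+ 2 * var c / 2.
  have v0 := var_ge0 c; have m20 : 0 < m ^+ 2 by rewrite exprn_gt0.
  have y0 : 0 <= y by rewrite divr_ge0// mulr_ge0 ?sqr_ge0.
  have ml1 : m * l <= 1 by rewrite mulr_ile1 ?(ltW m0) ?(ltW l0).
  have y1 : y <= 1 by rewrite /y; lra.
  have e3 := expR_le_quad y1; have e4 := expR_ge1Dx y.
  have y2 : y ^+ 2 <= m ^+ 2 * (l * var c / 4).
    rewrite (_ : y ^+ 2 = m ^+ 2 * (var c / 4) * (m ^+ 2 * var c)); last by rewrite /y; field.
    rewrite (_ : m ^+ 2 * (l * var c / 4) = m ^+ 2 * (var c / 4) * l); last by ring.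
    apply: ler_wpM2l; first by rewrite mulr_ge0 ?divr_ge0 ?sqr_ge0.
    by apply: (le_trans mv); rewrite ler_piMl// ltW.
  have M0 : 0 <= M by apply: Ex_ge0 => t; rewrite mulr_ge0 ?exprn_ge0 ?expR_ge0.
  have m3 : m ^+ 3 * M <= m ^+ 2 * (l * M).
    by rewrite exprSr -mulrA ler_pM2l// ler_wpM2r.
  rewrite !ler_norml => /andP[h1 h2].
  have lv0 : 0 <= m ^+ 2 * (l * var c) by apply: mulr_ge0 (ltW m20) (mulr_ge0 (ltW l0) v0).
  apply/andP; split; rewrite -(ler_pM2l m20); rewrite /y in e3 e4 h1 h2 y2 *; lra.
apply/eqP; rewrite -subr_eq0 -normr_le0.
by apply: (@le_of_eps _ _ _ (2 * M + var c)) => l /main; rewrite add0r.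
Qed.

Lemma lin_cov c c' : Ex P (fun t => lin c t * lin c' t) = \sum_i c i * c' i.
Proof.
have linD t : lin (fun i => c i + c' i) t = lin c t + lin c' t.
  by rewrite /lin -big_split; apply: eq_bigr => i _; rewrite mulrDl.
have linB t : lin (fun i => c i - c' i) t = lin c t - lin c' t.
  by rewrite /lin -sumrB; apply: eq_bigr => i _; rewrite mulrBl.
have -> : (fun t => lin c t * lin c' t) = fun t =>
    4^-1 * (lin (fun i => c i + c' i) t ^+ 2 - lin (fun i => c i - c' i) t ^+ 2).
  by apply/funext => t; rewrite linD linB; field.
rewrite ExZ; last by apply: intgB; exact: lin_sqr_intg.
rewrite ExB; [|exact: lin_sqr_intg|exact: lin_sqr_intg].
rewrite !lin_var /var -sumrB mulr_sumr; apply: eq_bigr => i _.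
by field.
Qed.

End GaussianMoments.

(** * Anti-concentration of Gaussian maxima *)

Lemma eq_le_ereal (R : realType) (x y : \bar R) : x = y -> (x <= y)%E.
Proof. by move=> ->. Qed.

Lemma sqrt1D_bound (R : realFieldType) (l : R) :
  1 ^+ 2 + l ^+ 2 <= (1 + l ^+ 2 / 2) ^+ 2.
Proof. by have := sqr_ge0 (l ^+ 2 / 2); lra. Qed.

Lemma cancel_le (R : realFieldType) (F x k u : R) : F + x - k <= F + u -> x <= u + k.
Proof. lra. Qed.

Section GibbsMeasure.
Context {R : realType}.

Lemma measurable_partf (I : finType) (b : R) d (T : measurableType d) (psi : T -> I -> R) :
  (forall i, measurable_fun [set: T] (psi^~ i)) ->
  measurable_fun [set: T] (fun t => partf b (psi t)).
Proof.
move=> mpsi; apply: measurable_sum => i.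
apply: (measurableT_comp (@measurable_expR R)).
exact: measurable_funM.
Qed.

Lemma measurable_smax (I : finType) (b : R) d (T : measurableType d) (psi : T -> I -> R) :
  (forall i, measurable_fun [set: T] (psi^~ i)) ->
  measurable_fun [set: T] (fun t => smax b (psi t)).
Proof.
move=> mpsi; apply: measurable_funM => //.
apply: (measurableT_comp (@measurable_ln R)).
exact: measurable_partf.
Qed.

Lemma Ex_gibbs (I : finType) (b : R) (y : I -> R) d (T : measurableType d)
    (P : probability T R) (F : T -> I -> R) :
  (forall i, intg P (F^~ i)) ->
  intg P (fun t => gibbs b y (F t)) /\
  Ex P (fun t => gibbs b y (F t)) = gibbs b y (fun i => Ex P (F^~ i)).
Proof.
move=> iF.
have E t : gibbs b y (F t) = \sum_i (expR (b * y i) / partf b y) * F t i.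
  by rewrite /gibbs mulr_suml; apply: eq_bigr => i _; rewrite mulrAC.
have iE i : intg P (fun t => (expR (b * y i) / partf b y) * F t i) by exact: intgZ.
rewrite (_ : (fun t => gibbs b y (F t)) =
    fun t => \sum_i (expR (b * y i) / partf b y) * F t i); last exact/funext.
split; first exact: (intg_sum _ iE).
rewrite (Ex_sum _ iE) /gibbs mulr_suml; apply: eq_bigr => i _.
by rewrite ExZ// mulrAC.
Qed.

Lemma measurable_orthant (J : finType) (w : J -> R) d' (T' : measurableType d') (psi : T' -> J -> R) :
  (forall j, measurable_fun [set: T'] (psi^~ j)) ->
  measurable [set t | forall j, psi t j <= w j].
Proof.
move=> mpsi.
rewrite (_ : [set t | _] = \bigcap_(j in [set: J]) ((psi^~ j) @^-1` `]-oo, w j])).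
  apply: fin_bigcap_measurable => // j _.
  by rewrite -[X in measurable X]setTI; apply: mpsi => //; exact: measurable_itv.
apply/seteqP; split=> t /= H j; first by move=> _; rewrite /= in_itv/=.
by have := H j Logic.I; rewrite /= in_itv.
Qed.

End GibbsMeasure.

Section AntiConcentration.
Context {d : measure_display} {T : measurableType d} {R : realType} {P : probability T R}.
Context {I J : finType}.
Variable e : I -> {RV P >-> R}.
Hypothesis indE : mutually_independent e.
Hypothesis stdE : forall i, standard_normal (e i).
Variables (a : I -> J -> R) (j0 : J).
Hypothesis a1 : forall j, var (a^~ j) = 1.
Variables (q : R) (hq : 0 < q) (qJ : ln (2 * #|J|%:R) <= q ^+ 2).

Let Z (t : T) (j : J) : R := gvec e a t j.

Let mZ j : measurable_fun [set: T] (Z^~ j).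
Proof. exact: measurable_gvec. Qed.

Let iZ j : intg P (Z^~ j).
Proof. exact: (lin_intg indE stdE (a^~ j)). Qed.

Let iZ3 j : intg P (fun t => `|Z t j| ^+ 3).
Proof. exact: (lin_pow_intg indE stdE (a^~ j) 3). Qed.

(* ln S <= ln A + S / A - 1 replaces Jensen's inequality *)
Let U (t : T) : R :=
  q^-1 * (ln (2 * #|J|%:R) + q ^+ 2 / 2 - 1 +
    (\sum_j expR (q * `|Z t j|)) / (2 * #|J|%:R * expR (q ^+ 2 / 2))).

Let J0 : 0 < #|J|%:R :> R.
Proof. by rewrite ltr0n; apply/card_gt0P; exists j0. Qed.

Let U_ge t j : `|Z t j| <= U t.
Proof.
rewrite /U ler_pdivlMl//.
set S := \sum_j _; set A := 2 * _ * _.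
have A0 : 0 < A by rewrite /A !mulr_gt0 ?expR_gt0.
have S0 : expR (q * `|Z t j|) <= S.
  rewrite /S (bigD1 j)//= lerDl sumr_ge0// => k _; exact: expR_ge0.
have S1 : 0 < S by rewrite (lt_le_trans _ S0) ?expR_gt0.
have h1 : q * `|Z t j| <= ln S by rewrite -ler_expR lnK ?posrE.
apply: (le_trans h1).
have -> : ln S = ln A + ln (S / A).
  by rewrite -lnM ?posrE ?divr_gt0// mulrC divfK ?gt_eqF.
have -> : ln A = ln (2 * #|J|%:R) + q ^+ 2 / 2.
  by rewrite /A lnM ?posrE ?mulr_gt0 ?expR_gt0// expRK.
have := @expR_ge1Dx R (ln (S / A)); rewrite lnK ?posrE ?divr_gt0//.
lra.
Qed.

(** The expected sum of exponentials is at most the denominator in [U], which leaves q^-1 (q^2 + q^2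
    / 2 - 1 + 1) = 3 q / 2. *)
Let U_intg : intg P U /\ Ex P U <= 3 / 2 * q.
Proof.
have m j := lin_mgf_abs indE stdE (a^~ j) (ltW hq).
have iS : intg P (fun t => \sum_j expR (q * `|Z t j|)).
  by apply: intg_sum => j; have [] := m j.
pose A := 2 * #|J|%:R * expR (q ^+ 2 / 2).
have A0 : 0 < A by rewrite /A !mulr_gt0 ?expR_gt0.
have UE : U = fun t => q^-1 * (ln (2 * #|J|%:R) + q ^+ 2 / 2 - 1 +
    A^-1 * \sum_j expR (q * `|Z t j|)).
  by apply/funext => t; rewrite /U -/A [_ / A]mulrC.
have ES : Ex P (fun t => \sum_j expR (q * `|Z t j|)) <= A.
  rewrite Ex_sum; last by move=> j; have [] := m j.
  apply: (@le_trans _ _ (\sum_(j : J) 2 * expR (q ^+ 2 / 2))).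
    apply: ler_sum => j _; have [_] := m j; rewrite a1 mulr1; exact.
  rewrite sumr_const /A le_eqVlt; apply/orP; left; apply/eqP.
  by rewrite -[(2 * _) *+ _]mulr_natr mulrAC.
rewrite UE; split.
  by apply: intgZ; apply: intgD; [exact: intg_cst|exact: intgZ].
rewrite ExZ; last by apply: intgD; [exact: intg_cst|exact: intgZ].
rewrite ExD; [|exact: intg_cst|exact: intgZ].
rewrite Ex_cst ExZ// ler_pdivrMl//.
have : A^-1 * Ex P (fun t => \sum_j expR (q * `|Z t j|)) <= 1.
  by rewrite ler_pdivrMl// mulr1.
have : q * (3 / 2 * q) = q ^+ 2 + q ^+ 2 / 2 by field.
move: qJ; lra.
Qed.

Section Key.
Variables (b : R) (hb : 0 < b) (c : J -> R).

(** The extra coordinate [None], frozen at 0, makes [f] a soft version of the positive part of max_j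
    (w j - c j). Its Gibbs weight [p0] is 1/2 where the soft maximum of w - c vanishes, so p0 (1 -
    p0) detects points near the boundary of the orthant. *)
Let oext (w : J -> R) (o : option J) : R := if o is Some j then w j - c j else 0.
Let ou (w : J -> R) (o : option J) : R := if o is Some j then w j else 0.
Let f (w : J -> R) : R := smax b (oext w).
Let p0 (w : J -> R) : R := (partf b (oext w))^-1.
Let nn (o : option J) : R := (o != None)%:R.

Let f_nnc : nnc (fun w => (f w)%:E).
Proof.
split=> [d' T' psi mpsi|w].
  apply/measurable_EFinP; apply: measurable_smax => -[j|] //=.
  exact: measurable_funB.
by rewrite lee_fin; exact: (smax_ge None hb (oext w) None).
Qed.

Let f_lip w w' (V : R) : 0 <= V -> (forall j, `|w' j| <= V) ->
  f (fun j => w j + w' j) <= f w + V.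
Proof.
move=> V0 w'V.
have H o : `|ou w' o| <= V by case: o => [j|] //=; rewrite normr0.
have := smax_lip None hb (oext w) H.
rewrite ler_norml => /andP[_]; rewrite lerBlDl => h.
rewrite /f (_ : oext _ = fun o => oext w o + ou w' o)//.
by apply/funext => -[j|] /=; rewrite ?addr0// addrAC.
Qed.

Let nnE w : gibbs b (oext w) nn = 1 - p0 w.
Proof.
rewrite /gibbs /p0.
have pE : \sum_o expR (b * oext w o) * nn o = partf b (oext w) - 1.
  rewrite /partf (bigD1 None)//= [in RHS](bigD1 None)//= /nn eqxx mulr0 add0r.
  rewrite mulr0 expR0 addrAC subrr add0r; apply: eq_bigr => o oN.
  by rewrite oN mulr1.
by rewrite pE mulrBl mul1r divff// gt_eqF// (partf_gt0 None).
Qed.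

Let p0_bnd w : 0 <= p0 w <= 1.
Proof.
have pf := partf_gt0 None b (oext w).
rewrite /p0 invr_ge0 (ltW pf)/= invf_le1//.
by rewrite /partf (bigD1 None)//= mulr0 expR0 lerDl sumr_ge0.
Qed.

(** Cauchy-Schwarz on the weight 1 - p0 outside [None], where [ou z] lives. With g1, g2 the Gibbs
    means of [ou z] and its square, g2 - g1^2 >= p0 g2: a lower bound on the curvature of the soft
    maximum. *)
Let gibbs_cs w z : gibbs b (oext w) (ou z) ^+ 2 <=
  (1 - p0 w) * gibbs b (oext w) (fun o => ou z o ^+ 2).
Proof.
set g := gibbs _ _ (ou z); set g2 := gibbs _ _ _; set m := 1 - p0 w.
have m0 : 0 < m.
  rewrite /m -nnE /gibbs divr_gt0 ?(partf_gt0 None)// (bigD1 (Some j0))//=.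
  rewrite ltr_pwDl ?mulr_gt0 ?expR_gt0//.
  by rewrite sumr_ge0// => o _; rewrite mulr_ge0 ?expR_ge0.
have H : 0 <= gibbs b (oext w) (fun o => (m * ou z o + - g * nn o) ^+ 2).
  by apply: (gibbs_ge0 None) => o; rewrite sqr_ge0.
move: H; rewrite (_ : (fun o => _) = fun o =>
   m ^+ 2 * ou z o ^+ 2 + (- (2 * m * g) * ou z o + g ^+ 2 * nn o)); last first.
  apply/funext => -[j|]; rewrite /nn/=; last by rewrite !mulr0 ?addr0 expr0n/= ?mulr0 ?addr0.
  by rewrite mulr1; ring.
rewrite !gibbsD !gibbsZ nnE -/g -/g2 -/m.
rewrite (_ : _ + _ = m * (m * g2 - g ^+ 2)); last by ring.
by rewrite pmulr_rge0// subr_ge0.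
Qed.

(* Z has the same law as (Z + l Z') / sqrt (1 + l^2) with Z' an independent
   copy. The Lipschitz bound for the change of scale and the second order
   expansion along l Z' leave b E[p0 (1 - p0)] <= E[U] as l -> 0, with U >= |Z|_oo. *)
Lemma anti_key : intg P (fun t => p0 (Z t) * (1 - p0 (Z t))) /\
  b * Ex P (fun t => p0 (Z t) * (1 - p0 (Z t))) <= 3 / 2 * q.
Proof.
have [iU EU] := U_intg.
have U0 t : 0 <= U t by exact: le_trans (normr_ge0 _) (U_ge t j0).
have mp0 : measurable_fun [set: T] (fun t => p0 (Z t)).
  have mo o : measurable_fun [set: T] (fun t => oext (Z t) o).
    by case: o => [j|] //=; exact: measurable_funB.
  have mm : measurable_fun [set: T] (fun t => expR (- ln (partf b (oext (Z t))))).
    apply: (measurableT_comp (@measurable_expR R)); apply: measurableT_comp => //.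
    by apply: (measurableT_comp (@measurable_ln R)); exact: measurable_partf.
  apply: (eq_measurable_fun _ _ mm) => t _.
  by rewrite expRN lnK ?posrE ?(partf_gt0 None).
have iD : intg P (fun t => p0 (Z t) * (1 - p0 (Z t))).
  apply: (@intg_bnd _ _ _ _ _ 1).
    by apply: measurable_funM => //; exact: measurable_funB.
  move=> t; have /andP[h0 h1] := p0_bnd (Z t).
  rewrite ger0_norm ?mulr_ge0 ?subr_ge0// mulr_ile1 ?subr_ge0//.
  by rewrite lerBlDr lerDl.
split => //.
pose K := Ex P (fun t => \sum_j `|Z t j| ^+ 3).
have iK : intg P (fun t => \sum_j `|Z t j| ^+ 3) by exact: intg_sum.
pose C := 12 * b ^+ 2 * K.
suff H (l : R) : 0 < l <= 1 ->
    b * Ex P (fun t => p0 (Z t) * (1 - p0 (Z t))) <= Ex P U + l * C.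
  exact: le_trans (le_of_eps H) EU.
move=> /andP[l0 l1].
have mf (psi : T -> J -> R) : (forall j, measurable_fun [set: T] (psi^~ j)) ->
    measurable_fun [set: T] (fun t => f (psi t)).
  by move=> mpsi; have [mf _] := f_nnc; apply/measurable_EFinP; exact: mf.
have fint (w : J -> R) (k : R) : 0 <= k -> intg P (fun t => f (fun j => w j + k * Z t j)).
  move=> k0; apply: (intg_le _ _ (intgD (intg_cst P (f w)) (intgZ k iU))).
    by apply: mf => j; apply: measurable_funD => //; exact: measurable_funM.
  move=> t; rewrite ger0_norm; last exact: (smax_ge None hb _ None).
  apply: f_lip => [|j]; first by rewrite mulr_ge0.
  by rewrite normrM ger0_norm// ler_wpM2l.
pose G w := Ex P (fun t => f (fun j => w j + l * Z t j)).
have GE w : gop e a l (fun w => (f w)%:E) w = (G w)%:E.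
  by rewrite /gop /avg ExE//; apply: fint; exact: ltW.
(* In the mean the linear term vanishes, the Gibbs second moment becomes 1 - p0 because all
   variances are 1, and [gibbs_cs] keeps the fraction p0 of it; only a cubic term in l is lost. *)
have G_ge w : f w + l ^+ 2 / 2 * (b * (p0 w * (1 - p0 w))) - 6 * b ^+ 2 * l ^+ 3 * K <= G w.
  pose uu t (o : option J) := l * ou (Z t) o.
  have iu o : intg P ((fun t => ou (Z t))^~ o).
    by case: o => [j|] //=; exact: intg_cst.
  have iu2 o : intg P ((fun t o => ou (Z t) o ^+ 2)^~ o).
    case: o => [j|] /=; last exact: intg_cst.
    exact: (lin_sqr_intg indE stdE (a^~ j)).
  have [ig1 Eg1] := Ex_gibbs b (oext w) iu.
  have [ig2 Eg2] := Ex_gibbs b (oext w) iu2.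
  have Eg1' : Ex P (fun t => gibbs b (oext w) (ou (Z t))) = 0.
    rewrite Eg1 -[RHS](gibbs_cst None b (oext w) 0); congr gibbs; apply/funext => -[j|] /=.
      exact: (lin_mean indE stdE (a^~ j)).
    exact: Ex_cst.
  have Eg2' : Ex P (fun t => gibbs b (oext w) (fun o => ou (Z t) o ^+ 2)) = 1 - p0 w.
    rewrite Eg2 -nnE; congr gibbs; apply/funext => -[j|] /=.
      by rewrite (lin_var indE stdE (a^~ j)) a1.
    by rewrite Ex_cst expr0n.
  have low t : f w + l * gibbs b (oext w) (ou (Z t)) +
      l ^+ 2 * (b / 2 * p0 w) * gibbs b (oext w) (fun o => ou (Z t) o ^+ 2)
      - 6 * b ^+ 2 * l ^+ 3 * \sum_j `|Z t j| ^+ 3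
      <= f (fun j => w j + l * Z t j).
    have A3 s : 0 <= s <= 1 -> gibbs b (fun o => oext w o + s * uu t o)
        (fun o => `|uu t o| ^+ 3) <= l ^+ 3 * \sum_j `|Z t j| ^+ 3.
      move=> _; rewrite -[leRHS](gibbs_cst None b (fun o => oext w o + s * uu t o)).
      apply: (gibbs_le None) => o; rewrite /uu normrM (gtr0_norm l0) exprMn.
      rewrite ler_wpM2l ?exprn_ge0 ?(ltW l0)//; case: o => [j|] /=.
        by rewrite (bigD1 j)//= lerDl sumr_ge0// => k _; rewrite exprn_ge0.
      by rewrite normr0 expr0n/= sumr_ge0// => k _; rewrite exprn_ge0.
    have := smax_taylor None hb A3.
    have -> : smax b (fun o => oext w o + uu t o) = f (fun j => w j + l * Z t j).
      rewrite /f; congr smax; apply/funext => -[j|]; rewrite /uu/= ?mulr0 ?addr0//.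
      by rewrite addrAC.
    rewrite ler_norml => /andP[h _].
    have cs := gibbs_cs w (Z t).
    rewrite /uu in h; rewrite gibbsZ in h.
    rewrite (_ : (fun o => (l * ou (Z t) o) ^+ 2) = fun o => l ^+ 2 * ou (Z t) o ^+ 2) in h; last first.
      by apply/funext => o; rewrite exprMn.
    rewrite gibbsZ -/(f w) in h.
    set g1 := gibbs _ _ (ou (Z t)) in h cs *; set g2 := gibbs _ _ _ in h cs *.
    have : l ^+ 2 * (b / 2) * (p0 w * g2) <= l ^+ 2 * (b / 2) * (g2 - g1 ^+ 2).
      rewrite ler_wpM2l; first by [].
        by rewrite mulr_ge0 ?sqr_ge0 ?divr_ge0// ltW.
      by lra.
    lra.
  have i1 : intg P (fun t => f w + l * gibbs b (oext w) (ou (Z t))).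
    by apply: intgD; [exact: intg_cst|exact: intgZ].
  have i2 : intg P (fun t => l ^+ 2 * (b / 2 * p0 w) * gibbs b (oext w) (fun o => ou (Z t) o ^+ 2)).
    exact: intgZ.
  have i3 : intg P (fun t => 6 * b ^+ 2 * l ^+ 3 * \sum_j `|Z t j| ^+ 3).
    exact: intgZ.
  have := Ex_le (intgB (intgD i1 i2) i3) (fint w l (ltW l0)) low.
  rewrite ExB; [|exact: intgD|by []].
  rewrite ExD// ExD; [|exact: intg_cst|exact: intgZ].
  rewrite Ex_cst (ExZ _ ig1) (ExZ _ ig2) (ExZ _ iK) Eg1' Eg2' -/K mulr0 addr0 /G; apply: le_trans.
  by rewrite le_eqVlt; apply/orP; left; apply/eqP; field.
(* Averaging [G] over Z adds an independent copy of l Z, and the semigroup property turns the sum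
   into Z rescaled by sqrt (1 + l^2). *)
have iG : intg P (fun t => G (fun j => 0 + 1 * Z t j)) /\
    Ex P (fun t => G (fun j => 0 + 1 * Z t j)) =
    Ex P (fun t => f (fun j => 0 + Num.sqrt (1 ^+ 2 + l ^+ 2) * Z t j)).
  have H := gop_merge indE stdE a 1 l (fun=> 0) f_nnc.
  rewrite (_ : gop e a l (fun w => (f w)%:E) = fun w => (G w)%:E) in H; last exact/funext.
  rewrite {2}/gop /avg (ExE (fint _ _ (sqrtr_ge0 _))) in H.
  have [mG G0] : nnc (fun w => (G w)%:E).
    have -> : (fun w => (G w)%:E) = gop e a l (fun w => (f w)%:E).
      by apply/funext => w; exact: esym (GE w).
    exact: gop_nnc.
  have iG : intg P (fun t => G (fun j => 0 + 1 * Z t j)).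
    have m1 : measurable_fun [set: T] (fun t => G (fun j => 0 + 1 * Z t j)).
      apply/measurable_EFinP; apply: mG => j; apply: measurable_funD => //.
      exact: measurable_funM.
    have p1 t : 0 <= G (fun j => 0 + 1 * Z t j).
      by have := G0 (fun j => 0 + 1 * Z t j); rewrite lee_fin.
    have b1 : (\int[P]_t (G (fun j => (0 + 1 * Z t j)%R))%:E <=
      (Ex P (fun t => f (fun j => 0 + Num.sqrt (1 ^+ 2 + l ^+ 2) * Z t j)))%:E)%E.
      by apply: eq_le_ereal; exact: H.
    exact: (ge0_intg m1 p1 b1).1.
  by split => //; apply/EFin_inj; rewrite -H -ExE.
have [iG1 EG1] := iG.
have Z1 t : (fun j => 0 + 1 * Z t j) = Z t by apply/funext => j; rewrite add0r mul1r.
have ifZ : intg P (fun t => f (Z t)).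
  by have := fint (fun=> 0) 1 ler01; under [X in intg P X -> _]eq_fun do rewrite Z1.
have iGZ : intg P (fun t => G (Z t)).
  by move: iG1; under [X in intg P X -> _]eq_fun do rewrite Z1.
have EGZ : Ex P (fun t => G (Z t)) =
    Ex P (fun t => f (fun j => 0 + Num.sqrt (1 ^+ 2 + l ^+ 2) * Z t j)).
  have EGf : (fun t => G (Z t)) = (fun t => G (fun j => 0 + 1 * Z t j)).
    by apply/funext => t; exact: (congr1 G (esym (Z1 t))).
  exact: etrans (congr1 (Ex P) EGf) EG1.
(* The rescaling factor is at most 1 + l^2 / 2, so the Lipschitz bound costs only (l^2 / 2) U, of
   the same order in l as the curvature gained. *)
have up : Ex P (fun t => f (fun j => 0 + Num.sqrt (1 ^+ 2 + l ^+ 2) * Z t j)) <=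
    Ex P (fun t => f (Z t)) + l ^+ 2 / 2 * Ex P U.
  rewrite -ExZ// -ExD//; last exact: intgZ.
  apply: Ex_le; [exact: (fint _ _ (sqrtr_ge0 _))|by apply: intgD => //; exact: intgZ|].
  move=> t; set r := Num.sqrt _.
  have r1 : 1 <= r by rewrite -[1]sqrtr1 ler_sqrt expr1n ?lerDl ?sqr_ge0// addr_ge0 ?sqr_ge0.
  have r2 : r <= 1 + l ^+ 2 / 2.
    rewrite -(@ler_pXn2r _ 2) ?nnegrE ?sqrtr_ge0 ?addr_ge0 ?divr_ge0 ?sqr_ge0//.
    rewrite sqr_sqrtr ?addr_ge0 ?sqr_ge0//.
    exact: sqrt1D_bound.
  rewrite (_ : (fun j => 0 + r * Z t j) = fun j => Z t j + (r - 1) * Z t j); last first.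
    by apply/funext => j; ring.
  apply: f_lip => [|j]; first by rewrite mulr_ge0 ?divr_ge0 ?sqr_ge0.
  rewrite normrM ger0_norm ?subr_ge0// ler_pM ?subr_ge0//.
  by rewrite lerBlDl.
have low : Ex P (fun t => f (Z t)) + l ^+ 2 / 2 * (b * Ex P (fun t => p0 (Z t) * (1 - p0 (Z t))))
    - 6 * b ^+ 2 * l ^+ 3 * K <= Ex P (fun t => G (Z t)).
  rewrite -ExZ// -ExZ; last exact: intgZ.
  rewrite -ExD//; last by do 2 apply: intgZ.
  rewrite -[X in _ - X](Ex_cst P) -ExB; [|by apply: intgD => //; do 2 apply: intgZ|exact: intg_cst].
  apply: Ex_le => [|//|t].
    by apply: intgB; [apply: intgD => //; do 2 apply: intgZ|exact: intg_cst].
  exact: G_ge.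
rewrite EGZ in low; have lu := le_trans low up.
have l2 : 0 < l ^+ 2 / 2 by rewrite divr_gt0 ?exprn_gt0.
rewrite -(ler_pM2l l2) /C.
have -> : l ^+ 2 / 2 * (Ex P U + l * (12 * b ^+ 2 * K)) =
  l ^+ 2 / 2 * Ex P U + 6 * b ^+ 2 * l ^+ 3 * K by field.
exact: cancel_le lu.
Qed.

End Key.

(* Nazarov's inequality for a standardized Gaussian vector *)
Lemma anti_concentration (c : J -> R) (x : R) : 0 < x ->
  (P [set t | (forall j, Z t j <= c j + x)%R /\ ~ (forall j, Z t j <= c j)%R] <=
   (72 * q * x)%:E)%E.
Proof.
move=> x0; set A := [set t | _].
have mA : measurable A.
  apply: measurableI; first exact: measurable_orthant.
  by apply: measurableC; exact: measurable_orthant.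
(* With b = N / x the bias ln |J| of b times the soft maximum is at most N, and the slab of width x
   has length N in that scale. The successor keeps N positive when |J| = 1. *)
pose N := (Num.truncn (ln #|J|%:R : R)).+1.
have NJ : ln #|J|%:R <= N%:R :> R by rewrite ltW// truncnS_gt.
have N0 : 0 < N%:R :> R by rewrite ltr0n.
pose b := N%:R / x.
have b0 : 0 < b by rewrite divr_gt0.
pose ck (k : nat) (j : J) := c j + k%:R / b.
pose oe (k : nat) (t : T) (o : option J) : R := if o is Some j then Z t j - ck k j else 0.
pose p k t : R := (partf b (oe k t))^-1.
have key k : intg P (fun t => p k t * (1 - p k t)) /\
    b * Ex P (fun t => p k t * (1 - p k t)) <= 3 / 2 * q := anti_key b0 (ck k).
have p0_ge0 k t : 0 <= p k t * (1 - p k t).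
  have pf := partf_gt0 None b (oe k t).
  rewrite mulr_ge0 ?invr_ge0 ?(ltW pf)// subr_ge0 invf_le1//.
  by rewrite /partf (bigD1 None)//= mulr0 expR0 lerDl sumr_ge0.
have ind t : (\1_A t : R) <= \sum_(k < (2 * N).+1) 16 * (p k t * (1 - p k t)).
  rewrite indicE; case: (boolP (t \in A)) => [|_] /=; last first.
    by rewrite sumr_ge0// => k _; rewrite mulr_ge0.
  rewrite inE => -[Z1 Z2].
  pose y j := Z t j - c j.
  pose F := smax b y.
  have F0 : 0 < F.
    have [j hj] : exists j, c j < Z t j.
      apply: contra_notP Z2 => h j; rewrite leNgt; apply/negP => h'.
      by apply: h; exists j.
    by apply: lt_le_trans (smax_ge j0 b0 y j); rewrite subr_gt0.
  have F2 : b * F <= (2 * N)%:R.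
    have yx j : y j <= x by rewrite /y; have := Z1 j; lra.
    have := smax_le j0 b0 yx; rewrite -/F -(ler_pM2l b0) => /le_trans; apply.
    rewrite (_ : b * (x + ln #|J|%:R / b) = b * x + ln #|J|%:R); last first.
      by field; rewrite gt_eqF.
    by rewrite /b divfK ?gt_eqF// natrM; lra.
  have bF0 : 0 <= b * F by rewrite mulr_ge0 ?(ltW b0) ?(ltW F0).
  have /andP[k1 k2] := truncn_itv bF0.
  (* On the event, b F lies in ]0, 2 N]; its integer part selects the shift for which [p k t] is
     neither close to 0 nor to 1. *)
  set k := Num.truncn _ in k1 k2.
  have kN : (k < (2 * N).+1)%N by rewrite ltnS -(ler_nat R) (le_trans k1).
  rewrite (bigD1 (Ordinal kN))//=.
  have h : 1 <= 16 * (p k t * (1 - p k t)); last first.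
    by apply: (le_trans h); rewrite lerDl sumr_ge0// => i _; rewrite mulr_ge0.
  pose v := b * F - k%:R.
  have pE : p k t = (1 + expR v)^-1.
    rewrite /p; congr (_^-1); rewrite /partf (bigD1 None)//= mulr0 expR0; congr (_ + _).
    have -> : expR v = \sum_j expR (b * (Z t j - ck k j)).
      rewrite /v expRD /F /smax mulrA divff ?gt_eqF// mul1r lnK ?posrE ?(partf_gt0 j0)//.
      rewrite /partf mulr_suml; apply: eq_bigr => j _; rewrite -expRD; congr expR.
      by rewrite /y /ck; field; rewrite gt_eqF.
    rewrite (reindex_onto Some (fun o => if o is Some j then j else j0))/=; last by case.
    by apply: eq_bigl => j; rewrite eqxx.
  have v0 : 0 <= v by rewrite subr_ge0.
  have v1 : v <= 1 by rewrite /v; move: k2; rewrite -natr1; lra.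
  (* For v in [0, 1] one has 1 <= exp v <= 3, hence p (1 - p) = exp v / (1 + exp v)^2 >= 1/16. *)
  have E1 : 1 <= expR v by rewrite -expR0 ler_expR.
  have E3 : expR v <= 3 by have := expR_le_quad v1; nra.
  rewrite pE (_ : _ * _ = 16 * expR v / (1 + expR v) ^+ 2); last first.
    by field; rewrite gt_eqF// addr_gt0 ?expR_gt0.
  rewrite ler_pdivlMr ?exprn_gt0 ?addr_gt0 ?expR_gt0// mul1r; nra.
rewrite -(Ex_indic P mA) lee_fin.
have iA : intg P (\1_A : T -> R).
  apply: (@intg_bnd _ _ _ _ _ 1); first exact: measurable_indic.
  by move=> t; rewrite indicE; case: (_ \in _); rewrite ?normr1 ?normr0.
have ip k : intg P (fun t => 16 * (p k t * (1 - p k t))) by apply: intgZ; have [] := key k.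
apply: le_trans (Ex_le iA (intg_sum _ (fun k : 'I_(2 * N).+1 => ip k)) ind) _.
rewrite Ex_sum; last by move=> k; exact: ip.
(* Each of the 2 N + 1 shifts contributes 16 times 3 q / (2 b); since (2 N + 1) / N <= 3 the total
   is at most 72 q x. *)
apply: (@le_trans _ _ (\sum_(k < (2 * N).+1) 24 * q / b)).
  apply: ler_sum => k _; rewrite ExZ; last by have [] := key k.
  have [_] := key k; rewrite -ler_pdivlMl// => h.
  have -> : 24 * q / b = 16 * (b^-1 * (3 / 2 * q)) by field; rewrite gt_eqF.
  by rewrite ler_pM2l.
rewrite sumr_const card_ord -[(24 * q / b) *+ _]mulr_natl.
have -> : (2 * N).+1%:R * (24 * q / b) = 24 * q * x * ((2 * N).+1%:R / N%:R).
  by rewrite /b; field; rewrite !gt_eqF.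
have -> : 72 * q * x = 24 * q * x * 3 by ring.
rewrite ler_wpM2l ?mulr_ge0 ?(ltW hq) ?(ltW x0)// ler_pdivrMr//.
have -> : (2 * N).+1%:R = 2 * N%:R + 1 :> R by rewrite -addn1 natrD natrM.
have : 1 <= N%:R :> R by rewrite ler1n.
lra.
Qed.

End AntiConcentration.

(** * The Lindeberg replacement *)

Lemma norm_expansion_diff (R : realFieldType) (x x' m p p' X Y : R) :
  `|x - m - p / 2| <= X -> `|x' - m - p' / 2| <= X -> `|p - p'| <= Y ->
  `|x - x'| <= 2 * X + Y / 2.
Proof.
rewrite !ler_norml => /andP[? ?] /andP[? ?] /andP[? ?].
by apply/andP; split; lra.
Qed.

Section OneStep.
Context {R : realType} {J : finType}.
Variables (j0 : J) (b phi : R) (hphi : 0 < phi) (phib : phi <= b).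

Let hb : 0 < b. Proof. exact: lt_le_trans phib. Qed.

(** Cubic tail of an increment: it dominates every error caused by a coordinate exceeding the scale
    1 / b of the soft maximum. *)
Definition tailf (u : J -> R) (j : J) : R :=
  if 1 <= b * `|u j| then (b * `|u j|) ^+ 3 else 0.

(** The derivatives of [msmooth] live on t <= smax <= t + 4 / phi; the band enlarges this by 1 / phi
    on both sides to allow for a small increment. *)
Definition band (t : R) (w : J -> R) : R :=
  ((t - phi^-1 <= smax b w) && (smax b w <= t + 5 / phi))%:R.

Lemma tailf_ge0 u j : 0 <= tailf u j.
Proof. by rewrite /tailf; case: ifP => // _; rewrite exprn_ge0// mulr_ge0// ltW. Qed.

Lemma band_ge0 t w : 0 <= band t w. Proof. exact: ler0n. Qed.

Lemma tailf_or_small u : (forall j, b * `|u j| <= 1) \/ 1 <= \sum_j tailf u j.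
Proof.
have [H|] := pselect (forall j, b * `|u j| <= 1); first by left.
move=> /existsNP[j /negP]; rewrite -ltNge => h; right.
rewrite (bigD1 j)//= {1}/tailf (ltW h) (le_trans (exprn_ege1 3 (ltW h)))// lerDl.
by apply: sumr_ge0 => k _; exact: tailf_ge0.
Qed.

Lemma step_remainder t w u :
  `|msmooth b phi t (fun j => w j + u j) - msmooth b phi t w
    - phi * (stepf1 (phi * (smax b w - t)) * gibbs b w u) - mquad b phi t w u / 2| <=
  2000 * expR 2 * (phi * b ^+ 2) * gibbs b w (fun j => `|u j| ^+ 3) * band t w
  + 1000 * \sum_j tailf u j.
Proof.
have T0 : 0 <= \sum_j tailf u j by apply: sumr_ge0 => j _; exact: tailf_ge0.
have [H|] := pselect (forall j, b * `|u j| <= 1).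
  apply: le_trans (msmooth_taylor_small j0 hb w t hphi phib (U := b^-1) _ _) _.
  - by move=> j; rewrite -[b^-1]mulr1 ler_pdivlMl.
  - by rewrite divff ?gt_eqF.
  - by rewrite lerDl; exact: mulr_ge0 (ler0n _ _) T0.
move=> /existsNP[j1 /negP]; rewrite -ltNge => h1.
have [j _ jmax] := @arg_maxP _ _ _ j1 xpredT (fun j => `|u j|) isT.
have hj : 1 <= b * `|u j|.
  by apply: (le_trans (ltW h1)); rewrite ler_pM2l//; exact: jmax.
apply: le_trans (msmooth_taylor_large j0 hb w t hphi phib (U := `|u j|) _ hj) _.
  by move=> k; exact: jmax.
apply: (@le_trans _ _ (1000 * \sum_j tailf u j)).
  apply: ler_wpM2l; first exact: ler0n.
  rewrite (bigD1 j)//= {1}/tailf hj lerDl.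
  by apply: sumr_ge0 => k _; exact: tailf_ge0.
have g0 : 0 <= gibbs b w (fun j => `|u j| ^+ 3).
  by apply: (gibbs_ge0 j0) => k; rewrite exprn_ge0.
rewrite lerDr; exact: mulr_ge0 (mulr_ge0 (mulr_ge0 (mulr_ge0 (ler0n _ _) (expR_ge0 _))
  (mulr_ge0 (ltW hphi) (sqr_ge0 _))) g0) (band_ge0 t w).
Qed.

Context {d : measure_display} {T : measurableType d} (P : probability T R).

(** What the replacement needs of one summand. Second moments are left out: they are compared
    between the two summands. *)
Definition step_moments (psi : T -> J -> R) (L3 Tl : R) : Prop :=
  [/\ forall j, measurable_fun [set: T] (psi^~ j),
      forall j, Ex P (psi^~ j) = 0,
      forall j, intg P (fun t => `|psi t j| ^+ 3),
      forall j, Ex P (fun t => `|psi t j| ^+ 3) <= L3 &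
      intg P (fun t => \sum_j tailf (psi t) j) /\
      Ex P (fun t => \sum_j tailf (psi t) j) <= Tl].

Lemma abs3_bound (k : nat) (x : R) : (k <= 3)%N -> `|x| ^+ k <= 1 + `|x| ^+ 3.
Proof.
move=> k3; have [h|h] := leP `|x| 1.
  by rewrite (le_trans (exprn_ile1 k (normr_ge0 _) h))// lerDl exprn_ge0.
by rewrite (le_trans (ler_weXn2l (ltW h) k3))// lerDr.
Qed.

Section Moments.
Variables (psi : T -> J -> R) (L3 Tl : R).
Hypothesis mom : step_moments psi L3 Tl.

Let mpsi j : measurable_fun [set: T] (psi^~ j). Proof. by case: mom. Qed.

Lemma step_intg1 j : intg P (psi^~ j).
Proof.
have [_ _ i3 _ _] := mom; apply: (intg_le (mpsi j) _ (intgD (intg_cst P 1) (i3 j))) => t.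
by rewrite -[`|psi t j|]expr1 abs3_bound.
Qed.

Lemma step_intg2 j k : intg P (fun t => psi t j * psi t k).
Proof.
have [_ _ i3 _ _] := mom.
apply: (intg_le _ _ (intgD (intgD (intg_cst P 1) (i3 j)) (intgD (intg_cst P 1) (i3 k)))) => [|t].
  by apply: measurable_funM.
apply: (@le_trans _ _ (`|psi t j| ^+ 2 + `|psi t k| ^+ 2)).
  rewrite normrM; have := sqr_ge0 (`|psi t j| - `|psi t k|).
  by have := sqr_ge0 (`|psi t j|); have := sqr_ge0 (`|psi t k|); nra.
by apply: lerD; exact: abs3_bound.
Qed.

(** Written as a double Gibbs average, the square has an expectation that depends only on the cross
    moments of u. *)
Lemma gibbs_sqrE (w u : J -> R) : gibbs b w u ^+ 2 =
  gibbs b w (fun j => gibbs b w (fun k => u j * u k)).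
Proof.
rewrite (_ : (fun j => _) = fun j => gibbs b w u * u j).
  by rewrite gibbsZ expr2.
by apply/funext => j; rewrite gibbsZ mulrC.
Qed.

Lemma Ex_mquad t w : intg P (fun x => mquad b phi t w (psi x)) /\
  Ex P (fun x => mquad b phi t w (psi x)) =
  phi * (stepf1 (phi * (smax b w - t)) *
   (b * (gibbs b w (fun j => Ex P (fun x => psi x j * psi x j)) -
     gibbs b w (fun j => gibbs b w (fun k => Ex P (fun x => psi x j * psi x k)))))
   + phi * (stepf2 (phi * (smax b w - t)) *
     gibbs b w (fun j => gibbs b w (fun k => Ex P (fun x => psi x j * psi x k))))).
Proof.
have [i2 E2] := Ex_gibbs b w (fun j => step_intg2 j j).
have H j := Ex_gibbs b w (fun k => step_intg2 j k).
have [i11 E11] := Ex_gibbs b w (fun j => (H j).1).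
have E11' : Ex P (fun x => gibbs b w (fun j => gibbs b w (fun k => psi x j * psi x k))) =
    gibbs b w (fun j => gibbs b w (fun k => Ex P (fun x => psi x j * psi x k))).
  by rewrite E11; congr gibbs; apply/funext => j; have [_ ->] := H j.
have -> : (fun x => mquad b phi t w (psi x)) = fun x =>
    phi * (stepf1 (phi * (smax b w - t)) *
   (b * (gibbs b w (fun j => psi x j * psi x j) -
     gibbs b w (fun j => gibbs b w (fun k => psi x j * psi x k))))
   + phi * (stepf2 (phi * (smax b w - t)) *
     gibbs b w (fun j => gibbs b w (fun k => psi x j * psi x k)))).
  apply/funext => x; rewrite /mquad gibbs_sqrE.
  by rewrite (_ : (fun i => psi x i ^+ 2) = fun i => psi x i * psi x i).
have iA : intg P (fun x => stepf1 (phi * (smax b w - t)) *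
   (b * (gibbs b w (fun j => psi x j * psi x j) -
     gibbs b w (fun j => gibbs b w (fun k => psi x j * psi x k))))).
  by do 2 apply: intgZ; exact: intgB.
have iB : intg P (fun x => phi * (stepf2 (phi * (smax b w - t)) *
     gibbs b w (fun j => gibbs b w (fun k => psi x j * psi x k)))).
  by do 2 apply: intgZ.
split; first by apply: intgZ; exact: intgD.
rewrite ExZ; last exact: intgD.
rewrite ExD// ExZ; last by apply: intgZ; exact: intgB.
rewrite ExZ; last exact: intgB.
rewrite ExB// ExZ; last exact: intgZ.
by rewrite ExZ// E2 E11'.
Qed.

Lemma msmooth_intg t w : intg P (fun x => msmooth b phi t (fun j => w j + psi x j)).
Proof.
apply: (@intg_bnd _ _ _ _ _ 1).
  rewrite /msmooth.
  have mst : measurable_fun [set: R] (@stepf R).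
    apply: continuous_measurable_fun => x.
    exact: is_derive_continuous (is_derive_stepf x).
  apply: (measurableT_comp mst); apply: measurable_funM => //.
  apply: measurable_funB => //; apply: measurable_smax => j.
  exact: measurable_funD.
by move=> x; rewrite ger0_norm ?stepf_ge0// stepf_le1.
Qed.

Lemma step_expansion t w :
  `|Ex P (fun x => msmooth b phi t (fun j => w j + psi x j)) - msmooth b phi t w
    - Ex P (fun x => mquad b phi t w (psi x)) / 2| <=
  2000 * expR 2 * (phi * b ^+ 2) * L3 * band t w + 1000 * Tl.
Proof.
have [_ m1 i3 m3 [iT mT]] := mom.
have [iq _] := Ex_mquad t w.
have im := msmooth_intg t w.
have [i1 E1] := Ex_gibbs b w step_intg1.
have [ig3 Eg3] := Ex_gibbs b w i3.
set k := phi * stepf1 (phi * (smax b w - t)).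
pose r x := msmooth b phi t (fun j => w j + psi x j) - msmooth b phi t w
   - k * gibbs b w (psi x) - 2^-1 * mquad b phi t w (psi x).
have ir : intg P r.
  apply: intgB; last exact: intgZ.
  by apply: intgB; [apply: intgB => //; exact: intg_cst|exact: intgZ].
have Er : Ex P r = Ex P (fun x => msmooth b phi t (fun j => w j + psi x j)) - msmooth b phi t w
    - Ex P (fun x => mquad b phi t w (psi x)) / 2.
  rewrite /r ExB; [|by apply: intgB; [apply: intgB => //; exact: intg_cst|exact: intgZ]|exact: intgZ].
  rewrite ExB; [|by apply: intgB => //; exact: intg_cst|exact: intgZ].
  rewrite ExB; [|by []|exact: intg_cst].
  rewrite Ex_cst ExZ// ExZ// E1.
  have -> : gibbs b w (fun i => Ex P (psi^~ i)) = 0.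
    by rewrite -[RHS](gibbs_cst j0 b w 0); congr gibbs; apply/funext => j; exact: m1.
  by rewrite mulr0 subr0 [_ / 2]mulrC.
pose K := 2000 * expR 2 * (phi * b ^+ 2) * band t w.
have K0 : 0 <= K by exact: mulr_ge0 (mulr_ge0 (mulr_ge0 (ler0n _ _) (expR_ge0 _)) (mulr_ge0 (ltW hphi) (sqr_ge0 _))) (band_ge0 t w).
have rb x : `|r x| <= K * gibbs b w (fun j => `|psi x j| ^+ 3) + 1000 * \sum_j tailf (psi x) j.
  have := step_remainder t w (psi x); rewrite /r /k /K.
  rewrite [2^-1 * _]mulrC -[phi * _ * gibbs _ _ _]mulrA => /le_trans; apply.
  by rewrite lerD2r -[leRHS]mulrA [leRHS]mulrA mulrAC.
rewrite -Er; apply: le_trans (Ex_norm ir) _.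
apply: le_trans (Ex_le (intg_abs ir) (intgD (intgZ K ig3) (intgZ 1000 iT)) rb) _.
rewrite ExD; [|exact: intgZ|exact: intgZ].
rewrite (ExZ _ ig3) (ExZ _ iT) Eg3; apply: lerD; last first.
  by apply: ler_wpM2l mT; exact: ler0n.
rewrite (_ : _ * band t w = K * L3); last by rewrite /K; ring.
apply: ler_wpM2l; first exact: K0.
by rewrite -[leRHS](gibbs_cst j0 b w); apply: (gibbs_le j0) => j; exact: m3.
Qed.

End Moments.

(** The expected quadratic terms are linear in the matrices of second moments and vanish off the
    band; 600 = 200 (2 + 1), using phi <= b. *)
Lemma mquad_diff (psi chi : T -> J -> R) L3 L3' Tl Tl' (dl : R) t w :
  step_moments psi L3 Tl -> step_moments chi L3' Tl' -> 0 <= dl ->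
  (forall j k, `|Ex P (fun x => psi x j * psi x k) - Ex P (fun x => chi x j * chi x k)| <= dl) ->
  `|Ex P (fun x => mquad b phi t w (psi x)) - Ex P (fun x => mquad b phi t w (chi x))| <=
  600 * (phi * b * dl) * band t w.
Proof.
move=> mom mom' dl0 H.
have [_ ->] := Ex_mquad mom t w; have [_ ->] := Ex_mquad mom' t w.
set s1 := stepf1 _; set s2 := stepf2 _.
set g2 := gibbs b w (fun j => Ex P (fun x => psi x j * psi x j)).
set g2' := gibbs b w (fun j => Ex P (fun x => chi x j * chi x j)).
set g11 := gibbs b w (fun j => gibbs b w (fun k => Ex P (fun x => psi x j * psi x k))).
set g11' := gibbs b w (fun j => gibbs b w (fun k => Ex P (fun x => chi x j * chi x k))).
have gd (F G : J -> R) : (forall j, `|F j - G j| <= dl) -> `|gibbs b w F - gibbs b w G| <= dl.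
  move=> FG; rewrite -[gibbs b w G]mul1r -mulNr -gibbsZ -gibbsD.
  apply: le_trans (gibbs_norm j0 _ _ _) _; rewrite -[leRHS](gibbs_cst j0 b w).
  by apply: (gibbs_le j0) => j; rewrite mulN1r.
have d2 : `|g2 - g2'| <= dl by apply: (gd) => j; exact: H.
have d11 : `|g11 - g11'| <= dl by apply: (gd) => j; apply: (gd) => k; exact: H.
rewrite (_ : _ - _ = phi * (b * (s1 * ((g2 - g2') - (g11 - g11')))
   + phi * (s2 * (g11 - g11')))); last by ring.
rewrite /band; case: (boolP (_ && _)) => [_|out] /=; last first.
  have [s10 s20 _] : [/\ s1 = 0, s2 = 0 & stepf3 (phi * (smax b w - t)) = 0].
    apply: stepfN_out; move: out; rewrite negb_and -!ltNge => /orP[ho|ho].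
      apply/orP; left; rewrite pmulr_rle0//.
      have : 0 < phi^-1 by rewrite invr_gt0.
      lra.
    apply/orP; right; rewrite -ler_pdivrMl// mulrC.
    have : 0 < phi^-1 by rewrite invr_gt0.
    lra.
  by rewrite s10 s20 !(mul0r, mulr0, addr0) normr0.
have [b1 b2 _] := stepf_bnd (phi * (smax b w - t)).
rewrite mulr1 normrM (gtr0_norm hphi).
rewrite (_ : 600 * _ = phi * (b * (200 * (2 * dl)) + b * (200 * dl))); last by ring.
rewrite ler_pM2l//; apply: le_trans (ler_normD _ _) _; apply: lerD.
  rewrite normrM (gtr0_norm hb) ler_pM2l// normrM ler_pM//.
  apply: le_trans (ler_normB _ _) _; lra.
rewrite normrM (gtr0_norm hphi); apply: ler_pM => //; first exact: ltW.
by rewrite normrM ler_pM.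
Qed.

Lemma step_compare (psi chi : T -> J -> R) L3 Tl (dl : R) t w :
  step_moments psi L3 Tl -> step_moments chi L3 Tl -> 0 <= dl ->
  (forall j k, `|Ex P (fun x => psi x j * psi x k) - Ex P (fun x => chi x j * chi x k)| <= dl) ->
  `|Ex P (fun x => msmooth b phi t (fun j => w j + psi x j)) -
    Ex P (fun x => msmooth b phi t (fun j => w j + chi x j))| <=
  (4000 * expR 2 * (phi * b ^+ 2) * L3 + 300 * (phi * b * dl)) * band t w + 2000 * Tl.
Proof.
move=> mom mom' dl0 H.
have e1 := step_expansion mom t w; have e2 := step_expansion mom' t w.
have e3 := mquad_diff t w mom mom' dl0 H.
apply: le_trans (norm_expansion_diff e1 e2 e3) _.
rewrite le_eqVlt; apply/orP; left; apply/eqP; field.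
by [].
Qed.

End OneStep.

(** * Calculus of hybrid sums *)

Section Swap.
Context {d : measure_display} {T : measurableType d} {R : realType} (P : probability T R).
Context {J : finType}.
Variables (psiA psiB : T -> J -> R).
Hypothesis mA : forall j, measurable_fun [set: T] (psiA^~ j).
Hypothesis mB : forall j, measurable_fun [set: T] (psiB^~ j).
Implicit Types f g : (J -> R) -> R.

Definition bnd f : Prop :=
  nnc (fun w => (f w)%:E) /\ exists C : R, forall w, f w <= C.

Let A := avg P psiA.
Let B := avg P psiB.

(* Expectation of f at a sum of i independent copies of psiA and k
   independent copies of psiB. *)
Definition hyb (i k : nat) f : \bar R :=
  iter i A (iter k B (fun w => (f w)%:E)) (fun=> 0).

Definition hval i k f : R := fine (hyb i k f).

Definition shiftE (psi : T -> J -> R) f (w : J -> R) : R :=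
  Ex P (fun t => f (fun j => w j + psi t j)).

Let iterA_nnc i (f : (J -> R) -> \bar R) : nnc f -> nnc (iter i A f).
Proof. by move=> nf; elim: i => //= i IH; exact: avg_nnc. Qed.

Let iterB_nnc i (f : (J -> R) -> \bar R) : nnc f -> nnc (iter i B f).
Proof. by move=> nf; elim: i => //= i IH; exact: avg_nnc. Qed.

Let it_nnc i k (f : (J -> R) -> \bar R) : nnc f -> nnc (iter i A (iter k B f)).
Proof. by move=> nf; apply: iterA_nnc; exact: iterB_nnc. Qed.

Let it_le i k (f g : (J -> R) -> \bar R) w : nnc f -> nnc g -> (forall w, f w <= g w)%E ->
  (iter i A (iter k B f) w <= iter i A (iter k B g) w)%E.
Proof.
move=> nf ng fg.
have H k' : forall w, (iter k' B f w <= iter k' B g w)%E.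
  elim: k' => [//|k' IH] v; apply: avg_le => //; exact: iterB_nnc.
elim: i w => [|i IH] w; first exact: H.
by apply: avg_le => //; exact: it_nnc.
Qed.

Let it_D i k (f g : (J -> R) -> \bar R) w : nnc f -> nnc g ->
  (iter i A (iter k B (fun w => f w + g w)) w =
   iter i A (iter k B f) w + iter i A (iter k B g) w)%E.
Proof.
move=> nf ng.
have H k' : iter k' B (fun w => f w + g w)%E = (fun w => iter k' B f w + iter k' B g w)%E.
  elim: k' => [//|k' IH]; apply/funext => v.
  rewrite iterS IH; apply: avgD => //; exact: iterB_nnc.
rewrite H; elim: i w => [//|i IH] w.
transitivity (A (fun w => iter i A (iter k B f) w + iter i A (iter k B g) w)%E w).
  by rewrite iterS; congr (A _ w); apply/funext => v; exact: IH.
by apply: avgD => //; exact: it_nnc.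
Qed.

Let it_Z i k (f : (J -> R) -> \bar R) (c : R) w : 0 <= c -> nnc f ->
  (iter i A (iter k B (fun w => c%:E * f w)) w = c%:E * iter i A (iter k B f) w)%E.
Proof.
move=> c0 nf.
have H k' : iter k' B (fun w => c%:E * f w)%E = (fun w => c%:E * iter k' B f w)%E.
  elim: k' => [//|k' IH]; apply/funext => v.
  rewrite iterS IH; apply: avgZ => //; exact: iterB_nnc.
rewrite H; elim: i w => [//|i IH] w.
transitivity (A (fun w => c%:E * iter i A (iter k B f) w)%E w).
  by rewrite iterS; congr (A _ w); apply/funext => v; exact: IH.
by apply: avgZ => //; exact: it_nnc.
Qed.

Let it_cst i k (c : R) w : (iter i A (iter k B (fun=> c%:E)) w = c%:E)%E.
Proof.
have H k' : iter k' B (fun=> c%:E) = (fun=> c%:E).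
  by elim: k' => [//|k' IH]; apply/funext => v; rewrite iterS IH; exact: avg_cst.
rewrite H; elim: i w => [//|i IH] w.
transitivity (A (fun=> c%:E) w); last exact: avg_cst.
by rewrite iterS; congr (A _ w); apply/funext => v; exact: IH.
Qed.

(** Commutation makes a hybrid depend only on the numbers of summands of each kind. *)
Let comm k (f : (J -> R) -> \bar R) : nnc f -> A (iter k B f) = iter k B (A f).
Proof.
move=> nf; elim: k => [//|k IH]; rewrite !iterS -IH.
apply/funext => w; apply: avgC => //; exact: iterB_nnc.
Qed.

Lemma hyb_fin i k f : bnd f -> hyb i k f = (hval i k f)%:E.
Proof.
move=> [nf [C fC]]; rewrite /hval fineK// fin_numE; apply/andP; split.
  rewrite gt_eqF// (lt_le_trans (ltNyr 0))//.
  by have [_] := it_nnc i k nf; exact.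
rewrite lt_eqF// (le_lt_trans (y := C%:E)) ?ltry//.
have C0 : 0 <= C.
  by have [_ f0] := nf; have := f0 (fun=> 0); rewrite lee_fin => /le_trans; apply.
rewrite -(it_cst i k C (fun=> 0)); apply: it_le => //.
exact: nnc_cst.
Qed.

Lemma bndD f g : bnd f -> bnd g -> bnd (fun w => f w + g w).
Proof.
move=> [nf [C fC]] [ng [D gD]]; split; last by exists (C + D) => w; exact: lerD.
by have := nncD nf ng.
Qed.

Lemma bndZ f (c : R) : 0 <= c -> bnd f -> bnd (fun w => c * f w).
Proof.
move=> c0 [nf [C fC]]; split; last by exists (c * C) => w; exact: ler_wpM2l.
by have := nncZ c0 nf.
Qed.

Lemma bnd_cst (c : R) : 0 <= c -> bnd (fun=> c).
Proof. by move=> c0; split; [exact: nnc_cst|exists c]. Qed.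

Lemma val_le i k f g : bnd f -> bnd g -> (forall w, f w <= g w) -> hval i k f <= hval i k g.
Proof.
move=> bf bg fg; rewrite -lee_fin -!hyb_fin//.
by apply: it_le; [exact: bf.1|exact: bg.1|move=> w; rewrite lee_fin].
Qed.

Lemma valD i k f g : bnd f -> bnd g -> hval i k (fun w => f w + g w) = hval i k f + hval i k g.
Proof.
move=> bf bg; apply/EFin_inj; rewrite EFinD -!hyb_fin//; last exact: bndD.
by rewrite /hyb -it_D//; [exact: bf.1|exact: bg.1].
Qed.

Lemma valZ i k f (c : R) : 0 <= c -> bnd f -> hval i k (fun w => c * f w) = c * hval i k f.
Proof.
move=> c0 bf; apply/EFin_inj; rewrite EFinM -!hyb_fin//; last exact: bndZ.
by rewrite /hyb -it_Z//; exact: bf.1.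
Qed.

Lemma val_cst i k (c : R) : 0 <= c -> hval i k (fun=> c) = c.
Proof. by move=> c0; rewrite /hval /hyb it_cst. Qed.

Lemma val_ge0 i k f : bnd f -> 0 <= hval i k f.
Proof.
by move=> bf; rewrite -lee_fin -hyb_fin//; have [_] := it_nnc i k bf.1; exact.
Qed.

Let shiftE_avg (psi : T -> J -> R) f w :
  (forall j, measurable_fun [set: T] (psi^~ j)) -> bnd f ->
  avg P psi (fun w => (f w)%:E) w = (shiftE psi f w)%:E.
Proof.
move=> mpsi [[mf f0] [C fC]]; rewrite /avg ExE//.
apply: (@intg_bnd _ _ _ _ _ C).
  by apply/measurable_EFinP; apply: mf => j; exact: measurable_funD.
by move=> t; rewrite ger0_norm// -lee_fin.
Qed.

Lemma bnd_shiftE (psi : T -> J -> R) f :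
  (forall j, measurable_fun [set: T] (psi^~ j)) -> bnd f -> bnd (shiftE psi f).
Proof.
move=> mpsi bf; have [nf [C fC]] := bf.
have E : (fun w => (shiftE psi f w)%:E) = avg P psi (fun w => (f w)%:E).
  by apply/funext => w; rewrite shiftE_avg.
split; first by rewrite E; exact: avg_nnc.
exists C => w; rewrite -lee_fin -shiftE_avg// -(avg_cst (P := P) C psi w).
apply: avg_le => //.
apply: nnc_cst; have [_ f0] := nf; have := f0 (fun=> 0); rewrite lee_fin => /le_trans; apply.
exact: fC.
Qed.

Lemma val_shiftA i k f : bnd f -> hval i k (shiftE psiA f) = hval i.+1 k f.
Proof.
move=> bf; rewrite /hval /hyb; congr fine.
have -> : (fun w => (shiftE psiA f w)%:E) = A (fun w => (f w)%:E).
  by apply/funext => w; rewrite /A shiftE_avg.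
by rewrite -comm ?iterSr//; exact: bf.1.
Qed.

Lemma val_shiftB i k f : bnd f -> hval i k (shiftE psiB f) = hval i k.+1 f.
Proof.
move=> bf; rewrite /hval /hyb; congr fine.
have -> : (fun w => (shiftE psiB f w)%:E) = B (fun w => (f w)%:E).
  by apply/funext => w; rewrite /B shiftE_avg.
by rewrite iterSr.
Qed.

End Swap.

Lemma norm_diff_le (R : realFieldType) (x y v e : R) :
  x <= y + v -> y <= x + v -> v <= e -> `|x - y| <= e.
Proof. by move=> ? ? ?; rewrite ler_norml; apply/andP; split; lra. Qed.

Lemma norm_sandwich (R : realFieldType) (x xm ym yo y xm' ym' yo' e k : R) :
  x <= xm -> `|xm - ym| <= e -> ym <= yo -> yo <= y + k ->
  xm' <= x -> `|xm' - ym'| <= e -> yo' <= ym' -> y <= yo' + k ->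
  `|x - y| <= k + e.
Proof.
rewrite !ler_norml => ? /andP[? ?] ? ? ? /andP[? ?] ? ?.
by apply/andP; split; lra.
Qed.

(** The right side contains r / 2, which is absorbed on the left before doubling. *)
Lemma rate_arith (R : realFieldType) (r k t m w : R) : 0 <= t ->
  w <= 4^-1 * (2 * r + 10 * k + t) -> r <= 5 * k + (w + 2000 * m) ->
  r <= 15 * k + t + 4000 * m.
Proof. lra. Qed.

Section Lindeberg.
Context {d : measure_display} {T : measurableType d} {R : realType} (P : probability T R).
Context {J : finType}.
Variables (j0 : J) (psiA psiB : T -> J -> R).
Variables (b phi L3 Tl dl kap : R) (n : nat).
Hypotheses (hphi : 0 < phi) (phib : phi <= b) (lnJ : ln #|J|%:R / b <= phi^-1).
Hypothesis momA : step_moments b P psiA L3 Tl.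
Hypothesis momB : step_moments b P psiB L3 Tl.
Hypotheses (dl0 : 0 <= dl) (kap0 : 0 <= kap).
Hypothesis covAB : forall j k, `|Ex P (fun x => psiA x j * psiA x k) -
  Ex P (fun x => psiB x j * psiB x k)| <= dl.

Let hb : 0 < b. Proof. exact: lt_le_trans phib. Qed.

Definition orth (s : R) (w : J -> R) : R := [forall j, w j <= s]%:R.

Let mA j : measurable_fun [set: T] (psiA^~ j). Proof. by case: momA. Qed.
Let mB j : measurable_fun [set: T] (psiB^~ j). Proof. by case: momB. Qed.

Local Notation val := (hval P psiA psiB).

Hypothesis anti : forall s x : R, 0 < x ->
  val 0 n (orth (s + x)) <= val 0 n (orth s) + kap * x.

Lemma bnd_indic (D : set (J -> R)) (f : (J -> R) -> R) :
  (forall w, f w = \1_D w) ->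
  (forall d' (T' : measurableType d') (psi : T' -> J -> R),
    (forall j, measurable_fun [set: T'] (psi^~ j)) -> measurable [set t | D (psi t)]) ->
  bnd f.
Proof.
move=> fE mD; split; last first.
  by exists 1 => w; rewrite fE indicE; case: (_ \in _).
split=> [d' T' psi mpsi|w]; last by rewrite fE lee_fin indicE.
apply/measurable_EFinP; apply: (eq_measurable_fun (\1_[set t | D (psi t)] : T' -> R)).
  by move=> t _; rewrite fE !indicE; congr (_%:R); congr nat_of_bool; apply/idP/idP => /set_mem h; exact/mem_set.
exact/measurable_indic/mD.
Qed.

Lemma bnd_orth s : bnd (orth s).
Proof.
apply: (@bnd_indic [set w | forall j, w j <= s]).
  move=> w; rewrite indicE /orth; congr (_%:R); congr nat_of_bool.
  by apply/forallP/idP => [h|/set_mem//]; exact/mem_set.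
by move=> d' T' psi mpsi; exact: (measurable_orthant (fun=> s) mpsi).
Qed.

Let bnd_band t : bnd (J := J) (band b phi t).
Proof.
apply: (@bnd_indic [set w | smax b w \in `[t - phi^-1, t + 5 / phi]]).
  move=> w; rewrite indicE /band; congr (_%:R); congr nat_of_bool.
  by apply/idP/idP => [h|/set_mem/=]; [apply/mem_set; rewrite /= in_itv|rewrite in_itv].
move=> d' T' psi mpsi; have := measurable_smax b mpsi.
by move=> /(_ measurableT _ (measurable_itv `[t - phi^-1, t + 5 / phi])); rewrite setTI.
Qed.

Let bnd_ms t : bnd (J := J) (msmooth b phi t).
Proof.
split; last by exists 1 => w; exact: stepf_le1.
split=> [d' T' psi mpsi|w]; last by rewrite lee_fin stepf_ge0.
apply/measurable_EFinP.
have mst : measurable_fun [set: R] (@stepf R).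
  apply: continuous_measurable_fun => x.
  exact: is_derive_continuous (is_derive_stepf x).
apply: (measurableT_comp mst); apply: measurable_funM => //.
by apply: measurable_funB => //; exact: measurable_smax.
Qed.

Let D := phi^-1.
Let D0 : 0 < D. Proof. by rewrite invr_gt0. Qed.

Let Bd (t : R) (w : J -> R) : R :=
  ([forall j, w j <= t + 6 * D] && ~~ [forall j, w j <= t - 4 * D])%:R.

Let BdE t w : orth (t - 4 * D) w + Bd t w = orth (t + 6 * D) w.
Proof.
rewrite /orth /Bd; case: (boolP [forall j, w j <= t - 4 * D]) => h1 /=.
  rewrite andbF addr0; suff -> : [forall j, w j <= t + 6 * D] by [].
  apply/forallP => j; have := forallP h1 j; have := D0; lra.
by rewrite andbT add0r.
Qed.

Let bnd_Bd t : bnd (Bd t).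
Proof.
apply: (@bnd_indic ([set w | forall j, w j <= t + 6 * D] `&` ~` [set w | forall j, w j <= t - 4 * D])).
  move=> w; rewrite indicE /Bd; congr (_%:R); congr nat_of_bool.
  apply/idP/idP => [/andP[/forallP h1 /negP h2]|/set_mem/= [h1 h2]].
    by apply/mem_set; split => // h; apply: h2; exact/forallP.
  by apply/andP; split; [exact/forallP|apply/negP => /forallP].
move=> d' T' psi mpsi; apply: measurableI.
  exact: (measurable_orthant (fun=> t + 6 * D) mpsi).
apply: measurableC; exact: (measurable_orthant (fun=> t - 4 * D) mpsi).
Qed.

Let smax_le_D (w : J -> R) s : (forall j, w j <= s) -> smax b w <= s + D.
Proof.
by move=> h; apply: le_trans (smax_le j0 hb h) _; rewrite lerD2l.
Qed.

(** The band concerns a sum lacking one summand. Restoring a small summand u moves the soft maximum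
    by at most D, and the soft maximum exceeds the maximum by at most D: hence the levels t + 6 D
    and t - 4 D for the complete sum. Large increments are charged to the tail. *)
Let band_le t (w u : J -> R) : band b phi t w <= Bd t (fun j => w j + u j) + \sum_j tailf b u j.
Proof.
have T0 : 0 <= \sum_j tailf b u j by apply: sumr_ge0 => j _; exact: (tailf_ge0 hphi phib).
have b0 : 0 <= Bd t (fun j => w j + u j) by rewrite ler0n.
rewrite /band; case: (boolP (_ && _)) => [/andP[l1 l2]|_] /=; last by rewrite addr_ge0.
have [small|] := tailf_or_small hphi phib u; last by move=> h; rewrite (le_trans h)// lerDr.
have uD j : `|u j| <= D.
  rewrite (@le_trans _ _ b^-1)//; first by rewrite -[b^-1]mulr1 ler_pdivlMl.
  by rewrite /D lef_pV2.
suff -> : Bd t (fun j => w j + u j) = 1 by rewrite lerDl.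
have := smax_lip j0 hb w uD; rewrite ler_norml => /andP[h1 h2].
rewrite /Bd; have -> : [forall j, w j + u j <= t + 6 * D].
  apply/forallP => j; apply: (le_trans (smax_ge j0 hb (fun j => w j + u j) j)).
  by rewrite -/D in l2 *; lra.
suff -> : [forall j, w j + u j <= t - 4 * D] = false by [].
apply/negP => /forallP h; have := smax_le_D h; have := D0.
by rewrite -/D in l1 *; lra.
Qed.

Let K1 := 4000 * expR 2 * (phi * b ^+ 2) * L3 + 300 * (phi * b * dl).
Hypothesis small : n%:R * K1 <= 4^-1.

Let L30 : 0 <= L3.
Proof. by case: momA => _ _ _ h _; apply: le_trans (h j0); apply: Ex_ge0 => t; rewrite exprn_ge0. Qed.

Let Tl0 : 0 <= Tl.
Proof.
case: momA => _ _ _ _ [_ h]; apply: le_trans h; apply: Ex_ge0 => t.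
by apply: sumr_ge0 => j _; exact: (tailf_ge0 hphi phib).
Qed.

Let K10 : 0 <= K1.
Proof.
have h1 : 0 <= phi * b ^+ 2 by rewrite mulr_ge0 ?sqr_ge0 ?(ltW hphi).
have h2 : 0 <= phi * b * dl by rewrite !mulr_ge0 ?(ltW hphi) ?(ltW hb).
exact: addr_ge0 (mulr_ge0 (mulr_ge0 (mulr_ge0 (ler0n _ _) (expR_ge0 _)) h1) L30)
  (mulr_ge0 (ler0n _ _) h2).
Qed.

Let hv i s := val i (n - i) (orth s).

Let hv01 i s : 0 <= hv i s <= 1.
Proof.
rewrite /hv (val_ge0 P mA mB _ _ (bnd_orth s))/=.
rewrite -[leRHS](val_cst P psiA psiB i (n - i) ler01).
apply: (val_le P mA mB); [exact: bnd_orth|exact: bnd_cst|].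
by move=> w; rewrite /orth lern1 leq_b1.
Qed.

Definition hyb_dev : set R :=
  [set x | exists i s, (i <= n)%N /\ x = `|hv i s - hv 0 s|].

Let r := sup hyb_dev.

Let hv_r i s : (i <= n)%N -> `|hv i s - hv 0 s| <= r.
Proof.
move=> i_n; apply: ub_le_sup; last by exists i, s.
exists 1 => _ [k [s' [_ ->]]].
have /andP[? ?] := hv01 k s'; have /andP[? ?] := hv01 0 s'.
by rewrite ler_norml; apply/andP; split; lra.
Qed.

(** With the missing summand restored, the band is a difference of two orthants under a full hybrid
    law. Each orthant costs r to compare with the Gaussian one, which has mass at most 10 kap D
    between the two levels. *)
Let band_val i k t : (i + k.+1)%N = n -> (val i k (band b phi t) <= 2 * r + kap * (10 * D) + Tl).
Proof.
move=> ik.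
have i1n : (i.+1 <= n)%N by rewrite -ik addnS ltnS leq_addr.
have kE : k = (n - i.+1)%N by rewrite -ik addnS subSS addKn.
have [_ _ _ _ [iT mT]] := momA.
have h1 : val i k (band b phi t) <= val i k (fun w => shiftE P psiA (Bd t) w + Tl).
  apply: (val_le P mA mB); [exact: bnd_band| |].
    by apply: bndD; [exact: bnd_shiftE|exact: bnd_cst].
  move=> w; have [nB [C BC]] := bnd_Bd t.
  have iB : intg P (fun x => Bd t (fun j => w j + psiA x j)).
    apply: (@intg_bnd _ _ _ _ _ 1).
      by apply/measurable_EFinP; apply: (nnc_shift_measurable _ nB) => j; exact: mA.
    by move=> x; rewrite ger0_norm ?ler0n// lern1 leq_b1.
  have := Ex_le (intg_cst P (band b phi t w)) (intgD iB iT) (fun x => band_le t w (psiA x)).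
  rewrite Ex_cst ExD// => /le_trans; apply; rewrite lerD2l.
  exact: mT.
apply: (le_trans h1); rewrite (valD P mA mB); [|exact: bnd_shiftE|exact: bnd_cst].
rewrite (val_cst P psiA psiB)// lerD2r (val_shiftA P mA mB)//.
have E : val i.+1 k (orth (t - 4 * D)) + val i.+1 k (Bd t) = val i.+1 k (orth (t + 6 * D)).
  rewrite -(valD P mA mB); [|exact: bnd_orth|exact: bnd_Bd].
  by congr hval; apply/funext => w; exact: BdE.
rewrite kE in E *; rewrite -/(hv i.+1 _) -/(hv i.+1 _) in E.
have h2 := hv_r (t - 4 * D) i1n; have h3 := hv_r (t + 6 * D) i1n.
have h4 : hv 0 (t + 6 * D) <= hv 0 (t - 4 * D) + kap * (10 * D).
  have := @anti (t - 4 * D) (10 * D); rewrite (_ : t - 4 * D + 10 * D = t + 6 * D); last by ring.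
  by rewrite /hv subn0; apply; rewrite mulr_gt0.
move: h2 h3; rewrite !ler_norml => /andP[? ?] /andP[? ?].
lra.
Qed.

Let stepv i k t : (i + k.+1)%N = n ->
  `|val i.+1 k (msmooth b phi t) - val i k.+1 (msmooth b phi t)| <=
  K1 * (2 * r + kap * (10 * D) + Tl) + 2000 * Tl.
Proof.
move=> ik; rewrite -(val_shiftA P mA mB)// -(val_shiftB P psiA mB)//.
have bT : 0 <= 2000 * Tl by exact: mulr_ge0 (ler0n _ _) Tl0.
have cmp w := step_compare j0 hphi phib t w momA momB dl0 covAB.
have bK : bnd (J := J) (fun w => K1 * band b phi t w) by apply: bndZ K10 _; exact: bnd_band.
have bC : bnd (J := J) (fun=> 2000 * Tl) by exact: bnd_cst.
have bg : bnd (J := J) (fun w => K1 * band b phi t w + 2000 * Tl).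
  exact: (bndD bK bC).
have vg : val i k (fun w => K1 * band b phi t w + 2000 * Tl) <=
    K1 * (2 * r + kap * (10 * D) + Tl) + 2000 * Tl.
  rewrite (valD P mA mB _ _ bK bC) (val_cst P psiA psiB _ _ bT) lerD2r.
  rewrite (valZ P mA mB _ _ K10 (bnd_band t)).
  by apply: ler_wpM2l => //; exact: band_val.
have bA : bnd (shiftE P psiA (msmooth b phi t)) by exact: bnd_shiftE.
have bB : bnd (shiftE P psiB (msmooth b phi t)) by exact: bnd_shiftE.
have h1 : val i k (shiftE P psiA (msmooth b phi t)) <=
    val i k (shiftE P psiB (msmooth b phi t)) + val i k (fun w => K1 * band b phi t w + 2000 * Tl).
  rewrite -(valD P mA mB _ _ bB bg); apply: (val_le P mA mB _ _ bA (bndD bB bg)) => w.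
  by have := cmp w; rewrite ler_norml => /andP[_]; rewrite lerBlDl.
have h2 : val i k (shiftE P psiB (msmooth b phi t)) <=
    val i k (shiftE P psiA (msmooth b phi t)) + val i k (fun w => K1 * band b phi t w + 2000 * Tl).
  rewrite -(valD P mA mB _ _ bA bg); apply: (val_le P mA mB _ _ bB (bndD bA bg)) => w.
  by have := cmp w; rewrite distrC ler_norml => /andP[_]; rewrite lerBlDl.
exact: norm_diff_le h1 h2 vg.
Qed.

Let err := n%:R * (K1 * (2 * r + kap * (10 * D) + Tl) + 2000 * Tl).

Let r0 : 0 <= r.
Proof. by apply: le_trans (@hv_r 0 0 _); rewrite ?subrr ?normr0. Qed.

(** Telescoping over the replaced summands. *)
Let hybms i t : (i <= n)%N ->
  `|val i (n - i) (msmooth b phi t) - val 0 n (msmooth b phi t)| <= err.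
Proof.
move=> i_n.
set E := K1 * (2 * r + kap * (10 * D) + Tl) + 2000 * Tl.
have errE : err = n%:R * E by [].
have E0 : 0 <= E.
  apply: addr_ge0 (mulr_ge0 (ler0n _ _) Tl0); apply: mulr_ge0 K10 _.
  apply: addr_ge0 Tl0; apply: addr_ge0; first exact: mulr_ge0.
  by apply: mulr_ge0 kap0 _; apply: mulr_ge0 (ltW D0).
apply: (@le_trans _ _ (i%:R * E)); last by rewrite errE; apply: ler_wpM2r => //; rewrite ler_nat.
elim: i i_n => [|i IH] i_n; first by rewrite subn0 subrr normr0 mul0r.
have ik : (i + (n - i.+1).+1)%N = n by rewrite -subSn// subSS subnKC// ltnW.
have := stepv t ik; rewrite -subSn// subSS => h1.
have h2 := IH (ltnW i_n).
rewrite -natr1 mulrDl mul1r.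
rewrite (_ : _ - _ = (val i (n - i) (msmooth b phi t) - val 0 n (msmooth b phi t)) +
  (val i.+1 (n - i.+1) (msmooth b phi t) - val i (n - i) (msmooth b phi t))); last by ring.
by apply: le_trans (ler_normD _ _) _; exact: lerD.
Qed.

Let orth_le_ms s (w : J -> R) : orth s w <= msmooth b phi (s + D) w.
Proof.
rewrite /orth; case: (boolP [forall j, _]) => [/forallP h|_] /=; last exact: stepf_ge0.
by rewrite /msmooth stepf_le0// pmulr_rle0// subr_le0; exact: smax_le_D.
Qed.

Let ms_le_orth s (w : J -> R) : msmooth b phi s w <= orth (s + 4 * D) w.
Proof.
rewrite /orth; case: (boolP [forall j, _]) => [_|/forallPn[j]] /=; first exact: stepf_le1.
rewrite -ltNge => h; rewrite /msmooth stepf_ge4//.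
rewrite -ler_pdivrMl// mulrC lerBrDl (le_trans (ltW h))//.
exact: smax_ge.
Qed.

(* The remainder of each replacement step lives on a band of width 10 / phi,
   whose probability under a hybrid law is at most 2 r + 10 kap / phi + Tl; as
   n K1 <= 1/4, the resulting inequality for r closes up. *)
Lemma lindeberg_rate : r <= 15 * kap * D + Tl + 4000 * n%:R * Tl.
Proof.
have D5 : 0 < 5 * D by rewrite mulr_gt0.
(* The smoothed indicator at s + D lies between the orthants at s and s + 5 D, and the one at s - 4
   D between those at s - 5 D and s; Gaussian anti-concentration pays for the shift 5 D on each
   side. *)
have main i s : (i <= n)%N -> `|hv i s - hv 0 s| <= kap * (5 * D) + err.
  move=> i_n.
  have le1 i' k' t : val i' k' (orth t) <= val i' k' (msmooth b phi (t + D)).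
    by apply: (val_le P mA mB); [exact: bnd_orth|exact: bnd_ms|move=> w; exact: orth_le_ms].
  have le2 i' k' t : val i' k' (msmooth b phi t) <= val i' k' (orth (t + 4 * D)).
    by apply: (val_le P mA mB); [exact: bnd_ms|exact: bnd_orth|move=> w; exact: ms_le_orth].
  have u1 := le1 i (n - i)%N s; have u2 := hybms (s + D) i_n.
  have u3 := le2 0 n (s + D).
  have u4 := @anti s (5 * D) D5.
  rewrite (_ : s + D + 4 * D = s + 5 * D) in u3; last by ring.
  have v1 := le2 i (n - i)%N (s - 4 * D); have v2 := hybms (s - 4 * D) i_n.
  have v3 := le1 0 n (s - 5 * D).
  have v4 := @anti (s - 5 * D) (5 * D) D5.
  rewrite subrK in v1; rewrite subrK in v4.
  rewrite (_ : s - 5 * D + D = s - 4 * D) in v3; last by ring.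
  rewrite /hv subn0; exact: (norm_sandwich u1 u2 u3 u4 v1 v2 v3 v4).
have rle : r <= kap * (5 * D) + err.
  apply: ge_sup; first by exists `|hv 0 0 - hv 0 0|, 0%N, 0.
  by move=> _ [i [s [i_n ->]]]; exact: main.
have T1 : 0 <= n%:R * Tl by rewrite mulr_ge0.
have kD : 0 <= kap * D by rewrite mulr_ge0// ltW.
have h : n%:R * K1 * (2 * r + kap * (10 * D) + Tl) <= 4^-1 * (2 * r + kap * (10 * D) + Tl).
  apply: ler_wpM2r => //; apply: addr_ge0 Tl0; apply: addr_ge0; first exact: mulr_ge0.
  by apply: mulr_ge0 kap0 _; apply: mulr_ge0 (ltW D0).
have errE : err = n%:R * K1 * (2 * r + kap * (10 * D) + Tl) + 2000 * (n%:R * Tl).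
  by rewrite /err; ring.
rewrite errE in rle.
rewrite -[4000 * _ * _]mulrA -[15 * _ * _]mulrA.
rewrite (_ : kap * (10 * D) = 10 * (kap * D)) in h rle; last by ring.
rewrite (_ : kap * (5 * D) = 5 * (kap * D)) in rle; last by ring.
exact: rate_arith Tl0 h rle.
Qed.

Lemma lindeberg i s : (i <= n)%N ->
  `|val i (n - i) (orth s) - val 0 n (orth s)| <= 15 * kap * D + Tl + 4000 * n%:R * Tl.
Proof.
by move=> i_n; apply: le_trans lindeberg_rate; have := hv_r s i_n; rewrite /hv subn0.
Qed.

End Lindeberg.

(** * Gaussian approximation on orthants *)

(** Half of the exponential absorbs the cube, since U^3 <= 48 exp (U / 2); the other half yields the
    factor exp (- Th / 2). *)
Lemma cube_tail_exp (R : realType) (U Th : R) : 1 <= Th -> Th <= U ->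
  (U / Th) ^+ 3 <= 48 * expR (- (Th / 2)) * expR U.
Proof.
move=> T1 TU; have T0 : 0 < Th by apply: lt_le_trans T1.
have U0 : 0 <= U by apply: le_trans TU; exact: ltW.
have h1 : (U / Th) ^+ 3 <= U ^+ 3.
  rewrite lerXn2r ?nnegrE ?divr_ge0 ?(ltW T0)// ler_pdivrMr//.
  by rewrite ler_peMr.
have h2 : U ^+ 3 <= 48 * expR (U / 2).
  have := pow_le_exp 3 (divr_ge0 U0 (ler0n R 2)).
  rewrite exprMn (_ : 3`!%:R = 6 :> R)// => h.
  have -> : U ^+ 3 = 8 * (U ^+ 3 * (2^-1) ^+ 3) by field.
  rewrite (_ : 48 * _ = 8 * (6 * expR (U / 2))); last by ring.
  by rewrite ler_pM2l.
apply: (le_trans h1); apply: (le_trans h2).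
rewrite -mulrA -expRD ler_pM2l// ler_expR; lra.
Qed.

Section ScaledStep.
Context {d : measure_display} {T : measurableType d} {R : realType} (P : probability T R).
Context {J : finType}.
Variables (y : T -> J -> R) (b rt s M3 L : R).
Hypotheses (b0 : 0 < b) (rt0 : 0 < rt) (s0 : 0 < s).
Hypothesis Th1 : 1 <= rt / (s * b).
Hypothesis my : forall j, measurable_fun [set: T] (y^~ j).
Hypothesis y1 : forall j, intg P (y^~ j) /\ Ex P (y^~ j) = 0.
Hypothesis y3 : forall j, intg P (fun t => `|y t j| ^+ 3) /\ Ex P (fun t => `|y t j| ^+ 3) <= M3.
Hypothesis yexp : forall j, intg P (fun t => expR (`|y t j| / s)) /\
  Ex P (fun t => expR (`|y t j| / s)) <= L.

(** After scaling, b |y| / rt = (|y| / s) / Th with Th = rt / (s b). A coordinate enters the tail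
    only when |y| / s >= Th, where its exponential moment gives the decay. *)
Lemma scaled_step_moments :
  step_moments b P (fun t j => rt^-1 * y t j) (M3 / rt ^+ 3)
    (#|J|%:R * (48 * expR (- (rt / (s * b) / 2)) * L)).
Proof.
pose Th := rt / (s * b); have Th1' : 1 <= Th by []; rewrite -/Th.
have my' j : measurable_fun [set: T] (fun t => rt^-1 * y t j) by exact: measurable_funM.
have E3 j t : `|rt^-1 * y t j| ^+ 3 = (rt ^+ 3)^-1 * `|y t j| ^+ 3.
  by rewrite normrM exprMn ger0_norm ?exprVn// invr_ge0 ltW.
pose g j t := 48 * expR (- (Th / 2)) * expR (`|y t j| / s).
have ig j : intg P (g j) by apply: intgZ; exact: (yexp j).1.
have tg j t : tailf b (fun j => rt^-1 * y t j) j <= g j t.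
  rewrite /tailf /g; case: ifPn => [h|_]; last first.
    by rewrite !mulr_ge0 ?expR_ge0 ?ler0n.
  have E : b * `|rt^-1 * y t j| = (`|y t j| / s) / Th.
    rewrite normrM ger0_norm ?invr_ge0 ?(ltW rt0)// /Th; field.
    by rewrite !gt_eqF.
  rewrite E in h *; apply: cube_tail_exp => //.
  by move: h; rewrite ler_pdivlMr ?mul1r// (lt_le_trans ltr01).
have t0 j t : 0 <= tailf b (fun j => rt^-1 * y t j) j.
  by rewrite /tailf; case: ifP => // _; rewrite exprn_ge0// mulr_ge0// ltW.
have mt j : measurable_fun [set: T] (fun t => tailf b (fun j => rt^-1 * y t j) j).
  have mb : measurable_fun [set: T] (fun t => b * `|rt^-1 * y t j|).
    by apply: measurable_funM => //; exact: measurableT_comp.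
  rewrite /tailf; apply: measurable_fun_ifT => //; last exact: measurable_funX.
  exact: measurable_fun_ler.
have it j : intg P (fun t => tailf b (fun j => rt^-1 * y t j) j).
  by apply: (intg_le (mt j) _ (ig j)) => t; rewrite ger0_norm.
split => //.
- by move=> j; rewrite ExZ ?(y1 j).2 ?mulr0//; exact: (y1 j).1.
- move=> j; rewrite (_ : (fun t => _) = (fun t => (rt ^+ 3)^-1 * `|y t j| ^+ 3)).
    by apply: intgZ; exact: (y3 j).1.
  by apply/funext => t; exact: E3.
- move=> j; rewrite (_ : (fun t => _) = (fun t => (rt ^+ 3)^-1 * `|y t j| ^+ 3)).
    rewrite ExZ; last exact: (y3 j).1.
    by rewrite mulrC ler_wpM2r ?(y3 j).2// invr_ge0 exprn_ge0// ltW.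
  by apply/funext => t; exact: E3.
- split; first by apply: intg_sum.
rewrite Ex_sum//; apply: (@le_trans _ _ (\sum_(j : J) 48 * expR (- (Th / 2)) * L)).
  apply: ler_sum => j _; apply: (le_trans (Ex_le (it j) (ig j) (tg j))).
  rewrite ExZ; last exact: (yexp j).1.
  by rewrite ler_wpM2l ?(yexp j).2// mulr_ge0 ?expR_ge0 ?ler0n.
by rewrite sumr_const [leRHS]mulr_natl.
Qed.

End ScaledStep.

Section HybridEnds.
Context {d : measure_display} {T : measurableType d} {R : realType} (P : probability T R).
Context {J : finType} {n : nat}.

Lemma ident_integral {I : Type} {d' : measure_display} {T' : measurableType d'}
    (X : I -> {RV P >-> T'}) (i i1 : I) (f : T' -> \bar R) :
  identically_distributed X ->
  measurable_fun [set: T'] f -> (forall x, (0 <= f x)%E) ->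
  (\int[P]_t f (X i t) = \int[P]_t f (X i1 t))%E.
Proof.
move=> idX mf f0.
rewrite -(ge0_integral_distribution (X i) mf f0) -(ge0_integral_distribution (X i1) mf f0).
by apply: (eq_measure_integral (distribution P (X i1))) => A mA _; exact: idX.
Qed.

Lemma prob_orth (psi : T -> J -> R) (s : R) :
  (forall j, measurable_fun [set: T] (psi^~ j)) ->
  (\int[P]_t (orth s (fun j => 0 + psi t j)%R)%:E = P [set t | (forall j, psi t j <= s)%R])%E.
Proof.
move=> mpsi.
have mO : measurable [set t | forall j, psi t j <= s] by exact: (measurable_orthant (fun=> s) mpsi).
rewrite -[RHS]Ex_indic// -ExE; last first.
  apply: (@intg_bnd _ _ _ _ _ 1); first exact: measurable_indic.
  by move=> t; rewrite indicE; case: (_ \in _); rewrite ?normr1 ?normr0.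
apply: eq_integral => t _; rewrite indicE /orth; congr (_%:R%:E); congr nat_of_bool.
apply/forallP/idP => [h|/set_mem/= h j]; last by rewrite add0r.
by apply/mem_set => j; have := h j; rewrite add0r.
Qed.

(** At this end all summands are data: identical laws replace the reference index [i1] by each index
    in turn, and independence recomposes the sum. *)
Lemma hyb_sample {d' : measure_display} {T' : measurableType d'}
    (X : 'I_n -> {RV P >-> T'}) (i1 : 'I_n) (psi : T' -> J -> R) (psiB : T -> J -> R) (s : R) :
  mutually_independent X -> identically_distributed X ->
  (forall j, measurable_fun [set: T'] (psi^~ j)) ->
  (hyb P (fun t => psi (X i1 t)) psiB n 0 (orth s) =
   P [set t | (forall j, \sum_i psi (X i t) j <= s)%R])%E.
Proof.
move=> indX idX mpsi.
have mX i j : measurable_fun [set: T] (fun t => psi (X i t) j).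
  by apply: (measurableT_comp (mpsi j)); exact: measurable_funPT.
have mS j : measurable_fun [set: T] (fun t => \sum_i psi (X i t) j) by exact: measurable_sum.
have no : nnc (fun w => (orth (J := J) s w)%:E) := (bnd_orth s).1.
rewrite -prob_orth//.
have sumE t j : \sum_i psi (X i t) j = \sum_(i <- enum 'I_n) psi (X i t) j by rewrite big_enum.
under eq_integral do under eq_fun do rewrite sumE.
rewrite (indep_avg indX (psi := fun _ => psi) (fun=> 0) (fun _ => mpsi) no (enum_uniq 'I_n)).
rewrite /hyb /= -[in LHS](size_enum_ord n).
elim: (enum 'I_n) (fun=> 0 : R) => //= i r IH w.
have -> : iter (size r) (avg P (fun t => psi (X i1 t))) (fun w => (orth s w)%:E) =
  foldr (fun i g => avg P (fun t => psi (X i t)) g) (fun w => (orth s w)%:E) r.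
  by apply/funext => v; exact: IH.
have nf : nnc (foldr (fun i g => avg P (fun t => psi (X i t)) g) (fun w => (orth s w)%:E) r).
  by elim: r {IH} => //= k r IH; apply: avg_nnc.
rewrite /avg; symmetry.
apply: (ident_integral i i1 (f := fun x => foldr (fun i g => avg P (fun t => psi (X i t)) g) (fun w => (orth s w)%:E) r (fun j => w j + psi x j)) idX).
  exact: nnc_shift_measurable.
by move=> x; exact: nf.2.
Qed.

Lemma iter_gop {I : finType} (e : I -> {RV P >-> R}) (a : I -> J -> R)
    (rt : R) (f : (J -> R) -> \bar R) k :
  mutually_independent e -> (forall i, standard_normal (e i)) -> 0 < rt -> nnc f ->
  iter k.+1 (gop e a rt^-1) f = gop e a (Num.sqrt (k.+1%:R / rt ^+ 2)) f.
Proof.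
move=> indE stdE rt0 nf; elim: k => [|k IH].
  by rewrite /= div1r -exprVn sqrtr_sqr ger0_norm// invr_ge0 ltW.
rewrite iterS IH; apply/funext => w.
rewrite (gop_merge indE stdE _ _ _ _ nf).
suff -> : rt^-1 ^+ 2 + Num.sqrt (k.+1%:R / rt ^+ 2) ^+ 2 = k.+2%:R / rt ^+ 2 by [].
rewrite sqr_sqrtr; last by rewrite divr_ge0// sqr_ge0.
by rewrite exprVn -[k.+2%:R]natr1 mulrDl mul1r addrC.
Qed.

(** At this end n Gaussian pieces of scale 1 / sqrt n merge into the Gaussian vector. Each piece
    involves all the multipliers, so the pieces are identically distributed. *)
Lemma hyb_gauss (e : 'I_n -> {RV P >-> R}) (a : 'I_n -> J -> R) (psiA : T -> J -> R) (rt s : R) :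
  mutually_independent e -> (forall i, standard_normal (e i)) ->
  0 < rt -> rt ^+ 2 = n%:R ->
  (hyb P psiA (fun t j => rt^-1 * gvec e a t j)%R 0 n (orth s) =
   P [set t | (forall j, gvec e a t j <= s)%R])%E.
Proof.
move=> indE stdE rt0 rt2.
have no : nnc (fun w => (orth (J := J) s w)%:E) := (bnd_orth s).1.
rewrite -(prob_orth (psi := gvec e a))//; last by move=> j; exact: measurable_gvec.
rewrite /hyb /=.
rewrite -[avg P _]/(gop e a rt^-1).
case: n rt2 e a indE stdE => [|m] rt2 e a indE stdE.
  by move/eqP: rt2; rewrite sqrf_eq0 gt_eqF.
rewrite (iter_gop a m indE stdE rt0 no) rt2 divff ?pnatr_eq0// sqrtr1 /gop /avg.
apply: eq_integral => t _; congr (orth _ _)%:E; apply/funext => j.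
by rewrite mul1r.
Qed.

End HybridEnds.

Section CltArith.
Context {R : realFieldType}.
Implicit Types nu q eps kappa L rt : R.

(** The ratio Th of the increment scale to the exponential scale 4 nu^2 is at least 8 q^2, so that
    exp (- Th / 2) <= exp (- 4 q^2). This is one source of the bound 1/64 on [kappa]. *)
Lemma clt_theta nu q eps kappa : 0 < nu -> 1 <= q -> 0 < eps <= 1 -> 0 < kappa <= 64^-1 ->
  8 * q ^+ 2 <= nu ^+ 2 * q ^+ 7 / eps ^+ 3 / (4 * nu ^+ 2 * (2 * q ^+ 2 * (kappa * q / eps))).
Proof.
move=> nu0 q1 /andP[e0 e1] /andP[k0 k1]; have q0 : 0 < q by apply: lt_le_trans q1.
rewrite (_ : _ / (_ * _) = q ^+ 4 / (8 * kappa * eps ^+ 2)); last first.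
  by field; rewrite !gt_eqF.
rewrite ler_pdivlMr; last by rewrite !mulr_gt0.
have k64 : 64 * kappa <= 1 by rewrite -ler_pdivlMl ?mulr1.
have e2 : eps ^+ 2 <= 1 by rewrite exprn_ile1// ltW.
have q2 : 1 <= q ^+ 2 by exact: exprn_ege1.
have h : 64 * kappa * eps ^+ 2 <= q ^+ 2.
  apply: le_trans q2; rewrite -[leRHS]mulr1; apply: ler_pM => //; last exact: sqr_ge0.
  by rewrite mulr_ge0 ?ltW.
rewrite (_ : 8 * q ^+ 2 * _ = q ^+ 2 * (64 * kappa * eps ^+ 2)); last by ring.
rewrite (_ : q ^+ 4 = q ^+ 2 * q ^+ 2); last by ring.
by apply: ler_wpM2l => //; exact: sqr_ge0.
Qed.

(** With n = rt^2 all of nu, q and eps cancel and 1/8 + 1/8 is left. The tolerance 1/4800 on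
    covariances is fixed here, as 300 times 2 over 4800 is 1/8. *)
Lemma clt_small nu q eps kappa L E rt (N : R) : 0 < nu -> 0 < q -> 0 < eps -> 0 < kappa <= 1 ->
  rt = nu ^+ 2 * q ^+ 7 / eps ^+ 3 -> N = rt ^+ 2 ->
  16000 * E * kappa ^+ 3 * L <= 8^-1 ->
  N * (4000 * E * (kappa * q / eps * (2 * q ^+ 2 * (kappa * q / eps)) ^+ 2) * (L * nu ^+ 2 / rt ^+ 3) +
    300 * (kappa * q / eps * (2 * q ^+ 2 * (kappa * q / eps)) * (eps ^+ 2 / (4800 * q ^+ 4) / N))) <= 4^-1.
Proof.
move=> nu0 q0 e0 /andP[k0 k1] -> -> h.
have k2 : kappa ^+ 2 <= 1 by rewrite exprn_ile1// ltW.
rewrite (_ : _ ^+ 2 * (_ + _) = 16000 * E * kappa ^+ 3 * L + 8^-1 * kappa ^+ 2); first by lra.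
by field; rewrite !gt_eqF.
Qed.

Lemma half_le (x y : R) : 8 * x <= y -> - (y / 2) <= - (4 * x).
Proof. lra. Qed.

Lemma clt_total (z t m L eps : R) : t <= m -> m <= 48 * L * eps ->
  z * eps + t + 4000 * m <= (z + 4001 * 48 * L) * eps.
Proof. lra. Qed.

End CltArith.

Lemma norm_mul_le (R : realFieldType) (u v : R) : `|u * v| <= u ^+ 2 + v ^+ 2.
Proof.
rewrite normrM -[u ^+ 2]real_normK ?num_real// -[v ^+ 2]real_normK ?num_real//.
have h3 := sqr_ge0 (`|u| - `|v|); have h := mulr_ge0 (normr_ge0 u) (normr_ge0 v).
by move: h3; rewrite sqrrB; lra.
Qed.

Section Clt.
Context {d : measure_display} {T : measurableType d} {R : realType} (P : probability T R).
Context {J : finType} {n : nat} {d' : measure_display} {T' : measurableType d'}.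
Variables (X : 'I_n -> {RV P >-> T'}) (i1 : 'I_n) (e : 'I_n -> {RV P >-> R}) (j0 : J).
Hypotheses (indX : mutually_independent X) (idX : identically_distributed X).
Hypotheses (indE : mutually_independent e) (stdE : forall i, standard_normal (e i)).

(** Dividing each coordinate by its standard deviation turns a common level into coordinate
    dependent ones, which is why anti-concentration is stated for a vector of thresholds. *)
Lemma gvec_shift (a : 'I_n -> J -> R) (q s0 s x : R) : 0 < s0 -> 0 < q ->
  (forall j, s0 ^+ 2 <= var (a^~ j)) -> ln (2 * #|J|%:R) <= q ^+ 2 -> 0 < x ->
  (P [set t | (forall j, gvec e a t j <= s + x)%R] <=
   P [set t | (forall j, gvec e a t j <= s)%R] + (72 * q * (x / s0))%:E)%E.
Proof.
move=> s00 q0 sv qJ x0.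
pose sg j := Num.sqrt (var (a^~ j)).
have sg0 j : 0 < sg j by rewrite sqrtr_gt0 (lt_le_trans _ (sv j))// exprn_gt0.
have sgs j : s0 <= sg j by rewrite -(ger0_norm (ltW s00)) -sqrtr_sqr ler_wsqrtr.
have sg2 j : sg j ^+ 2 = var (a^~ j) by rewrite sqr_sqrtr// var_ge0.
pose a' i j := a i j / sg j.
have gE t j : gvec e a' t j = gvec e a t j / sg j.
  rewrite /gvec mulr_suml; apply: eq_bigr => i _; rewrite /a'; ring.
have v1 j : var (a'^~ j) = 1.
  rewrite /var /a'; under eq_bigr do rewrite exprMn.
  by rewrite -mulr_suml -/(var _) -sg2 exprVn divff// sqrf_eq0 gt_eqF.
have A := anti_concentration indE stdE j0 v1 q0 qJ (fun j => s / sg j) (divr_gt0 x0 s00).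
have mo (c : R) : measurable [set t | forall j, gvec e a t j <= c].
  by apply: (measurable_orthant (fun=> c)) => j; exact: measurable_gvec.
have mo' (c : J -> R) : measurable [set t | forall j, gvec e a' t j <= c j].
  by apply: measurable_orthant => j; exact: measurable_gvec.
set B := [set t | _ /\ _] in A.
have mB : measurable B.
  apply: measurableI; first exact: (mo' (fun j => s / sg j + x / s0)).
  by apply: measurableC; exact: (mo' (fun j => s / sg j)).
apply: (@le_trans _ _ (P ([set t | (forall j, gvec e a t j <= s)%R] `|` B))).
  apply: le_measure; rewrite ?inE//; first exact: measurableU.
  move=> t h; have [h1|h1] := pselect (forall j, gvec e a t j <= s); [by left|right].
  split=> [j|h2].
    rewrite gE (@le_trans _ _ ((s + x) / sg j))//.
      by apply: ler_wpM2r; rewrite ?invr_ge0 ?(ltW (sg0 j)).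
    rewrite mulrDl lerD2l; apply: ler_wpM2l; first exact: ltW.
    by rewrite lef_pV2 ?posrE.
  apply: h1 => j; have := h2 j; rewrite gE ler_pM2r//.
  by rewrite invr_gt0.
apply: (le_trans (measureU2 P (mo s) mB)).
by apply: leeD.
Qed.

Variables (xi0 : T' -> J -> R) (a : 'I_n -> J -> R).
Hypothesis mxi : forall j, measurable_fun [set: T'] (xi0^~ j).
Variables nu q eps kappa L s0 sY : R.
Hypotheses (nu1 : 1 <= nu) (q1 : 1 <= q) (eps01 : 0 < eps <= 1) (hk : 0 < kappa <= 64^-1).
Hypothesis hn : Num.sqrt n%:R = nu ^+ 2 * q ^+ 7 / eps ^+ 3.
Hypothesis hJ : ln (2 * #|J|%:R) <= 2 * q ^+ 2.
Hypothesis hne : n%:R <= expR (q ^+ 2).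
Hypothesis he : expR (- q ^+ 2) <= eps.
Hypothesis hkL : 16000 * expR 2 * kappa ^+ 3 * L <= 8^-1.
Let y t := xi0 (X i1 t).
Hypothesis y1 : forall j, intg P (y^~ j) /\ Ex P (y^~ j) = 0.
Hypothesis y3 : forall j, intg P (fun t => `|y t j| ^+ 3) /\
  Ex P (fun t => `|y t j| ^+ 3) <= L * nu ^+ 2.
Hypothesis yexp : forall j, intg P (fun t => expR (`|y t j| / (4 * nu ^+ 2))) /\
  Ex P (fun t => expR (`|y t j| / (4 * nu ^+ 2))) <= L.
Hypotheses (s00 : 0 < s0) (sY0 : 0 < sY).
Hypothesis av : forall j, s0 ^+ 2 <= var (a^~ j) <= sY ^+ 2.
Hypotheses (sY3 : 24 * sY ^+ 3 <= L * nu ^+ 2).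
Hypothesis sYexp : 2 * expR ((4 * nu ^+ 2)^-1 ^+ 2 * sY ^+ 2 / 2) <= L.
Hypothesis cov : forall j k, `|Ex P (fun t => y t j * y t k) - \sum_i a i j * a i k| <=
  eps ^+ 2 / (4800 * q ^+ 4).

Lemma clt s :
  `|fine (P [set t | (forall j, \sum_i (Num.sqrt n%:R)^-1 * xi0 (X i t) j <= s)%R]) -
    fine (P [set t | (forall j, gvec e a t j <= s)%R])| <=
  (2160 / (s0 * kappa) + 4001 * 48 * L) * eps.
Proof.
have nu0 : 0 < nu by apply: lt_le_trans nu1.
have q0 : 0 < q by apply: lt_le_trans q1.
have [e0 e1] := andP eps01; have [k0 k1] := andP hk.
have k01 : 0 < kappa <= 1 by rewrite k0 (le_trans k1)//; lra.
pose rt := Num.sqrt n%:R : R.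
have hn' : rt = nu ^+ 2 * q ^+ 7 / eps ^+ 3 := hn; rewrite -/rt.
have rt0 : 0 < rt by rewrite hn' divr_gt0 ?mulr_gt0 ?exprn_gt0.
have rt2 : rt ^+ 2 = n%:R by rewrite sqr_sqrtr.
(* The factor 2 q^2 dominates ln |J|, so the bias of the soft maximum is at most 1 / phi. *)
pose phi := kappa * q / eps; pose b := 2 * q ^+ 2 * phi.
have phi0 : 0 < phi by rewrite divr_gt0 ?mulr_gt0.
have q2 : 1 <= q ^+ 2 by exact: exprn_ege1.
have phib : phi <= b.
  rewrite /b ler_peMl ?(ltW phi0)//; lra.
have b0 : 0 < b by apply: lt_le_trans phib.
have J0 : (0 < #|J|)%N by apply/card_gt0P; exists j0.
have JR : (0 : R) < #|J|%:R by rewrite ltr0n.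
have lnJ : ln #|J|%:R / b <= phi^-1.
  rewrite ler_pdivrMr// /b mulrC mulfK ?gt_eqF//.
  by apply: le_trans hJ; rewrite ler_ln ?posrE ?mulr_gt0// ler_peMl ?ler0n// ler1n.
pose s4 := 4 * nu ^+ 2.
have s40 : 0 < s4 by rewrite mulr_gt0// exprn_gt0.
have Th : 8 * q ^+ 2 <= rt / (s4 * b).
  by rewrite hn'; exact: clt_theta.
have Th1 : 1 <= rt / (s4 * b) by apply: le_trans Th; lra.
have my j : measurable_fun [set: T] (y^~ j).
  by apply: (measurableT_comp (mxi j)); exact: measurable_funPT.
have momA := scaled_step_moments b0 rt0 s40 Th1 my y1 y3 yexp.
have momB : step_moments b P (fun t j => rt^-1 * gvec e a t j) (L * nu ^+ 2 / rt ^+ 3)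
    (#|J|%:R * (48 * expR (- (rt / (s4 * b) / 2)) * L)).
  apply: (scaled_step_moments b0 rt0 s40 Th1) => j.
  - exact: measurable_gvec.
  - by split; [exact: lin_intg|exact: lin_mean].
  - split; first exact: lin_pow_intg.
    by apply: le_trans sY3; apply: lin_abs3 => //; case/andP: (av j).
  - have s4V : 0 <= s4^-1 by rewrite invr_ge0 ltW.
    have [i2 e2] := lin_mgf_abs indE stdE (a^~ j) s4V.
    have E : (fun t => expR (`|gvec e a t j| / s4)) = (fun t => expR (s4^-1 * `|lin e (a^~ j) t|)).
      by apply/funext => t; rewrite mulrC.
    rewrite E; split => //; apply: (le_trans e2); apply: le_trans sYexp.
    rewrite ler_pM2l// ler_expR ler_wpM2r// ler_wpM2l ?sqr_ge0//.
    by case/andP: (av j).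
set Tl := #|J|%:R * _ in momA momB.
have L0 : 0 <= L.
  by apply: le_trans sYexp; rewrite mulr_ge0// expR_ge0.
have n0 : (0 : R) < n%:R by rewrite -rt2 exprn_gt0.
have n1 : 1 <= n%:R :> R by rewrite ler1n -(ltr0n R).
have dl0 : 0 <= eps ^+ 2 / (4800 * q ^+ 4) / n%:R.
  apply: divr_ge0 (ltW n0); apply: divr_ge0; first exact: sqr_ge0.
  by apply: mulr_ge0 (ler0n _ _) _; exact/exprn_ge0/ltW.
have kap0 : 0 <= 72 * (2 * q) / s0 by rewrite ltW ?divr_gt0 ?mulr_gt0.
have y2 j k : intg P (fun t => y t j * y t k).
  have : intg P (fun t => (1 + `|y t j| ^+ 3) + (1 + `|y t k| ^+ 3)).
    by apply: intgD; apply: intgD; [exact: intg_cst|exact: (y3 _).1|exact: intg_cst|exact: (y3 _).1].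
  apply: intg_le; first exact: measurable_funM.
  move=> t; apply: (le_trans (norm_mul_le _ _)).
  have h1 := @abs3_bound R 2 (y t j) isT; have h2 := @abs3_bound R 2 (y t k) isT.
  rewrite !real_normK ?num_real// in h1 h2; exact: lerD.
have covAB j k : `|Ex P (fun t => (rt^-1 * y t j) * (rt^-1 * y t k)) -
    Ex P (fun t => (rt^-1 * gvec e a t j) * (rt^-1 * gvec e a t k))| <=
    eps ^+ 2 / (4800 * q ^+ 4) / n%:R.
  have E (u v : R) : rt^-1 * u * (rt^-1 * v) = n%:R^-1 * (u * v).
    by rewrite -rt2; field; rewrite gt_eqF.
  under [X in Ex P X - _]eq_fun do rewrite E.
  under [X in _ - Ex P X]eq_fun do rewrite E.
  have ig : intg P (fun t => gvec e a t j * gvec e a t k).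
    have := intgD (lin_sqr_intg indE stdE (a^~ j)) (lin_sqr_intg indE stdE (a^~ k)).
    apply: intg_le; first by apply: measurable_funM; exact: measurable_gvec.
    by move=> t; exact: norm_mul_le.
  rewrite ExZ// ExZ// -mulrBr normrM ger0_norm ?invr_ge0 ?(ltW n0)// mulrC.
  rewrite ler_wpM2r ?invr_ge0 ?(ltW n0)//.
  by have := cov j k; rewrite -(lin_cov indE stdE).
have mA j : measurable_fun [set: T] (fun t => rt^-1 * y t j) by exact: measurable_funM.
have mB j : measurable_fun [set: T] (fun t => rt^-1 * gvec e a t j).
  by apply: measurable_funM => //; exact: measurable_gvec.
have valA s' : P [set t | (forall j, \sum_i rt^-1 * xi0 (X i t) j <= s')%R] =
    (hval P (fun t j => rt^-1 * y t j) (fun t j => rt^-1 * gvec e a t j) n 0 (orth s'))%:E.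
  rewrite -(hyb_fin P mA mB _ _ (bnd_orth s')).
  symmetry; apply: (hyb_sample i1 (psi := fun x j => rt^-1 * xi0 x j)) => // j.
  exact: measurable_funM.
have valB s' : P [set t | (forall j, gvec e a t j <= s')%R] =
    (hval P (fun t j => rt^-1 * y t j) (fun t j => rt^-1 * gvec e a t j) 0 n (orth s'))%:E.
  rewrite -(hyb_fin P mA mB _ _ (bnd_orth s')).
  by symmetry; exact: hyb_gauss.
have anti s' x : 0 < x ->
    hval P (fun t j => rt^-1 * y t j) (fun t j => rt^-1 * gvec e a t j) 0 n (orth (s' + x)) <=
    hval P (fun t j => rt^-1 * y t j) (fun t j => rt^-1 * gvec e a t j) 0 n (orth s') +
      72 * (2 * q) / s0 * x.
  move=> x0; rewrite -lee_fin EFinD -!valB.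
  have sv j : s0 ^+ 2 <= var (a^~ j) by case/andP: (av j).
  have qJ : ln (2 * #|J|%:R) <= (2 * q) ^+ 2.
    by apply: (le_trans hJ); rewrite exprMn ler_pM2r ?exprn_gt0// expr2 ler_peMl// ler1n.
  have q20 : 0 < 2 * q by rewrite mulr_gt0.
  by have := @gvec_shift a (2 * q) s0 s' x s00 q20 sv qJ x0; rewrite mulrA mulrAC.
have small : n%:R * (4000 * expR 2 * (phi * b ^+ 2) * (L * nu ^+ 2 / rt ^+ 3) +
    300 * (phi * b * (eps ^+ 2 / (4800 * q ^+ 4) / n%:R))) <= 4^-1.
  by apply: clt_small => //; rewrite rt2.
have main := lindeberg j0 phi0 phib lnJ momA momB dl0 kap0 covAB anti small s (leqnn n).
rewrite subnn in main; rewrite valA valB /=; apply: (le_trans main).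
have JE : #|J|%:R <= expR (2 * q ^+ 2).
  rewrite -ler_ln ?posrE ?expR_gt0// expRK; apply: le_trans hJ.
  by rewrite ler_ln ?posrE ?mulr_gt0// ler_peMl ?ler0n// ler1n.
have Tl0 : 0 <= Tl.
  apply: mulr_ge0 (ler0n _ _) _; apply: mulr_ge0 L0.
  exact: mulr_ge0 (ler0n _ _) (expR_ge0 _).
(* The factors n <= exp (q^2), |J| <= exp (2 q^2) and exp (- 4 q^2) multiply to at most exp (- q^2)
   <= eps. *)
have nTl : n%:R * Tl <= 48 * L * eps.
  rewrite (_ : n%:R * Tl = 48 * L * (n%:R * (#|J|%:R * expR (- (rt / (s4 * b) / 2))))); last first.
    by rewrite /Tl; ring.
  apply: ler_wpM2l; first exact: mulr_ge0 (ler0n _ _) L0.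
  apply: le_trans he.
  apply: (@le_trans _ _ (expR (q ^+ 2) * (expR (2 * q ^+ 2) * expR (- (4 * q ^+ 2))))).
    apply: ler_pM => //; apply: ler_pM => //.
    by rewrite ler_expR half_le.
  by rewrite -!expRD (_ : _ + _ = - q ^+ 2)//; ring.
(* The q of the anti-concentration constant cancels against phi, leaving a multiple of eps; 2160 =
   15 times 72 times 2. *)
have -> : 15 * (72 * (2 * q) / s0) * phi^-1 = 2160 / (s0 * kappa) * eps.
  by rewrite /phi; field; rewrite !gt_eqF.
have Tn : Tl <= n%:R * Tl by rewrite ler_peMl.
rewrite -[4000 * _ * _]mulrA; exact: clt_total Tn nTl.
Qed.

End Clt.

(** * Concentration *)

Section UnionBound.
Context {d : measure_display} {T : measurableType d} {R : realType} (P : probability T R).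

Lemma indic_bnd (A : set T) (t : T) : `|\1_A t : R| <= 1.
Proof. by rewrite indicE; case: (_ \in _); rewrite ?normr1 ?normr0. Qed.

Lemma indic_intg (A : set T) : measurable A -> intg P (\1_A : T -> R).
Proof.
move=> mA; apply: (@intg_bnd _ _ _ _ _ 1); first exact: measurable_indic.
exact: indic_bnd.
Qed.

Lemma measurable_above (f : T -> R) (a : R) : measurable_fun [set: T] f ->
  measurable [set t | a < f t].
Proof.
move=> mf; have := mf measurableT _ (measurable_itv `]a, +oo[).
by rewrite setTI; congr measurable; apply/seteqP; split=> t /=; rewrite in_itv/= andbT.
Qed.

Lemma markov_le (A : set T) (g : T -> R) (k : R) : measurable A -> intg P g ->
  (forall t, 0 <= g t) -> (forall t, A t -> 1 <= g t) -> Ex P g <= k -> (P A <= k%:E)%E.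
Proof.
move=> mA ig g0 gA Ek; rewrite -Ex_indic// lee_fin; apply: le_trans Ek.
apply: Ex_le => //; first exact: indic_intg.
by move=> t; rewrite indicE; have [/set_mem h|_] := boolP (t \in A); [exact: gA|exact: g0].
Qed.

Lemma union_bound (I : finType) (A : I -> set T) (k : R) :
  (forall i, measurable (A i)) -> (forall i, P (A i) <= k%:E)%E ->
  measurable [set t | exists i, A i t] /\
  (P [set t | exists i, A i t] <= (#|I|%:R * k)%:E)%E.
Proof.
move=> mA Ak.
have E : [set t | exists i, A i t] = \bigcup_(i in [set: I]) A i.
  by apply/seteqP; split=> t [i]; [exists i|exists i].
have mU : measurable [set t | exists i, A i t].
  by rewrite E; apply: fin_bigcup_measurable => //.
split=> //.
have isum : intg P (fun t => \sum_i \1_(A i) t) by apply: intg_sum => i; exact: indic_intg.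
apply: (markov_le mU isum).
- by move=> t; apply: sumr_ge0 => i _; rewrite indicE.
- move=> t [i Ai]; rewrite (bigD1 i)//= indicE mem_set// lerDl.
  by apply: sumr_ge0 => k' _; rewrite indicE.
rewrite Ex_sum; last by move=> i; exact: indic_intg.
rewrite mulr_natl -sumr_const; apply: ler_sum => i _.
by rewrite -lee_fin Ex_indic.
Qed.

End UnionBound.

Section Concentration.
Context {d : measure_display} {T : measurableType d} {R : realType} (P : probability T R).
Context {n : nat} {d' : measure_display} {T' : measurableType d'}.
Variables (X : 'I_n -> {RV P >-> T'}) (i1 : 'I_n).
Hypotheses (indX : mutually_independent X) (idX : identically_distributed X).

Let mX (g : T' -> R) i : measurable_fun [set: T'] g -> measurable_fun [set: T] (fun t => g (X i t)).
Proof. by move=> mg; apply: (measurableT_comp mg); exact: measurable_funPT. Qed.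

(** Each averaging operator multiplies the exponential by at most m; identical laws reduce every
    factor to the index [i1]. *)
Lemma exp_sum_le (g : T' -> R) (m : R) : measurable_fun [set: T'] g -> 0 <= m ->
  intg P (fun t => expR (g (X i1 t))) -> Ex P (fun t => expR (g (X i1 t))) <= m ->
  intg P (fun t => expR (\sum_i g (X i t))) /\
  Ex P (fun t => expR (\sum_i g (X i t))) <= m ^+ n.
Proof.
move=> mg m0 ig Eg.
pose F (w : unit -> R) : \bar R := (expR (w tt))%:E.
have nF : nnc F.
  split=> [d1 T1 psi mpsi|w]; last by rewrite lee_fin expR_ge0.
  by apply/measurable_EFinP; apply: (measurableT_comp (@measurable_expR R)).
have mpsi (i : 'I_n) (j : unit) : measurable_fun [set: T'] (fun x : T' => g x) by [].
have H := indep_avg indX (psi := fun _ x _ => g x) (fun=> 0) mpsi nF (enum_uniq 'I_n).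
have K (s : seq 'I_n) w :
    (foldr (fun i h => avg P (fun t _ => g (X i t)) h) F s w <= (m ^+ size s * expR (w tt))%:E)%E.
  elim: s w => [|i s IH] w; first by rewrite /= expr0 mul1r.
  have nf r : nnc (foldr (fun i h => avg P (fun t _ => g (X i t)) h) F r).
    by elim: r => //= k r IHr; apply: avg_nnc => // _; exact: mX.
  have nG : nnc (fun w : unit -> R => (m ^+ size s * expR (w tt))%:E).
    have := nncZ (exprn_ge0 (size s) m0) nF.
    by [].
  apply: (@le_trans _ _ (avg P (fun t _ => g (X i t)) (fun w : unit -> R => (m ^+ size s * expR (w tt))%:E) w)).
    by apply: avg_le => // _; exact: mX.
  rewrite /avg.
  have -> : (\int[P]_t (m ^+ size s * expR (w tt + g (X i t))%R)%:E =
      \int[P]_t (m ^+ size s * expR (w tt + g (X i1 t))%R)%:E)%E.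
    apply: (ident_integral i i1 (f := fun x => (m ^+ size s * expR (w tt + g x))%:E) idX).
      apply/measurable_EFinP; apply: measurable_funM => //.
      by apply: (measurableT_comp (@measurable_expR R)); exact: measurable_funD.
    by move=> x; rewrite lee_fin mulr_ge0 ?exprn_ge0 ?expR_ge0.
  have E t : m ^+ size s * expR (w tt + g (X i1 t)) =
      (m ^+ size s * expR (w tt)) * expR (g (X i1 t)) by rewrite expRD mulrA.
  under eq_integral do rewrite E.
  have := intgZ (m ^+ size s * expR (w tt)) ig.
  move=> /ExE -> ; rewrite lee_fin ExZ//.
  rewrite /= (_ : m ^+ (size s).+1 * _ = m ^+ size s * expR (w tt) * m); last by rewrite exprS; ring.
  by rewrite ler_wpM2l// mulr_ge0 ?exprn_ge0 ?expR_ge0.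
have mS : measurable_fun [set: T] (fun t => expR (\sum_i g (X i t))).
  apply: (measurableT_comp (@measurable_expR R)).
  by apply: measurable_sum => i; exact: mX.
apply: ge0_intg => //.
have E t : \sum_i g (X i t) = 0 + \sum_(i <- enum 'I_n) g (X i t) by rewrite add0r big_enum.
under eq_integral do rewrite E.
rewrite [leLHS]H; apply: (le_trans (K _ _)).
by rewrite expR0 mulr1 size_enum_ord.
Qed.

Section Truncated.
Variables (f : T' -> R) (b mf v : R).
Hypotheses (mf_ : measurable_fun [set: T'] f) (b0 : 0 < b).
Hypothesis if1 : intg P (fun t => f (X i1 t)) /\ Ex P (fun t => f (X i1 t)) <= mf.
Hypothesis if2 : intg P (fun t => f (X i1 t) ^+ 2) /\ Ex P (fun t => f (X i1 t) ^+ 2) <= v.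

(* One-sided truncation: min(f, b) <= f in the linear term and
   min(f, b)^2 <= f^2 in the quadratic one, so no bias appears. *)
Lemma exp_trunc_sum :
  intg P (fun t => expR (\sum_i Num.min (f (X i t)) b / b)) /\
  Ex P (fun t => expR (\sum_i Num.min (f (X i t)) b / b)) <=
    expR (n%:R * (mf / b + v / b ^+ 2)).
Proof.
pose g x := Num.min (f x) b / b.
have mg : measurable_fun [set: T'] g.
  by apply: measurable_funM => //; exact: measurable_minr.
have ge x : expR (g x) <= 1 + b^-1 * f x + (b ^+ 2)^-1 * f x ^+ 2.
  have g1 : g x <= 1 by rewrite /g ler_pdivrMr// mul1r ge_min lexx orbT.
  apply: (le_trans (expR_le_quad g1)); apply: lerD.
    by rewrite lerD2l /g mulrC ler_wpM2l ?invr_ge0 ?(ltW b0)// ge_min lexx.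
  rewrite -exprVn -exprMn.
  have [h|h] := leP (f x) b; first by rewrite /g (min_idPl h) mulrC.
  rewrite /g (min_idPr (ltW h)) divff ?gt_eqF// expr1n.
  by apply: exprn_ege1; rewrite mulrC ler_pdivlMr// mul1r ltW.
have ib : intg P (fun t => 1 + b^-1 * f (X i1 t) + (b ^+ 2)^-1 * f (X i1 t) ^+ 2).
  by apply: intgD; [apply: intgD; [exact: intg_cst|exact/intgZ/if1.1]|exact/intgZ/if2.1].
have ig : intg P (fun t => expR (g (X i1 t))).
  apply: (intg_le _ _ ib) => [|t]; last by rewrite ger0_norm ?expR_ge0.
  by apply: (measurableT_comp (@measurable_expR R)); exact: mX.
have Eg : Ex P (fun t => expR (g (X i1 t))) <= expR (mf / b + v / b ^+ 2).
  apply: (le_trans (Ex_le ig ib (fun t => ge (X i1 t)))).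
  rewrite !ExD ?ExZ ?Ex_cst//; [|exact: if2.1|exact: if1.1|exact: intg_cst|exact/intgZ/if1.1
   |by apply: intgD; [exact: intg_cst|exact/intgZ/if1.1]|exact/intgZ/if2.1].
  apply: le_trans (expR_ge1Dx _); rewrite -addrA lerD2l.
  apply: lerD; rewrite mulrC ler_wpM2r ?invr_ge0 ?exprn_ge0 ?(ltW b0)//.
    exact: if1.2.
  exact: if2.2.
have [h1 h2] := exp_sum_le mg (expR_ge0 _) ig Eg.
split => //; apply: (le_trans h2).
by rewrite -expRM_natl.
Qed.

(** Chernoff's bound at the parameter 1 / b. On the event the truncation at b is inactive, and v / b
    <= tau / 2 makes the variance term cost at most half of tau. *)
Lemma conc_upper (tau : R) : v / b <= tau / 2 ->
  measurable [set t | mf + tau < n%:R^-1 * \sum_i f (X i t) /\ forall i, f (X i t) <= b] /\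
  (P [set t | (mf + tau < n%:R^-1 * \sum_i f (X i t))%R /\ (forall i, f (X i t) <= b)%R] <=
    (expR (- (n%:R * tau / (2 * b))))%:E)%E.
Proof.
move=> vb; set A := [set t | _].
have n0 : 0 < n%:R :> R by rewrite ltr0n (leq_ltn_trans (leq0n i1)).
have mS : measurable_fun [set: T] (fun t => n%:R^-1 * \sum_i f (X i t)).
  by apply: measurable_funM => //; apply: measurable_sum => i; exact: mX.
have mA : measurable A.
  apply: measurableI.
    exact: measurable_above.
  by apply: (measurable_orthant (fun=> b) (psi := fun t i => f (X i t))) => i; exact: mX.
have [iS ES] := exp_trunc_sum.
split=> //.
pose k := expR (- (n%:R * (mf + tau) / b)).
apply: (markov_le mA (intgZ k iS)).
- by move=> t; rewrite mulr_ge0 ?expR_ge0.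
- move=> t [h1 h2]; rewrite /k -expRD -[leLHS]expR0 ler_expR.
  rewrite (eq_bigr (fun i => f (X i t) / b)); last by move=> i _; rewrite (min_idPl (h2 i)).
  rewrite -mulr_suml addrC subr_ge0 ler_pM2r ?invr_gt0//.
  rewrite -ler_pdivlMl//; exact: ltW.
rewrite ExZ//; apply: (@le_trans _ _ (k * expR (n%:R * (mf / b + v / b ^+ 2)))).
  by rewrite ler_wpM2l ?expR_ge0.
rewrite /k -expRD ler_expR.
rewrite (_ : - _ + _ = n%:R / b * (v / b - tau)); last by field; rewrite gt_eqF.
rewrite [leRHS](_ : _ = n%:R / b * (tau / 2 - tau)); last by field; rewrite gt_eqF.
by rewrite ler_wpM2l ?divr_ge0 ?(ltW n0) ?(ltW b0)// lerD2r.
Qed.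

End Truncated.

Lemma conc (f : T' -> R) (b v tau : R) : measurable_fun [set: T'] f -> 0 < b ->
  intg P (fun t => f (X i1 t)) ->
  intg P (fun t => f (X i1 t) ^+ 2) -> Ex P (fun t => f (X i1 t) ^+ 2) <= v ->
  v / b <= tau / 2 ->
  let bad := [set t | tau < `|n%:R^-1 * \sum_i f (X i t) - Ex P (fun t => f (X i1 t))| /\
                      forall i, `|f (X i t)| <= b] in
  measurable bad /\ (P bad <= (2 * expR (- (n%:R * tau / (2 * b))))%:E)%E.
Proof.
move=> mf b0 if1 if2 Ef2 vb bad.
set m := Ex P _ in bad *.
have [mA hA] := conc_upper mf b0 (conj if1 (lexx m)) (conj if2 Ef2) vb.
have mfN : measurable_fun [set: T'] (fun x => - f x) by exact: measurableT_comp.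
have if1N : intg P (fun t => - f (X i1 t)) by exact: intgN.
have EN : Ex P (fun t => - f (X i1 t)) <= - m by rewrite ExN.
have if2N : intg P (fun t => (- f (X i1 t)) ^+ 2) /\ Ex P (fun t => (- f (X i1 t)) ^+ 2) <= v.
  by under [X in intg _ X]eq_fun do rewrite sqrrN; under [X in Ex _ X]eq_fun do rewrite sqrrN.
have [mB hB] := conc_upper mfN b0 (conj if1N EN) if2N vb.
set A := [set t | _] in mA hA; set B := [set t | _] in mB hB.
have mbad : measurable bad.
  apply: measurableI.
    have mS : measurable_fun [set: T] (fun t => `|n%:R^-1 * \sum_i f (X i t) - m|).
      apply: measurableT_comp => //; apply: measurable_funB => //.
      by apply: measurable_funM => //; apply: measurable_sum => i; exact: mX.
    exact: measurable_above.
  apply: (measurable_orthant (fun=> b) (psi := fun t i => `|f (X i t)|)) => i.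
  by apply: measurableT_comp => //; exact: mX.
split=> //; apply: (@le_trans _ _ (P (A `|` B))).
  apply: le_measure; rewrite ?inE//; first exact: measurableU.
  move=> t [h1 h2]; have h3 i := ler_normlP _ _ (h2 i).
  have [h|h] := ltP (m + tau) (n%:R^-1 * \sum_i f (X i t)).
    by left; split=> // i; case: (h3 i).
  right; split=> [|i]; last by case: (h3 i).
  rewrite sumrN mulrN; move: h1; rewrite ltNge ler_norml negb_and -!ltNge => /orP[|]; lra.
apply: (le_trans (measureU2 P mA mB)).
rewrite mulr_natl mulr2n EFinD; exact: leeD.
Qed.

End Concentration.

(** * Moments of the products of coordinates *)

Section MomArith.
Context {R : realFieldType}.
Implicit Types x y u v mu : R.

Lemma expr4_ge0 x : 0 <= x ^+ 4.
Proof. by rewrite -[4%N]/(2 * 2)%N exprM sqr_ge0. Qed.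

Lemma expr6_ge0 x : 0 <= x ^+ 6.
Proof. by rewrite -[6%N]/(2 * 3)%N exprM exprn_ge0// sqr_ge0. Qed.

Lemma prod2_le x y : `|x * y| <= (x ^+ 2 + y ^+ 2) / 2.
Proof.
rewrite normrM -[x ^+ 2]real_normK ?num_real// -[y ^+ 2]real_normK ?num_real//.
by have := sqr_ge0 (`|x| - `|y|); lra.
Qed.

Lemma prod4_le x y u v : `|x * y * u * v| <= (x ^+ 4 + y ^+ 4 + u ^+ 4 + v ^+ 4) / 4.
Proof.
rewrite -mulrA normrM.
have h1 := prod2_le x y; have h2 := prod2_le u v.
have h3 : `|x * y| * `|u * v| <= (x ^+ 2 + y ^+ 2) / 2 * ((u ^+ 2 + v ^+ 2) / 2) by exact: ler_pM.
apply: (le_trans h3).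
have := sqr_ge0 (x ^+ 2 - y ^+ 2); have := sqr_ge0 (u ^+ 2 - v ^+ 2).
have := sqr_ge0 (x ^+ 2 + y ^+ 2 - u ^+ 2 - v ^+ 2).
lra.
Qed.

(** Pointwise interpolation, split at |x| = mu. Together with the sixth moment it gives the orders
    mu^2 and mu^4 of the lower moments. *)
Lemma pow2_interp x mu : 0 < mu -> x ^+ 2 <= mu ^+ 2 + x ^+ 6 / mu ^+ 4.
Proof.
move=> mu0; have [h|h] := leP `|x| mu.
  have : x ^+ 2 <= mu ^+ 2 by rewrite -real_normK ?num_real// lerXn2r ?nnegrE ?(ltW mu0).
  by move=> /le_trans; apply; rewrite lerDl; apply: divr_ge0; [exact: expr6_ge0|exact/exprn_ge0/ltW].
rewrite (@le_trans _ _ (x ^+ 6 / mu ^+ 4))//; last by rewrite lerDr exprn_ge0// ltW.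
rewrite ler_pdivlMr ?exprn_gt0// (_ : x ^+ 6 = x ^+ 2 * x ^+ 4); last by rewrite -exprD.
rewrite ler_wpM2l ?sqr_ge0// -[x ^+ 4]ger0_norm ?expr4_ge0// normrX.
by rewrite lerXn2r ?nnegrE ?(ltW mu0) ?(ltW h).
Qed.

Lemma pow4_interp x mu : 0 < mu -> x ^+ 4 <= mu ^+ 4 + x ^+ 6 / mu ^+ 2.
Proof.
move=> mu0; have [h|h] := leP `|x| mu.
  have : x ^+ 4 <= mu ^+ 4.
    by rewrite -[x ^+ 4]ger0_norm ?expr4_ge0// normrX lerXn2r ?nnegrE ?(ltW mu0).
  by move=> /le_trans; apply; rewrite lerDl; apply: divr_ge0; [exact: expr6_ge0|exact/exprn_ge0/ltW].
rewrite (@le_trans _ _ (x ^+ 6 / mu ^+ 2))//; last by rewrite lerDr exprn_ge0// ltW.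
rewrite ler_pdivlMr ?exprn_gt0// (_ : x ^+ 6 = x ^+ 4 * x ^+ 2); last by rewrite -exprD.
rewrite ler_wpM2l ?expr4_ge0// -[x ^+ 2]real_normK ?num_real//.
by rewrite lerXn2r ?nnegrE ?(ltW mu0) ?(ltW h).
Qed.

Lemma cube_add_le x y : `|x - y| ^+ 3 <= 4 * (`|x| ^+ 3 + `|y| ^+ 3).
Proof.
have h : `|x - y| ^+ 3 <= (`|x| + `|y|) ^+ 3 by rewrite lerXn2r ?nnegrE ?addr_ge0// ler_normB.
apply: (le_trans h).
have : 0 <= 3 * ((`|x| + `|y|) * (`|x| - `|y|) ^+ 2).
  by apply: mulr_ge0 => //; apply: mulr_ge0; [exact: addr_ge0|exact: sqr_ge0].
rewrite (_ : 3 * _ = 4 * (`|x| ^+ 3 + `|y| ^+ 3) - (`|x| + `|y|) ^+ 3); last by ring.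
by rewrite subr_ge0.
Qed.

End MomArith.

Section CoordinateMoments.
Context {d : measure_display} {T : measurableType d} {R : realType} (P : probability T R).
Context {p : nat}.
Variable Y : {RV P >-> p.-tuple R}.
Local Notation x := (rvcoord Y).

Lemma measurable_rvcoord k : measurable_fun [set: T] (x k).
Proof. by apply: (measurableT_comp (measurable_tnth k)); exact: measurable_funPT. Qed.

Lemma xi_moment (q : nat) (c : R) k : (0 < q)%N -> (xi Y q <= c%:E)%E ->
  intg P (fun t => `|x k t| ^+ q) /\ Ex P (fun t => `|x k t| ^+ q) <= c ^+ q.
Proof.
move=> q0 h.
have q0' : q%:R != 0 :> R by rewrite pnatr_eq0 -lt0n.
have hN : ('N[P]_(q%:R%:E)[EFin \o x k] <= c%:E)%E.
  apply: le_trans h; rewrite /xi.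
  exact: (le_bigmax 0%E (fun k => 'N[P]_(q%:R%:E)[EFin \o x k])%E k).
have N0 : (0 <= 'N[P]_(q%:R%:E)[EFin \o x k])%E by exact: Lnorm_ge0.
have c0 : 0 <= c by rewrite -lee_fin (le_trans N0).
apply: ge0_intg.
- apply: measurable_funX; apply: measurableT_comp => //; exact: measurable_rvcoord.
- by move=> t; rewrite exprn_ge0.
have E := poweR_Lnorm P (EFin \o x k) q0'.
rewrite (_ : (\int[P]_t (`|x k t| ^+ q)%:E = \int[P]_t (`|(EFin \o x k) t| `^ q%:R))%E); last first.
  by apply: eq_integral => t _; rewrite /= powR_mulrn.
rewrite -E -powR_mulrn// -poweR_EFin; apply: gt0_ler_poweR => //.
  by rewrite in_itv/= N0 leey.
by rewrite in_itv/= lee_fin c0 leey.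
Qed.

End CoordinateMoments.

Section Moments.
Context {d : measure_display} {T : measurableType d} {R : realType} (P : probability T R).
Context {p : nat}.
Variable Y : {RV P >-> p.-tuple R}.
Local Notation x := (rvcoord Y).
Variables (nu mu K6 K8 C C1 : R).
Hypotheses (mu1 : 1 <= mu) (nuE : nu = mu ^+ 3).
Hypothesis hmean : forall k, mean_zero P (x k).
Hypothesis hsub : forall k, subgaussian P (nu ^+ 2) (x k).
Hypothesis h6 : forall k, intg P (fun t => `|x k t| ^+ 6) /\ Ex P (fun t => `|x k t| ^+ 6) <= K6 * mu ^+ 6.
Hypothesis h8 : forall k, intg P (fun t => `|x k t| ^+ 8) /\ Ex P (fun t => `|x k t| ^+ 8) <= K8 * nu ^+ 4.
Hypotheses (C6 : 1 + K6 <= C) (C8 : K8 <= C) (C1le : 1 <= C).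
Hypothesis hGamma : forall j k, (C1%:E <= Gamma Y (j, k) (j, k))%E.

Let mu0 : 0 < mu. Proof. exact: lt_le_trans mu1. Qed.
Let C0 : 0 <= C. Proof. exact: le_trans C1le. Qed.
Let mx k : measurable_fun [set: T] (x k). Proof. exact: measurable_rvcoord. Qed.

Let x6E k t : `|x k t| ^+ 6 = x k t ^+ 6.
Proof. by rewrite -normrX ger0_norm// expr6_ge0. Qed.

Lemma mom2 k : intg P (fun t => x k t ^+ 2) /\ Ex P (fun t => x k t ^+ 2) <= C * mu ^+ 2.
Proof.
have [i6 e6] := h6 k.
have ig : intg P (fun t => mu ^+ 2 + (mu ^+ 4)^-1 * `|x k t| ^+ 6).
  by apply: intgD; [exact: intg_cst|exact: intgZ].
have le t : x k t ^+ 2 <= mu ^+ 2 + (mu ^+ 4)^-1 * `|x k t| ^+ 6.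
  by rewrite x6E mulrC; exact: pow2_interp.
have i2 : intg P (fun t => x k t ^+ 2).
  by apply: (intg_le _ _ ig) => [|t]; [exact: measurable_funX|rewrite ger0_norm ?sqr_ge0].
split => //; apply: (le_trans (Ex_le i2 ig le)).
rewrite ExD; [rewrite Ex_cst ExZ//|exact: intg_cst|exact: intgZ].
apply: (@le_trans _ _ ((1 + K6) * mu ^+ 2)); last by rewrite ler_wpM2r ?sqr_ge0.
rewrite mulrDl mul1r lerD2l ler_pdivrMl ?exprn_gt0//.
by rewrite mulrCA -exprD.
Qed.

Lemma mom4 k : intg P (fun t => x k t ^+ 4) /\ Ex P (fun t => x k t ^+ 4) <= C * mu ^+ 4.
Proof.
have [i6 e6] := h6 k.
have ig : intg P (fun t => mu ^+ 4 + (mu ^+ 2)^-1 * `|x k t| ^+ 6).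
  by apply: intgD; [exact: intg_cst|exact: intgZ].
have le t : x k t ^+ 4 <= mu ^+ 4 + (mu ^+ 2)^-1 * `|x k t| ^+ 6.
  by rewrite x6E mulrC; exact: pow4_interp.
have i2 : intg P (fun t => x k t ^+ 4).
  by apply: (intg_le _ _ ig) => [|t]; [exact: measurable_funX|rewrite ger0_norm ?expr4_ge0].
split => //; apply: (le_trans (Ex_le i2 ig le)).
rewrite ExD; [rewrite Ex_cst ExZ//|exact: intg_cst|exact: intgZ].
apply: (@le_trans _ _ ((1 + K6) * mu ^+ 4)); last by rewrite ler_wpM2r ?expr4_ge0.
rewrite mulrDl mul1r lerD2l ler_pdivrMl ?exprn_gt0//.
by rewrite mulrCA -exprD.
Qed.

Lemma mom1 k : intg P (x k) /\ Ex P (x k) = 0.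
Proof.
split; last by have := hmean k; rewrite /mean_zero unlock /Ex => ->.
apply: (intg_le (mx k) _ (intgD (intg_cst P 1) (mom2 k).1)) => t.
rewrite -[x k t ^+ 2]real_normK ?num_real//.
have := sqr_ge0 (`|x k t| - 1); have := normr_ge0 (x k t); lra.
Qed.

Definition pop2 (j k : 'I_p) : R := Ex P (fun t => x j t * x k t).
Definition pop4 (a b c e : 'I_p) : R := Ex P (fun t => x a t * x b t * x c t * x e t).

Lemma intg2 j k : intg P (fun t => x j t * x k t).
Proof.
have ig := intgZ 2^-1 (intgD (mom2 j).1 (mom2 k).1).
apply: (intg_le _ _ ig) => [|t]; first exact: measurable_funM.
by rewrite [leRHS]mulrC; exact: prod2_le.
Qed.

Lemma pop2_le j k : `|pop2 j k| <= C * mu ^+ 2.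
Proof.
have ig := intgZ 2^-1 (intgD (mom2 j).1 (mom2 k).1).
apply: (le_trans (Ex_norm (intg2 j k))).
have le t : `|x j t * x k t| <= 2^-1 * (x j t ^+ 2 + x k t ^+ 2).
  by rewrite [leRHS]mulrC; exact: prod2_le.
apply: (le_trans (Ex_le (intg_abs (intg2 j k)) ig le)).
rewrite ExZ ?ExD//; [|exact: (mom2 j).1|exact: (mom2 k).1|exact: intgD (mom2 j).1 (mom2 k).1].
have := (mom2 j).2; have := (mom2 k).2; lra.
Qed.

Let ig4 a b c e : intg P (fun t => 4^-1 * (x a t ^+ 4 + x b t ^+ 4 + x c t ^+ 4 + x e t ^+ 4)).
Proof.
by apply: intgZ; apply: intgD; [apply: intgD; [apply: intgD|]|]; exact: (mom4 _).1.
Qed.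

Lemma intg4 a b c e : intg P (fun t => x a t * x b t * x c t * x e t).
Proof.
apply: (intg_le _ _ (ig4 a b c e)) => [|t].
  by do 3! apply: measurable_funM => //.
by rewrite [leRHS]mulrC; exact: prod4_le.
Qed.

Lemma pop4_le a b c e : `|pop4 a b c e| <= C * mu ^+ 4.
Proof.
apply: (le_trans (Ex_norm (intg4 a b c e))).
have le t : `|x a t * x b t * x c t * x e t| <=
    4^-1 * (x a t ^+ 4 + x b t ^+ 4 + x c t ^+ 4 + x e t ^+ 4).
  by rewrite [leRHS]mulrC; exact: prod4_le.
apply: (le_trans (Ex_le (intg_abs (intg4 a b c e)) (ig4 a b c e) le)).
have i3 : intg P (fun t => x a t ^+ 4 + x b t ^+ 4) by exact: intgD (mom4 a).1 (mom4 b).1.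
have i4 : intg P (fun t => x a t ^+ 4 + x b t ^+ 4 + x c t ^+ 4) by exact: intgD i3 (mom4 c).1.
have i5 : intg P (fun t => x a t ^+ 4 + x b t ^+ 4 + x c t ^+ 4 + x e t ^+ 4).
  exact: intgD i4 (mom4 e).1.
rewrite ExZ// ExD//; last exact: (mom4 e).1.
rewrite ExD//; last exact: (mom4 c).1.
rewrite ExD//; [|exact: (mom4 a).1|exact: (mom4 b).1].
have := (mom4 a).2; have := (mom4 b).2; have := (mom4 c).2; have := (mom4 e).2; lra.
Qed.

Lemma cov_mxE j k : cov_mx Y j k = pop2 j k.
Proof.
rewrite /cov_mx mxE covariance.unlock.
have E i : fine 'E_P[x i] = 0 by rewrite expectation.unlock -/(Ex P (x i)) (mom1 i).2.
rewrite !E expectation.unlock /pop2 /Ex; congr fine; apply: eq_integral => t _.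
by rewrite fctE /= !subr0.
Qed.

(** Evaluated at an arbitrary point u, with the centring taken from the law of Y; the sign bit makes
    maxima of absolute values into maxima of coordinates. *)
Definition xivec (u : p.-tuple R) (j : 'I_p * 'I_p * bool) : R :=
  (-1) ^+ j.2 * (tnth u j.1.1 * tnth u j.1.2 - pop2 j.1.1 j.1.2).

Lemma measurable_xivec j : measurable_fun [set: p.-tuple R] (xivec^~ j).
Proof.
apply: measurable_funM => //; apply: measurable_funB => //.
by apply: measurable_funM; exact: measurable_tnth.
Qed.

Lemma xivec_mean j : intg P (fun t => xivec (Y t) j) /\ Ex P (fun t => xivec (Y t) j) = 0.
Proof.
have i2 := intg2 j.1.1 j.1.2.
have ib : intg P (fun t => x j.1.1 t * x j.1.2 t - pop2 j.1.1 j.1.2).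
  by apply: intgB => //; exact: intg_cst.
split; first exact: intgZ.
by rewrite ExZ// ExB ?Ex_cst ?subrr ?mulr0//; exact: intg_cst.
Qed.

Lemma xivec_cov j k : Ex P (fun t => xivec (Y t) j * xivec (Y t) k) =
  (-1) ^+ j.2 * (-1) ^+ k.2 *
    (pop4 j.1.1 j.1.2 k.1.1 k.1.2 - pop2 j.1.1 j.1.2 * pop2 k.1.1 k.1.2).
Proof.
case: j k => [[a b] s] [[c e] s']; rewrite /xivec /=.
have E t : (-1) ^+ s * (x a t * x b t - pop2 a b) * ((-1) ^+ s' * (x c t * x e t - pop2 c e)) =
  (-1) ^+ s * (-1) ^+ s' * (x a t * x b t * x c t * x e t
    - pop2 c e * (x a t * x b t) - pop2 a b * (x c t * x e t) + pop2 a b * pop2 c e) by ring.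
rewrite (_ : (fun t => _) = fun t => (-1) ^+ s * (-1) ^+ s' * (x a t * x b t * x c t * x e t
    - pop2 c e * (x a t * x b t) - pop2 a b * (x c t * x e t) + pop2 a b * pop2 c e)); last first.
  by apply/funext => t; exact: E.
have j1 := intg4 a b c e; have j2 := intgZ (pop2 c e) (intg2 a b).
have j3 := intgZ (pop2 a b) (intg2 c e); have j4 := intg_cst P (pop2 a b * pop2 c e).
have j12 := intgB j1 j2; have j123 := intgB j12 j3; have j1234 := intgD j123 j4.
rewrite ExZ// ExD// ExB// ExB// Ex_cst !ExZ; [|exact: intg2|exact: intg2].
rewrite -/(pop4 a b c e) -/(pop2 a b) -/(pop2 c e).
by congr (_ * _); ring.
Qed.

(** The kernel projection is half of the centred product, hence the factor 4. *)
Lemma xivec_var a b : 4 * C1 <= pop4 a b a b - pop2 a b * pop2 a b.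
Proof.
have := hGamma a b; rewrite /Gamma covariance.unlock.
have i2 := intg2 a b.
have ib : intg P (fun t => x a t * x b t - pop2 a b) by apply: intgB => //; exact: intg_cst.
have gE t : gproj Y (a, b) t = 2^-1 * (x a t * x b t - pop2 a b).
  by rewrite /gproj cov_mxE mulrC.
have Eg : Ex P (gproj Y (a, b)) = 0.
  rewrite (_ : gproj Y (a, b) = fun t => 2^-1 * (x a t * x b t - pop2 a b)); last first.
    by apply/funext => t; exact: gE.
  by rewrite ExZ// ExB ?Ex_cst ?subrr ?mulr0//; exact: intg_cst.
have -> : fine 'E_P[gproj Y (a, b)] = 0 by rewrite expectation.unlock -/(Ex P _).
rewrite expectation.unlock.
have := xivec_cov (a, b, false) (a, b, false); rewrite /= !expr0 !mul1r => <-.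
pose F t := xivec (Y t) (a, b, false) * xivec (Y t) (a, b, false).
have iF : intg P F.
  have i4 := intgZ 2 (intgD (intg4 a b a b) (intg_cst P (pop2 a b ^+ 2))).
  apply: (intg_le _ _ i4) => [|t].
    by apply: measurable_funM; apply: (measurableT_comp (measurable_xivec _)); exact: measurable_funPT.
  rewrite /F /xivec /= expr0 mul1r ger0_norm -?expr2 ?sqr_ge0//.
  rewrite -/(x a t) -/(x b t).
  rewrite (_ : x a t * x b t * x a t * x b t = (x a t * x b t) ^+ 2); last by ring.
  have := sqr_ge0 (x a t * x b t + pop2 a b); rewrite sqrrD sqrrB; lra.
rewrite (_ : (\int[P]_w _)%E = (4^-1 * Ex P F)%:E).
  by rewrite lee_fin -ler_pdivrMl// invrK.
rewrite -ExZ// -ExE; last exact: intgZ.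
apply: eq_integral => t _; congr EFin.
rewrite fctE /= !subr0 !gE /F /xivec /= expr0 mul1r.
by rewrite -/(x a t) -/(x b t); field.
Qed.

Lemma xivec_cube j : intg P (fun t => `|xivec (Y t) j| ^+ 3) /\
  Ex P (fun t => `|xivec (Y t) j| ^+ 3) <= 8 * C ^+ 3 * nu ^+ 2.
Proof.
case: j => [[a b] s].
have le t : `|xivec (Y t) (a, b, s)| ^+ 3 <=
    2 * (`|x a t| ^+ 6 + `|x b t| ^+ 6) + 4 * `|pop2 a b| ^+ 3.
  rewrite /xivec /= normrM normrX normrN1 expr1n mul1r.
  apply: (le_trans (cube_add_le _ _)); rewrite -/(x a t) -/(x b t).
  have h := prod2_le (`|x a t| ^+ 3) (`|x b t| ^+ 3).
  rewrite -!exprM ger0_norm ?mulr_ge0 ?exprn_ge0// in h.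
  rewrite normrM exprMn; move: h; lra.
have ig : intg P (fun t => 2 * (`|x a t| ^+ 6 + `|x b t| ^+ 6) + 4 * `|pop2 a b| ^+ 3).
  by apply: intgD; [apply: intgZ; exact: intgD (h6 a).1 (h6 b).1|exact: intg_cst].
have mm : measurable_fun [set: T] (fun t => `|xivec (Y t) (a, b, s)| ^+ 3).
  apply: measurable_funX; apply: measurableT_comp => //.
  by apply: (measurableT_comp (measurable_xivec _)); exact: measurable_funPT.
have i3 : intg P (fun t => `|xivec (Y t) (a, b, s)| ^+ 3).
  by apply: (intg_le mm _ ig) => t; rewrite ger0_norm ?exprn_ge0.
split => //; apply: (le_trans (Ex_le i3 ig le)).
have i66 : intg P (fun t => `|x a t| ^+ 6 + `|x b t| ^+ 6) by exact: intgD (h6 a).1 (h6 b).1.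
rewrite ExD ?Ex_cst ?ExZ// ?ExD//; [|exact: (h6 a).1|exact: (h6 b).1|exact: intgZ|exact: intg_cst].
have p3 : `|pop2 a b| ^+ 3 <= C ^+ 3 * mu ^+ 6.
  rewrite (_ : C ^+ 3 * mu ^+ 6 = (C * mu ^+ 2) ^+ 3); last by rewrite exprMn -exprM.
  by rewrite lerXn2r ?nnegrE ?mulr_ge0 ?exprn_ge0 ?(ltW mu0) ?pop2_le.
have n2 : nu ^+ 2 = mu ^+ 6 by rewrite nuE -exprM.
have CC : K6 * mu ^+ 6 <= C ^+ 3 * mu ^+ 6.
  rewrite ler_wpM2r ?exprn_ge0 ?(ltW mu0)//.
  have : C <= C ^+ 3 by rewrite [leRHS]exprS ler_peMr// exprn_ege1.
  by move: C6; lra.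
rewrite n2 -mulrA; have := (h6 a).2; have := (h6 b).2.
by move: p3 CC; move: (C ^+ 3 * mu ^+ 6) (K6 * mu ^+ 6) => U V; lra.
Qed.

Lemma sub_exp k : intg P (fun t => expR (x k t ^+ 2 / nu ^+ 2)) /\
  Ex P (fun t => expR (x k t ^+ 2 / nu ^+ 2)) <= 2.
Proof.
apply: ge0_intg.
- apply: (measurableT_comp (@measurable_expR R)); apply: measurable_funM => //.
  exact: measurable_funX.
- by move=> t; exact: expR_ge0.
have := hsub k; rewrite /subgaussian expectation.unlock => /le_trans; apply.
rewrite lee_fin -[leRHS]ger0_norm// -sqrtr_sqr ler_wsqrtr//.
by rewrite expr2 ler_peMl// ler1n.
Qed.

(** As |x_a x_b| <= (x_a^2 + x_b^2) / 2, the scale 4 nu^2 leaves an exponent at most C + (u + v) /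
    2, where C pays for the centring; then 2 exp (u / 2) exp (v / 2) <= exp u + exp v. *)
Lemma xivec_exp j : intg P (fun t => expR (`|xivec (Y t) j| / (4 * nu ^+ 2))) /\
  Ex P (fun t => expR (`|xivec (Y t) j| / (4 * nu ^+ 2))) <= 2 * expR C.
Proof.
case: j => [[a b] s].
have nu1 : 1 <= nu by rewrite nuE exprn_ege1.
have nu2 : 0 < nu ^+ 2 by rewrite exprn_gt0// (lt_le_trans ltr01).
pose g t := expR C * (2^-1 * (expR (x a t ^+ 2 / nu ^+ 2) + expR (x b t ^+ 2 / nu ^+ 2))).
have ig0 : intg P (fun t => expR (x a t ^+ 2 / nu ^+ 2) + expR (x b t ^+ 2 / nu ^+ 2)).
  exact: intgD (sub_exp a).1 (sub_exp b).1.
have ig : intg P g by apply: intgZ; exact: intgZ.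
have le t : expR (`|xivec (Y t) (a, b, s)| / (4 * nu ^+ 2)) <= g t.
  pose u := x a t ^+ 2 / nu ^+ 2; pose v := x b t ^+ 2 / nu ^+ 2.
  have u0 : 0 <= u by rewrite divr_ge0 ?sqr_ge0// ltW.
  have v0 : 0 <= v by rewrite divr_ge0 ?sqr_ge0// ltW.
  have h : `|xivec (Y t) (a, b, s)| / (4 * nu ^+ 2) <= C + (u + v) / 2.
    have s40 : 0 < 4 * nu ^+ 2 by rewrite mulr_gt0.
    rewrite ler_pdivrMr// /xivec /= normrM normrX normrN1 expr1n mul1r.
    apply: (le_trans (ler_normB _ _)).
    have h1 := prod2_le (x a t) (x b t); have h2 := pop2_le a b.
    have h3 : C * mu ^+ 2 <= C * nu ^+ 2.
      by rewrite ler_wpM2l// nuE -exprM ler_weXn2l.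
    have h4 : 0 <= C * nu ^+ 2 by rewrite mulr_ge0// ltW.
    have h5 : (C + (u + v) / 2) * (4 * nu ^+ 2) = 4 * (C * nu ^+ 2) + 2 * (x a t ^+ 2 + x b t ^+ 2).
      by rewrite /u /v; field; rewrite gt_eqF// (lt_le_trans ltr01).
    rewrite h5; have := sqr_ge0 (x a t); have := sqr_ge0 (x b t).
    rewrite -/(x a t) -/(x b t).
    lra.
  apply: (@le_trans _ _ (expR (C + (u + v) / 2))); first by rewrite ler_expR.
  rewrite expRD /g ler_pM2l ?expR_gt0// -/u -/v.
  have [w|w] := leP u v.
    have -> : (u + v) / 2 = u / 2 + v / 2 by ring.
    rewrite expRD; have E z : expR z = expR (z / 2) ^+ 2 by rewrite expr2 -expRD; congr expR; field.
    rewrite [expR u]E [expR v]E; have := sqr_ge0 (expR (u / 2) - expR (v / 2)); lra.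
  have -> : (u + v) / 2 = u / 2 + v / 2 by ring.
  rewrite expRD; have E z : expR z = expR (z / 2) ^+ 2 by rewrite expr2 -expRD; congr expR; field.
  rewrite [expR u]E [expR v]E; have := sqr_ge0 (expR (u / 2) - expR (v / 2)); lra.
have mm : measurable_fun [set: T] (fun t => expR (`|xivec (Y t) (a, b, s)| / (4 * nu ^+ 2))).
  apply: (measurableT_comp (@measurable_expR R)); apply: measurable_funM => //.
  apply: measurableT_comp => //.
  by apply: (measurableT_comp (measurable_xivec _)); exact: measurable_funPT.
have iL : intg P (fun t => expR (`|xivec (Y t) (a, b, s)| / (4 * nu ^+ 2))).
  by apply: (intg_le mm _ ig) => t; rewrite ger0_norm ?expR_ge0.
split => //; apply: (le_trans (Ex_le iL ig le)).
rewrite ExZ; last exact: intgZ.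
rewrite mulrC ler_wpM2r ?expR_ge0// ExZ// ExD; [|exact: (sub_exp a).1|exact: (sub_exp b).1].
have := (sub_exp a).2; have := (sub_exp b).2; lra.
Qed.

End Moments.

(** * Estimation error on the event of a small covariance error *)

Section EstimatorBound.
Context {R : realType} {p : nat}.
Implicit Types (v h : 'cV[R]_p) (A S : 'M[R]_p).

Lemma norm_oo_ge v j : `|v j 0| <= norm_oo v.
Proof. by rewrite /norm_oo (bigD1 j)//= le_max lexx. Qed.

Lemma norm_oo_le v (c : R) : 0 <= c -> (forall j, `|v j 0| <= c) -> norm_oo v <= c.
Proof.
by move=> c0 vc; rewrite /norm_oo; elim/big_ind: _ => // x y; rewrite ge_max => -> ->.
Qed.

Lemma norm_oo_ge0 v : 0 <= norm_oo v.
Proof. by rewrite /norm_oo; elim/big_ind: _ => // x y x0 y0; rewrite le_max x0. Qed.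

Lemma norm1_ge0 v : 0 <= norm1 v.
Proof. exact: sumr_ge0. Qed.

Lemma mx_max_ge A m k : `|A m k| <= mx_max A.
Proof. by rewrite /mx_max (bigD1 m)//= le_max (bigD1 k)//= le_max lexx. Qed.

Lemma mx_max_le A (c : R) : 0 <= c -> (forall m k, `|A m k| <= c) -> mx_max A <= c.
Proof.
move=> c0 Ac; rewrite /mx_max; elim/big_ind: _ => // [x y|m _].
  by rewrite ge_max => -> ->.
by elim/big_ind: _ => // x y; rewrite ge_max => -> ->.
Qed.

Lemma norm_L1_ge A k : \sum_m `|A m k| <= norm_L1 A.
Proof. exact: (le_bigmax 0 (fun k => \sum_m `|A m k|) k). Qed.

Lemma norm_L1_ge0 A : 0 <= norm_L1 A.
Proof.
apply: (big_ind (fun x => 0 <= x)) => // [x y x0 y0|k _]; first by rewrite le_max x0.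
exact: sumr_ge0.
Qed.

Lemma mulmx_norm_oo A v : norm_oo (A *m v) <= mx_max A * norm1 v.
Proof.
have A0 : 0 <= mx_max A by rewrite /mx_max; elim/big_ind: _ => // [x y x0 y0|m _];
  [rewrite le_max x0 | elim/big_ind: _ => // x y x0 y0; rewrite le_max x0].
apply: norm_oo_le; first by rewrite mulr_ge0// norm1_ge0.
move=> j; rewrite mxE mulr_sumr; apply: le_trans (ler_norm_sum _ _ _) _.
by apply: ler_sum => k _; rewrite normrM ler_wpM2r// mx_max_ge.
Qed.

(** The operator norm for the sup-norm is the largest row sum whereas [norm_L1] takes column sums,
    hence the transpose. *)
Lemma mulmx_norm_L1 A v : norm_oo (A *m v) <= norm_L1 A^T * norm_oo v.
Proof.
apply: norm_oo_le; first by rewrite mulr_ge0 ?norm_L1_ge0 ?norm_oo_ge0.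
move=> j; rewrite mxE; apply: le_trans (ler_norm_sum _ _ _) _.
apply: (@le_trans _ _ (\sum_k `|A j k| * norm_oo v)).
  by apply: ler_sum => k _; rewrite normrM ler_wpM2l// norm_oo_ge.
rewrite -mulr_suml ler_wpM2r ?norm_oo_ge0//.
have := norm_L1_ge A^T j; under eq_bigr do rewrite mxE.
by [].
Qed.

Lemma norm_ooD v h : norm_oo (v + h) <= norm_oo v + norm_oo h.
Proof.
apply: norm_oo_le; first by rewrite addr_ge0 ?norm_oo_ge0.
by move=> j; rewrite mxE; apply: le_trans (ler_normD _ _) _; rewrite lerD ?norm_oo_ge.
Qed.

Lemma norm_ooN v : norm_oo (- v) = norm_oo v.
Proof. by rewrite /norm_oo; apply: eq_bigr => j _; rewrite mxE normrN. Qed.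

(** The minimum is split into powers r and 1 - r of itself and each is bounded by one argument; r =
    0 is apart because of the convention on |x|^0. *)
Lemma min_abs_pow (r x dl : R) : 0 <= r < 1 -> 0 <= dl ->
  Num.min `|x| dl <= abs_pow r x * dl `^ (1 - r).
Proof.
move=> /andP[r0 r1] d0; rewrite /abs_pow; case: eqVneq => [->|r_neq0].
  rewrite subr0 powRr1//; have [->|x0] := eqVneq x 0.
    by rewrite normr0 mul0r ge_min lexx.
  by rewrite mul1r ge_min lexx orbT.
have r0' : 0 < r by rewrite lt_neqAle eq_sym r_neq0.
have r1' : 0 < 1 - r by rewrite subr_gt0.
have E (u : R) : 0 <= u -> u = u `^ r * u `^ (1 - r).
  move=> u0; have rr : r + (1 - r) = 1 by rewrite addrC subrK.
  have h := @powRD _ u r (1 - r); rewrite rr oner_eq0 in h.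
  by rewrite -h// powRr1.
set m := Num.min _ _.
have m0 : 0 <= m by rewrite /m le_min normr_ge0.
rewrite [leLHS]E//; apply: ler_pM; rewrite ?powR_ge0// ge0_ler_powR ?nnegrE ?(ltW r0') ?(ltW r1')//.
  by rewrite /m ge_min lexx.
by rewrite /m ge_min lexx orbT.
Qed.

Lemma l1_decay (th th' : 'cV[R]_p) (r zeta dl : R) : 0 <= r < 1 -> 0 <= dl ->
  norm1 th' <= norm1 th -> norm_oo (th' - th) <= dl -> sparse_class r zeta th ->
  norm1 (th' - th) <= 2 * (zeta * dl `^ (1 - r)).
Proof.
move=> r01 d0 h1 hd sp.
have key j : `|(th' - th) j 0| <= `|th' j 0| - `|th j 0| + 2 * Num.min `|th j 0| dl.
  have := le_trans (norm_oo_ge (th' - th) j) hd; rewrite !mxE => hj.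
  have t1 := ler_normD (th' j 0) (- th j 0); rewrite normrN in t1.
  have t2 := ler_normD (th' j 0) (th j 0 - th' j 0).
  rewrite addrC subrK distrC in t2.
  by have [_|_] := leP `|th j 0| dl; lra.
have K : \sum_j Num.min `|th j 0| dl <= zeta * dl `^ (1 - r).
  apply: (@le_trans _ _ (\sum_j abs_pow r (th j 0) * dl `^ (1 - r))).
    by apply: ler_sum => j _; exact: min_abs_pow.
  by rewrite -mulr_suml ler_wpM2r ?powR_ge0.
apply: le_trans (ler_sum _ (fun j _ => key j)) _.
rewrite big_split sumrB /= -mulr_sumr.
have -> : \sum_(i < p) `|th' i 0| = norm1 th' by [].
have -> : \sum_(i < p) `|th i 0| = norm1 th by [].
lra.
Qed.

(** Interpolation: w - 1 powers of each coordinate are bounded by the sup-norm, the last one is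
    summed. *)
Lemma lnorm_le v (w dl B : R) : 1 <= w -> 0 <= dl -> norm_oo v <= dl ->
  norm1 v <= B -> \sum_j `|v j 0| `^ w <= dl `^ (w - 1) * B.
Proof.
move=> w1 d0 vd vB; apply: (@le_trans _ _ (dl `^ (w - 1) * norm1 v)); last first.
  by rewrite ler_wpM2l ?powR_ge0.
rewrite mulr_sumr; apply: ler_sum => j _.
have w0 : 0 <= w - 1 by rewrite subr_ge0.
have -> : `|v j 0| `^ w = `|v j 0| `^ (w - 1) * `|v j 0|.
  have [v0|v0] := eqVneq (v j 0) 0.
    by rewrite v0 normr0 mulr0 powR0// gt_eqF// (lt_le_trans ltr01).
  have h := @powRD _ `|v j 0| (w - 1) 1; rewrite subrK in h.
  by rewrite h ?powRr1// normr_eq0 v0 implybT.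
rewrite ler_wpM2r// ge0_ler_powR ?nnegrE//.
exact: le_trans (norm_oo_ge _ _) vd.
Qed.

Lemma powR_ge1 (x y : R) : 1 <= x -> 0 <= y -> 1 <= x `^ y.
Proof. by move=> x1 y0; rewrite -[leLHS](powRr0 x) ler_powR. Qed.

(** The argument yields the constant 2^(1/w) 2^(1 - r/w), which is smaller than the one
    announced. *)
Lemma lnorm_rate (w r zeta A : R) : 1 <= w -> 0 <= r < 1 -> 0 <= zeta -> 0 <= A ->
  ((2 * A) `^ (w - 1) * (2 * (zeta * (2 * A) `^ (1 - r)))) `^ w^-1 <=
  2 * 6 `^ w^-1 * 5 `^ ((1 - r) * w^-1) * zeta `^ w^-1 * A `^ (1 - r * w^-1).
Proof.
move=> w1 /andP[r0 r1] z0 A0; have w0 : 0 < w by apply: lt_le_trans w1.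
have u0 : 0 <= w^-1 by rewrite invr_ge0 ltW.
have A20 : 0 <= 2 * A by rewrite mulr_ge0.
have wr : w - 1 + (1 - r) = w - r by ring.
have E : (2 * A) `^ (w - 1) * (2 * A) `^ (1 - r) = (2 * A) `^ (w - r).
  have h := @powRD _ (2 * A) (w - 1) (1 - r); rewrite wr in h.
  by rewrite h// gt_eqF// subr_gt0 (lt_le_trans r1).
rewrite (_ : _ * (2 * _) = (2 * zeta) * ((2 * A) `^ (w - 1) * (2 * A) `^ (1 - r))); last by ring.
rewrite E powRM ?mulr_ge0 ?powR_ge0// powRM// -powRrM.
have -> : (w - r) * w^-1 = 1 - r * w^-1 by field; rewrite gt_eqF.
rewrite powRM//; set x := 1 - _.
have x1 : x <= 1 by rewrite /x gerBl mulr_ge0.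
have a1 : 2 `^ w^-1 <= 6 `^ w^-1 by apply: ge0_ler_powR => //; rewrite ?nnegrE ?ler0n// ler_nat.
have a2 : 2 `^ x <= 2 by rewrite -[leRHS]powRr1 ?ler0n// ler_powR ?ler1n.
have a3 : 1 <= 5 `^ ((1 - r) * w^-1).
  by apply: powR_ge1; rewrite ?ler1n// mulr_ge0// subr_ge0 ltW.
have k : 2 `^ w^-1 * 2 `^ x <= 2 * 6 `^ w^-1 * 5 `^ ((1 - r) * w^-1).
  apply: (@le_trans _ _ (2 * 6 `^ w^-1)).
    by rewrite mulrC; apply: ler_pM; rewrite ?powR_ge0.
  by rewrite ler_peMr// mulr_ge0 ?powR_ge0 ?ler0n.
rewrite (_ : _ * _ = 2 `^ w^-1 * 2 `^ x * zeta `^ w^-1 * A `^ x); last by ring.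
by do 2! (apply: ler_wpM2r; first exact: powR_ge0).
Qed.

Lemma estimator_bound (Sigma S : 'M[R]_p) (b th' : 'cV[R]_p) (M a r zeta : R) (w : \bar R) :
  let theta := invmx Sigma *m b in
  Sigma^T = Sigma -> Sigma \in unitmx -> 0 <= a -> mx_max (S - Sigma) <= a ->
  0 <= r < 1 -> sparse_class r zeta theta -> norm1 theta <= M ->
  ((exists v, feasible S b (M * a) v) -> l1_minimizer S b (M * a) th') ->
  (1 <= w)%E ->
  lnorm w (th' - theta) <= 2 * 6 `^ recip w * 5 `^ ((1 - r) * recip w)
    * zeta `^ recip w * (M * norm_L1 (invmx Sigma)) `^ (1 - r * recip w)
    * a `^ (1 - r * recip w).
Proof.
move=> theta sym uS a0 Sa r01 sp thM hmin w1.
have M0 : 0 <= M by apply: le_trans thM; exact: norm1_ge0.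
have Sth : Sigma *m theta = b by rewrite /theta mulmxA mulmxV// mul1mx.
have feast : feasible S b (M * a) theta.
  rewrite /feasible/= -{1}Sth -mulmxBl.
  apply: (le_trans (mulmx_norm_oo _ _)); rewrite mulrC.
  apply: (@le_trans _ _ (norm1 theta * a)); first by rewrite ler_wpM2l ?norm1_ge0.
  by rewrite ler_wpM2r.
have [feas mini] : l1_minimizer S b (M * a) th' by apply: hmin; exists theta.
have h1 := mini _ feast.
pose A := M * norm_L1 (invmx Sigma) * a.
have N0 := norm_L1_ge0 (invmx Sigma).
have A0 : 0 <= A by rewrite !mulr_ge0.
(* Sigma (th' - theta) splits into (S - Sigma) th', bounded through |th'|_1 <= M, and the residual S
   th' - b, bounded by feasibility; each is at most M a. *)
have dl : norm_oo (th' - theta) <= 2 * A.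
  have -> : th' - theta = invmx Sigma *m (Sigma *m (th' - theta)) by rewrite mulmxA mulVmx// mul1mx.
  apply: (le_trans (mulmx_norm_L1 _ _)); rewrite trmx_inv sym.
  rewrite (_ : 2 * A = norm_L1 (invmx Sigma) * (M * a + M * a)); last by rewrite /A; ring.
  rewrite ler_wpM2l//.
  have -> : Sigma *m (th' - theta) = - ((S - Sigma) *m th') + (S *m th' - b).
    by rewrite mulmxBr Sth mulmxBl opprB addrA subrK.
  apply: (le_trans (norm_ooD _ _)); rewrite norm_ooN lerD//.
  apply: (le_trans (mulmx_norm_oo _ _)).
  apply: (@le_trans _ _ (a * norm1 th')); first by rewrite ler_wpM2r ?norm1_ge0.
  by rewrite mulrC ler_wpM2r// (le_trans h1).
have z0 : 0 <= zeta.
  apply: le_trans sp; apply: sumr_ge0 => j _; rewrite /abs_pow.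
  by case: ifP => _; [exact: ler0n|exact: powR_ge0].
rewrite -mulrA -powRM ?mulr_ge0// -/A.
case: w w1 => [w w1|_|//]; last first.
  by rewrite /= mulr0 !mulr0 subr0 !powRr0 !mulr1 powRr1.
rewrite lee_fin in w1; have w0 : 0 < w by apply: lt_le_trans w1.
rewrite /= ; apply: le_trans (lnorm_rate w1 r01 z0 A0).
have A20 : 0 <= 2 * A by rewrite mulr_ge0.
apply: ge0_ler_powR; rewrite ?nnegrE ?invr_ge0 ?(ltW w0)//.
- by apply: sumr_ge0 => j _; exact: powR_ge0.
- by rewrite !mulr_ge0 ?powR_ge0.
apply: lnorm_le => //; exact: l1_decay.
Qed.

End EstimatorBound.

(** * The multiplier bootstrap statistic *)

Lemma mxBE (R : realType) m k (A B : 'M[R]_(m, k)) i j : (A - B) i j = A i j - B i j.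
Proof. by rewrite !mxE. Qed.

Section SampleAlgebra.
Context {R : realType} {n p : nat}.
Variable x : 'I_n -> 'cV[R]_p.
Hypothesis n2 : (2 <= n)%N.

Definition smean (k : 'I_p) : R := n%:R^-1 * \sum_i x i k 0.
Definition cent (i : 'I_n) (k : 'I_p) : R := x i k 0 - smean k.
Definition scov (m k : 'I_p) : R := n%:R^-1 * \sum_i cent i m * cent i k.
Definition smom2 (m k : 'I_p) : R := n%:R^-1 * \sum_i x i m 0 * x i k 0.

Let n0 : (n%:R : R) != 0. Proof. by rewrite pnatr_eq0 -lt0n (leq_trans _ n2). Qed.
Let n1 : (n%:R - 1 : R) != 0.
Proof. by rewrite subr_eq0 -[1]/(1%:R) eqr_nat gtn_eqF. Qed.

Lemma sum_cent k : \sum_i cent i k = 0.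
Proof.
rewrite /cent sumrB sumr_const card_ord -[X in _ - X]mulr_natl /smean mulrA divff// mul1r.
by rewrite subrr.
Qed.

Lemma scovE m k : scov m k = smom2 m k - smean m * smean k.
Proof.
rewrite /scov /smom2 (eq_bigr (fun i => x i m 0 * x i k 0 - smean k * x i m 0 - smean m * cent i k)).
  rewrite 2!sumrB -2!mulr_sumr sum_cent mulr0 subr0 mulrBr; congr (_ - _).
  by rewrite {2}/smean; ring.
by move=> i _; rewrite /cent; ring.
Qed.

Lemma sample_mean_entry k : sample_mean x k 0 = smean k.
Proof. by rewrite /sample_mean mxE summxE. Qed.

Lemma sample_cov_entry m k : sample_cov x m k = n%:R / (n%:R - 1) * scov m k.
Proof.
rewrite /sample_cov mxE summxE /scov.
have E i l : (x i - sample_mean x) l 0 = cent i l.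
  by rewrite mxBE sample_mean_entry.
under eq_bigr do rewrite mxE big_ord1 [X in _ * X]mxE !E.
by rewrite mulrA; congr (_ * _); field; rewrite n1 n0.
Qed.

Lemma kernel_sum i m k :
  (\sum_(j | j != i) cov_kernel (x i) (x j)) m k =
  n%:R / 2 * (cent i m * cent i k + scov m k).
Proof.
rewrite summxE.
have E j : cov_kernel (x i) (x j) m k = 2^-1 * ((cent i m - cent j m) * (cent i k - cent j k)).
  by rewrite /cov_kernel !mxE big_ord1 !mxE /cent; ring.
under eq_bigr do rewrite E.
(* The term j = i vanishes, so the sum may run over all indices. *)
transitivity (\sum_j 2^-1 * ((cent i m - cent j m) * (cent i k - cent j k))).
  by rewrite [RHS](bigD1 i)//= !subrr mulr0 mulr0 add0r.
rewrite -mulr_sumr (eq_bigr (fun j => cent i m * cent i k - cent i m * cent j k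
  - cent i k * cent j m + cent j m * cent j k)); last by move=> j _; ring.
rewrite big_split /= 2!sumrB -2!mulr_sumr !sum_cent !mulr0 !subr0 sumr_const card_ord.
rewrite -[_ *+ n]mulr_natl -mulr_sumr sum_cent mulr0 subr0 /scov; field; exact: n0.
Qed.

(* The sign carried by an index turns the maximum of absolute values into a
   maximum of coordinates. *)
Definition bcoef (i : 'I_n) (j : 'I_p * 'I_p * bool) : R :=
  (-1) ^+ j.2 * ((Num.sqrt n%:R)^-1 * (n%:R / (n%:R - 1)) *
    (cent i j.1.1 * cent i j.1.2 - scov j.1.1 j.1.2)).

(** The leave-one-out average contains half of the sample covariance; subtracting all of it leaves
    half of the centred product minus [scov], up to n / (n - 1). The bootstrap matrix is thus linear
    in the multipliers. *)
Lemma Tsharp_entry (z : 'I_n -> R) m k :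
  2 * Tsharp x z m k = \sum_i bcoef i (m, k, false) * z i.
Proof.
rewrite /Tsharp mxE summxE /bcoef /= mulrCA mulr_sumr mulr_sumr.
apply: eq_bigr => i _; rewrite mxE mxBE sample_cov_entry mxE kernel_sum.
rewrite expr0 mul1r; field.
by rewrite n1 sqrtr_eq0 -ltNge ltr0n (leq_trans _ n2).
Qed.

Lemma Tbar_le (z : 'I_n -> R) (s : R) : (0 < p)%N ->
  (Tbar x z <= s) <-> (forall j, \sum_i bcoef i j * z i <= Num.sqrt n%:R * s).
Proof.
move=> p0; have rt0 : 0 < Num.sqrt n%:R :> R by rewrite sqrtr_gt0 ltr0n (leq_trans _ n2).
have T m k : 2 * `|Tsharp x z m k| = `|\sum_i bcoef i (m, k, false) * z i|.
  by rewrite -Tsharp_entry normrM ger0_norm ?ler0n.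
have Sg m k b : \sum_i bcoef i (m, k, b) * z i = (-1) ^+ b * \sum_i bcoef i (m, k, false) * z i.
  by rewrite mulr_sumr; apply: eq_bigr => i _; rewrite /bcoef /= expr0 mul1r; ring.
have TE : (Tbar x z <= s) = (mx_max (Tsharp x z) <= Num.sqrt n%:R * s / 2).
  by rewrite /Tbar -ler_pdivlMl ?divr_gt0//; congr (_ <= _); field; rewrite gt_eqF.
rewrite TE; split=> [h [[m k] b]|h].
  have := le_trans (mx_max_ge (Tsharp x z) m k) h.
  rewrite ler_pdivlMr// mulrC T ler_norml => /andP[h1 h2]; rewrite Sg.
  by case: b; rewrite ?expr0 ?mul1r// expr1 mulN1r lerNl.
have h' m k : `|\sum_i bcoef i (m, k, false) * z i| <= Num.sqrt n%:R * s.
  rewrite ler_norml (h (m, k, false)) andbT lerNl.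
  by have := h (m, k, true); rewrite Sg expr1 mulN1r.
have s0 : 0 <= Num.sqrt n%:R * s.
  by apply: le_trans (h' (Ordinal p0) (Ordinal p0)).
apply: mx_max_le; first by rewrite divr_ge0.
by move=> m k; rewrite ler_pdivlMr// mulrC T.
Qed.

End SampleAlgebra.

Section GoodArith.
Context {R : realFieldType}.
Implicit Types u v w x c t mu : R.

Lemma mul3_le u v w : 0 <= u -> 0 <= v -> 0 <= w ->
  3 * (u * v * w) <= u ^+ 3 + v ^+ 3 + w ^+ 3.
Proof.
move=> u0 v0 w0.
have h : 0 <= (u + v + w) * ((u - v) ^+ 2 + (v - w) ^+ 2 + (u - w) ^+ 2).
  by rewrite mulr_ge0 ?addr_ge0 ?sqr_ge0.
have E : u ^+ 3 + v ^+ 3 + w ^+ 3 - 3 * (u * v * w) =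
  2^-1 * ((u + v + w) * ((u - v) ^+ 2 + (v - w) ^+ 2 + (u - w) ^+ 2)) by field.
by rewrite -subr_ge0 E mulr_ge0// invr_ge0.
Qed.

(** One factor is changed at a time, and each product of three is bounded by the mean of the
    cubes. *)
Lemma prod4_diff (a b c e a' b' c' e' t : R) : 0 <= t <= 1 ->
  `|a' - a| <= t -> `|b' - b| <= t -> `|c' - c| <= t -> `|e' - e| <= t ->
  `|a' * b' * c' * e' - a * b * c * e| <=
  t * ((`|a| + 1) ^+ 3 + (`|b| + 1) ^+ 3 + (`|c| + 1) ^+ 3 + (`|e| + 1) ^+ 3).
Proof.
move=> /andP[t0 t1] ha hb hc he.
have X (z z' : R) : `|z' - z| <= t -> `|z'| <= `|z| + 1.
  by move=> h; have := ler_normD z (z' - z); rewrite addrC subrK => /le_trans; apply; rewrite lerD2l (le_trans h).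
have Y (z : R) : `|z| <= `|z| + 1 by rewrite lerDl.
have Z (z : R) : 0 <= `|z| + 1 by rewrite addr_ge0.
have X1 := X _ _ ha; have X2 := X _ _ hb; have X3 := X _ _ hc; have X4 := X _ _ he.
have B (u1 u2 u3 u4 v2 v3 v4 : R) : `|u1| <= t -> `|u2| <= v2 -> `|u3| <= v3 -> `|u4| <= v4 ->
    `|u1 * (u2 * u3 * u4)| <= t * (v2 * v3 * v4).
  move=> h1 h2 h3 h4; rewrite !normrM; apply: ler_pM; rewrite ?mulr_ge0//.
  by apply: ler_pM; rewrite ?mulr_ge0//; apply: ler_pM.
have -> : a' * b' * c' * e' - a * b * c * e =
  (a' - a) * (b' * c' * e') + (b' - b) * (a * c' * e') + (c' - c) * (a * b * e')
  + (e' - e) * (a * b * c) by ring.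
have S1 := B _ _ _ _ _ _ _ ha X2 X3 X4.
have S2 := B _ _ _ _ _ _ _ hb (Y a) X3 X4.
have S3 := B _ _ _ _ _ _ _ hc (Y a) (Y b) X4.
have S4 := B _ _ _ _ _ _ _ he (Y a) (Y b) (Y c).
move: (`|a| + 1) (`|b| + 1) (`|c| + 1) (`|e| + 1) (Z a) (Z b) (Z c) (Z e) S1 S2 S3 S4.
move=> A B' C E A0 B0 C0 E0 S1 S2 S3 S4.
have M1 := ler_wpM2l t0 (mul3_le B0 C0 E0); have M2 := ler_wpM2l t0 (mul3_le A0 C0 E0).
have M3 := ler_wpM2l t0 (mul3_le A0 B0 E0); have M4 := ler_wpM2l t0 (mul3_le A0 B0 C0).
apply: (le_trans (ler_normD _ _)); apply: (le_trans (lerD (ler_normD _ _) (lexx _))).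
apply: (le_trans (lerD (lerD (ler_normD _ _) (lexx _)) (lexx _))).
clear -S1 S2 S3 S4 M1 M2 M3 M4.
lra.
Qed.

Lemma cube_shift_le x mu : 1 <= mu -> (`|x| + 1) ^+ 3 <= 4 * (mu ^+ 3 + x ^+ 4 / mu + 1).
Proof.
move=> mu1; have mu0 : 0 < mu by apply: lt_le_trans mu1.
have X0 := normr_ge0 x.
have h1 : (`|x| + 1) ^+ 3 <= 4 * (`|x| ^+ 3 + 1).
  have : 0 <= 3 * ((`|x| + 1) * (`|x| - 1) ^+ 2).
    by apply: mulr_ge0 => //; apply: mulr_ge0; [exact: addr_ge0|exact: sqr_ge0].
  rewrite (_ : 3 * _ = 4 * (`|x| ^+ 3 + 1) - (`|x| + 1) ^+ 3); last by ring.
  by rewrite subr_ge0.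
apply: (le_trans h1); rewrite ler_pM2l// lerD2r.
have x4 : x ^+ 4 = `|x| ^+ 4 by rewrite -normrX ger0_norm// -[4%N]/(2 * 2)%N exprM sqr_ge0.
have [h|h] := leP `|x| mu.
  rewrite (@le_trans _ _ (mu ^+ 3))//; first by rewrite lerXn2r ?nnegrE ?(ltW mu0).
  by rewrite lerDl divr_ge0 ?(ltW mu0)// x4 exprn_ge0.
rewrite (@le_trans _ _ (x ^+ 4 / mu))//; last by rewrite lerDr exprn_ge0// ltW.
rewrite ler_pdivlMr// x4 [`|x| ^+ 4]exprSr ler_wpM2l ?exprn_ge0//; exact: ltW.
Qed.

End GoodArith.

(** * Bootstrap covariances on a sample with accurate moments *)

Section GoodSample.
Context {R : realType} {n p : nat}.
Variable x : 'I_n -> 'cV[R]_p.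
Hypothesis n4 : (4 <= n)%N.
Variables (Sg : 'I_p -> 'I_p -> R) (Q : 'I_p -> 'I_p -> 'I_p -> 'I_p -> R).
Variables tau tau2 mu C : R.
Hypotheses (tau01 : 0 <= tau <= 1) (tau201 : 0 <= tau2 <= 1) (mu1 : 1 <= mu) (C1 : 1 <= C).

Definition smom4 (a b c e : 'I_p) : R :=
  n%:R^-1 * \sum_i x i a 0 * x i b 0 * x i c 0 * x i e 0.

Hypothesis hmean : forall k, `|smean x k| <= tau.
Hypothesis hmom2 : forall m k, `|smom2 x m k - Sg m k| <= tau.
Hypothesis hmom4 : forall a b c e, `|smom4 a b c e - Q a b c e| <= tau2.
Hypothesis hSg : forall m k, `|Sg m k| <= C * mu ^+ 2.
Hypothesis hQ : forall a b c e, `|Q a b c e| <= C * mu ^+ 4.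

Let n2 : (2 <= n)%N. Proof. exact: leq_trans n4. Qed.
Let N0 : 0 < n%:R :> R. Proof. by rewrite ltr0n (leq_trans _ n4). Qed.
Let N4 : 4 <= n%:R :> R. Proof. by rewrite ler_nat. Qed.
Let mu0 : 0 < mu. Proof. exact: lt_le_trans mu1. Qed.

Let cmom4 (a b c e : 'I_p) : R :=
  n%:R^-1 * \sum_i cent x i a * cent x i b * cent x i c * cent x i e.

Let avg_cube k : n%:R^-1 * \sum_i (`|x i k 0| + 1) ^+ 3 <= 4 * ((C + 3) * mu ^+ 3).
Proof.
have h : n%:R^-1 * \sum_i (`|x i k 0| + 1) ^+ 3 <= 4 * (mu ^+ 3 + smom4 k k k k / mu + 1).
  apply: (@le_trans _ _ (n%:R^-1 * \sum_i 4 * (mu ^+ 3 + x i k 0 ^+ 4 / mu + 1))).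
    rewrite ler_wpM2l ?invr_ge0 ?(ltW N0)//; apply: ler_sum => i _; exact: cube_shift_le.
  rewrite -mulr_sumr !big_split /= !sumr_const !card_ord -mulr_suml.
  have -> : \sum_i x i k 0 ^+ 4 = n%:R * smom4 k k k k.
    by rewrite /smom4 mulrA divff ?gt_eqF// mul1r; apply: eq_bigr => i _; ring.
  rewrite -[mu ^+ 3 *+ n]mulr_natl le_eqVlt; apply/orP; left; apply/eqP.
  by field; rewrite !gt_eqF.
apply: (le_trans h); rewrite ler_pM2l//.
have := ler_norm (smom4 k k k k); have := hmom4 k k k k; have := hQ k k k k.
set s := smom4 _ _ _ _; set qq := Q _ _ _ _ => h1 h2 _.
have h3 : s <= C * mu ^+ 4 + 1.
  move: h1 h2; rewrite !ler_norml => /andP[_ h1] /andP[_ h2].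
  by case/andP: tau201 => _; lra.
have h4 : s / mu <= C * mu ^+ 3 + 1.
  rewrite ler_pdivrMr//; apply: (le_trans h3); rewrite mulrDl mul1r -mulrA -exprSr.
  by rewrite lerD2l.
have h5 : 1 <= mu ^+ 3 by exact: exprn_ege1.
lra.
Qed.

(** Recentring shifts each coordinate by at most tau; the error is tau times average cubes, of order
    mu^3 by the empirical fourth moments. *)
Let cmom4_close a b c e : `|cmom4 a b c e - smom4 a b c e| <= 16 * (tau * ((C + 3) * mu ^+ 3)).
Proof.
rewrite /cmom4 /smom4 -mulrBr -sumrB normrM ger0_norm ?invr_ge0 ?(ltW N0)//.
have cx i k : `|cent x i k - x i k 0| <= tau by rewrite /cent addrC addKr normrN.
apply: (@le_trans _ _ (n%:R^-1 * \sum_i tau * ((`|x i a 0| + 1) ^+ 3 + (`|x i b 0| + 1) ^+ 3 +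
  (`|x i c 0| + 1) ^+ 3 + (`|x i e 0| + 1) ^+ 3))).
  rewrite ler_wpM2l ?invr_ge0 ?(ltW N0)//; apply: le_trans (ler_norm_sum _ _ _) _.
  by apply: ler_sum => i _; exact: prod4_diff.
rewrite -mulr_sumr !big_split /=.
have t0 : 0 <= tau by case/andP: tau01.
have K k := ler_wpM2l t0 (avg_cube k).
rewrite mulrCA !mulrDr.
apply: (le_trans (lerD (lerD (lerD (K a) (K b)) (K c)) (K e))).
by rewrite le_eqVlt; apply/orP; left; apply/eqP; ring.
Qed.

Let scov_close m k : `|scov x m k - Sg m k| <= 2 * tau.
Proof.
rewrite scovE// addrAC; apply: (le_trans (ler_normB _ _)).
have [t0 t1] := andP tau01.
have h : `|smean x m * smean x k| <= tau * 1.
  by rewrite normrM; apply: ler_pM => //; exact: le_trans t1.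
by have := hmom2 m k; move: h; lra.
Qed.

Let ratio_bound : 1 <= n%:R / (n%:R - 1) :> R /\
  (n%:R / (n%:R - 1)) ^+ 2 - 1 <= 4 / n%:R :> R.
Proof.
have m0 : 0 < n%:R - 1 :> R by move: N4; lra.
split; first by rewrite ler_pdivlMr//; lra.
rewrite (_ : _ - 1 = (2 * n%:R - 1) / (n%:R - 1) ^+ 2); last by field; rewrite gt_eqF.
rewrite ler_pdivrMr ?exprn_gt0// mulrAC ler_pdivlMr//.
have := N4; move: (n%:R : R) => N hN.
have : 0 <= (N - 4) * (2 * N) by rewrite mulr_ge0; lra.
lra.
Qed.

(** Centred empirical moments are compared with the population ones, the factor (n / (n - 1))^2 <= 2
    being kept outside. Its distance 4 / n to 1, times a population covariance of size 2 C^2 mu^4,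
    is the last term. *)
Lemma bcoef_cov (j k : 'I_p * 'I_p * bool) :
  `|\sum_i bcoef x i j * bcoef x i k -
    (-1) ^+ j.2 * (-1) ^+ k.2 *
      (Q j.1.1 j.1.2 k.1.1 k.1.2 - Sg j.1.1 j.1.2 * Sg k.1.1 k.1.2)| <=
  2 * (tau2 + 24 * ((C + 3) * (tau * mu ^+ 3))) + 8 * C ^+ 2 * (mu ^+ 4 / n%:R).
Proof.
case: j k => [[a b] s] [[c e] s'] /=.
have [t0 t1] := andP tau01.
pose TT := cmom4 a b c e - scov x a b * scov x c e.
pose po := Q a b c e - Sg a b * Sg c e.
pose r := n%:R / (n%:R - 1) : R.
have rt2 : Num.sqrt n%:R ^+ 2 = n%:R :> R by rewrite sqr_sqrtr// ltW.
have m0 : 0 < n%:R - 1 :> R by move: N4; lra.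
have E : \sum_i bcoef x i (a, b, s) * bcoef x i (c, e, s') =
    (-1) ^+ s * (-1) ^+ s' * (r ^+ 2 * TT).
  rewrite /TT /bcoef /=.
  rewrite (eq_bigr (fun i => (-1) ^+ s * (-1) ^+ s' * (r ^+ 2 / n%:R) *
     (cent x i a * cent x i b * cent x i c * cent x i e -
      scov x c e * (cent x i a * cent x i b) - scov x a b * (cent x i c * cent x i e - scov x c e)))); last first.
    move=> i _; rewrite -[in RHS]rt2 /r; field.
    by rewrite !gt_eqF ?sqrtr_gt0.
  rewrite -mulr_sumr !sumrB -!mulr_sumr sumrB sumr_const card_ord.
  have V u v : \sum_i cent x i u * cent x i v = n%:R * scov x u v.
    by rewrite /scov mulrA divff ?gt_eqF// mul1r.
  rewrite !V -[scov x c e *+ n]mulr_natl subrr mulr0 subr0.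
  rewrite /cmom4; field; by rewrite gt_eqF.
rewrite E -/po -mulrBr normrM.
have -> : `|(-1) ^+ s * (-1) ^+ s'| = 1 :> R by rewrite normrM !normrX !normrN1 !expr1n mul1r.
rewrite mul1r.
set ta := tau * mu ^+ 3.
have mu3 : 1 <= mu ^+ 3 by exact: exprn_ege1.
have mu23 : mu ^+ 2 <= mu ^+ 3 by rewrite [leRHS]exprS ler_peMl// exprn_ge0// ltW.
have ta0 : 0 <= ta by rewrite mulr_ge0// (le_trans ler01).
have tata : tau <= ta by rewrite /ta ler_peMr.
have C0 : 0 <= C by apply: le_trans C1.
have D : `|TT - po| <= tau2 + 24 * ((C + 3) * ta).
  have h1 : `|cmom4 a b c e - Q a b c e| <= tau2 + 16 * ((C + 3) * ta).
    rewrite (_ : _ - _ = (cmom4 a b c e - smom4 a b c e) + (smom4 a b c e - Q a b c e)); last by ring.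
    apply: (le_trans (ler_normD _ _)); rewrite addrC lerD//.
    by apply: (le_trans (cmom4_close _ _ _ _)); rewrite [tau * (_ * _)]mulrCA.
  have h2 : `|scov x a b * scov x c e - Sg a b * Sg c e| <= 4 * ((C + 1) * ta).
    rewrite (_ : _ - _ = (scov x a b - Sg a b) * (scov x c e - Sg c e)
      + (scov x a b - Sg a b) * Sg c e + Sg a b * (scov x c e - Sg c e)); last by ring.
    have k1 := scov_close a b; have k2 := scov_close c e.
    apply: (le_trans (ler_normD _ _)); apply: (le_trans (lerD (ler_normD _ _) (lexx _))).
    rewrite !normrM.
    have w1 : `|scov x a b - Sg a b| * `|scov x c e - Sg c e| <= 2 * tau * 2.
      apply: ler_pM => //; apply: (le_trans k2); move: t1; lra.
    have w2 : `|scov x a b - Sg a b| * `|Sg c e| <= 2 * tau * (C * mu ^+ 3).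
      by apply: ler_pM => //; apply: (le_trans (hSg _ _)); rewrite ler_wpM2l.
    have w3 : `|Sg a b| * `|scov x c e - Sg c e| <= C * mu ^+ 3 * (2 * tau).
      by apply: ler_pM => //; apply: (le_trans (hSg _ _)); rewrite ler_wpM2l.
    apply: (le_trans (lerD (lerD w1 w2) w3)).
    rewrite (_ : 2 * tau * (C * _) = 2 * (C * ta)); last by rewrite /ta; ring.
    rewrite (_ : _ * (2 * tau) = 2 * (C * ta)); last by rewrite /ta; ring.
    by lra.
  rewrite (_ : TT - po = (cmom4 a b c e - Q a b c e) - (scov x a b * scov x c e - Sg a b * Sg c e)); last by rewrite /TT /po; ring.
  apply: (le_trans (ler_normB _ _)); have Cta : 0 <= C * ta by rewrite mulr_ge0.
  by lra.
have po_le : `|po| <= 2 * C ^+ 2 * mu ^+ 4.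
  apply: (le_trans (ler_normB _ _)); rewrite normrM.
  have w1 := hQ a b c e.
  have w2 : `|Sg a b| * `|Sg c e| <= C * mu ^+ 2 * (C * mu ^+ 2) by exact: ler_pM.
  have w3 : C * mu ^+ 4 <= C ^+ 2 * mu ^+ 4.
    by rewrite ler_wpM2r ?exprn_ge0 ?(ltW mu0)// expr2 ler_peMl.
  rewrite (_ : C * mu ^+ 2 * _ = C ^+ 2 * mu ^+ 4) in w2; last by ring.
  by lra.
have [r1 r2] := ratio_bound; rewrite -/r in r1 r2.
have r20 : 0 <= r ^+ 2 - 1 by rewrite subr_ge0 exprn_ege1.
have n41 : 4 / n%:R <= 1 :> R by rewrite ler_pdivrMr// mul1r.
rewrite (_ : r ^+ 2 * TT - po = r ^+ 2 * (TT - po) + (r ^+ 2 - 1) * po); last by ring.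
apply: (le_trans (ler_normD _ _)); rewrite [`|r ^+ 2 * _|]normrM [`|(_ - 1) * _|]normrM (ger0_norm r20) (ger0_norm (sqr_ge0 r)).
apply: lerD.
  apply: ler_pM => //; first exact: sqr_ge0.
  by lra.
rewrite (_ : 8 * _ * _ = 4 / n%:R * (2 * C ^+ 2 * mu ^+ 4)); last by field; rewrite gt_eqF.
exact: ler_pM.
Qed.

(** Linearization: up to the product of the sample means and the factor n / (n - 1), the covariance
    error is an average of independent centred products. *)
Lemma sample_cov_close m k :
  `|sample_cov x m k - Sg m k - (smom2 x m k - Sg m k)| <=
  2 / n%:R * ((C + 1) * mu ^+ 3) + 2 * tau ^+ 2.
Proof.
have [t0 t1] := andP tau01.
have m0 : 0 < n%:R - 1 :> R by move: N4; lra.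
have [r1 r2] := ratio_bound; rewrite sample_cov_entry// scovE//.
set r := n%:R / (n%:R - 1) in r1 r2 *.
have rE : r - 1 <= 2 / n%:R.
  rewrite (_ : r - 1 = (n%:R - 1)^-1); last by rewrite /r; field; rewrite gt_eqF.
  rewrite ler_pdivlMr// mulrC ler_pdivrMr//; move: N4; lra.
have r2' : r <= 2.
  have h : 2 / n%:R <= 1 :> R by rewrite ler_pdivrMr// mul1r; move: N4; lra.
  by move: rE h; lra.
have r10 : 0 <= r - 1 by rewrite subr_ge0.
rewrite (_ : _ - _ = (r - 1) * smom2 x m k - r * (smean x m * smean x k)); last by ring.
apply: (le_trans (ler_normB _ _)); rewrite [`|(r - 1) * _|]normrM [`|r * _|]normrM [`|smean x m * _|]normrM.
rewrite (ger0_norm r10) (ger0_norm (le_trans ler01 r1)).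
apply: lerD.
  apply: ler_pM => //.
  have mu3 : 1 <= mu ^+ 3 by exact: exprn_ege1.
  have mu23 : mu ^+ 2 <= mu ^+ 3 by rewrite [leRHS]exprS ler_peMl// exprn_ge0// ltW.
  have := hmom2 m k; have := hSg m k.
  have : C * mu ^+ 2 <= C * mu ^+ 3 by rewrite ler_wpM2l// (le_trans ler01).
  have := ler_normD (smom2 x m k - Sg m k) (Sg m k); rewrite subrK.
  by lra.
by apply: ler_pM => //; [exact: le_trans r1|rewrite expr2; exact: ler_pM].
Qed.

End GoodSample.

(** * Probability of a good sample *)

(* Throughout, q = sqrt (ln (n p)) and eps^6 = nu^4 q^14 / n is the sixth power
   of the approximation rate, so that sqrt n = nu^2 q^7 / eps^3 and all
   thresholds are rational in eps, q and nu. *)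
Section GpArith.
Context {R : realFieldType}.
Implicit Types nu q eps c C : R.

Lemma gp_exponent1 nu q eps c (N : R) : 0 < nu -> 1 <= q -> 0 < eps -> 12 * eps <= c ->
  N = (nu ^+ 2 * q ^+ 7 / eps ^+ 3) ^+ 2 ->
  6 * q ^+ 2 <= N * (c * eps ^+ 2 / (q ^+ 4 * nu)) / (2 * (nu ^+ 3 * q ^+ 6 / eps ^+ 3)).
Proof.
move=> nu0 q1 e0 h ->; have q0 : 0 < q by apply: lt_le_trans q1.
rewrite (_ : _ / _ = q ^+ 4 * (c / (2 * eps))); last by field; rewrite !gt_eqF.
have h1 : 6 <= c / (2 * eps) by rewrite ler_pdivlMr ?mulr_gt0//; lra.
rewrite mulrC; apply: ler_pM => //; first exact: sqr_ge0.
by rewrite ler_weXn2l.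
Qed.

Lemma gp_exponent2 nu q eps c (N : R) : 0 < nu -> 1 <= q -> 0 < eps -> 12 * eps <= c ->
  N = (nu ^+ 2 * q ^+ 7 / eps ^+ 3) ^+ 2 ->
  6 * q ^+ 2 <= N * (c * eps ^+ 2 / q ^+ 4) / (2 * (nu ^+ 4 * q ^+ 6 / eps ^+ 3)).
Proof.
move=> nu0 q1 e0 h ->; have q0 : 0 < q by apply: lt_le_trans q1.
rewrite (_ : _ / _ = q ^+ 4 * (c / (2 * eps))); last by field; rewrite !gt_eqF.
have h1 : 6 <= c / (2 * eps) by rewrite ler_pdivlMr ?mulr_gt0//; lra.
rewrite mulrC; apply: ler_pM => //; first exact: sqr_ge0.
by rewrite ler_weXn2l.
Qed.

Lemma gp_var1 nu q eps c C : 0 < nu -> 1 <= q -> 0 < eps -> 2 * C * eps <= c -> 0 <= c ->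
  C * nu ^+ 2 / (nu ^+ 3 * q ^+ 6 / eps ^+ 3) <= c * eps ^+ 2 / (q ^+ 4 * nu) / 2.
Proof.
move=> nu0 q1 e0 h c0; have q0 : 0 < q by apply: lt_le_trans q1.
rewrite (_ : _ / (_ / _) = eps ^+ 2 / (2 * q ^+ 6 * nu) * (2 * C * eps)); last by field; rewrite !gt_eqF.
rewrite (_ : c * _ / _ / _ = eps ^+ 2 / (2 * q ^+ 6 * nu) * (c * q ^+ 2)); last by field; rewrite !gt_eqF.
rewrite ler_wpM2l ?divr_ge0 ?mulr_ge0 ?exprn_ge0 ?(ltW q0) ?(ltW nu0) ?(ltW e0)//.
by apply: (le_trans h); rewrite ler_peMr// exprn_ege1.
Qed.

Lemma gp_var2 nu q eps c C : 0 < nu -> 1 <= q -> 0 < eps -> 2 * C * eps <= c -> 0 <= c ->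
  C * nu ^+ 4 / (nu ^+ 4 * q ^+ 6 / eps ^+ 3) <= c * eps ^+ 2 / q ^+ 4 / 2.
Proof.
move=> nu0 q1 e0 h c0; have q0 : 0 < q by apply: lt_le_trans q1.
rewrite (_ : _ / (_ / _) = eps ^+ 2 / (2 * q ^+ 6) * (2 * C * eps)); last by field; rewrite !gt_eqF.
rewrite (_ : c * _ / _ / _ = eps ^+ 2 / (2 * q ^+ 6) * (c * q ^+ 2)); last by field; rewrite !gt_eqF.
rewrite ler_wpM2l ?divr_ge0 ?mulr_ge0 ?exprn_ge0 ?(ltW q0) ?(ltW nu0) ?(ltW e0)//.
by apply: (le_trans h); rewrite ler_peMr// exprn_ege1.
Qed.

(** Products of at most four coordinates bounded by 3 nu q stay below the truncation levels, as 3^4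
    = 81 <= 5^3. Degrees up to three share the power nu^3. *)
Lemma gp_trunc nu q eps (k : nat) : 1 <= nu -> 1 <= q -> 0 < eps -> 5 * eps <= 1 -> (k < 4)%N ->
  (3 * nu * q) ^+ k.+1 <= nu ^+ (maxn 3 k.+1) * q ^+ 6 / eps ^+ 3.
Proof.
move=> nu1 q1 e0 e5 k4.
have nu0 : 0 < nu by apply: lt_le_trans nu1.
have q0 : 0 < q by apply: lt_le_trans q1.
have e3 : 81 * eps ^+ 3 <= 1.
  have h : (5 * eps) ^+ 3 <= 1 by rewrite exprn_ile1// mulr_ge0// ltW.
  by apply: le_trans h; rewrite exprMn ler_wpM2r ?exprn_ge0 ?(ltW e0)// -natrX ler_nat.
have k81 : (3 : R) ^+ k.+1 <= 81.
  apply: (@le_trans _ _ (3 ^+ 4)); last by rewrite -natrX.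
  by rewrite ler_weXn2l// ler1n.
rewrite ler_pdivlMr ?exprn_gt0// !exprMn.
apply: (@le_trans _ _ (81 * (nu ^+ maxn 3 k.+1 * q ^+ 6) * eps ^+ 3)); last first.
  by rewrite -mulrA mulrCA -[leRHS]mulr1 ler_wpM2l ?mulr_ge0 ?exprn_ge0 ?(ltW nu0) ?(ltW q0).
rewrite ler_wpM2r ?exprn_ge0 ?(ltW e0)// -mulrA.
apply: ler_pM; rewrite ?mulr_ge0 ?exprn_ge0 ?ler0n ?(ltW nu0) ?(ltW q0)//.
apply: ler_pM; rewrite ?exprn_ge0 ?(ltW nu0) ?(ltW q0)//; rewrite ler_weXn2l//.
  by rewrite leq_maxr.
exact: leq_trans k4 _.
Qed.

End GpArith.

Section GoodEvent.
Context {d : measure_display} {T : measurableType d} {R : realType} (P : probability T R).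
Context {n p : nat}.
Variables (X : 'I_n -> {RV P >-> p.-tuple R}) (i1 : 'I_n).
Hypotheses (indX : mutually_independent X) (idX : identically_distributed X).
Local Notation x k := (rvcoord (X i1) k).
Variables nu q eps c C : R.
Hypotheses (nu1 : 1 <= nu) (q1 : 1 <= q) (e0 : 0 < eps) (e5 : 5 * eps <= 1) (C1 : 1 <= C).
Hypothesis hc : 12 * C * eps <= c.
Hypothesis hn : Num.sqrt n%:R = nu ^+ 2 * q ^+ 7 / eps ^+ 3.
Hypothesis hnp : (n * p)%:R <= expR (q ^+ 2).
Hypothesis he : expR (- q ^+ 2) <= eps.
Hypothesis m1 : forall k, intg P (x k) /\ Ex P (x k) = 0.
Hypothesis m2 : forall k, intg P (fun t => x k t ^+ 2) /\ Ex P (fun t => x k t ^+ 2) <= C * nu ^+ 2.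
Hypothesis m4 : forall k, intg P (fun t => x k t ^+ 4) /\ Ex P (fun t => x k t ^+ 4) <= C * nu ^+ 2.
Hypothesis m8 : forall k, intg P (fun t => `|x k t| ^+ 8) /\ Ex P (fun t => `|x k t| ^+ 8) <= C * nu ^+ 4.
Hypothesis i2 : forall j k, intg P (fun t => x j t * x k t).
Hypothesis i4 : forall a b c e, intg P (fun t => x a t * x b t * x c t * x e t).
Hypothesis msub : forall i k, intg P (fun t => expR (rvcoord (X i) k t ^+ 2 / nu ^+ 2)) /\
  Ex P (fun t => expR (rvcoord (X i) k t ^+ 2 / nu ^+ 2)) <= 2.

Let nu0 : 0 < nu. Proof. exact: lt_le_trans nu1. Qed.
Let q0 : 0 < q. Proof. exact: lt_le_trans q1. Qed.
Let C0 : 0 <= C. Proof. exact: le_trans C1. Qed.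
Let c12 : 12 * eps <= c.
Proof. by apply: le_trans hc; rewrite ler_pM2r// ler_peMr. Qed.
Let c2 : 2 * C * eps <= c.
Proof.
apply: le_trans hc; rewrite ler_pM2r// ler_wpM2r//.
by rewrite ler_nat.
Qed.
Let c0 : 0 <= c. Proof. by apply: le_trans c12; rewrite mulr_ge0// ltW. Qed.
Let hn2 : n%:R = (nu ^+ 2 * q ^+ 7 / eps ^+ 3) ^+ 2 :> R.
Proof. by rewrite -hn sqr_sqrtr. Qed.

Definition good_sample (y : 'I_n -> 'cV[R]_p) (tau tau2 : R) : Prop :=
  [/\ forall k, `|smean y k| <= tau,
      forall j k, `|smom2 y j k - pop2 (X i1) j k| <= tau &
      forall a b c e, `|smom4 y a b c e - pop4 (X i1) a b c e| <= tau2].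

Lemma coord_tail i k : measurable [set t | 3 * nu * q < `|rvcoord (X i) k t|] /\
  (P [set t | (3 * nu * q < `|rvcoord (X i) k t|)%R] <= (2 * expR (- (9 * q ^+ 2)))%:E)%E.
Proof.
have mA : measurable [set t | 3 * nu * q < `|rvcoord (X i) k t|].
  by apply: measurable_above; apply: measurableT_comp => //; exact: measurable_rvcoord.
split => //; have [ie ee] := msub i k.
apply: (markov_le mA (intgZ (expR (- (9 * q ^+ 2))) ie)).
- by move=> t; rewrite mulr_ge0 ?expR_ge0.
- move=> t /= h; rewrite -expRD -[leLHS]expR0 ler_expR addrC subr_ge0.
  rewrite ler_pdivlMr ?exprn_gt0// -[rvcoord _ _ _ ^+ 2]real_normK ?num_real//.
  rewrite (_ : 9 * q ^+ 2 * nu ^+ 2 = (3 * nu * q) ^+ 2); last by ring.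
  by rewrite lerXn2r ?nnegrE ?mulr_ge0 ?(ltW nu0) ?(ltW q0) ?(ltW h).
by rewrite ExZ// mulrC ler_wpM2r ?expR_ge0.
Qed.

Let conc_poly (I : finType) (f : I -> p.-tuple R -> R) (b v tau : R) :
  (forall i, measurable_fun [set: p.-tuple R] (f i)) -> 0 < b ->
  (forall i, intg P (fun t => f i (X i1 t))) ->
  (forall i, intg P (fun t => f i (X i1 t) ^+ 2) /\ Ex P (fun t => f i (X i1 t) ^+ 2) <= v) ->
  v / b <= tau / 2 -> 6 * q ^+ 2 <= n%:R * tau / (2 * b) ->
  (forall i (u : p.-tuple R), (forall k, `|tnth u k| <= 3 * nu * q) -> `|f i u| <= b) ->
  exists B : set T, [/\ measurable B, (P B <= (#|I|%:R * (2 * expR (- (6 * q ^+ 2))))%:E)%E &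
    forall t, ~ B t -> (forall i k, `|rvcoord (X i) k t| <= 3 * nu * q) ->
    forall i, `|n%:R^-1 * \sum_l f i (X l t) - Ex P (fun t => f i (X i1 t))| <= tau].
Proof.
move=> mf b0 if1 if2 vb hexp hb.
pose A i := [set t | tau < `|n%:R^-1 * \sum_l f i (X l t) - Ex P (fun t => f i (X i1 t))| /\
                      forall l, `|f i (X l t)| <= b].
have HA i : measurable (A i) /\ (P (A i) <= (2 * expR (- (6 * q ^+ 2)))%:E)%E.
  have [mA PA] := conc indX idX (mf i) b0 (if1 i) (if2 i).1 (if2 i).2 vb.
  split => //; apply: (le_trans PA); rewrite lee_fin ler_pM2l// ler_expR lerN2.
  exact: hexp.
have [mU PU] := union_bound (fun i => (HA i).1) (fun i => (HA i).2).
exists [set t | exists i, A i t]; split => // t nB hx i.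
rewrite leNgt; apply/negP => h; apply: nB; exists i; split => // l.
by apply: hb => k; exact: hx.
Qed.

Let x2_le (j k : 'I_p) (u : p.-tuple R) : (forall k, `|tnth u k| <= 3 * nu * q) ->
  `|tnth u j * tnth u k| <= (3 * nu * q) ^+ 2.
Proof. by move=> h; rewrite normrM expr2; apply: ler_pM. Qed.

(** There are four bad events of probability at most 2 eps each: a coordinate above 3 nu q, or a
    deviating average of products of degree one, two or four. *)
Lemma good_event : exists E : set T, [/\ measurable E, (P (~` E) <= (8 * eps)%:E)%E &
  forall t, E t -> good_sample (data X t) (c * eps ^+ 2 / (q ^+ 4 * nu)) (c * eps ^+ 2 / q ^+ 4)].
Proof.
have b10 : 0 < nu ^+ 3 * q ^+ 6 / eps ^+ 3 by rewrite divr_gt0 ?mulr_gt0 ?exprn_gt0.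
have b20 : 0 < nu ^+ 4 * q ^+ 6 / eps ^+ 3 by rewrite divr_gt0 ?mulr_gt0 ?exprn_gt0.
have tn k := @measurable_tnth _ (measurableTypeR R) p k.
have [m0 P0] := union_bound (fun ik : 'I_n * 'I_p => (coord_tail ik.1 ik.2).1)
  (fun ik : 'I_n * 'I_p => (coord_tail ik.1 ik.2).2).
set B0 := [set t | _] in m0 P0.
have [B1 [mB1 P1 H1]] := @conc_poly _ (fun (k : 'I_p) u => tnth u k) _ _
  (c * eps ^+ 2 / (q ^+ 4 * nu)) (fun k => tn k) b10 (fun k => (m1 k).1) m2
  (gp_var1 nu0 q1 e0 c2 c0) (gp_exponent1 nu0 q1 e0 c12 hn2)
  (fun k u h => le_trans (h k) (gp_trunc nu1 q1 e0 e5 (isT : (0 < 4)%N))).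
have f2m (jk : 'I_p * 'I_p) : intg P (fun t => (x jk.1 t * x jk.2 t) ^+ 2) /\
    Ex P (fun t => (x jk.1 t * x jk.2 t) ^+ 2) <= C * nu ^+ 2.
  have E t : (x jk.1 t * x jk.2 t) ^+ 2 = x jk.1 t * x jk.2 t * x jk.1 t * x jk.2 t by ring.
  have ii : intg P (fun t => (x jk.1 t * x jk.2 t) ^+ 2).
    by under [X in intg _ X]eq_fun do rewrite E; exact: i4.
  split => //.
  have ig := intgZ 2^-1 (intgD (m4 jk.1).1 (m4 jk.2).1).
  have le t : (x jk.1 t * x jk.2 t) ^+ 2 <= 2^-1 * (x jk.1 t ^+ 4 + x jk.2 t ^+ 4).
    rewrite exprMn; have := sqr_ge0 (x jk.1 t ^+ 2 - x jk.2 t ^+ 2); lra.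
  apply: (le_trans (Ex_le ii ig le)); rewrite ExZ; last exact: intgD (m4 jk.1).1 (m4 jk.2).1.
  rewrite ExD; [|exact: (m4 _).1|exact: (m4 _).1].
  have := (m4 jk.1).2; have := (m4 jk.2).2; lra.
have [B2 [mB2 P2 H2]] := @conc_poly _ (fun (jk : 'I_p * 'I_p) u => tnth u jk.1 * tnth u jk.2) _ _
  (c * eps ^+ 2 / (q ^+ 4 * nu)) (fun jk => measurable_funM (tn jk.1) (tn jk.2)) b10
  (fun jk => i2 jk.1 jk.2) f2m
  (gp_var1 nu0 q1 e0 c2 c0) (gp_exponent1 nu0 q1 e0 c12 hn2)
  (fun jk u h => le_trans (x2_le jk.1 jk.2 h) (gp_trunc nu1 q1 e0 e5 (isT : (1 < 4)%N))).
pose f4 (s : 'I_p * 'I_p * 'I_p * 'I_p) (u : p.-tuple R) : R :=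
  tnth u s.1.1.1 * tnth u s.1.1.2 * tnth u s.1.2 * tnth u s.2.
have f4mm s : measurable_fun [set: p.-tuple R] (f4 s).
  by do 3! (apply: measurable_funM; last exact: tn); exact: tn.
have f4m s : intg P (fun t => f4 s (X i1 t) ^+ 2) /\ Ex P (fun t => f4 s (X i1 t) ^+ 2) <= C * nu ^+ 4.
  case: s => [[[a b] c'] e'].
  have ig : intg P (fun t => 4^-1 * (`|x a t| ^+ 8 + `|x b t| ^+ 8 + `|x c' t| ^+ 8 + `|x e' t| ^+ 8)).
    by apply: intgZ; apply: intgD; [apply: intgD; [apply: intgD|]|]; exact: (m8 _).1.
  have le t : f4 (a, b, c', e') (X i1 t) ^+ 2 <=
      4^-1 * (`|x a t| ^+ 8 + `|x b t| ^+ 8 + `|x c' t| ^+ 8 + `|x e' t| ^+ 8).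
    rewrite /f4 /= !exprMn -/(x a t) -/(x b t) -/(x c' t) -/(x e' t).
    have E (z : R) : `|z| ^+ 8 = (z ^+ 2) ^+ 4.
      by rewrite -exprM -normrX ger0_norm// -[8%N]/(2 * 4)%N exprM exprn_ge0 ?sqr_ge0.
    rewrite !E [leRHS]mulrC; apply: le_trans (prod4_le _ _ _ _); exact: ler_norm.
  have ii : intg P (fun t => f4 (a, b, c', e') (X i1 t) ^+ 2).
    apply: (intg_le _ _ ig) => [|t]; last by rewrite ger0_norm ?sqr_ge0.
    apply: measurable_funX; apply: (measurableT_comp (f4mm _)); exact: measurable_funPT.
  split => //; apply: (le_trans (Ex_le ii ig le)).
  have j1 := intgD (m8 a).1 (m8 b).1; have j2 := intgD j1 (m8 c').1; have j3 := intgD j2 (m8 e').1.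
  rewrite ExZ//; rewrite ExD//; last exact: (m8 e').1.
  rewrite ExD//; last exact: (m8 c').1.
  rewrite ExD; [|exact: (m8 _).1|exact: (m8 _).1].
  have := (m8 a).2; have := (m8 b).2; have := (m8 c').2; have := (m8 e').2; lra.
have f4b s u : (forall k, `|tnth u k| <= 3 * nu * q) -> `|f4 s u| <= nu ^+ 4 * q ^+ 6 / eps ^+ 3.
  move=> h; apply: le_trans (gp_trunc nu1 q1 e0 e5 (isT : (3 < 4)%N)).
  rewrite /f4 !normrM (_ : _ ^+ 4 = 3 * nu * q * (3 * nu * q) * (3 * nu * q) * (3 * nu * q)); last by ring.
  by do 3! (apply: ler_pM; rewrite ?mulr_ge0//).
have [B3 [mB3 P3 H3]] := @conc_poly _ f4 _ _ (c * eps ^+ 2 / q ^+ 4) f4mm b20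
  (fun s => i4 _ _ _ _) f4m (gp_var2 nu0 q1 e0 c2 c0) (gp_exponent2 nu0 q1 e0 c12 hn2) f4b.
pose B := B0 `|` (B1 `|` (B2 `|` B3)).
have mB : measurable B by apply: measurableU => //; apply: measurableU => //; exact: measurableU.
exists (~` B); split; first exact: measurableC.
  rewrite setCK.
  have PB : (P B <= P B0 + (P B1 + (P B2 + P B3)))%E.
    apply: (le_trans (measureU2 P m0 (measurableU _ _ mB1 (measurableU _ _ mB2 mB3)))).
    rewrite leeD2l//; apply: (le_trans (measureU2 P mB1 (measurableU _ _ mB2 mB3))).
    rewrite leeD2l//; exact: measureU2.
  apply: (le_trans PB); apply: (le_trans (leeD P0 (leeD P1 (leeD P2 P3)))).
  rewrite -!EFinD lee_fin !card_prod !card_ord.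
  have n1 : (1 <= n)%N by rewrite (leq_ltn_trans (leq0n i1)).
  have pE : p%:R <= expR (q ^+ 2) :> R.
    by apply: le_trans hnp; rewrite ler_nat leq_pmull.
  have q2 := sqr_ge0 q.
  (* A family of at most exp (k q^2) events, each of probability 2 exp (- m q^2), costs at most 2
     exp (- q^2) when k < m. The p^4 fourth order moments fix the exponent 6. *)
  have G (k m : nat) (z : R) : 0 <= z -> z <= expR (q ^+ 2) ^+ k -> (k + 1 <= m)%N ->
      z * (2 * expR (- (m%:R * q ^+ 2))) <= 2 * eps.
    move=> z0 zk km; rewrite mulrCA ler_pM2l//; apply: le_trans he.
    apply: (@le_trans _ _ (expR (q ^+ 2) ^+ k * expR (- (m%:R * q ^+ 2)))).
      by rewrite ler_wpM2r ?expR_ge0.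
    rewrite -expRM_natl -expRD ler_expR.
    have : ((k + 1)%:R : R) * q ^+ 2 <= m%:R * q ^+ 2 by rewrite ler_wpM2r// ler_nat.
    by rewrite natrD; lra.
  have pk k : p%:R ^+ k <= expR (q ^+ 2) ^+ k.
    by rewrite lerXn2r ?nnegrE ?expR_ge0.
  have g0 := G 1%N 9%N (n * p)%:R (ler0n _ _) hnp isT.
  have g1 := G 1%N 6%N p%:R (ler0n _ _) pE isT.
  have g2 := G 2%N 6%N (p * p)%:R (ler0n _ _).
  have g4 := G 4%N 6%N (p * p * p * p)%:R (ler0n _ _).
  have h2 : (p * p)%:R <= expR (q ^+ 2) ^+ 2 by rewrite natrM -expr2; exact: pk.
  have h4 : (p * p * p * p)%:R <= expR (q ^+ 2) ^+ 4.
    by rewrite !natrM (_ : _ * _ = p%:R ^+ 4); [exact: (pk 4%N)|ring].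
  have := g2 h2 isT; have := g4 h4 isT; move: g0 g1.
  move: ((n * p)%:R * _) (p%:R * _) ((p * p)%:R * _) ((p * p * p * p)%:R * _) => w1 w2 w3 w4.
  lra.
move=> t nB.
have hx i k : `|rvcoord (X i) k t| <= 3 * nu * q.
  by rewrite leNgt; apply/negP => h; apply: nB; left; exists (i, k).
have nB1 : ~ B1 t by move=> h; apply: nB; right; left.
have nB2 : ~ B2 t by move=> h; apply: nB; right; right; left.
have nB3 : ~ B3 t by move=> h; apply: nB; right; right; right.
have dE i k : data X t i k 0 = tnth (X i t) k by rewrite /data mxE.
split=> [k|j k|a b c' e'].
- have := H1 t nB1 hx k; rewrite -/(Ex P (x k)) (m1 k).2 subr0 /smean.
  by under eq_bigr do rewrite -dE.
- have := H2 t nB2 hx (j, k); rewrite /smom2 /pop2 /=.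
  by under eq_bigr do rewrite -!dE.
- have := H3 t nB3 hx (a, b, c', e'); rewrite /smom4 /pop4 /f4 /=.
  by under eq_bigr do rewrite -!dE.
Qed.

End GoodEvent.

(** * The bootstrap quantile *)

Section Levels.
Context {d : measure_display} {T : measurableType d} {R : realType} (P : probability T R).
Context {J : finType}.
Variable Z : T -> J -> R.
Hypothesis mZ : forall j, measurable_fun [set: T] (Z^~ j).

Definition below (s : R) : set T := [set t | forall j, Z t j <= s].
Definition cdf (s : R) : R := fine (P (below s)).

Lemma measurable_below s : measurable (below s).
Proof. exact: (measurable_orthant (fun=> s) mZ). Qed.

Lemma cdfE s : P (below s) = (cdf s)%:E.
Proof. by rewrite /cdf fineK// fin_num_measure//; exact: measurable_below. Qed.

Lemma cdf_le s s' : s <= s' -> cdf s <= cdf s'.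
Proof.
move=> ss'; rewrite -lee_fin -!cdfE; apply: le_measure; rewrite ?inE; try exact: measurable_below.
by move=> t h j; apply: le_trans ss'.
Qed.

(** The events below the grid levels increase to the whole space, so continuity from below
    applies. *)
Lemma cdf_level (q Dl : R) : q < 1 -> 0 < Dl -> exists k : nat, q <= cdf (k%:R * Dl).
Proof.
move=> q1 D0.
pose F (k : nat) := below (k%:R * Dl).
have mF k : measurable (F k) by exact: measurable_below.
have ndF : nondecreasing_seq F.
  move=> k l kl; apply/subsetPset => t h j; apply: (le_trans (h j)).
  by rewrite ler_wpM2r ?(ltW D0)// ler_nat.
have UF : \bigcup_k F k = [set: T].
  apply/seteqP; split=> // t _.
  pose m := \sum_j `|Z t j| / Dl.
  have m0 : 0 <= m by apply: sumr_ge0 => j _; rewrite divr_ge0// ltW.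
  exists (Num.truncn m).+1 => // j.
  rewrite -ler_pdivrMr//; apply: (@le_trans _ _ m); last by rewrite ltW// truncnS_gt.
  rewrite /m (bigD1 j)//= ler_wpDr//; last by rewrite ler_wpM2r ?invr_ge0 ?(ltW D0)// ler_norm.
  by apply: sumr_ge0 => j' _; rewrite divr_ge0// ltW.
have cv : P (F k) @[k --> \oo] --> 1%E.
  rewrite -(probability_setT P) -UF.
  exact: (nondecreasing_cvg_mu (mu := P) mF (bigcup_measurable (fun k _ => mF k)) ndF).
have [k _ Hk] : \forall k \near \oo, (q%:E < P (F k))%E.
  by apply: (cv [set y | (q%:E < y)%E]); apply: open_nbhs_nbhs; split; [exact: open_ereal_gt_ereal|rewrite /= lte_fin].
exists k; rewrite -lee_fin -cdfE; exact: ltW (Hk k (leqnn k)).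
Qed.

End Levels.

(* [cdf Z] and [cdf (W x)] play the roles of the law of the statistic and of
   its bootstrap approximation at the sample x; the set [A x] collects the
   admissible levels, whose infimum is the bootstrap quantile. *)
Section QuantileTransfer.
Context {d : measure_display} {T : measurableType d} {R : realType} (P : probability T R).
Context {J : finType}.
Variables (j0 : J) (neg : J -> J).
Variables (Z : T -> J -> R) (W : T -> T -> J -> R).
Hypothesis mZ : forall j, measurable_fun [set: T] (Z^~ j).
Hypothesis mW : forall x j, measurable_fun [set: T] ((W x)^~ j).
Hypothesis Zneg : forall t j, Z t (neg j) = - Z t j.
Variables (E : set T) (dlt eta kap Dl rt al : R).
Hypotheses (mE : measurable E) (PE : (P (~` E) <= dlt%:E)%E).
Hypotheses (Dl0 : 0 < Dl) (eta0 : 0 <= eta) (kap0 : 0 <= kap) (rt0 : 0 < rt) (al01 : 0 < al < 1).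
Hypothesis close : forall x s, E x -> `|cdf P Z s - cdf P (W x) s| <= eta.
Hypothesis anti : forall x s y, E x -> 0 < y -> cdf P (W x) (s + y) <= cdf P (W x) s + kap * y.

(** No continuity of the law of Z is used: its level 1 - al - eta is located on a grid of mesh Dl,
    and the anti-concentration of W at one fixed good sample bounds the mass between neighbouring
    grid points. *)
Lemma quantile_transfer : exists E' : set T,
  [/\ measurable E', E' `<=` E,
    ((1 - al - (dlt + 3 * eta + 2 * kap * Dl))%:E <= P E')%E &
    forall x, E' x -> forall j,
      Z x j + Dl <= rt * inf [set s | 1 - al <= cdf P (W x) (rt * s)]].
Proof.
have [triv|pos] := leP (1 - al - (dlt + 3 * eta + 2 * kap * Dl)) 0.
  by exists set0; split => //; rewrite measure0 lee_fin.
have d0 : 0 <= dlt by rewrite -lee_fin (le_trans _ PE).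
have kD0 : 0 <= kap * Dl by rewrite mulr_ge0// ltW.
have [al_0 al_1] := andP al01; have et0 := eta0.
have q1 : 1 - al - eta < 1 by lra.
have q0 : 0 < 1 - al - eta by move: pos; lra.
have ex := cdf_level P mZ q1 Dl0.
(* If there were no good sample, dlt would be at least 1, against [pos]. *)
have [x0 Ex0] : exists x, E x.
  have [//|/forallNP h] := pselect (exists x, E x); have E0 : ~` E = [set: T].
    by apply/seteqP; split=> // t _ Et; exact: h Et.
  by move: PE; rewrite E0 probability_setT lee_fin; lra.
pose k := ex_minn ex.
have [Hk kmin] : 1 - al - eta <= cdf P Z (k%:R * Dl) /\
    forall m : nat, 1 - al - eta <= cdf P Z (m%:R * Dl) -> (k <= m)%N.
  by rewrite /k; case: ex_minnP.
(* One mesh below the first grid point reaching the level: cdf Z is below 1 - al - eta there, so no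
   bootstrap level under t0 is admissible at a good sample. *)
pose t0 := k%:R * Dl - Dl.
have Ht0 : cdf P Z t0 < 1 - al - eta.
  (* If k = 0 then t0 is negative, and Z j and - Z j cannot both lie below it. *)
  case: (posnP k) => k0.
    rewrite (_ : cdf P Z t0 = 0)//; rewrite /cdf (_ : below Z t0 = set0) ?measure0//.
    apply/seteqP; split=> // t h; have := h j0; have := h (neg j0).
    rewrite Zneg /t0 k0 mul0r sub0r; move: Dl0; lra.
  rewrite ltNge; apply/negP => h; have := kmin k.-1; rewrite -subn1 natrB// mulrBl mul1r => /(_ h).
  by rewrite leqNgt subn1 prednK ?leqnn.
(* The second mesh leaves room for the linearization error, and makes the total loss 2 Dl in
   [anti]. *)
pose E' := E `&` below Z (t0 - Dl).
have mE' : measurable E' by apply: measurableI => //; exact: measurable_below.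
exists E'; split => //; first by move=> t [].
- have h1 := close (k%:R * Dl) Ex0; have h2 := close (t0 - Dl) Ex0.
  have h3 := @anti x0 (t0 - Dl) (2 * Dl) Ex0 (mulr_gt0 (ltr0n _ 2) Dl0).
  rewrite (_ : t0 - Dl + 2 * Dl = k%:R * Dl) in h3; last by rewrite /t0; ring.
  have lo : 1 - al - 3 * eta - 2 * kap * Dl <= cdf P Z (t0 - Dl).
    move: h1 h2 h3 Hk; rewrite !ler_norml => /andP[? ?] /andP[? ?]; lra.
  have up : (P (below Z (t0 - Dl)) <= P E' + P (~` E))%E.
    apply: (@le_trans _ _ (P (E' `|` ~` E))).
      apply: le_measure; rewrite ?inE; [exact: measurable_below|by apply: measurableU => //; exact: measurableC|].
      by move=> t h; have [Et|nE] := pselect (E t); [left|right].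
    by apply: measureU2 => //; exact: measurableC.
  have up2 : ((cdf P Z (t0 - Dl))%:E <= P E' + dlt%:E)%E.
    by rewrite -(cdfE P mZ); apply: (le_trans up); rewrite leeD2l.
  rewrite -(fineK (x := P E')) ?fin_num_measure// in up2 *.
  by move: up2; rewrite -EFinD !lee_fin; move: lo; lra.
- move=> x [Ex hx] j; apply: (@le_trans _ _ t0); first by have := hx j; lra.
  rewrite -ler_pdivrMl//; apply: lb_le_inf.
    have [m hm] := cdf_level P (mW x) (ltac:(lra) : 1 - al < 1) rt0.
    by exists m%:R; rewrite /= mulrC.
  move=> s /= hs; rewrite ler_pdivrMl//.
  rewrite leNgt; apply/negP => st; have := cdf_le P mZ (ltW st).
  have := close (rt * s) Ex; rewrite ler_norml => /andP[? ?]; move: Ht0; lra.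
Qed.

End QuantileTransfer.

Section BootArith.
Context {R : realFieldType}.
Implicit Types nu mu q eps c C : R.

Lemma boot_cov_arith nu q eps c C (N w : R) : 1 <= nu -> 1 <= q -> 0 < eps -> eps <= 1 ->
  1 <= C -> 12 * C * eps <= c -> 4 * (24 * C + 73) * c <= w -> w <= 1 ->
  N = (nu ^+ 2 * q ^+ 7 / eps ^+ 3) ^+ 2 ->
  2 * (c * eps ^+ 2 / q ^+ 4 + 24 * ((C + 3) * (c * eps ^+ 2 / (q ^+ 4 * nu) * nu))) +
    8 * C ^+ 2 * (nu ^+ 2 / N) <= eps ^+ 2 / q ^+ 4 * w.
Proof.
move=> nu1 q1 e0 e1 C1 hc hC w1 ->.
have nu0 : 0 < nu by apply: lt_le_trans nu1.
have q0 : 0 < q by apply: lt_le_trans q1.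
have C0 : 0 < C by apply: lt_le_trans C1.
rewrite (_ : 2 * _ = eps ^+ 2 / q ^+ 4 * (2 * (24 * C + 73) * c)); last by field; rewrite !gt_eqF.
rewrite (_ : 8 * C ^+ 2 * _ = eps ^+ 2 / q ^+ 4 * (8 * (C * eps) ^+ 2 * (eps ^+ 2 / (nu ^+ 2 * q ^+ 10)))); last by field; rewrite !gt_eqF.
rewrite -mulrDr ler_wpM2l ?divr_ge0 ?exprn_ge0 ?(ltW e0) ?(ltW q0)//.
have h1 : eps ^+ 2 / (nu ^+ 2 * q ^+ 10) <= 1.
  rewrite ler_pdivrMr ?mulr_gt0 ?exprn_gt0// mul1r.
  apply: (@le_trans _ _ 1); first by rewrite exprn_ile1 ?(ltW e0).
  by rewrite -[leLHS]mulr1; apply: ler_pM => //; exact: exprn_ege1.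
have Ce0 : 0 <= C * eps by rewrite mulr_ge0 ?ltW.
have z : 8 * (C * eps) ^+ 2 * (eps ^+ 2 / (nu ^+ 2 * q ^+ 10)) <= 8 * (C * eps) ^+ 2.
  by rewrite ler_piMr// mulr_ge0 ?exprn_ge0.
have c0 : 0 <= c by apply: le_trans hc; rewrite !mulr_ge0 ?ltW.
have Cc : 24 * c <= 24 * C * c by rewrite ler_wpM2r// ler_peMr.
apply: (le_trans (lerD (lexx _) z)).
have Ce : C * eps <= c / 12 by move: hc; rewrite -mulrA; move: (C * eps) => v; lra.
have cw : 388 * c <= w.
  apply: le_trans hC; rewrite (_ : 4 * _ * c = 4 * (24 * C * c) + 292 * c); last by ring.
  by move: Cc; move: (24 * C * c) => v; lra.
have v : (C * eps) ^+ 2 <= c / 12.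
  rewrite expr2 -[leRHS]mulr1; apply: ler_pM => //; apply: (le_trans Ce).
  by clear -cw w1 c0; lra.
have y : 2 * (24 * C + 73) * c = 2^-1 * (4 * (24 * C + 73) * c) by field.
rewrite y; move: (4 * _ * c) ((C * eps) ^+ 2) hC v => A B hA hB.
by clear -hA hB cw c0; lra.
Qed.

Lemma boot_frac_le q eps (K : R) : 1 <= q -> 0 < eps -> eps <= 1 -> 1 <= K ->
  eps ^+ 2 / (K * q ^+ 4) <= eps.
Proof.
move=> q1 e0 e1 K1; have q0 : 0 < q by apply: lt_le_trans q1.
have K0 : 0 < K by apply: lt_le_trans K1.
rewrite ler_pdivrMr ?mulr_gt0 ?exprn_gt0// expr2 ler_wpM2l ?(ltW e0)//.
apply: (le_trans e1); rewrite -[leLHS]mulr1; apply: ler_pM => //; exact: exprn_ege1.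
Qed.

(** Sqrt n times the linearization error of the sample covariance fits into the mesh (2 C + 4) eps /
    q, whose mass under a Gaussian law with density of order q is of order eps. *)
Lemma boot_shift_arith nu q eps c C (r : R) : 1 <= nu -> 1 <= q -> 0 < eps -> eps <= 1 ->
  1 <= C -> 0 <= c <= 1 ->
  r = nu ^+ 2 * q ^+ 7 / eps ^+ 3 ->
  r * (2 / r ^+ 2 * ((C + 1) * nu) + 2 * (c * eps ^+ 2 / (q ^+ 4 * nu)) ^+ 2) <=
  (2 * C + 4) * eps / q.
Proof.
move=> nu1 q1 e0 e1 C1 /andP[c0 c1] ->.
have nu0 : 0 < nu by apply: lt_le_trans nu1.
have q0 : 0 < q by apply: lt_le_trans q1.
have C0 : 0 < C by apply: lt_le_trans C1.
rewrite (_ : _ * (_ + _) = eps / q * (2 * (C + 1) * (eps ^+ 2 / (nu * q ^+ 6)) + 2 * c ^+ 2)); last by field; rewrite !gt_eqF.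
rewrite (_ : (2 * C + 4) * eps / q = eps / q * (2 * (C + 1) * 1 + 2 * 1)); last by field; rewrite gt_eqF.
rewrite ler_wpM2l ?divr_ge0 ?(ltW e0) ?(ltW q0)//; apply: lerD; last first.
  by rewrite ler_wpM2l// exprn_ile1.
rewrite ler_wpM2l ?mulr_ge0 ?addr_ge0 ?(ltW C0)//.
rewrite ler_pdivrMr ?mulr_gt0 ?exprn_gt0// mul1r.
apply: (@le_trans _ _ 1); first by rewrite exprn_ile1 ?(ltW e0).
by rewrite -[leLHS]mulr1; apply: ler_pM => //; exact: exprn_ege1.
Qed.

End BootArith.

(** * From a good sample to the bootstrap quantile *)

Section BootstrapEvent.
Context {d : measure_display} {T : measurableType d} {R : realType} (P : probability T R).
Context {n p : nat}.
Variables (X : 'I_n -> {RV P >-> p.-tuple R}) (i1 : 'I_n) (e : 'I_n -> {RV P >-> R}).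
Hypotheses (n4 : (4 <= n)%N) (p0 : (0 < p)%N).
Hypotheses (indX : mutually_independent X) (idX : identically_distributed X).
Hypotheses (indE : mutually_independent e) (stdE : forall i, standard_normal (e i)).
Variables nu mu q eps c C C1 K6 K8 kappa L al : R.
Hypotheses (mu1 : 1 <= mu) (nuE : nu = mu ^+ 3).
Hypothesis hmean : forall k, mean_zero P (rvcoord (X i1) k).
Hypothesis hsub : forall i k, subgaussian P (nu ^+ 2) (rvcoord (X i) k).
Hypothesis h6 : forall k, intg P (fun t => `|rvcoord (X i1) k t| ^+ 6) /\
  Ex P (fun t => `|rvcoord (X i1) k t| ^+ 6) <= K6 * mu ^+ 6.
Hypothesis h8 : forall k, intg P (fun t => `|rvcoord (X i1) k t| ^+ 8) /\
  Ex P (fun t => `|rvcoord (X i1) k t| ^+ 8) <= K8 * nu ^+ 4.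
Hypotheses (C6 : 1 + K6 <= C) (C8 : K8 <= C) (Cge1 : 1 <= C) (C10 : 0 < C1).
Hypothesis hGamma : forall j k, (C1%:E <= Gamma (X i1) (j, k) (j, k))%E.
Hypotheses (q1 : 1 <= q) (e0 : 0 < eps) (e5 : 5 * eps <= 1) (eC1 : eps <= C1).
Hypotheses (hc : 12 * C * eps <= c) (hcC : 4 * (24 * C + 73) * c <= 4800^-1).
Hypothesis hn : Num.sqrt n%:R = nu ^+ 2 * q ^+ 7 / eps ^+ 3.
Hypothesis hnp : (n * p)%:R <= expR (q ^+ 2).
Hypothesis he : expR (- q ^+ 2) <= eps.
Hypothesis hJ : ln (4 * (p * p)%:R) <= 2 * q ^+ 2.
Hypothesis hL : L = 192 * C ^+ 3 + 2 * expR (C ^+ 2).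
Hypotheses (hk : 0 < kappa <= 64^-1) (hkL : 16000 * expR 2 * kappa ^+ 3 * L <= 8^-1).
Hypothesis al01 : 0 < al < 1.

Local Notation J := ('I_p * 'I_p * bool)%type.

Let nu1 : 1 <= nu. Proof. by rewrite nuE exprn_ege1. Qed.
Let mu0 : 0 < mu. Proof. exact: lt_le_trans mu1. Qed.
Let nu0 : 0 < nu. Proof. exact: lt_le_trans nu1. Qed.
Let q0 : 0 < q. Proof. exact: lt_le_trans q1. Qed.
Let C0 : 0 < C. Proof. exact: lt_le_trans Cge1. Qed.
Let c0 : 0 < c.
Proof. by apply: lt_le_trans hc; rewrite !mulr_gt0. Qed.
Let c1 : c <= 1.
Proof.
have h : c <= 4 * (24 * C + 73) * c.
  by rewrite ler_peMl ?(ltW c0)//; move: Cge1; lra.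
by apply: (le_trans h); apply: (le_trans hcC); rewrite invf_le1 ?ltr0n// ler1n.
Qed.
Let eps1 : eps <= 1. Proof. by move: e5 e0; lra. Qed.
Let rt := Num.sqrt n%:R : R.
Let rt0 : 0 < rt. Proof. by rewrite sqrtr_gt0 ltr0n (leq_trans _ n4). Qed.
Let rt2 : rt ^+ 2 = n%:R. Proof. by rewrite sqr_sqrtr. Qed.
Let tau := c * eps ^+ 2 / (q ^+ 4 * nu).
Let tau2 := c * eps ^+ 2 / q ^+ 4.

Let tau201 : 0 <= tau2 <= 1.
Proof.
rewrite /tau2 divr_ge0 ?mulr_ge0 ?exprn_ge0 ?(ltW c0) ?(ltW e0) ?(ltW q0)//=.
rewrite ler_pdivrMr ?exprn_gt0// mul1r (@le_trans _ _ 1)//; last by rewrite exprn_ege1.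
rewrite -[leRHS]mulr1; apply: ler_pM; rewrite ?exprn_ge0 ?(ltW c0) ?(ltW e0)//.
by rewrite exprn_ile1// ltW.
Qed.

Let tau01 : 0 <= tau <= 1.
Proof.
rewrite /tau invfM mulrA -/tau2; case/andP: tau201 => h1 h2.
rewrite divr_ge0 ?(ltW nu0)//= ler_pdivrMr// mul1r; exact: le_trans nu1.
Qed.

Let m2 := mom2 mu1 h6 C6.
Let m4 := mom4 mu1 h6 C6.
Let hSg := pop2_le mu1 h6 C6.
Let hQ := pop4_le mu1 h6 C6.

Let xiv := xivec (X i1).

Lemma bcoef_cov_good (y : 'I_n -> 'cV[R]_p) (j k : J) : good_sample X i1 y tau tau2 ->
  `|Ex P (fun t => xiv (X i1 t) j * xiv (X i1 t) k) - \sum_i bcoef y i j * bcoef y i k| <=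
  eps ^+ 2 / (4800 * q ^+ 4).
Proof.
move=> [g1 g2 g3].
have E : Ex P (fun t => xiv (X i1 t) j * xiv (X i1 t) k) =
    (-1) ^+ j.2 * (-1) ^+ k.2 *
    (pop4 (X i1) j.1.1 j.1.2 k.1.1 k.1.2 - pop2 (X i1) j.1.1 j.1.2 * pop2 (X i1) k.1.1 k.1.2).
  exact: (xivec_cov mu1 h6 C6).
rewrite distrC E.
apply: (le_trans (bcoef_cov n4 tau01 tau201 mu1 Cge1 g1 g2 g3 hSg hQ j k)).
rewrite (_ : eps ^+ 2 / (_ * q ^+ 4) = eps ^+ 2 / q ^+ 4 * 4800^-1); last by rewrite invfM mulrCA mulrC.
have k1 : 4800^-1 <= 1 :> R by rewrite invf_le1 ?ltr0n// ler1n.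
apply: le_trans (boot_cov_arith nu1 q1 e0 eps1 Cge1 hc hcC k1 (N := n%:R) _); last by rewrite -hn sqr_sqrtr.
rewrite -nuE lerD2l ler_wpM2l ?mulr_ge0 ?exprn_ge0 ?(ltW C0)//.
rewrite ler_wpM2r ?invr_ge0// nuE -exprM ler_weXn2l//.
Qed.

Let s0 := Num.sqrt C1.
Let s00 : 0 < s0. Proof. by rewrite sqrtr_gt0. Qed.
Let sY := 2 * C * mu ^+ 2.

(** The population variance is at least 4 C1 and the error at most eps <= C1, so C1 remains; above,
    the population fourth moment dominates. *)
Lemma bcoef_var_good (y : 'I_n -> 'cV[R]_p) (j : J) : good_sample X i1 y tau tau2 ->
  s0 ^+ 2 <= var (fun i => bcoef y i j) <= sY ^+ 2.
Proof.
move=> g; have h := bcoef_cov_good j j g.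
have E : \sum_i bcoef y i j * bcoef y i j = var (fun i => bcoef y i j) by [].
have EV : Ex P (fun t => xiv (X i1 t) j * xiv (X i1 t) j) =
    pop4 (X i1) j.1.1 j.1.2 j.1.1 j.1.2 - pop2 (X i1) j.1.1 j.1.2 * pop2 (X i1) j.1.1 j.1.2.
  rewrite (_ : Ex P _ = (-1) ^+ j.2 * (-1) ^+ j.2 *
    (pop4 (X i1) j.1.1 j.1.2 j.1.1 j.1.2 - pop2 (X i1) j.1.1 j.1.2 * pop2 (X i1) j.1.1 j.1.2)).
    by rewrite -expr2 sqrr_sign mul1r.
  exact: (xivec_cov mu1 h6 C6).
have lo := xivec_var mu1 hmean h6 C6 hGamma j.1.1 j.1.2.
rewrite E EV in h; move: h.
have es : eps ^+ 2 / (4800 * q ^+ 4) <= eps.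
  by apply: boot_frac_le q1 e0 eps1 _; rewrite ler1n.
move: (eps ^+ 2 / _) es => z es.
rewrite sqr_sqrtr ?(ltW C10)// ler_norml => /andP[h1 h2].
apply/andP; split; first by move: eC1 C10; lra.
have up := le_trans (ler_norm _) (hQ j.1.1 j.1.2 j.1.1 j.1.2).
have sq := sqr_ge0 (pop2 (X i1) j.1.1 j.1.2); rewrite expr2 in sq.
have m1 : 1 <= C * mu ^+ 4.
  by rewrite -[leLHS]mulr1; apply: ler_pM => //; exact: exprn_ege1.
have c4 : C * mu ^+ 4 <= C ^+ 2 * mu ^+ 4.
  by rewrite ler_wpM2r ?exprn_ge0 ?(ltW mu0)// expr2 ler_peMl// ltW.
rewrite (_ : sY ^+ 2 = 4 * (C ^+ 2 * mu ^+ 4)); last by rewrite /sY; ring.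
by move: eps1; lra.
Qed.

Let Z (t : T) (j : J) : R := \sum_i rt^-1 * xiv (X i t) j.
Let W (x : T) (t : T) (j : J) : R := gvec e (bcoef (data X x)) t j.

Let mZ j : measurable_fun [set: T] (Z^~ j).
Proof.
apply: measurable_sum => i; apply: measurable_funM => //.
by apply: (measurableT_comp (measurable_xivec _ j)); exact: measurable_funPT.
Qed.

Let mW x j : measurable_fun [set: T] ((W x)^~ j).
Proof. exact: measurable_gvec. Qed.

Let cardJ : #|{: J}| = (p * p * 2)%N.
Proof. by rewrite !card_prod !card_ord card_bool. Qed.

Let j0 : J := (Ordinal p0, Ordinal p0, true).

Let hJ' : ln (2 * #|{: J}|%:R) <= 2 * q ^+ 2.
Proof.
rewrite cardJ (_ : 2 * _ = 4 * (p * p)%:R :> R)//.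
by rewrite natrM; ring.
Qed.

Let Kc := 2160 / (s0 * kappa) + 4001 * 48 * L.

Let L192 : 192 * C ^+ 3 <= L. Proof. by rewrite hL lerDl mulr_ge0 ?expR_ge0. Qed.

(** The sample point x is frozen, so the coefficients [bcoef] are deterministic and the Gaussian
    vector is driven by the multipliers alone. *)
Lemma clt_good x s : good_sample X i1 (data X x) tau tau2 ->
  `|cdf P Z s - cdf P (W x) s| <= Kc * eps.
Proof.
move=> g.
have eps01 : 0 < eps <= 1 by rewrite e0 eps1.
have hne : n%:R <= expR (q ^+ 2).
  by apply: le_trans hnp; rewrite ler_nat leq_pmulr.
have nuE2 : nu ^+ 2 = mu ^+ 6 by rewrite nuE -exprM.
have y3 j : intg P (fun t => `|xiv (X i1 t) j| ^+ 3) /\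
    Ex P (fun t => `|xiv (X i1 t) j| ^+ 3) <= L * nu ^+ 2.
  have [h1 h2] := xivec_cube mu1 nuE h6 C6 Cge1 j; split => //; apply: (le_trans h2).
  rewrite ler_wpM2r ?exprn_ge0 ?(ltW nu0)//; apply: le_trans L192.
  by rewrite ler_wpM2r ?exprn_ge0 ?(ltW C0)// ler_nat.
have yexp j : intg P (fun t => expR (`|xiv (X i1 t) j| / (4 * nu ^+ 2))) /\
    Ex P (fun t => expR (`|xiv (X i1 t) j| / (4 * nu ^+ 2))) <= L.
  have [h1 h2] := xivec_exp mu1 nuE (hsub i1) h6 C6 Cge1 j; split => //; apply: (le_trans h2).
  rewrite hL (@le_trans _ _ (2 * expR (C ^+ 2)))//; last by rewrite lerDr mulr_ge0 ?exprn_ge0 ?(ltW C0).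
  by rewrite ler_pM2l// ler_expR expr2 ler_peMl// ltW.
have sY0 : 0 < sY by rewrite !mulr_gt0// exprn_gt0.
have sY3 : 24 * sY ^+ 3 <= L * nu ^+ 2.
  rewrite (_ : 24 * sY ^+ 3 = 192 * C ^+ 3 * mu ^+ 6); last by rewrite /sY; ring.
  by rewrite nuE2 ler_wpM2r ?exprn_ge0 ?(ltW mu0).
have sYexp : 2 * expR ((4 * nu ^+ 2)^-1 ^+ 2 * sY ^+ 2 / 2) <= L.
  rewrite hL (@le_trans _ _ (2 * expR (C ^+ 2)))//; last by rewrite lerDr mulr_ge0 ?exprn_ge0 ?(ltW C0).
  rewrite ler_pM2l// ler_expR nuE2.
  rewrite (_ : _ / 2 = C ^+ 2 * (1 / (8 * mu ^+ 8))); last by rewrite /sY; field; rewrite gt_eqF.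
  rewrite ler_piMr ?exprn_ge0 ?(ltW C0)// ler_pdivrMr ?mulr_gt0 ?exprn_gt0// mul1r.
  by rewrite -[leLHS]mulr1; apply: ler_pM; rewrite ?ler1n// exprn_ege1.
have A1 j : s0 ^+ 2 <= var ((bcoef (data X x))^~ j) <= sY ^+ 2 by exact: bcoef_var_good.
have A2 j k := bcoef_cov_good j k g.
have Y1 := xivec_mean mu1 h6 C6.
have H2 := @clt _ _ _ P J n _ _ X i1 e j0 indX idX indE stdE xiv (bcoef (data X x))
  (fun j => measurable_xivec (X i1) j) nu q eps kappa L s0 sY nu1 q1 eps01 hk hn hJ' hne he hkL
  Y1 y3 yexp s00 sY0 A1 sY3 sYexp A2 s.
exact: H2.
Qed.

Lemma anti_good x s y : good_sample X i1 (data X x) tau tau2 -> 0 < y ->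
  cdf P (W x) (s + y) <= cdf P (W x) s + 144 * q / s0 * y.
Proof.
move=> g y0; rewrite -lee_fin EFinD -!(cdfE P (mW x)).
have qJ : ln (2 * #|{: J}|%:R) <= (2 * q) ^+ 2.
  apply: (le_trans hJ'); rewrite exprMn ler_pM2r ?exprn_gt0//.
  by rewrite -natrX ler_nat.
have sv j : s0 ^+ 2 <= var (fun i => bcoef (data X x) i j) by case/andP: (bcoef_var_good j g).
have := gvec_shift j0 indE stdE s s00 (mulr_gt0 (ltr0n _ 2) q0) sv qJ y0.
move=> /le_trans; apply; rewrite leeD2l// lee_fin le_eqVlt; apply/orP; left; apply/eqP.
by field; rewrite gt_eqF.
Qed.

Let Dl := (2 * C + 4) * eps / q.

Lemma cov_close_good x m k : good_sample X i1 (data X x) tau tau2 ->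
  rt * `|sample_cov (data X x) m k - cov_mx (X i1) m k| <= Num.max (Z x (m, k, false)) (Z x (m, k, true)) + Dl.
Proof.
move=> [g1 g2 g3]; rewrite (cov_mxE mu1 hmean h6 C6).
set S := sample_cov _ m k; set Sg := pop2 (X i1) m k.
have ZE b : Z x (m, k, b) = (-1) ^+ b * (rt * (smom2 (data X x) m k - Sg)).
  rewrite /Z -mulr_sumr /xiv /xivec /= -mulr_sumr sumrB sumr_const card_ord.
  rewrite -[pop2 _ _ _ *+ n]mulr_natl /smom2.
  under [X in _ = _ * (_ * (_ * X - _))]eq_bigr do rewrite /data !mxE.
  rewrite -rt2 /Sg; field; by rewrite gt_eqF.
have h := sample_cov_close n4 tau01 mu1 Cge1 g1 g2 hSg m k.
rewrite -/S -/Sg -nuE in h.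
have h' : rt * `|S - Sg - (smom2 (data X x) m k - Sg)| <= Dl.
  apply: le_trans (boot_shift_arith nu1 q1 e0 eps1 Cge1 (c := c) _ (r := rt) hn); last by rewrite (ltW c0).
  by rewrite rt2 ler_wpM2l ?(ltW rt0).
have hmax : rt * `|smom2 (data X x) m k - Sg| <= Num.max (Z x (m, k, false)) (Z x (m, k, true)).
  rewrite !ZE expr0 expr1 mul1r mulN1r -[rt in leLHS](ger0_norm (ltW rt0)) -normrM.
  by rewrite le_max; have [z|z] := leP 0 (rt * (smom2 (data X x) m k - Sg));
    [rewrite ger0_norm// lexx|rewrite ltr0_norm// lexx orbT].
apply: le_trans (lerD hmax h'); rewrite -mulrDr ler_wpM2l ?(ltW rt0)//.
by rewrite -{1}(subrK (smom2 (data X x) m k - Sg) (S - Sg)) addrC ler_normD.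
Qed.

(** The constant adds 8 for the good event, 3 Kc for the three comparisons of laws and 2 times 144
    (2 C + 4) / s0 for the two meshes. *)
Lemma bootstrap_event : exists E : set T, [/\ measurable E,
  ((1 - al - (8 + 3 * Kc + 288 * (2 * C + 4) / s0) * eps)%:E <= P E)%E &
  forall x, E x -> mx_max (sample_cov (data X x) - cov_mx (X i1)) <=
    boot_quantile e (data X x) (1 - al)].
Proof.
have m1 := mom1 mu1 hmean h6 C6.
have C2nu : C * mu ^+ 2 <= C * nu ^+ 2.
  by rewrite ler_wpM2l ?(ltW C0)// nuE -exprM ler_weXn2l.
have C4nu : C * mu ^+ 4 <= C * nu ^+ 2.
  by rewrite ler_wpM2l ?(ltW C0)// nuE -exprM ler_weXn2l.
have C8nu : K8 * nu ^+ 4 <= C * nu ^+ 4 by rewrite ler_wpM2r ?exprn_ge0 ?(ltW nu0).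
have [E [mE PE HE]] := good_event indX idX nu1 q1 e0 e5 Cge1 hc hn hnp he m1
  (fun k => conj (m2 k).1 (le_trans (m2 k).2 C2nu)) (fun k => conj (m4 k).1 (le_trans (m4 k).2 C4nu))
  (fun k => conj (h8 k).1 (le_trans (h8 k).2 C8nu)) (intg2 mu1 h6 C6) (intg4 mu1 h6 C6)
  (fun i k => sub_exp (hsub i) k).
have Dl0 : 0 < Dl.
  by rewrite divr_gt0// mulr_gt0// addr_gt0// mulr_gt0.
have Kc0 : 0 <= Kc * eps.
  have [k0 k1] := andP hk.
  have L0 : 0 <= L by apply: le_trans L192; rewrite mulr_ge0 ?exprn_ge0 ?(ltW C0).
  apply: mulr_ge0 (ltW e0); apply: addr_ge0; last first.
    exact: mulr_ge0 (mulr_ge0 (ler0n _ _) (ler0n _ _)) L0.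
  exact: divr_ge0 (ler0n _ _) (mulr_ge0 (ltW s00) (ltW k0)).
have kap0 : 0 <= 144 * q / s0 by exact: divr_ge0 (mulr_ge0 (ler0n _ _) (ltW q0)) (ltW s00).
pose neg (j : J) : J := (j.1, ~~ j.2).
have Zneg t j : Z t (neg j) = - Z t j.
  rewrite /Z -sumrN; apply: eq_bigr => i _; rewrite /xiv /xivec /neg /=.
  by case: j.2; rewrite /= ?expr0 ?expr1; ring.
have [E' [mE' E'E PE' HE']] := quantile_transfer j0 mZ mW Zneg mE PE Dl0 Kc0 kap0 rt0 al01
  (fun x s Ex => clt_good s (HE x Ex)) (fun x s y Ex => @anti_good x s y (HE x Ex)).
exists E'; split => //.
  apply: le_trans PE'; rewrite lee_fin le_eqVlt; apply/orP; left; apply/eqP.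
  rewrite /Dl; field; by rewrite !gt_eqF.
move=> x Ex.
have n2 : (2 <= n)%N by exact: leq_trans n4.
have -> : boot_quantile e (data X x) (1 - al) = inf [set s | 1 - al <= cdf P (W x) (rt * s)].
  rewrite /boot_quantile; congr inf; apply/seteqP; split=> s /=.
    rewrite -lee_fin -(cdfE P (mW x)) => /le_trans; apply; rewrite le_eqVlt; apply/orP; left.
    by apply/eqP; congr (P _); apply/seteqP; split=> t /= /(Tbar_le (data X x) n2 _ _ p0).
  rewrite -lee_fin -(cdfE P (mW x)) => /le_trans; apply; rewrite le_eqVlt; apply/orP; left.
  by apply/eqP; congr (P _); apply/seteqP; split=> t /= /(Tbar_le (data X x) n2 _ _ p0).
have HH := HE' x Ex; have G := HE x (E'E x Ex).
set aa := inf _ in HH *.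
have B m k : rt * `|sample_cov (data X x) m k - cov_mx (X i1) m k| <= rt * aa.
  apply: (le_trans (cov_close_good m k G)); rewrite -lerBrDr ge_max !lerBrDr.
  by rewrite !HH.
have B' m k : `|sample_cov (data X x) m k - cov_mx (X i1) m k| <= aa.
  by have := B m k; rewrite ler_pM2l.
apply: mx_max_le; first exact: le_trans (B' (Ordinal p0) (Ordinal p0)).
by move=> m k; rewrite mxBE.
Qed.

End BootstrapEvent.

(** * Expected size of the bootstrap quantile *)

(** Monotonicity without measurability, from the supremum over simple functions; it is applied to
    the bootstrap quantile as a function of the sample. *)
Lemma ge0_le_integralT (d : measure_display) (T : measurableType d) (R : realType)
    (mu : {measure set T -> \bar R}) (f g : T -> \bar R) :
  (forall t, 0 <= f t)%E -> (forall t, f t <= g t)%E ->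
  (\int[mu]_t f t <= \int[mu]_t g t)%E.
Proof.
move=> f0 fg.
have g0 t : (0 <= g t)%E by exact: le_trans (fg t).
rewrite !ge0_integralTE//; apply: le_ereal_sup => _ [h hf <-].
by exists h => // t; apply: le_trans (fg t); exact: hf.
Qed.

Lemma lin_tail (d : measure_display) (T : measurableType d) (R : realType) (P : probability T R)
    (I : finType) (e : I -> {RV P >-> R}) (c : I -> R) (s v : R) :
  mutually_independent e -> (forall i, standard_normal (e i)) ->
  0 <= s -> 0 < v -> var c <= v ->
  measurable [set t | s < lin e c t] /\
  (P [set t | (s < lin e c t)%R] <= (expR (- (s ^+ 2 / (2 * v))))%:E)%E.
Proof.
move=> indE stdE s0 v0 cv.
have mA : measurable [set t | s < lin e c t].
  by apply: measurable_above; exact: measurable_lin.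
split=> //; have [iL eL] := lin_mgf indE stdE c (s / v).
apply: (markov_le mA (intgZ (expR (- (s / v * s))) iL)).
- by move=> t; rewrite mulr_ge0 ?expR_ge0.
- move=> t /= h; rewrite -expRD -[leLHS]expR0 ler_expR addrC subr_ge0.
  by rewrite ler_wpM2l ?divr_ge0 ?(ltW v0)// ltW.
rewrite ExZ// eL -expRD ler_expR.
have h : (s / v) ^+ 2 * var c / 2 <= (s / v) ^+ 2 * v / 2.
  by rewrite ler_wpM2r// ler_wpM2l ?sqr_ge0.
apply: (le_trans (lerD (lexx _) h)); rewrite le_eqVlt; apply/orP; left; apply/eqP.
by field; rewrite gt_eqF.
Qed.

Section QuantileBound.
Context {d : measure_display} {T : measurableType d} {R : realType} (P : probability T R).
Context {n p : nat}.
Variables (e : 'I_n -> {RV P >-> R}).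
Hypotheses (n4 : (4 <= n)%N) (p2 : (2 <= p)%N).
Hypotheses (indE : mutually_independent e) (stdE : forall i, standard_normal (e i)).

Let n2 : (2 <= n)%N. Proof. exact: leq_trans n4. Qed.
Let p0 : (0 < p)%N. Proof. exact: leq_trans p2. Qed.
Let N0 : 0 < n%:R :> R. Proof. by rewrite ltr0n (leq_trans _ n4). Qed.
Let N4 : 4 <= n%:R :> R. Proof. by rewrite ler_nat. Qed.

(** Centring multiplies fourth moments by at most 16, subtracting [scov] can only decrease a second
    moment, and (n / (n - 1))^2 <= 2; this holds for every sample, good or not. *)
Lemma bcoef_var_le (y : 'I_n -> 'cV[R]_p) (G : R) j : (forall k, smom4 y k k k k <= G) ->
  var (fun i => bcoef y i j) <= 32 * G.
Proof.
case: j => [[a b] s] hG.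
have NV : 0 <= n%:R^-1 :> R by rewrite invr_ge0 ltW.
have m4 k : n%:R^-1 * \sum_i cent y i k ^+ 4 <= 16 * G.
  have sm : smean y k ^+ 4 <= smom4 y k k k k.
    have j1 (f : 'I_n -> R) : (n%:R^-1 * \sum_i f i) ^+ 2 <= n%:R^-1 * \sum_i f i ^+ 2.
      have h : 0 <= n%:R^-1 * \sum_i (f i - n%:R^-1 * \sum_l f l) ^+ 2.
        by rewrite mulr_ge0//; apply: sumr_ge0 => i _; exact: sqr_ge0.
      move: h; set m := n%:R^-1 * \sum_l f l.
      rewrite (eq_bigr (fun i => f i ^+ 2 - 2 * m * f i + m ^+ 2)); last by move=> i _; ring.
      rewrite big_split /= sumrB -mulr_sumr sumr_const card_ord.
      have -> : \sum_i f i = n%:R * m by rewrite /m mulrA divff ?mul1r// gt_eqF.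
      rewrite -[m ^+ 2 *+ n]mulr_natl (_ : n%:R^-1 * _ = n%:R^-1 * \sum_i f i ^+ 2 - m ^+ 2) ?subr_ge0//.
      by field; rewrite gt_eqF.
    rewrite (_ : smean y k ^+ 4 = (smean y k ^+ 2) ^+ 2); last by rewrite -exprM.
    apply: (@le_trans _ _ ((n%:R^-1 * \sum_i y i k 0 ^+ 2) ^+ 2)).
      rewrite lerXn2r ?nnegrE ?sqr_ge0//; last exact: j1.
      by rewrite mulr_ge0//; apply: sumr_ge0 => i _; exact: sqr_ge0.
    apply: (le_trans (j1 _)); rewrite /smom4 ler_wpM2l//; apply: ler_sum => i _.
    by rewrite le_eqVlt; apply/orP; left; apply/eqP; ring.
  apply: (@le_trans _ _ (n%:R^-1 * \sum_i 8 * (y i k 0 * y i k 0 * y i k 0 * y i k 0 + smean y k ^+ 4))).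
    rewrite ler_wpM2l//; apply: ler_sum => i _; rewrite /cent.
    move: (y i k 0) (smean y k) => u v.
    have h1 : (u - v) ^+ 2 <= 2 * (u ^+ 2 + v ^+ 2) by have := sqr_ge0 (u + v); lra.
    have h2 : (u - v) ^+ 4 <= (2 * (u ^+ 2 + v ^+ 2)) ^+ 2.
      rewrite (_ : (u - v) ^+ 4 = ((u - v) ^+ 2) ^+ 2); last by rewrite -exprM.
      by rewrite lerXn2r ?nnegrE ?sqr_ge0// (le_trans (sqr_ge0 _) h1).
    apply: (le_trans h2); have := sqr_ge0 (u ^+ 2 - v ^+ 2); lra.
  rewrite -mulr_sumr big_split /= sumr_const card_ord mulrCA mulrDr -/(smom4 y k k k k).
  rewrite -[_ ^+ 4 *+ n]mulr_natl mulrA mulVf ?gt_eqF// mul1r.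
  have := hG k; move: sm; lra.
pose r := n%:R / (n%:R - 1) : R.
have m0 : 0 < n%:R - 1 :> R by move: N4; lra.
have r2 : r ^+ 2 <= 2.
  rewrite /r expr_div_n ler_pdivrMr ?exprn_gt0//.
  have : 0 <= (n%:R - 4) * n%:R :> R by rewrite mulr_ge0 ?subr_ge0.
  by move: N4; move: (n%:R : R) => N; lra.
have rt2 : Num.sqrt n%:R ^+ 2 = n%:R :> R by rewrite sqr_sqrtr// ltW.
have V2 : n%:R^-1 * \sum_i (cent y i a * cent y i b - scov y a b) ^+ 2 <=
    n%:R^-1 * \sum_i (cent y i a * cent y i b) ^+ 2.
  rewrite (eq_bigr (fun i => (cent y i a * cent y i b) ^+ 2 - 2 * scov y a b * (cent y i a * cent y i b)
    + scov y a b ^+ 2)); last by move=> i _; ring.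
  rewrite big_split /= sumrB -mulr_sumr sumr_const card_ord.
  have -> : \sum_i cent y i a * cent y i b = n%:R * scov y a b.
    by rewrite /scov mulrA divff ?gt_eqF// mul1r.
  rewrite -[_ ^+ 2 *+ n]mulr_natl -subr_ge0.
  rewrite (_ : _ - _ = scov y a b ^+ 2) ?sqr_ge0//.
  by field; rewrite gt_eqF.
have E : var (fun i => bcoef y i (a, b, s)) =
    r ^+ 2 * (n%:R^-1 * \sum_i (cent y i a * cent y i b - scov y a b) ^+ 2).
  rewrite /var /bcoef /= mulr_sumr mulr_sumr; apply: eq_bigr => i _.
  rewrite exprMn sqrr_sign mul1r !exprMn exprVn rt2 /r.
  by field; rewrite !gt_eqF.
have A0 : 0 <= n%:R^-1 * \sum_i (cent y i a * cent y i b) ^+ 2.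
  by rewrite mulr_ge0//; apply: sumr_ge0 => i _; exact: sqr_ge0.
have B : n%:R^-1 * \sum_i (cent y i a * cent y i b) ^+ 2 <= 16 * G.
  have := m4 a; have := m4 b.
  have : n%:R^-1 * \sum_i (cent y i a * cent y i b) ^+ 2 <=
     2^-1 * (n%:R^-1 * \sum_i cent y i a ^+ 4) + 2^-1 * (n%:R^-1 * \sum_i cent y i b ^+ 4).
    rewrite (_ : _ + _ = n%:R^-1 * (2^-1 * (\sum_i cent y i a ^+ 4 + \sum_i cent y i b ^+ 4))); last by ring.
    rewrite -big_split [2^-1 * _]mulr_sumr ler_wpM2l//.
    apply: ler_sum => i _; have := sqr_ge0 (cent y i a ^+ 2 - cent y i b ^+ 2).
    by rewrite /= exprMn; move: (cent y i a) (cent y i b) => u v; lra.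
  move: (n%:R^-1 * _) (n%:R^-1 * _) (n%:R^-1 * _) => u v w; lra.
rewrite E; apply: (@le_trans _ _ (r ^+ 2 * (n%:R^-1 * \sum_i (cent y i a * cent y i b) ^+ 2))).
  by rewrite ler_wpM2l ?sqr_ge0.
apply: (@le_trans _ _ (2 * (16 * G))); last by lra.
by apply: ler_pM => //; exact: sqr_ge0.
Qed.

Lemma quantile_ge0 (y : 'I_n -> 'cV[R]_p) (al : R) : al < 1 ->
  lbound [set s | ((1 - al)%:E <= P [set t | Tbar y (fun i => e i t) <= s]%R)%E] 0 /\
  0 <= boot_quantile e y (1 - al).
Proof.
move=> al1.
have lb : lbound [set s | ((1 - al)%:E <= P [set t | Tbar y (fun i => e i t) <= s]%R)%E] 0.
  move=> s /= hs; rewrite leNgt; apply/negP => s0.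
  have E : [set t | Tbar y (fun i => e i t) <= s] = set0.
    apply/seteqP; split=> // t /= h.
    have T0 : 0 <= Tbar y (fun i => e i t).
      rewrite /Tbar mulr_ge0 ?divr_ge0 ?sqrtr_ge0//.
      exact: le_trans (mx_max_ge _ (Ordinal p0) (Ordinal p0)).
    by move: s0; rewrite ltNge (le_trans T0 h).
  by move: hs; rewrite E measure0 lee_fin; move: al1; lra.
split => //; rewrite /boot_quantile.
(* The infimum of the empty set is 0 by convention. *)
set A := [set s | _] in lb *; have [->|/set0P A0] := eqVneq A set0; first by rewrite inf0.
exact: lb_le_inf.
Qed.

(** Union bound over the 2 p^2 signed coordinates, each exceeding the level with probability at most
    al / (2 p^2). *)
Lemma quantile_le (y : 'I_n -> 'cV[R]_p) (al sg : R) : 0 < al < 1 -> 0 < sg ->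
  (forall j, var (fun i => bcoef y i j) <= sg ^+ 2) ->
  boot_quantile e y (1 - al) <=
    sg * Num.sqrt (2 * ln (2 * (p * p)%:R / al)) / Num.sqrt n%:R.
Proof.
move=> /andP[al0 al1] sg0 hv.
have rt0 : 0 < Num.sqrt n%:R :> R by rewrite sqrtr_gt0.
pose l := ln (2 * (p * p)%:R / al).
have pp : 1 <= (p * p)%:R :> R by rewrite ler1n muln_gt0 p0.
have arg1 : 1 <= 2 * (p * p)%:R / al by rewrite ler_pdivlMr// mul1r; move: pp al1; lra.
have l0 : 0 <= l by rewrite ln_ge0.
set s := sg * Num.sqrt (2 * l).
have s0 : 0 <= s by rewrite mulr_ge0 ?sqrtr_ge0 ?(ltW sg0).
have sg2 : 0 < sg ^+ 2 by rewrite exprn_gt0.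
have tl j := lin_tail indE stdE s0 sg2 (hv j).
have [mU PU] := union_bound (fun j => (tl j).1) (fun j => (tl j).2).
have ex : expR (- (s ^+ 2 / (2 * sg ^+ 2))) = al / (2 * (p * p)%:R).
  rewrite /s exprMn sqr_sqrtr ?mulr_ge0// (_ : _ / _ = l); last by field; rewrite gt_eqF.
  by rewrite expRN /l lnK ?posrE ?(lt_le_trans ltr01)// invf_div.
have card : #|{: 'I_p * 'I_p * bool}|%:R = 2 * (p * p)%:R :> R.
  by rewrite !card_prod !card_ord card_bool natrM mulrC.
rewrite ex card mulrC divfK in PU; last first.
  by rewrite mulf_neq0// pnatr_eq0 muln_eq0 negb_or -!lt0n p0.
have [lb _] := quantile_ge0 y al1.
apply: ge_inf; first by exists 0.
rewrite /=.
pose B := [set t | exists j, s < lin e (fun i => bcoef y i j) t].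
rewrite (_ : [set t | _] = ~` B).
  rewrite probability_setC//.
  rewrite -(fineK (x := P B)) ?fin_num_measure// -EFinB lee_fin lerD2l lerN2.
  by rewrite -lee_fin fineK ?fin_num_measure.
apply/seteqP; split=> t /=.
  move=> /(Tbar_le y n2 _ _ p0) h [j]; apply/negP; rewrite -leNgt.
  by have := h j; rewrite mulrC divfK// gt_eqF.
move=> h; apply/(Tbar_le y n2 _ _ p0) => j; rewrite mulrC divfK ?gt_eqF//.
by rewrite leNgt; apply/negP => hj; apply: h; exists j.
Qed.

End QuantileBound.

(** Past the truncation U = x^2 / nu^2 is at least q^6, and U^2 <= 8 exp (U / 2) <= 8 exp (- q^6 /
    2) exp U. *)
Lemma fourth_tail (R : realType) (x nu q : R) : 0 < nu -> 0 < q ->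
  x ^+ 4 <= Num.min (x ^+ 4) (nu ^+ 4 * q ^+ 12) +
    8 * nu ^+ 4 * expR (- (q ^+ 6 / 2)) * expR (x ^+ 2 / nu ^+ 2).
Proof.
move=> nu0 q0; have [h|h] := leP (x ^+ 4) (nu ^+ 4 * q ^+ 12).
  by rewrite lerDl !mulr_ge0 ?expR_ge0 ?exprn_ge0 ?(ltW nu0).
apply: (@le_trans _ _ (8 * nu ^+ 4 * expR (- (q ^+ 6 / 2)) * expR (x ^+ 2 / nu ^+ 2))); last first.
  by rewrite lerDr mulr_ge0 ?exprn_ge0 ?(ltW nu0) ?(ltW q0).
set U := x ^+ 2 / nu ^+ 2.
have nu2 : 0 < nu ^+ 2 by rewrite exprn_gt0.
have U0 : 0 <= U by rewrite divr_ge0 ?sqr_ge0 ?(ltW nu2).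
have xU : x ^+ 4 = nu ^+ 4 * U ^+ 2 by rewrite /U; field; rewrite gt_eqF.
have Uq : q ^+ 6 <= U.
  rewrite leNgt; apply/negP => Ul; move: h; rewrite xU ltNge => /negP; apply.
  rewrite (_ : q ^+ 12 = (q ^+ 6) ^+ 2); last by rewrite -exprM.
  by rewrite ler_wpM2l ?exprn_ge0 ?(ltW nu0)// lerXn2r ?nnegrE ?exprn_ge0 ?(ltW q0) ?(ltW Ul).
have k := pow_le_exp 2 (divr_ge0 U0 (ler0n R 2)).
have k2 : U ^+ 2 <= 8 * expR (U / 2).
  rewrite (_ : U ^+ 2 = 4 * (U / 2) ^+ 2); last by field.
  by move: k; rewrite (_ : 2`!%:R = 2 :> R)//; lra.
rewrite xU (_ : _ * expR U = nu ^+ 4 * (8 * (expR (- (q ^+ 6 / 2)) * expR U))); last by ring.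
rewrite ler_wpM2l ?exprn_ge0 ?(ltW nu0)// -expRD; apply: (le_trans k2).
by rewrite ler_pM2l// ler_expR; move: Uq; lra.
Qed.

Section MaxFourth.
Context {d : measure_display} {T : measurableType d} {R : realType} (P : probability T R).
Context {n p : nat}.
Variables (X : 'I_n -> {RV P >-> p.-tuple R}) (i1 : 'I_n).
Hypotheses (indX : mutually_independent X) (idX : identically_distributed X) (p0 : (0 < p)%N).
Variables nu q C C4 M4 : R.
Hypotheses (nu1 : 1 <= nu) (q1 : 1 <= q) (C0 : 0 <= C) (C40 : 0 < C4).
Hypothesis hC4 : nu ^+ 4 * q ^+ 14 <= C4 * n%:R.
Hypothesis hnp : (n * p)%:R <= expR (q ^+ 2).
Hypothesis m4 : forall k, intg P (fun t => rvcoord (X i1) k t ^+ 4) /\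
  Ex P (fun t => rvcoord (X i1) k t ^+ 4) <= M4.
Hypothesis m8 : forall k, intg P (fun t => `|rvcoord (X i1) k t| ^+ 8) /\
  Ex P (fun t => `|rvcoord (X i1) k t| ^+ 8) <= C * nu ^+ 4.
Hypothesis msub : forall i k, intg P (fun t => expR (rvcoord (X i) k t ^+ 2 / nu ^+ 2)) /\
  Ex P (fun t => expR (rvcoord (X i) k t ^+ 2 / nu ^+ 2)) <= 2.

(* The maximum over k is split at b = nu^4 q^12: the truncated part is
   controlled by max_k S_k <= Lam + sum_k exp (S_k - Lam), the rest by the
   exponential moments. *)
Lemma max_fourth_moment : exists G : T -> R,
  [/\ intg P G, Ex P G <= M4 + C + 2 * C4 + 16 * C4 * expR 1, forall t, 0 <= G t &
      forall t k, smom4 (data X t) k k k k <= G t].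
Proof.
have nu0 : 0 < nu by apply: lt_le_trans nu1.
have q0 : 0 < q by apply: lt_le_trans q1.
have N0 : 0 < n%:R :> R by rewrite ltr0n (leq_ltn_trans (leq0n i1)).
have pR : 0 < p%:R :> R by rewrite ltr0n.
pose b := nu ^+ 4 * q ^+ 12.
have b0 : 0 < b by rewrite mulr_gt0 ?exprn_gt0.
pose S k t := \sum_i Num.min (rvcoord (X i) k t ^+ 4) b / b.
pose A := n%:R * (M4 / b + C * nu ^+ 4 / b ^+ 2).
(* Chosen so that p exp (A - Lam) = 1: the sum over k of the shifted exponential moments is then at
   most 1. *)
pose Lam := ln p%:R + A.
pose tl := 8 * nu ^+ 4 * expR (- (q ^+ 6 / 2)).
have tl0 : 0 <= tl by rewrite !mulr_ge0 ?expR_ge0 ?exprn_ge0 ?(ltW nu0).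
have HS k : intg P (fun t => expR (S k t)) /\ Ex P (fun t => expR (S k t)) <= expR A.
  have mf : measurable_fun [set: p.-tuple R] (fun u : p.-tuple R => tnth u k ^+ 4).
    by apply: measurable_funX; exact: measurable_tnth.
  have f2 : intg P (fun t => (rvcoord (X i1) k t ^+ 4) ^+ 2) /\
      Ex P (fun t => (rvcoord (X i1) k t ^+ 4) ^+ 2) <= C * nu ^+ 4.
    rewrite (_ : (fun t => _) = (fun t => `|rvcoord (X i1) k t| ^+ 8)); first exact: m8.
    apply/funext => t; rewrite -exprM -normrX ger0_norm// -[8%N]/(2 * 4)%N exprM.
    by rewrite exprn_ge0 ?sqr_ge0.
  exact: (exp_trunc_sum indX idX mf b0 (m4 k) f2).
pose G t := b / n%:R * (Lam + \sum_k expR (- Lam) * expR (S k t)) +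
  \sum_k \sum_i tl / n%:R * expR (rvcoord (X i) k t ^+ 2 / nu ^+ 2).
have i1' : intg P (fun t => \sum_k expR (- Lam) * expR (S k t)).
  by apply: intg_sum => k; apply: intgZ; exact: (HS k).1.
have i2' : intg P (fun t => Lam + \sum_k expR (- Lam) * expR (S k t)).
  by apply: intgD => //; exact: intg_cst.
have i3k k : intg P (fun t => \sum_i tl / n%:R * expR (rvcoord (X i) k t ^+ 2 / nu ^+ 2)).
  by apply: intg_sum => i; apply: intgZ; exact: (msub i k).1.
have i3 : intg P (fun t => \sum_k \sum_i tl / n%:R * expR (rvcoord (X i) k t ^+ 2 / nu ^+ 2)).
  exact: intg_sum.
have iG : intg P G by apply: intgD => //; exact: intgZ.
have key t k : smom4 (data X t) k k k k <= G t.
  have xE i : data X t i k 0 = rvcoord (X i) k t by rewrite /data mxE.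
  have h1 : smom4 (data X t) k k k k <= b / n%:R * S k t +
      \sum_i tl / n%:R * expR (rvcoord (X i) k t ^+ 2 / nu ^+ 2).
    rewrite /smom4 /S mulr_sumr mulr_sumr -big_split /=; apply: ler_sum => i _.
    rewrite xE (_ : _ * _ * _ * _ = rvcoord (X i) k t ^+ 4); last by ring.
    have h := fourth_tail (rvcoord (X i) k t) nu0 q0; rewrite -/b -/tl in h.
    rewrite (_ : _ + _ = n%:R^-1 * (Num.min (rvcoord (X i) k t ^+ 4) b +
       tl * expR (rvcoord (X i) k t ^+ 2 / nu ^+ 2))); last by field; rewrite !gt_eqF.
    by rewrite ler_wpM2l ?invr_ge0 ?(ltW N0).
  apply: (le_trans h1); rewrite /G; apply: lerD.
    rewrite ler_wpM2l ?divr_ge0 ?(ltW b0) ?(ltW N0)//.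
    have e1 : S k t <= Lam + expR (- Lam) * expR (S k t).
      by rewrite -expRD; have := expR_ge1Dx (- Lam + S k t); lra.
    apply: (le_trans e1); rewrite lerD2l (bigD1 k)//= lerDl.
    by apply: sumr_ge0 => j _; rewrite mulr_ge0 ?expR_ge0.
  rewrite [leRHS](bigD1 k)//= lerDl; apply: sumr_ge0 => j _; apply: sumr_ge0 => i _.
  by rewrite mulr_ge0 ?expR_ge0// divr_ge0 ?(ltW N0).
exists G; split => //; last first.
  move=> t; apply: le_trans (key t (Ordinal p0)).
  rewrite /smom4 mulr_ge0 ?invr_ge0 ?(ltW N0)//; apply: sumr_ge0 => i _.
  move: (data X t i _ _) => z; rewrite (_ : z * z * z * z = (z ^+ 2) ^+ 2) ?sqr_ge0//; ring.
have E1 : Ex P (fun t => \sum_k expR (- Lam) * expR (S k t)) <= 1.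
  rewrite Ex_sum; last by move=> k; apply: intgZ; exact: (HS k).1.
  apply: (@le_trans _ _ (\sum_(k < p) expR (- Lam) * expR A)).
    apply: ler_sum => k _; rewrite ExZ; last exact: (HS k).1.
    by rewrite ler_wpM2l ?expR_ge0//; exact: (HS k).2.
  rewrite sumr_const card_ord -mulr_natl -expRD /Lam opprD addrNK.
  by rewrite expRN lnK ?posrE// divff// gt_eqF.
have E3 : Ex P (fun t => \sum_k \sum_i tl / n%:R * expR (rvcoord (X i) k t ^+ 2 / nu ^+ 2)) <=
    p%:R * (tl * 2).
  rewrite Ex_sum; last exact: i3k.
  apply: (@le_trans _ _ (\sum_(k < p) tl * 2)); last by rewrite sumr_const card_ord [leRHS]mulr_natl.
  apply: ler_sum => k _; rewrite Ex_sum; last by move=> i; apply: intgZ; exact: (msub i k).1.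
  apply: (@le_trans _ _ (\sum_(i < n) tl / n%:R * 2)).
    apply: ler_sum => i _; rewrite ExZ; last exact: (msub i k).1.
    by rewrite ler_wpM2l ?divr_ge0 ?(ltW N0)//; exact: (msub i k).2.
  rewrite sumr_const card_ord -[leLHS]mulr_natl le_eqVlt; apply/orP; left; apply/eqP.
  by field; rewrite gt_eqF.
rewrite /G ExD//; last exact: intgZ.
rewrite ExZ// ExD//; last exact: intg_cst.
rewrite Ex_cst.
have bn : 0 <= b / n%:R by rewrite divr_ge0 ?(ltW b0) ?(ltW N0).
have B1 : b / n%:R * (ln p%:R + 1) <= 2 * C4.
  have pe : p%:R <= expR (q ^+ 2) :> R.
    by apply: le_trans hnp; rewrite ler_nat leq_pmull// (leq_ltn_trans (leq0n i1)).
  have lp : ln p%:R <= q ^+ 2 by rewrite -[leRHS]expRK ler_ln ?posrE ?expR_gt0.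
  have q2 : 1 <= q ^+ 2 by exact: exprn_ege1.
  apply: (@le_trans _ _ (b / n%:R * (2 * q ^+ 2))); first by rewrite ler_wpM2l//; lra.
  rewrite (_ : _ * (2 * _) = 2 * (nu ^+ 4 * q ^+ 14 / n%:R)); last by rewrite /b; field; rewrite gt_eqF.
  by rewrite ler_pM2l// ler_pdivrMr.
have B2 : b / n%:R * A <= M4 + C.
  rewrite (_ : b / n%:R * A = M4 + C * (nu ^+ 4 / b)); last by rewrite /A; field; rewrite !gt_eqF.
  rewrite lerD2l ler_piMr// ler_pdivrMr// mul1r /b ler_peMr ?exprn_ge0 ?(ltW nu0)//.
  exact: exprn_ege1.
have B3 : p%:R * (tl * 2) <= 16 * C4 * expR 1.
  have nu4 : nu ^+ 4 <= C4 * n%:R.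
    apply: le_trans hC4; rewrite ler_peMr ?exprn_ge0 ?(ltW nu0)//; exact: exprn_ege1.
  have np : (n * p)%:R * expR (- (q ^+ 6 / 2)) <= expR 1.
    apply: (@le_trans _ _ (expR (q ^+ 2) * expR (- (q ^+ 6 / 2)))).
      by rewrite ler_wpM2r ?expR_ge0.
    rewrite -expRD ler_expR.
    (* This says q^6 >= 3 q^2 - 2, so that q^2 - q^6 / 2 <= 1. *)
    have h : 0 <= (q ^+ 2 - 1) ^+ 2 * (q ^+ 2 + 2) by rewrite mulr_ge0 ?sqr_ge0// addr_ge0 ?sqr_ge0.
    have E : (q ^+ 2 - 1) ^+ 2 * (q ^+ 2 + 2) = q ^+ 6 - 3 * q ^+ 2 + 2 by ring.
    have := exprn_ge0 2 (ltW q0); move: h; rewrite E; lra.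
  rewrite (_ : p%:R * (tl * 2) = 16 * (nu ^+ 4 * (p%:R * expR (- (q ^+ 6 / 2))))); last by rewrite /tl; ring.
  rewrite -mulrA ler_pM2l//; apply: (@le_trans _ _ (C4 * n%:R * (p%:R * expR (- (q ^+ 6 / 2))))).
    by rewrite ler_wpM2r ?mulr_ge0 ?expR_ge0.
  rewrite (_ : C4 * _ * _ = C4 * ((n * p)%:R * expR (- (q ^+ 6 / 2)))); last by rewrite natrM; ring.
  by rewrite ler_wpM2l ?(ltW C40).
have B0 : b / n%:R * (Lam + Ex P (fun t => \sum_k expR (- Lam) * expR (S k t))) <=
    b / n%:R * (ln p%:R + 1) + b / n%:R * A.
  rewrite -mulrDr ler_wpM2l// /Lam; move: E1; lra.
move: E3 B1 B2 B3 B0; lra.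
Qed.

End MaxFourth.

(** * Choice of the constants *)

Section Tuning.
Context {R : realType}.
Implicit Types nu x : R.

Lemma powR_root nu (k : nat) : (0 < k)%N -> 0 <= nu -> (nu `^ (1 / k%:R)) ^+ k = nu.
Proof.
move=> k0 nu0; rewrite -powR_mulrn ?powR_ge0// -powRrM div1r mulVf ?powRr1//.
by rewrite pnatr_eq0 -lt0n.
Qed.

Lemma expR1_le3 : expR 1 <= 3 :> R.
Proof. by have := expR_le_quad (lexx (1 : R)); rewrite expr1n; lra. Qed.

Lemma cube_small (E k : R) : 0 < E -> 0 < k -> k <= (8 * E)^-1 -> k <= 1 ->
  E * k ^+ 3 <= 8^-1.
Proof.
move=> E0 k0 kE k1.
have k3 : k ^+ 3 <= k by rewrite exprS ler_piMr ?(ltW k0)// exprn_ile1// ltW.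
apply: (le_trans (ler_wpM2l (ltW E0) (le_trans k3 kE))).
by rewrite invfM mulrCA divff ?mulr1// gt_eqF.
Qed.

Lemma ln_np_ge1 (n p : nat) : (4 <= n)%N -> (2 <= p)%N -> 1 <= ln (n * p)%:R :> R.
Proof.
move=> n4 p2; have np : (8 <= n * p)%N by apply: (leq_mul n4 p2).
rewrite -[leLHS]expRK ler_ln ?posrE ?expR_gt0 ?ltr0n ?(leq_trans _ np)//.
apply: (le_trans expR1_le3); rewrite ler_nat; exact: leq_trans np.
Qed.

(** As p >= 2, both ln 2 and ln (1 / al) are bounded by multiples of ln p. *)
Lemma quantile_log (p : nat) (al : R) : (2 <= p)%N -> 0 < al < 1 ->
  Num.sqrt (2 * ln (2 * (p * p)%:R / al)) <=
  Num.sqrt (2 * (3 + ln al^-1 / ln 2)) * Num.sqrt (ln p%:R).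
Proof.
move=> p2 /andP[al0 al1].
have l2 : 0 < ln 2 :> R by rewrite ln_gt0// ltr1n.
have p0 : 0 < p%:R :> R by rewrite ltr0n (leq_trans _ p2).
have lp : ln 2 <= ln p%:R :> R by rewrite ler_ln ?posrE// ler_nat.
have la : 0 <= ln al^-1 by rewrite ln_ge0// invf_ge1// ltW.
rewrite -sqrtrM; last by rewrite mulr_ge0// addr_ge0// divr_ge0// ltW.
apply: ler_wsqrtr; rewrite -[leRHS]mulrA ler_pM2l//.
rewrite natrM !lnM ?posrE ?invr_gt0 ?mulr_gt0//.
have h : ln al^-1 <= ln al^-1 / ln 2 * ln p%:R.
  by rewrite -mulrA ler_peMr// ler_pdivlMl// mulr1.
rewrite mulrDl; move: h lp; lra.
Qed.

End Tuning.

Section MomentsOfXi.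
Context {d : measure_display} {T : measurableType d} {R : realType} (P : probability T R).
Context {p : nat}.
Variable Y : {RV P >-> p.-tuple R}.

Lemma xi_ge0 q : (0 <= xi Y q)%E.
Proof.
rewrite /xi; apply: (big_ind (fun x => 0 <= x)%E) => // [x y x0 y0|k _].
  by rewrite le_max x0.
exact: Lnorm_ge0.
Qed.

Lemma xi4_fin : (forall k, intg P (fun t => rvcoord Y k t ^+ 4)) ->
  exists2 m : R, 0 <= m & xi Y 4 = m%:E.
Proof.
move=> i4; exists (fine (xi Y 4)); first by rewrite fine_ge0// xi_ge0.
rewrite fineK// ge0_fin_numE ?xi_ge0// /xi.
apply: (big_ind (fun x => x < +oo)%E) => [|x y x0 y0|k _]; first exact: ltry.
  by rewrite gt_max x0.
rewrite unlock; apply: poweR_lty.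
rewrite (_ : (\int[P]_x _)%E = (\int[P]_t (rvcoord Y k t ^+ 4)%:E)%E).
  by rewrite ExE ?ltry.
apply: eq_integral => t _; rewrite /= powR_mulrn// -normrX ger0_norm//.
exact: expr4_ge0.
Qed.

End MomentsOfXi.

Section Setting.
Context {R : realType}.
Variables (C1 C2 C3 C4 : R).
Hypotheses (hC1 : 0 < C1) (hC2 : 0 < C2) (hC3 : 0 < C3) (hC4 : 0 < C4).

Definition cst_mom : R := 1 + C2 ^+ 6 + C3 ^+ 8.
(** Largest relative deviation of the empirical moments that keeps the bootstrap covariances within
    the tolerance 1/4800. *)
Definition cst_dev : R := 4800^-1 / (4 * (24 * cst_mom + 73)).
Definition cst_exp : R := 192 * cst_mom ^+ 3 + 2 * expR (cst_mom ^+ 2).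
Definition cst_kap : R := Num.min 64^-1 (8 * (16000 * expR 2 * cst_exp))^-1.
(** The three entries ensure 5 eps <= 1, eps <= C1 and 12 [cst_mom] eps <= [cst_dev]. *)
Definition cst_eps : R := Num.min 5^-1 (Num.min C1 (cst_dev / (12 * cst_mom))).
Definition cst_prob : R :=
  8 + 3 * (2160 / (Num.sqrt C1 * cst_kap) + 4001 * 48 * cst_exp) +
  288 * (2 * cst_mom + 4) / Num.sqrt C1.
(** The summand 1 / [cst_eps] makes the bound exceed one as soon as eps exceeds [cst_eps]; the power
    of C4 converts eps into n^(- K / 6). *)
Definition cst_rate : R := (cst_prob + cst_eps^-1) * C4 `^ (1 / 6%:R).
(** The denominator 4 C1 comes from absorbing additive constants into xi_4^4, which is at least 4
    C1. *)
Definition cst_quant (al : R) : R := Num.sqrt (2 * (3 + ln al^-1 / ln 2)) *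
  (32 + (1 + 32 * (cst_mom + 2 * C4 + 16 * C4 * expR 1)) / (4 * C1)).

Lemma cst_mom_ge1 : 1 <= cst_mom.
Proof. by rewrite /cst_mom -addrA lerDl addr_ge0 ?exprn_ge0 ?ltW. Qed.

Let cm0 : 0 < cst_mom. Proof. exact: lt_le_trans cst_mom_ge1. Qed.

Let den0 : 0 < 4 * (24 * cst_mom + 73).
Proof. by rewrite mulr_gt0// addr_gt0// mulr_gt0. Qed.

Lemma cst_dev_gt0 : 0 < cst_dev.
Proof. by apply: (divr_gt0 _ den0); rewrite invr_gt0 ltr0n. Qed.

Lemma cst_exp_gt0 : 0 < cst_exp.
Proof.
apply: ltr_wpDr; last by rewrite mulr_gt0// exprn_gt0.
by rewrite mulr_ge0 ?expR_ge0.
Qed.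

Lemma cst_kapP : 0 < cst_kap <= 64^-1 /\ 16000 * expR 2 * cst_kap ^+ 3 * cst_exp <= 8^-1.
Proof.
have E0 : 0 < 16000 * expR 2 * cst_exp.
  have h : 0 < 16000 :> R by rewrite ltr0n.
  exact: mulr_gt0 (mulr_gt0 h (expR_gt0 _)) cst_exp_gt0.
have k0 : 0 < cst_kap.
  by rewrite lt_min invr_gt0 ltr0n/= invr_gt0; exact: mulr_gt0 (ltr0n _ 8) E0.
have k1 : cst_kap <= 64^-1 by rewrite ge_min lexx.
split; first by rewrite k0.
have k1' : cst_kap <= 1 by apply: (le_trans k1); rewrite invf_le1// ler1n.
rewrite mulrAC; apply: cube_small E0 k0 _ k1'.
by rewrite ge_min lexx orbT.
Qed.

Lemma cst_eps_gt0 : 0 < cst_eps.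
Proof. by rewrite !lt_min hC1 invr_gt0 ltr0n/= divr_gt0 ?cst_dev_gt0// mulr_gt0. Qed.

Lemma cst_prob_ge0 : 0 <= cst_prob.
Proof.
have [/andP[k0 _] _] := cst_kapP; have s0 : 0 < Num.sqrt C1 by rewrite sqrtr_gt0.
apply: addr_ge0; last first.
  apply: (fun h => divr_ge0 h (ltW s0)); apply: (mulr_ge0 (ler0n _ _)).
  exact: addr_ge0 (mulr_ge0 (ler0n _ _) (ltW cm0)) (ler0n _ _).
apply: (addr_ge0 (ler0n _ _)); apply: (mulr_ge0 (ler0n _ _)); apply: addr_ge0.
  exact: divr_ge0 (ler0n _ _) (mulr_ge0 (ltW s0) (ltW k0)).
exact: mulr_ge0 (mulr_ge0 (ler0n _ _) (ler0n _ _)) (ltW cst_exp_gt0).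
Qed.

Lemma cst_rate_gt0 : 0 < cst_rate.
Proof.
rewrite mulr_gt0 ?powR_gt0//; apply: ltr_wpDl; first exact: cst_prob_ge0.
by rewrite invr_gt0 cst_eps_gt0.
Qed.

Lemma cst_max_ge0 : 0 <= 1 + 32 * (cst_mom + 2 * C4 + 16 * C4 * expR 1).
Proof.
have c4 := ltW hC4.
apply: (addr_ge0 ler01); apply: (mulr_ge0 (ler0n _ _)).
exact: addr_ge0 (addr_ge0 (ltW cm0) (mulr_ge0 (ler0n _ _) c4))
  (mulr_ge0 (mulr_ge0 (ler0n _ _) c4) (expR_ge0 _)).
Qed.

Lemma cst_quant_gt0 al : 0 < al < 1 -> 0 < cst_quant al.
Proof.
move=> /andP[al0 al1].
have l2 : 0 < ln 2 :> R by rewrite ln_gt0// ltr1n.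
have la : 0 <= ln al^-1 by rewrite ln_ge0// invf_ge1// ltW.
rewrite mulr_gt0 ?sqrtr_gt0 ?mulr_gt0//.
  by rewrite ltr_wpDr// divr_ge0// ltW.
rewrite ltr_wpDr// divr_ge0 ?mulr_ge0 ?(ltW hC1)//.
exact: cst_max_ge0.
Qed.

Context {d : measure_display} {T : measurableType d} (P : probability T R).
Variables (n p : nat) (hn : (4 <= n)%N) (hp : (3 <= p ^ 2)%N).
Variables (X : 'I_n -> {RV P >-> p.-tuple R}) (e : 'I_n -> {RV P >-> R}) (i1 : 'I_n).
Variables nu K : R.
Hypotheses (indX : mutually_independent X) (idX : identically_distributed X).
Hypotheses (indE : mutually_independent e) (stdE : forall i, standard_normal (e i)).
Hypothesis nu1 : 1 <= nu.
Hypothesis hmean : forall i k, mean_zero P (rvcoord (X i) k).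
Hypothesis hsub : forall i k, subgaussian P (nu ^+ 2) (rvcoord (X i) k).
Hypothesis hGamma : forall j k, (C1%:E <= Gamma (X i1) (j, k) (j, k))%E.
Hypothesis xi6 : (xi (X i1) 6 <= (C2 * nu `^ (1 / 3))%:E)%E.
Hypothesis xi8 : (xi (X i1) 8 <= (C3 * nu `^ (1 / 2))%:E)%E.
Hypothesis hK : 0 < K < 1.
Hypothesis hrate : nu ^+ 4 * ln (n * p)%:R ^+ 7 <= C4 * n%:R `^ (1 - K).

Let p2 : (2 <= p)%N. Proof. by case: p hp => [//|[//|//]]. Qed.
Let p0 : (0 < p)%N. Proof. exact: leq_trans p2. Qed.
Let nu0 : 0 < nu. Proof. exact: lt_le_trans nu1. Qed.
Let N0 : 0 < n%:R :> R. Proof. by rewrite ltr0n (leq_trans _ hn). Qed.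
Let l1 : 1 <= ln (n * p)%:R :> R. Proof. exact: ln_np_ge1. Qed.

Let mu := nu `^ (1 / 3%:R).
Let muE : nu = mu ^+ 3. Proof. by rewrite powR_root// ltW. Qed.
Let mu1 : 1 <= mu. Proof. by apply: powR_ge1 => //; rewrite divr_ge0. Qed.
Let q := Num.sqrt (ln (n * p)%:R) : R.
Let q2 : q ^+ 2 = ln (n * p)%:R. Proof. by rewrite sqr_sqrtr// (le_trans _ l1). Qed.
Let q1 : 1 <= q.
Proof. by rewrite -sqrtr1 ler_wsqrtr. Qed.
Let q0 : 0 < q. Proof. exact: lt_le_trans q1. Qed.
Let q14 : q ^+ 14 = ln (n * p)%:R ^+ 7. Proof. by rewrite -q2 -exprM. Qed.
Let eps := (nu ^+ 4 * ln (n * p)%:R ^+ 7 / n%:R) `^ (1 / 6%:R).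
Let r0 : 0 < nu ^+ 4 * ln (n * p)%:R ^+ 7 / n%:R.
Proof. by rewrite divr_gt0// mulr_gt0// exprn_gt0// (lt_le_trans ltr01). Qed.
Let e0 : 0 < eps. Proof. exact: powR_gt0. Qed.
Let e6 : eps ^+ 6 = nu ^+ 4 * q ^+ 14 / n%:R.
Proof. by rewrite q14 powR_root// ltW. Qed.

Let h6 k : intg P (fun t => `|rvcoord (X i1) k t| ^+ 6) /\
  Ex P (fun t => `|rvcoord (X i1) k t| ^+ 6) <= C2 ^+ 6 * mu ^+ 6.
Proof. by rewrite -exprMn; exact: xi_moment. Qed.

Let h8 k : intg P (fun t => `|rvcoord (X i1) k t| ^+ 8) /\
  Ex P (fun t => `|rvcoord (X i1) k t| ^+ 8) <= C3 ^+ 8 * nu ^+ 4.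
Proof.
have -> : nu ^+ 4 = (nu `^ (1 / 2%:R)) ^+ 8.
  by rewrite -[8%N]/(2 * 4)%N exprM powR_root// ltW.
by rewrite -exprMn; exact: xi_moment.
Qed.

Let c6 : 1 + C2 ^+ 6 <= cst_mom. Proof. by rewrite /cst_mom lerDl exprn_ge0// ltW. Qed.
Let c8 : C3 ^+ 8 <= cst_mom. Proof. by rewrite /cst_mom lerDr addr_ge0 ?exprn_ge0 ?ltW. Qed.

Lemma eps_rate : eps <= C4 `^ (1 / 6%:R) * n%:R `^ (- (K / 6)).
Proof.
have E : n%:R `^ (1 - K) / n%:R = n%:R `^ (- K) :> R.
  rewrite powRB; last by apply/implyP => _; rewrite gt_eqF.
  by rewrite powRr1 ?ler0n// mulrAC divff ?gt_eqF// mul1r powRN.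
have h : nu ^+ 4 * ln (n * p)%:R ^+ 7 / n%:R <= C4 * n%:R `^ (- K).
  by rewrite -E mulrA ler_wpM2r// invr_ge0 ltW.
apply: (@le_trans _ _ ((C4 * n%:R `^ (- K)) `^ (1 / 6%:R))).
  apply: ge0_ler_powR => //; rewrite ?nnegrE ?(ltW r0)//.
  by rewrite mulr_ge0 ?powR_ge0 ?ltW.
rewrite powRM ?powR_ge0 ?(ltW hC4)// -powRrM.
by rewrite (_ : - K * (1 / 6%:R) = - (K / 6))//; ring.
Qed.

Let hnp : (n * p)%:R <= expR (q ^+ 2) :> R.
Proof. by rewrite q2 lnK// posrE ltr0n muln_gt0 p0 (leq_trans _ hn). Qed.

Lemma sample_cov_event al : 0 < al < 1 -> exists E : set T, [/\ measurable E,
  ((1 - al - cst_rate * n%:R `^ (- (K / 6)))%:E <= P E)%E &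
  forall x, E x -> mx_max (sample_cov (data X x) - cov_mx (X i1)) <=
    boot_quantile e (data X x) (1 - al)].
Proof.
move=> al01; have Kp := powR_ge0 (n%:R : R) (- (K / 6)).
have C4p : 0 <= C4 `^ (1 / 6%:R) by exact: powR_ge0.
have er := eps_rate.
have [small|big] := leP eps cst_eps; last first.
  (* For eps above the threshold the claimed probability is not positive, and the empty event
     suffices. *)
  exists set0; split=> //; rewrite measure0 lee_fin.
  have h : 1 <= cst_rate * n%:R `^ (- (K / 6)).
    rewrite /cst_rate -mulrA; apply: (@le_trans _ _ (cst_eps^-1 * eps)).
      by rewrite ler_pdivlMl ?cst_eps_gt0// mulr1 ltW.
    apply: ler_pM => //; rewrite ?invr_ge0 ?(ltW cst_eps_gt0) ?(ltW e0)//.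
    by rewrite lerDr cst_prob_ge0.
  by move: h; case/andP: al01; lra.
move: (small); rewrite !le_min => /and3P[s1 s2 s3].
have [hk hkL] := cst_kapP.
have e5 : 5 * eps <= 1 by rewrite -ler_pdivlMl ?mulr1.
have eps1 : eps <= 1 by apply: le_trans e5; rewrite ler_peMl ?(ltW e0)// ler1n.
have hc : 12 * cst_mom * eps <= cst_dev.
  by rewrite -ler_pdivlMl ?mulr_gt0// mulrC.
have hcC : 4 * (24 * cst_mom + 73) * cst_dev <= 4800^-1.
  by rewrite /cst_dev mulrC divfK// gt_eqF.
have hsq : Num.sqrt n%:R = nu ^+ 2 * q ^+ 7 / eps ^+ 3.
  have B0 : 0 <= nu ^+ 2 * q ^+ 7 / eps ^+ 3.
    by rewrite divr_ge0 ?mulr_ge0 ?exprn_ge0 ?(ltW nu0) ?(ltW q0) ?(ltW e0).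
  rewrite -[RHS]ger0_norm// -sqrtr_sqr; congr Num.sqrt.
  rewrite [RHS](_ : _ = nu ^+ 4 * q ^+ 14 / eps ^+ 6); last by field; rewrite gt_eqF.
  rewrite e6; field; by rewrite !gt_eqF.
(* exp (- q^2) = 1 / (n p) <= 1 / n <= eps^6 <= eps. *)
have he : expR (- q ^+ 2) <= eps.
  rewrite expRN q2 lnK ?posrE ?ltr0n ?muln_gt0 ?p0 ?(leq_trans _ hn)//.
  apply: (@le_trans _ _ (n%:R^-1)).
    by rewrite lef_pV2 ?posrE ?ltr0n ?muln_gt0 ?p0 ?(leq_trans _ hn)// ler_nat leq_pmulr.
  apply: (@le_trans _ _ (eps ^+ 6)); last by rewrite exprS ler_piMr ?(ltW e0)// exprn_ile1// ltW.
  rewrite e6 ler_peMl ?invr_ge0 ?(ltW N0)// -[leLHS]mulr1.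
  by apply: ler_pM => //; exact: exprn_ege1.
have hJ : ln (4 * (p * p)%:R) <= 2 * q ^+ 2.
  rewrite q2.
  have -> : 2 * ln (n * p)%:R = ln ((n * p)%:R ^+ 2) :> R.
    by rewrite lnXn ?mulr_natl// ltr0n muln_gt0 p0 (leq_trans _ hn).
  rewrite ler_ln ?posrE ?mulr_gt0 ?exprn_gt0 ?ltr0n ?muln_gt0 ?p0 ?(leq_trans _ hn)//.
  rewrite -natrX -natrM ler_nat expnMn -mulnn; apply: leq_mul => //.
  by apply: (leq_trans (n := 4 ^ 2)) => //; rewrite leq_exp2r.
have [E [mE PE HE]] := bootstrap_event hn p0 indX idX indE stdE mu1 muE (hmean i1) hsub h6 h8
  c6 c8 cst_mom_ge1 hC1 hGamma q1 e0 e5 s2 hc hcC hsq hnp he hJ (erefl cst_exp) hk hkL al01.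
exists E; split => //; apply: le_trans PE; rewrite lee_fin lerD2l lerN2.
apply: (@le_trans _ _ (cst_prob * (C4 `^ (1 / 6%:R) * n%:R `^ (- (K / 6))))).
  by rewrite ler_wpM2l ?cst_prob_ge0.
rewrite mulrA ler_wpM2r// /cst_rate ler_wpM2r//.
by rewrite lerDl invr_ge0 (ltW cst_eps_gt0).
Qed.

Lemma expected_quantile (M al : R) : 0 <= M -> 0 < al < 1 ->
  ('E_P[(fun t => M * boot_quantile e (data X t) (1 - al))%R] <=
   (cst_quant al * M)%:E * xi (X i1) 4 ^+ 4 * (Num.sqrt (ln p%:R / n%:R))%:E)%E.
Proof.
move=> M0 al01; have [al0 al1] := andP al01.
have m4 := mom4 mu1 h6 c6.
have [m m0 xiE] := xi4_fin (fun k => (m4 k).1).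
have nrm4 k t : `|rvcoord (X i1) k t| ^+ 4 = rvcoord (X i1) k t ^+ 4.
  by rewrite -normrX ger0_norm// expr4_ge0.
have m4' k : intg P (fun t => rvcoord (X i1) k t ^+ 4) /\
    Ex P (fun t => rvcoord (X i1) k t ^+ 4) <= m ^+ 4.
  have xm : (xi (X i1) 4 <= m%:E)%E by rewrite xiE.
  have := xi_moment k (isT : (0 < 4)%N) xm.
  by rewrite (_ : (fun t => `|rvcoord (X i1) k t| ^+ 4) = fun t => rvcoord (X i1) k t ^+ 4)//;
    apply/funext => t; exact: nrm4.
have k0 : 'I_p := Ordinal p0.
(* The nondegeneracy of a diagonal product bounds a fourth moment from below. *)
have mC1 : 4 * C1 <= m ^+ 4.
  apply: (le_trans (xivec_var mu1 (hmean i1) h6 c6 hGamma k0 k0)).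
  apply: (@le_trans _ _ (pop4 (X i1) k0 k0 k0 k0)).
    by rewrite gerBl -expr2 sqr_ge0.
  rewrite /pop4 (_ : (fun t => _) = fun t => rvcoord (X i1) k0 t ^+ 4); first exact: (m4' k0).2.
  by apply/funext => t; ring.
have hC4' : nu ^+ 4 * q ^+ 14 <= C4 * n%:R.
  rewrite q14; apply: (le_trans hrate); rewrite ler_wpM2l ?(ltW hC4)//.
  have N1 : 1 <= n%:R :> R by rewrite ler1n (leq_trans _ hn).
  rewrite -[leRHS]powRr1 ?ler0n// ler_powR//; case/andP: hK; lra.
have C0 : 0 <= cst_mom by rewrite ltW.
have m8 k : intg P (fun t => `|rvcoord (X i1) k t| ^+ 8) /\
    Ex P (fun t => `|rvcoord (X i1) k t| ^+ 8) <= cst_mom * nu ^+ 4.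
  split; first exact: (h8 k).1.
  by apply: (le_trans (h8 k).2); rewrite ler_wpM2r ?exprn_ge0 ?(ltW nu0).
have [G [iG EG G0 HG]] := max_fourth_moment indX idX p0 nu1 q1 C0 hC4 hC4' hnp m4' m8
  (fun i k => sub_exp (hsub i) k).
set C5 := 2 * C4 in EG; pose A := cst_mom + 2 * C4 + 16 * C4 * expR 1.
have EG' : Ex P G <= m ^+ 4 + A by rewrite /A; move: EG; rewrite /C5; lra.
pose ka := Num.sqrt (2 * (3 + ln al^-1 / ln 2)).
pose sq := Num.sqrt (ln p%:R / n%:R) : R.
have bound t : M * boot_quantile e (data X t) (1 - al) <= M * (ka * sq) * (1 + 32 * G t).
  rewrite -mulrA ler_wpM2l//.
  have sg0 : 0 < 1 + 32 * G t by rewrite ltr_wpDr// mulr_ge0.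
  (* The variance is at most 32 G <= (1 + 32 G)^2: taking 1 + 32 G as standard deviation avoids a
     square root and keeps the bound linear in G. *)
  have hv j : var (fun i => bcoef (data X t) i j) <= (1 + 32 * G t) ^+ 2.
    apply: (le_trans (bcoef_var_le hn j (HG t))).
    have g0 : 0 <= 32 * G t by rewrite mulr_ge0.
    move: (32 * G t) g0 => g g0; have := sqr_ge0 g; rewrite sqrrD; lra.
  apply: (le_trans (quantile_le hn p2 indE stdE al01 sg0 hv)).
  rewrite mulrC [leRHS]mulrC mulrCA ler_wpM2l ?(ltW sg0)//.
  have -> : sq = (Num.sqrt n%:R)^-1 * Num.sqrt (ln p%:R).
    by rewrite /sq mulrC sqrtrM ?invr_ge0 ?(ltW N0)// sqrtrV// ltW.
  rewrite mulrCA ler_wpM2l ?invr_ge0 ?sqrtr_ge0//.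
  exact: quantile_log.
have b0 t : 0 <= M * boot_quantile e (data X t) (1 - al).
  by rewrite mulr_ge0//; exact: (quantile_ge0 e p2 _ al1).2.
rewrite expectation.unlock.
apply: (@le_trans _ _ (\int[P]_t (M * (ka * sq) * (1 + 32 * G t))%:E)%E).
  by apply: ge0_le_integralT => t; rewrite lee_fin.
have iG1 : intg P (fun t => 1 + 32 * G t) by apply: intgD; [exact: intg_cst|exact: intgZ].
rewrite ExE; last exact: intgZ.
rewrite xiE -EFin_expe -!EFinM lee_fin ExZ// ExD; [|exact: intg_cst|exact: intgZ].
rewrite Ex_cst ExZ// -/sq.
have ks0 : 0 <= M * (ka * sq) by rewrite !mulr_ge0 ?sqrtr_ge0.
apply: (@le_trans _ _ (M * (ka * sq) * (1 + 32 * (m ^+ 4 + A)))).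
  by rewrite ler_wpM2l// lerD2l ler_pM2l.
rewrite /cst_quant -/ka -/A.
rewrite (_ : ka * _ * M * m ^+ 4 * sq = M * (ka * sq) * ((32 + (1 + 32 * A) / (4 * C1)) * m ^+ 4)); last by ring.
rewrite ler_wpM2l// mulrDl.
have A0 : 0 <= 1 + 32 * A := cst_max_ge0.
have h : 1 + 32 * A <= (1 + 32 * A) / (4 * C1) * m ^+ 4.
  rewrite -mulrA ler_peMr// ler_pdivlMl ?mulr1//; exact: mulr_gt0.
move: h; lra.
Qed.

End Setting.

Theorem theoremH2 (R : realType) (C1 C2 C3 C4 : R)
    (hC1 : 0 < C1) (hC2 : 0 < C2) (hC3 : 0 < C3) (hC4 : 0 < C4) :
  exists2 C : R, 0 < C &
  forall alpha : R, 0 < alpha < 1 ->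
  exists2 C' : R, 0 < C' &
  forall (d : measure_display) (T : measurableType d) (P : probability T R)
    (n p : nat) (hn : (4 <= n)%N) (hp : (3 <= p ^ 2)%N)
    (X : 'I_n -> {RV P >-> p.-tuple R}) (e : 'I_n -> {RV P >-> R})
    (i1 : 'I_n) (hi1 : i1 = 0%N :> nat)
    (b : 'cV[R]_p) (thetahat : R -> T -> 'cV[R]_p)
    (nu r zeta M K : R),
  let Sigma := cov_mx (X i1) in
  let theta := invmx Sigma *m b in
  let a t := boot_quantile e (data X t) (1 - alpha) in
  let lambda t := M * a t in
  mutually_independent X ->
  identically_distributed X ->
  mutually_independent e ->
  (forall i, standard_normal (e i)) ->
  independent_pair P (fun t => [tuple X i t | i < n])
                     (fun t => [tuple e i t | i < n]) ->
  Sigma \in unitmx ->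
  1 <= nu ->
  (forall i k, mean_zero P (rvcoord (X i) k)) ->
  (forall i k, subgaussian P (nu ^+ 2) (rvcoord (X i) k)) ->
  (forall j k, (C1%:E <= Gamma (X i1) (j, k) (j, k))%E) ->
  (xi (X i1) 6 <= (C2 * nu `^ (1 / 3))%:E)%E ->
  (xi (X i1) 8 <= (C3 * nu `^ (1 / 2))%:E)%E ->
  0 <= r < 1 ->
  sparse_class r zeta theta ->
  0 < K < 1 ->
  nu ^+ 4 * ln (n * p)%:R ^+ 7 <= C4 * n%:R `^ (1 - K) ->
  norm1 theta <= M ->
  is_estimator X b thetahat ->
  (forall w : \bar R, (1 <= w)%E ->
     with_prob_ge P (1 - alpha - C * n%:R `^ (- (K / 6)))
       [set t | lnorm w (thetahat (lambda t) t - theta)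
                <= 2 * 6 `^ recip w * 5 `^ ((1 - r) * recip w)
                   * zeta `^ recip w
                   * (M * norm_L1 (invmx Sigma)) `^ (1 - r * recip w)
                   * a t `^ (1 - r * recip w)])
  /\
  ('E_P[lambda] <= (C' * M)%:E * xi (X i1) 4 ^+ 4
                   * (Num.sqrt (ln p%:R / n%:R))%:E)%E.
Proof.
exists (cst_rate C1 C2 C3 C4); first exact: cst_rate_gt0.
move=> al al01; exists (cst_quant C1 C2 C3 C4 al); first exact: cst_quant_gt0.
move=> d T P n p hn hp X e i1 _ b thetahat nu r zeta M K Sigma theta a lambda.
move=> indX idX indE stdE _ uS nu1 hmean hsub hGamma xi6 xi8 r01 sp hK hrate thM est.
have p2 : (2 <= p)%N by case: p hp {X b thetahat Sigma theta a lambda indX idX uS hmean hsub hGamma xi6 xi8 sp hrate thM est} => [//|[//|//]].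
have M0 : 0 <= M by apply: le_trans thM; exact: norm1_ge0.
have al1 : al < 1 by case/andP: al01.
have a0 t : 0 <= a t by exact: (quantile_ge0 e p2 _ al1).2.
split; last exact: (expected_quantile hC1 hC2 hC3 hC4 hn hp indX idX indE stdE nu1 hmean hsub hGamma xi6 xi8 hK hrate M0 al01).
move=> w w1.
have [E [mE PE HE]] := sample_cov_event hC1 hC2 hC3 hC4 hn hp indX idX indE stdE nu1 hmean hsub
  hGamma xi6 xi8 hrate al01.
exists E; split => // t Et.
have sym : Sigma^T = Sigma.
  by apply/matrixP => j k; rewrite !mxE covarianceC.
apply: (estimator_bound sym uS (a0 t) (HE t Et) r01 sp thM _ w1).
by apply: est; exact: mulr_ge0.
Qed.
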